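(* Under Assumptions (A)–(C) of the context, for every $\phi,\psi\in C^\infty(\mathbb T)$, $$\langle M^\gamma(\phi),M^\gamma(\psi)\rangle_t\longrightarrow\sigma_*^2\,t\int_{\mathbb T}\partial_x\phi(x)\,\partial_x\psi(x)\,dx$$ in $L^1(\mathbb P_{f_{N,0}})$, uniformly for $t\in[0,T]$, as $\gamma\downarrow0$. Equivalently, the martingale process $M_\gamma$ converges (in law) to the conservative Gaussian martingale $\sigma_*\nabla\cdot W(t,x)$ associated with the divergence-type noise $\sigma_*\partial_x\xi$.
   Context: Model. $\gamma\in(0,\frac14)$ is the Kac parameter and $N=N(\gamma)\to\infty$ as $\gamma\downarrow0$. $\Lambda_N=\mathbb Z/(2N+1)\mathbb Z$, $\varepsilon_\gamma=1/(2N+1)$, $\Lambda_{\varepsilon_\gamma}=\varepsilon_\gamma\Lambda_N\subset\mathbb T=\mathbb R/\mathbb Z$, $\Sigma_N=\{-1,1\}^{\Lambda_N}$. $\kappa_\gamma(z)=\gamma\mathfrak K(\gamma z)$, $H_\gamma(\sigma)=-\frac12\sum_{i,j}\kappa_\gamma(i-j)\sigma_i\sigma_j$, $\sigma^{i,i+1}$ is $\sigma$ with spins at $i,i+1$ exchanged, $\Delta_iH_\gamma(\sigma)=H_\gamma(\sigma^{i,i+1})-H_\gamma(\sigma)$. $\sigma^N(t)$ is the Markov process on $\Sigma_{N,M}=\{\sigma:\sum_i\sigma_i=M(N)\}$ with generator $\mathscr L^N_\gamma f(\sigma)=\sum_ic_{i,i+1}(\sigma)[f(\sigma^{i,i+1})-f(\sigma)]$,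 $c_{i,i+1}=(1+e^{\beta\Delta_iH_\gamma})^{-1}$, with initial law $\nu_{N,0}=f_{N,0}\mu_{N,\gamma,\beta}$, where $\mu_{N,\gamma,\beta}(\sigma)\propto e^{-\beta H_\gamma(\sigma)}\mathbf 1_{\Sigma_{N,M}}(\sigma)$; $\mathbb P_{f_{N,0}}$ is the corresponding law. $h_\gamma(\sigma;i)=\sum_j\kappa_\gamma(i-j)\sigma_j$, $X_\gamma(t,\varepsilon_\gamma i)=\delta_\gamma^{-1}h_\gamma(\sigma^N(t/\alpha_\gamma);i)$, $\langle f,g\rangle_\gamma=\varepsilon_\gamma\sum_if(\varepsilon_\gamma i)g(\varepsilon_\gamma i)$. Martingale. For $\phi\in C^\infty(\mathbb T)$, $$M_t^\gamma(\phi)=\langle X_\gamma(t),\phi\rangle_\gamma-\langle X_\gamma(0),\phi\rangle_\gamma-\int_0^t\bigl(\alpha_\gamma^{-1}\mathscr L^N_\gamma\langle X_\gamma,\phi\rangle_\gamma\bigr)(\sigma^N(s/\alpha_\gamma))\,ds,$$ and $\langle\cdot,\cdot\rangle_t$ denotes predictable quadratic covariation. The limit Gaussian martingale is the family of continuous centered Gaussian martingales $M(\phi)$ with $\langle M(\phi),M(\psi)\rangle_t=\sigma_*^2t\int\partial_x\phi\,\partial_x\psi\,dx$. $\xi=\dot W$ is space-time white noise on $\mathbb R^+\times\mathbb T$. Assumptions. (A) $\mathfrak K\ge0$ is even, $\mathfrak K\in W^{1,1}(\mathbb R)\cap W^{1,\infty}(\mathbb R)$, $\mathfrak K(0)=0$,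 $\sum_{z\in\Lambda_N}\kappa_\gamma(z)=1$, $\mathfrak m_2:=\int u^2\mathfrak K(u)du<\infty$. (B) As $\gamma\downarrow0$: $\alpha_\gamma\sim\varepsilon_\gamma^{5/2}$, $\delta_\gamma\sim\varepsilon_\gamma^{1/4}$, $\gamma\sim\varepsilon_\gamma^{3/4}$ (ratios tend to 1); for some constants $\nu,\chi,\sigma_*>0$, $\frac{\mathfrak m_{2,\gamma}}4\frac{\varepsilon_\gamma^4}{\alpha_\gamma\gamma^2}\to\nu$ with $\mathfrak m_{2,\gamma}=\gamma^2\sum_zz^2\kappa_\gamma(z)$, $\frac\beta6\frac{\varepsilon_\gamma^2\delta_\gamma^2}{\alpha_\gamma}\to\chi$, $\frac{\varepsilon_\gamma^3}{\alpha_\gamma\delta_\gamma^2}\to\sigma_*^2$; and $\beta$ is tuned so that $\frac{\varepsilon_\gamma^2}{\alpha_\gamma}(\frac12-\beta\kappa_\gamma(1)-\frac\beta2)\to A\in(0,\infty)$. (C) The relative entropy satisfies $H_N(\nu_{N,0}\mid\mu_{N,\gamma,\beta})\le CN$. Mass normalization: $m_N:=\varepsilon_\gamma M(N)$ satisfies $\delta_\gamma^{-1}m_N\to M\in\mathbb R$. *)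

(* Defs.v *)
From HB Require Import structures.
From mathcomp Require Import all_boot all_order all_fingroup all_algebra.
From mathcomp Require Import all_classical all_reals all_analysis.

Set Implicit Arguments.
Unset Strict Implicit.
Unset Printing Implicit Defensive.

Import Order.TTheory GRing.Theory Num.Theory.
Import numFieldNormedType.Exports.

Local Open Scope classical_set_scope.
Local Open Scope ring_scope.

Section FunctionSpaces.
Context (R : realType).
Local Notation mu := (@lebesgue_measure R).

Definition smooth (f : R -> R) := forall n x, derivable (derive1n n f) x 1.

(* C^oo(R/Z), seen as the smooth 1-periodic functions on R. *)
Definition smooth_torus (f : R -> R) :=
  smooth f /\ forall x, f (x + 1) = f x.

Definition test_function (f : R -> R) :=
  smooth f /\ exists r, forall x, r < `|x| -> f x = 0.

Definition weak_derivative (f g : R -> R) := forall phi, test_function phi ->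
  Rintegral mu setT (fun x => f x * derive1 phi x) =
  - Rintegral mu setT (fun x => g x * phi x).

(* Membership in W^{1,p}(R). *)
Definition sobolev1 (p : \bar R) (f : R -> R) :=
  f \in Lfun mu p /\ exists2 g : R -> R, g \in Lfun mu p & weak_derivative f g.

Definition dirichlet_form (phi psi : R -> R) : R :=
  Rintegral mu `[0, 1] (fun x => derive1 phi x * derive1 psi x).

End FunctionSpaces.

Section Kawasaki.
Context (R : realType) (K : R -> R) (N : nat) (gamma beta : R).

(* Z/(2N+1)Z with its canonical group structure, so that [i - j] below is
   subtraction modulo 2N+1. *)
Definition site := 'I_(N.*2).+1.

Definition config := {ffun site -> bool}.

Definition spin (c : config) (i : site) : R := if c i then 1 else -1.

Definition total_spin (c : config) : R := \sum_i spin c i.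

Definition eps : R := ((N.*2).+1%:R)^-1.

(* The representative in {-N, ..., N} of a site. *)
Definition centered (i : site) : int :=
  if (i <= N)%N then i%:Z else i%:Z - (N.*2).+1%:Z.

Definition kappaZ (z : int) : R := gamma * K (gamma * z%:~R).

Definition kappa (i : site) : R := kappaZ (centered i).

Definition hamiltonian (c : config) : R :=
  - 2^-1 * \sum_i \sum_j kappa (i - j) * spin c i * spin c j.

Definition succ_site (i : site) : site := i + inZp 1.

Definition exchange (c : config) (i : site) : config :=
  [ffun j => c (tperm i (succ_site i) j)].

Definition rate (c : config) (i : site) : R :=
  (1 + expR (beta * (hamiltonian (exchange c i) - hamiltonian c)))^-1.

Definition generator (f : config -> R) (c : config) : R :=
  \sum_i rate c i * (f (exchange c i) - f c).

(* exp (t L) applied to f; the series converges as the state space is finite. *)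
Definition semigroup (t : R) (f : config -> R) (c : config) : R :=
  limn (series (fun k => t ^+ k / k`!%:R * iter k generator f c)).

Definition gibbs (m : int) (c : config) : R :=
  if total_spin c == m%:~R then
    expR (- beta * hamiltonian c) /
      \sum_(c' | total_spin c' == m%:~R) expR (- beta * hamiltonian c')
  else 0.

Definition is_density (m : int) (f : config -> R) :=
  (forall c, total_spin c = m%:~R -> 0 <= f c) /\ \sum_c f c * gibbs m c = 1.

(* Relative entropy of the probability vector [p] with respect to [q], for [p]
   absolutely continuous with respect to [q]; the convention 0 ln 0 = 0 holds
   since [ln] is total. *)
Definition rel_entropy (p q : config -> R) : R := \sum_c p c * ln (p c / q c).

Definition local_field (c : config) (i : site) : R :=
  \sum_j kappa (i - j) * spin c j.

Definition rescaled_field (delta : R) (c : config) (i : site) : R :=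
  delta^-1 * local_field c i.

(* <f, phi>_gamma, for f a function on the discrete torus (f i standing for its
   value at eps * i) and phi a function on the continuous one. *)
Definition pairing (f : site -> R) (phi : R -> R) : R :=
  eps * \sum_i f i * phi (eps * (i : nat)%:R).

Definition second_moment : R :=
  gamma ^+ 2 * \sum_(z : site) (centered z)%:~R ^+ 2 * kappa z.

Definition field_observable (delta : R) (phi : R -> R) (c : config) : R :=
  pairing (rescaled_field delta c) phi.

Definition dynkin_martingale (alpha delta : R) (Om : Type)
    (sigma : R -> Om -> config) (phi : R -> R) (t : R) (w : Om) : R :=
  field_observable delta phi (sigma (t / alpha) w)
  - field_observable delta phi (sigma (0 / alpha) w)
  - Rintegral lebesgue_measure `[0, t] (fun s =>
      alpha^-1 * generator (field_observable delta phi) (sigma (s / alpha) w)).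

End Kawasaki.

Section StochasticProcesses.
Context (R : realType) (d : measure_display) (Om : measurableType d)
        (P : probability Om R).

Definition cadlag (T : R) (x : R -> R) :=
  (forall t, 0 <= t < T -> x @ t^'+ --> x t) /\
  (forall t, 0 < t <= T -> cvg (x @ t^'-)).

Definition adapted (F : R -> set (set Om)) (X : R -> Om -> R) :=
  forall t, 0 <= t -> forall B : set R, measurable B -> F t (X t @^-1` B).

(* The last clause says that X s is the conditional expectation of X t given
   F s. *)
Definition is_martingale (F : R -> set (set Om)) (X : R -> Om -> R) :=
  [/\ adapted F X,
      forall t, 0 <= t -> P.-integrable setT (EFin \o X t) &
      forall s t, 0 <= s <= t -> forall B, F s B ->
        (\int[P]_(w in B) (X t w)%:E = \int[P]_(w in B) (X s w)%:E)%E].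

Definition square_integrable (X : R -> Om -> R) :=
  forall t, 0 <= t -> P.-integrable setT (fun w => ((X t w) ^+ 2)%:E).

(* Generators {0} x B (B in F 0) and ]s, t] x B (B in F s) of the predictable
   sigma-algebra on [0, +oo[ x Om. *)
Definition predictable_rectangle (F : R -> set (set Om)) : set (set (R * Om)) :=
  [set [set 0] `*` B | B in F 0] `|`
  [set C | exists s t B, [/\ 0 <= s <= t, F s B & C = `]s, t] `*` B]].

Definition predictable (F : R -> set (set Om)) (A : R -> Om -> R) :=
  forall B : set R, measurable B ->
    <<s `[0, +oo[ `*` setT, predictable_rectangle F >>
      [set p : R * Om | 0 <= p.1 /\ B (A p.1 p.2)].

(* A is the predictable quadratic covariation <X, Y> of the square-integrable
   martingales X and Y. *)
Definition predictable_covariation (F : R -> set (set Om))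
    (X Y A : R -> Om -> R) :=
  [/\ is_martingale F X /\ square_integrable X,
      is_martingale F Y /\ square_integrable Y,
      predictable F A,
      forall w, A 0 w = 0 /\ forall T, 0 < T ->
        cadlag T (A ^~ w) /\ bounded_variation 0 T (A ^~ w) &
      is_martingale F (fun t w => X t w * Y t w - A t w)].

Definition centered_gaussian (X : Om -> R) :=
  measurable_fun setT X /\
  ((exists2 s, 0 < s & forall B : set R, measurable B ->
      P (X @^-1` B) = normal_prob 0 s B)
   \/ P (X @^-1` [set 0]) = 1%E).

Definition natural_filtration (N : nat) (sigma : R -> Om -> config N) (t : R) :
    set (set Om) :=
  <<s [set B | exists s c, 0 <= s <= t /\ B = sigma s @^-1` [set c]] >>.

(* Markov process with generator [generator K gamma beta] on the
   configurations of total spin m, with initial law [init]: a right-continuous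
   jump process such that E[f(sigma_(s+t)) | sigma_r, r <= s] =
   (exp(t L) f)(sigma_s). *)
Definition kawasaki_process (K : R -> R) (N : nat) (gamma beta : R) (m : int)
    (init : config N -> R) (sigma : R -> Om -> config N) :=
  [/\ forall t c, 0 <= t -> measurable (sigma t @^-1` [set c]),
      forall t w, 0 <= t -> total_spin R (sigma t w) = m%:~R,
      forall w,
        (forall t, 0 <= t -> \forall s \near t^'+, sigma s w = sigma t w) /\
        (forall t, 0 < t -> exists c, \forall s \near t^'-, sigma s w = c),
      forall c, P (sigma 0 @^-1` [set c]) = (init c)%:E &
      forall s t, 0 <= s -> 0 <= t -> forall B, natural_filtration sigma s B ->
        forall f : config N -> R,
          (\int[P]_(w in B) (f (sigma (s + t) w))%:E =
           \int[P]_(w in B) (semigroup K gamma beta t f (sigma s w))%:E)%E].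

Definition family_filtration (M : (R -> R) -> R -> Om -> R) (t : R) :
    set (set Om) :=
  <<s [set C | exists phi s (B : set R),
         [/\ smooth_torus phi, 0 <= s <= t, measurable B &
             C = M phi s @^-1` B]] >>.

(* The conservative Gaussian martingale sigma_* div W: a family of continuous,
   jointly centered Gaussian martingales M(phi), started at 0, with
   <M(phi), M(psi)>_t = sigma_*^2 t int phi' psi'. For a space-time white noise
   xi it is realized by M_t(phi) = - sigma_* xi(1_[0, t] (x) phi'). *)
Definition conservative_gaussian_martingale (sigmastar : R)
    (M : (R -> R) -> R -> Om -> R) :=
  [/\ forall phi w, smooth_torus phi ->
        M phi 0 w = 0 /\ {within `[0, +oo[, continuous (fun t => M phi t w)},
      forall k (phi : 'I_k -> R -> R) (t a : 'I_k -> R),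
        (forall i, smooth_torus (phi i)) -> (forall i, 0 <= t i) ->
        centered_gaussian (fun w => \sum_i a i * M (phi i) (t i) w) &
      forall phi psi, smooth_torus phi -> smooth_torus psi ->
        predictable_covariation (family_filtration M) (M phi) (M psi)
          (fun t _ => sigmastar ^+ 2 * t * dirichlet_form phi psi)].

End StochasticProcesses.

Section SkorokhodConvergence.
Context (R : realType) (k : nat).
Implicit Types x y : R -> 'I_k -> R.

(* x and y, restricted to [0, T], are at J1-distance less than e. *)
Definition skorokhod_close (T e : R) x y :=
  exists lam : R -> R,
    [/\ lam 0 = 0, lam T = T,
        {in `[0, T] &, {homo lam : s t / s < t}},
        {within `[0, T], continuous lam} &
        forall t, 0 <= t <= T ->
          `|lam t - t| < e /\ forall i, `|x t i - y (lam t) i| < e].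

Definition in_skorokhod (T : R) x := forall i, cadlag T (x ^~ i).

Definition skorokhod_continuous (T : R) (Phi : (R -> 'I_k -> R) -> R) :=
  forall x, in_skorokhod T x -> forall e, 0 < e -> exists2 eta, 0 < eta &
    forall y, in_skorokhod T y -> skorokhod_close T eta x y ->
      `|Phi x - Phi y| < e.

Definition bounded_functional (Phi : (R -> 'I_k -> R) -> R) :=
  exists b, forall x, `|Phi x| <= b.

(* Convergence in law in D([0, T], R^k), for every T > 0, along the filter F. *)
Definition cvg_in_law (I : Type) (F : set_system I) (d : I -> measure_display)
    (Om : forall i, measurableType (d i)) (P : forall i, probability (Om i) R)
    (X : forall i, Om i -> R -> 'I_k -> R)
    (d' : measure_display) (Om' : measurableType d') (P' : probability Om' R)
    (Y : Om' -> R -> 'I_k -> R) :=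
  forall T : R, 0 < T -> forall Phi : (R -> 'I_k -> R) -> R,
    bounded_functional Phi -> skorokhod_continuous T Phi ->
    (\int[P i]_w (Phi (X i w))%:E)%E @[i --> F] -->
    (\int[P']_w (Phi (Y w))%:E)%E.

End SkorokhodConvergence.

Section Assumptions.
Context (R : realType).

(* gamma decreases to 0 inside a set G of admissible Kac parameters. G = ]0, 1/4[
   is allowed, but the exact normalization sum_z kappa_gamma(z) = 1 for a fixed K
   is typically available only along smaller sets such as {1/n}. *)
Definition kac_limit (G : set R) : set_system R := within G (0 : R)^'+.

(* K is the continuous representative of its Sobolev class, since its pointwise
   values are used. *)
Definition assumption_kernel (G : set R) (N : R -> nat) (K : R -> R) :=
  [/\ (forall u, 0 <= K u) /\ (forall u, K (- u) = K u),
      [/\ continuous K, sobolev1 1%E K & sobolev1 +oo%E K],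
      K 0 = 0,
      forall g, G g -> \sum_(z : site (N g)) kappa K g z = 1 &
      (\int[lebesgue_measure]_u (u ^+ 2 * K u)%:E < +oo)%E].

Definition assumption_scaling (G : set R) (N : R -> nat) (K : R -> R)
    (alpha delta beta : R -> R) (nu chi sigmastar A : R) :=
  let F := kac_limit G in
  let e (g : R) : R := eps R (N g) in
  [/\ [/\ alpha g / (e g `^ (5 / 2)) @[g --> F] --> (1 : R),
          delta g / (e g `^ (1 / 4)) @[g --> F] --> (1 : R) &
          g / (e g `^ (3 / 4)) @[g --> F] --> (1 : R)],
      [/\ 0 < nu, 0 < chi, 0 < sigmastar & 0 < A],
      second_moment K (N g) g / 4 * (e g ^+ 4 / (alpha g * g ^+ 2))
        @[g --> F] --> nu,
      (beta g / 6 * (e g ^+ 2 * delta g ^+ 2 / alpha g) @[g --> F] --> chi) /\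
      (e g ^+ 3 / (alpha g * delta g ^+ 2) @[g --> F] --> sigmastar ^+ 2) &
      e g ^+ 2 / alpha g * (1 / 2 - beta g * kappaZ K g 1 - beta g / 2)
        @[g --> F] --> A].

Definition assumption_entropy (G : set R) (N : R -> nat) (K : R -> R)
    (beta : R -> R) (M : nat -> int) (f0 : forall g, config (N g) -> R) :=
  exists C : R, forall g, G g ->
    rel_entropy (fun c => f0 g c * gibbs K g (beta g) (M (N g)) c)
                (gibbs K g (beta g) (M (N g))) <= C * (N g)%:R.

End Assumptions.

(* Main.v *)
(* Exchanging neighbouring spins changes <X, phi> by e^2 (s_i - s_(i+1)) / delta
   times a discrete gradient of phi. Hence the carre du champ of two observables,
   whose time integral is the predictable covariation, is e^3 / (alpha delta^2)
   times a Riemann sum of phi' psi' (1 - s_i s_(i+1)), up to the Kac gradients of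
   the energy, and the point is that s_i s_(i+1) averages to 0.

   The initial entropy relative to the Gibbs weight is at most of order N, and its
   production bounds the change of the time-averaged law under exchanges inside
   boxes of length of order 1 / gamma. This invariance replaces s_j by a local
   magnetization, a function of the Kac field and of the average of a box; all
   boxes turn out to share the same average, and monotonicity of the mean-field
   equation, valid up to beta = 1, bounds the fluctuations of the field.

   For the convergence in law, a Taylor expansion of the cosine along the jumps
   gives the characteristic functions of the increments, and Bernstein polynomials
   in sines pass from these to Lipschitz functions of the increments. A functional
   Phi is bounded below by the infimum over y of Phi(y) + L |y - z|, with z the step
   path of the increments, and Doob's inequality for the fourth moments controls
   |x - z|. This gives a lower bound on the limit for Phi and for - Phi. *)

Require Import Defs.
From mathcomp Require Import all_boot all_order all_fingroup all_algebra.
From mathcomp Require Import all_classical all_reals all_analysis.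
From mathcomp Require Import measurable_realfun zify ring lra.

Set Implicit Arguments.
Unset Strict Implicit.
Unset Printing Implicit Defensive.

Import Order.TTheory GRing.Theory Num.Theory.
Import numFieldNormedType.Exports.

Local Open Scope classical_set_scope.
Local Open Scope ring_scope.

(** * Exchanges of two spins and the Gibbs weight *)

(** The obstacle is criticality: the limit A forces [beta] to 1, where the linear part of the
    mean-field equation degenerates. Comparing field and magnetization to second order then gives
    nothing; only a fourth-order gain, with constant [cst_c], controls differences of
    magnetizations. Box lengths are dictated by energy: a nearest-neighbour exchange costs an energy
    of order [gamma], so carrying a spin across d bonds compares weights up to exp(C [gamma] d),
    bounded for d of order 1 / [gamma]. Power counting, with p = eps^(1/4), n of order p^-4, [gamma]
    of order p^3 and [alpha] of order p^10: the cost of exchanges is at most dissipation / theta +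
    theta n, the time integral of the dissipation is at most of order n [alpha], and theta = p^5
    makes both contributions of order p. The number of boxes times the influence [om] of one spin is
    of order p^2, and the conserved mean spin is of order p. Time is treated by grids: the semigroup
    enters only through its first-order expansion with error h^2 per step, and martingale
    identities, entropy production and moment bounds follow by summing over a grid and refining
    it. *)

Section Swaps.
Context (R : realType) (K : R -> R) (N : nat) (gamma beta : R).
Local Notation n := (N.*2).+1.
Local Notation site := (site N).
Local Notation config := (config N).
Local Notation kap := (@kappa R K N gamma).
Local Notation H := (@hamiltonian R K N gamma).
Local Notation s := (@spin R N).
Local Notation h := (@local_field R K N gamma).

Definition swap (c : config) (j k : site) : config := [ffun l => c (tperm j k l)].

Lemma exchangeE c i : exchange c i = swap c i (succ_site i).
Proof. by []. Qed.

Lemma swapK j k : involutive (fun c => swap c j k).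
Proof. by move=> c; apply/ffunP => l; rewrite !ffunE tpermK. Qed.

Lemma swapC c j k : swap c j k = swap c k j.
Proof. by apply/ffunP => l; rewrite !ffunE tpermC. Qed.

Lemma swapxx c j : swap c j j = c.
Proof. by apply/ffunP => l; rewrite !ffunE tperm1 perm1. Qed.

(** Conjugating the transposition (i j) by (j k) gives (i k): a long exchange is a shorter one
    between two exchanges across the last bond. *)
Lemma swap_conj c i j k : i != j -> j != k -> i != k ->
  swap (swap (swap c j k) i j) j k = swap c i k.
Proof.
move=> ij jk ik; apply/ffunP => l; rewrite !ffunE; congr (c _).
have -> : tperm i k = (tperm i j ^ tperm j k)%g.
  by rewrite tpermJ tpermL tpermD// eq_sym.
by rewrite conjgE tpermV !permM.
Qed.

Lemma spin_sq c j : s c j * s c j = 1.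
Proof. by rewrite /spin; case: ifP => _; ring. Qed.

Lemma spin_norm c j : `|s c j| = 1.
Proof. by rewrite /spin; case: ifP => _; rewrite ?normrN normr1. Qed.

Lemma spin_cases c j : s c j = 1 \/ s c j = -1.
Proof. by rewrite /spin; case: ifP => _; [left|right]. Qed.

(** An additive form of the exchange, valid also for j = k: the increments of the field and of the
    energy become sums against [sum_delta]. *)
Lemma spin_swap c j k l : s (swap c j k) l =
  s c l + (s c k - s c j) * ((l == j)%:R - (l == k)%:R).
Proof.
rewrite /spin ffunE; case: tpermP => [->|->|/eqP lj /eqP lk].
- by rewrite eqxx; case: eqP => [->|_]; rewrite ?subrr ?mulr0 ?addr0//= subr0 mulr1; ring.
- by rewrite eqxx; case: eqP => [->|_]; rewrite ?subrr ?mulr0 ?addr0//=; ring.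
- by rewrite (negbTE lj) (negbTE lk) subrr mulr0 addr0.
Qed.

Lemma spin_swapl c j k : s (swap c j k) j = s c k.
Proof. by rewrite /spin ffunE tpermL. Qed.

Lemma spin_swapr c j k : s (swap c j k) k = s c j.
Proof. by rewrite /spin ffunE tpermR. Qed.

Lemma spin_swap_out c j k l : l != j -> l != k -> s (swap c j k) l = s c l.
Proof. by move=> lj lk; rewrite /spin ffunE tpermD // eq_sym. Qed.

Lemma sum_delta (F : site -> R) j k d :
  \sum_l F l * (d * ((l == j)%:R - (l == k)%:R)) = d * (F j - F k).
Proof.
under eq_bigr do rewrite mulrBr mulrBr mulrCA [X in _ - X]mulrCA -mulrBr.
rewrite -mulr_sumr sumrB; congr (_ * (_ - _)).
  rewrite (bigD1 j)//= eqxx mulr1 big1 ?addr0// => i /negbTE ->; exact: mulr0.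
rewrite (bigD1 k)//= eqxx mulr1 big1 ?addr0// => i /negbTE ->; exact: mulr0.
Qed.

Lemma local_field_swap c j k i :
  h (swap c j k) i = h c i + (s c k - s c j) * (kap (i - j) - kap (i - k)).
Proof.
rewrite /local_field; under eq_bigr do rewrite spin_swap mulrDr.
by rewrite big_split/= sum_delta.
Qed.

Hypothesis kap0 : kap 0 = 0.
Hypothesis kapN : forall i, kap (- i) = kap i.

Lemma kap_sym i j : kap (i - j) = kap (j - i).
Proof. by rewrite -kapN opprB. Qed.

Lemma hamE c : H c = - 2^-1 * \sum_i h c i * s c i.
Proof.
rewrite /hamiltonian; congr (_ * _); apply: eq_bigr => i _.
rewrite /local_field mulr_suml; apply: eq_bigr => j _; by rewrite mulrAC.
Qed.

Lemma sum_field_sym c (d : site -> R) :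
  \sum_i (\sum_j kap (i - j) * d j) * s c i = \sum_j h c j * d j.
Proof.
under eq_bigr do rewrite mulr_suml.
rewrite exchange_big/=; apply: eq_bigr => j _; rewrite /local_field mulr_suml.
apply: eq_bigr => i _; rewrite kap_sym; ring.
Qed.

(** The quadratic form is expanded around c. Since [kap 0 = 0], the second-order term reduces to the
    coupling between the two exchanged sites. *)
Lemma ham_swap c j k : H (swap c j k) - H c =
  (s c j - s c k) * (h c j - h c k) + kap (j - k) * (s c j - s c k) ^+ 2.
Proof.
rewrite !hamE -mulrBr.
under eq_bigr do rewrite local_field_swap spin_swap [X in X * _]/= mulrDr
  (mulrDl _ _ (s c _)) (mulrDl _ _ (_ * (_ - _))).
rewrite !big_split/= sum_delta.
have -> : \sum_i (s c k - s c j) * (kap (i - j) - kap (i - k)) * s c i =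
   (s c k - s c j) * (h c j - h c k).
  under eq_bigr do rewrite -mulrA; rewrite -mulr_sumr; congr (_ * _).
  under eq_bigr do rewrite mulrBl; rewrite sumrB /local_field.
  by congr (_ - _); apply: eq_bigr => i _; rewrite kap_sym.
have -> : \sum_i (s c k - s c j) * (kap (i - j) - kap (i - k)) *
    ((s c k - s c j) * ((i == j)%:R - (i == k)%:R)) =
   (s c k - s c j) ^+ 2 * (- 2 * kap (j - k)).
  by rewrite sum_delta !subrr kap0 (kap_sym k j); ring.
by field.
Qed.

(** Neither normalized nor restricted to a fixed total spin: it is positive on every configuration,
    so that densities with respect to it always make sense. *)
Definition weight c := expR (- beta * H c).
Local Notation w := weight.

(** The reciprocal of the factor exp(beta s_j h_j) through which the interaction of the site j
    enters the weight. *)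
Definition tilt c j := expR (- beta * (s c j * h c j)).
Local Notation u := tilt.

Lemma weight_gt0 c : 0 < w c. Proof. exact: expR_gt0. Qed.
Lemma weight_ge0 c : 0 <= w c. Proof. exact: expR_ge0. Qed.
Lemma tilt_gt0 c j : 0 < u c j. Proof. exact: expR_gt0. Qed.

(* Removing the interaction of the sites j and k from the Gibbs weight leaves a
   weight that is invariant under their exchange. *)
Lemma weight_tilt_swap c j k : j != k ->
  w (swap c j k) * (u (swap c j k) j * u (swap c j k) k) = w c * (u c j * u c k).
Proof.
move=> jk; rewrite /weight /tilt -!expRD; congr expR.
have := ham_swap c j k.
rewrite !local_field_swap spin_swapl spin_swapr !subrr kap0 (kap_sym k j).
set a := H _; set b := H c => /eqP; rewrite subr_eq => /eqP ->.
have := spin_sq c j; have := spin_sq c k.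
move: (s c j) (s c k) (h c j) (h c k) (kap _) => x y p q r xx yy.
ring: xx yy.
Qed.

End Swaps.

(** * Observables that depend weakly on each single spin *)

Section WeakDependence.
Context (R : realType) (N : nat) (om : R).
Local Notation site := (site N).
Local Notation config := (config N).
Local Notation s := (@spin R N).

(* F is bounded by b and changes by at most b * om when two spins outside S are
   exchanged. *)
Definition weak (S : seq site) (b : R) (F : config -> R) :=
  (forall c, `|F c| <= b) /\
  (forall j k c, j \notin S -> k \notin S -> `|F (swap c j k) - F c| <= b * om).

Hypothesis om0 : 0 <= om.

Lemma weak_ge0 S b F : weak S b F -> 0 <= b.
Proof. by case=> Fb _; apply: le_trans (Fb [ffun=> true]); exact: normr_ge0. Qed.

Lemma weak_sub S S' b b' F : {subset S <= S'} -> b <= b' ->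
  weak S b F -> weak S' b' F.
Proof.
move=> SS bb [Fb Fo]; split=> [c|j k c jS kS]; first exact: le_trans (Fb c) bb.
apply: le_trans (Fo j k c _ _) _; first by apply: contra jS => /SS.
  by apply: contra kS => /SS.
exact: ler_wpM2r.
Qed.

Lemma weak_cst S a : weak S `|a| (fun=> a).
Proof. by split=> // j k c _ _; rewrite subrr normr0 mulr_ge0. Qed.

(** One constant has to dominate both the sup norm, at most B, and the oscillation divided by [om],
    at most L * b; hence the sum. *)
Lemma weak_lip S b B F L (phi : R -> R) : weak S b F ->
  (forall c, `|phi (F c)| <= B) -> 0 <= L ->
  (forall c c', `|phi (F c) - phi (F c')| <= L * `|F c - F c'|) ->
  weak S (B + L * b) (phi \o F).
Proof.
move=> wF phiB L0 phiL; have [Fb Fo] := wF; have b0 := weak_ge0 wF.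
split=> [c|j k c jS kS] /=.
  by apply: le_trans (phiB c) _; rewrite lerDl mulr_ge0.
apply: le_trans (phiL _ _) _; rewrite mulrDl -mulrA.
have B0 : 0 <= B by apply: le_trans (phiB c); exact: normr_ge0.
apply: (@le_trans _ _ (L * (b * om))); first by rewrite ler_wpM2l// Fo.
by rewrite lerDr mulr_ge0.
Qed.

Lemma weakD S b b' F G : weak S b F -> weak S b' G ->
  weak S (b + b') (fun c => F c + G c).
Proof.
move=> [Fb Fo] [Gb Go]; split=> [c|j k c jS kS].
  exact: le_trans (ler_normD _ _) (lerD (Fb c) (Gb c)).
rewrite opprD addrACA mulrDl.
exact: le_trans (ler_normD _ _) (lerD (Fo _ _ _ _ _) (Go _ _ _ _ _)).
Qed.

Lemma weakN S b F : weak S b F -> weak S b (fun c => - F c).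
Proof.
move=> [Fb Fo]; split=> [c|j k c jS kS]; first by rewrite normrN.
by rewrite -opprD normrN Fo.
Qed.

Lemma weakM S b b' F G : weak S b F -> weak S b' G ->
  weak S (2 * b * b') (fun c => F c * G c).
Proof.
move=> wF wG; have b0 := weak_ge0 wF; have b0' := weak_ge0 wG.
have [Fb Fo] := wF; have [Gb Go] := wG.
have M c c' : `|F c| * `|G c'| <= b * b' by apply: ler_pM.
split=> [c|j k c jS kS].
  rewrite normrM; apply: le_trans (M c c) _.
  by rewrite -mulrA ler_peMl ?mulr_ge0// ler1n.
have -> : F (swap c j k) * G (swap c j k) - F c * G c =
  F (swap c j k) * (G (swap c j k) - G c) + (F (swap c j k) - F c) * G c by ring.
apply: le_trans (ler_normD _ _) _; rewrite !normrM.
have -> : 2 * b * b' * om = b * (b' * om) + b * om * b' by ring.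
by apply: lerD; apply: ler_pM => //; [exact: Go|exact: Fo].
Qed.

Lemma weak_inv S b m F : 0 < m -> (forall c, m <= F c) -> weak S b F ->
  weak S (m^-1 + m^-1 * m^-1 * b) (fun c => (F c)^-1).
Proof.
move=> m0 mF wF.
have F0 c : 0 < F c by apply: lt_le_trans (mF c).
have Fi c : `|(F c)^-1| <= m^-1 by rewrite gtr0_norm ?invr_gt0// lef_pV2 ?posrE.
apply: (weak_lip wF (phi := GRing.inv)) => //.
  by rewrite mulr_ge0// invr_ge0 ltW.
move=> c c'.
have -> : (F c)^-1 - (F c')^-1 = (F c)^-1 * (F c')^-1 * (F c' - F c).
  by field; rewrite !gt_eqF.
rewrite !normrM (distrC (F c')) ler_wpM2r//.
by apply: ler_pM.
Qed.

Lemma expR_lip (b x y : R) : `|x| <= b -> `|y| <= b ->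
  `|expR x - expR y| <= expR b * `|x - y|.
Proof.
wlog xy : x y / x <= y.
  move=> W xb yb; have [xy|/ltW yx] := leP x y; first exact: W.
  by rewrite distrC (distrC x); exact: W.
move=> _ yb; rewrite distrC (distrC x) !ger0_norm ?subr_ge0 ?ler_expR//.
have -> : expR y - expR x = expR y * (1 - expR (x - y)).
  by rewrite mulrBr mulr1 -expRD subrKC.
apply: ler_pM; rewrite ?expR_ge0//.
- by rewrite subr_ge0 -expR0 ler_expR subr_le0.
- by rewrite ler_expR; apply: le_trans (ler_norm _) yb.
- by have := expR_ge1Dx (x - y); lra.
Qed.

Lemma weak_exp S b F : weak S b F ->
  weak S (expR b + expR b * b) (fun c => expR (F c)).
Proof.
move=> wF; have [Fb _] := wF.
apply: (weak_lip wF (phi := expR)) => //; rewrite ?expR_ge0//.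
  move=> c; rewrite ger0_norm ?expR_ge0// ler_expR.
  exact: le_trans (ler_norm _) (Fb c).
by move=> c c'; apply: expR_lip.
Qed.

Lemma weak_spin j S : j \in S -> weak S 1 (s ^~ j).
Proof.
move=> jS; split=> [c|k l c kS lS]; first by rewrite spin_norm.
rewrite spin_swap_out ?subrr ?normr0 ?mul1r//.
  by apply: contraNneq kS => <-.
by apply: contraNneq lS => <-.
Qed.

(** Averaging removes the exceptional sites. Outside them the oscillation is b * om; the indices
    whose exceptional set contains j or k carry a weight of at most 2 * om each, and there the
    trivial bound 2 * b is used: 1 + (2 + 2) * 2 = 9. *)
Lemma weak_avg (I : finType) (P : pred I) (a : I -> R) (S : I -> seq site) b
    (F : I -> config -> R) :
  (forall i, P i -> 0 <= a i) -> \sum_(i | P i) a i <= 1 ->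
  (forall i, P i -> weak (S i) b (F i)) -> 0 <= b ->
  (forall j, \sum_(i | P i && (j \in S i)) a i <= 2 * om) ->
  weak [::] (9 * b) (fun c => \sum_(i | P i) a i * F i c).
Proof.
move=> a0 a1 wF b0 aS; split=> [c|j k c _ _].
  apply: le_trans (ler_norm_sum _ _ _) _.
  apply: (@le_trans _ _ (\sum_(i | P i) a i * b)).
    apply: ler_sum => i Pi; rewrite normrM ger0_norm ?a0//.
    by rewrite ler_wpM2l ?a0//; case: (wF i Pi).
  by rewrite -mulr_suml ler_wpM2r// (le_trans a1)// ler1n.
rewrite -sumrB; apply: le_trans (ler_norm_sum _ _ _) _.
pose ind (i : I) (l : site) : R := (l \in S i)%:R.
apply: (@le_trans _ _ (\sum_(i | P i)
   (a i * (b * om) + (a i * (ind i j)  + a i * ind i k) * (2 * b)))).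
  apply: ler_sum => i Pi; rewrite -mulrBr normrM ger0_norm ?a0//.
  have [Fb Fo] := wF i Pi.
  have T : `|F i (swap c j k) - F i c| <= 2 * b.
    by apply: le_trans (ler_normB _ _) _; rewrite mulr2n mulrDl mul1r lerD.
  have E : a i * (b * om) + (a i * ind i j + a i * ind i k) * (2 * b) =
     a i * (b * om + (ind i j + ind i k) * (2 * b)) by ring.
  rewrite E ler_wpM2l ?a0// /ind.
  have [jS|jS] := boolP (j \in S i).
    apply: le_trans T _; apply: ler_wpDl; first exact: mulr_ge0.
    by rewrite ler_peMl ?mulr_ge0// lerDl ler0n.
  have [kS|kS] := boolP (k \in S i).
    apply: le_trans T _; apply: ler_wpDl; first exact: mulr_ge0.
    by rewrite ler_peMl ?mulr_ge0// lerDr ler0n.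
  by rewrite addr0 mul0r addr0 Fo.
have H (l : site) : \sum_(i | P i) a i * ind i l <= 2 * om.
  rewrite (bigID (fun i => l \in S i))/= [X in _ + X]big1 ?addr0.
    apply: le_trans (aS l); apply: ler_sum => i /andP[Pi li].
    by rewrite /ind li mulr1.
  by move=> i /andP[_ /negbTE li]; rewrite /ind li mulr0.
rewrite big_split/= -!mulr_suml big_split/= -mulrA (mulrC b om).
have -> : 9 * (om * b) = 1 * (om * b) + (2 * om + 2 * om) * (2 * b) by ring.
apply: lerD; first by rewrite ler_wpM2r ?mulr_ge0.
by rewrite ler_wpM2r ?mulr_ge0// lerD.
Qed.

End WeakDependence.

(** * The cost of exchanging two distant spins *)

Section Replacement.
Context (R : realType) (K : R -> R) (N : nat) (gamma beta : R).
Local Notation n := (N.*2).+1.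
Local Notation site := (site N).
Local Notation config := (config N).
Local Notation kap := (@kappa R K N gamma).
Local Notation H := (@hamiltonian R K N gamma).
Local Notation s := (@spin R N).
Local Notation h := (@local_field R K N gamma).
Local Notation w := (@weight R K N gamma beta).
Local Notation u := (@tilt R K N gamma beta).

Hypothesis kap0 : kap 0 = 0.
Hypothesis kapN : forall i, kap (- i) = kap i.
Hypothesis kap_ge0 : forall i, 0 <= kap i.
Hypothesis kap_sum : \sum_i kap i = 1.
Hypothesis beta1 : `|beta| <= 1.

Lemma kap_sumB i : \sum_j kap (i - j) = 1.
Proof.
rewrite -kap_sum (reindex_inj (h := fun j => i - j)) /=; last first.
  by move=> x y /addrI/oppr_inj.
by apply: eq_bigr => j _; rewrite opprB addrC subrK.
Qed.

Lemma kap_sumBl i : \sum_j kap (j - i) = 1.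
Proof. by rewrite -(kap_sumB i); apply: eq_bigr => j _; exact: kap_sym. Qed.

Lemma kap_le1 i : kap i <= 1.
Proof. by rewrite -kap_sum (bigD1 i)//= lerDl sumr_ge0. Qed.

Lemma field_norm c j : `|h c j| <= 1.
Proof.
apply: le_trans (ler_norm_sum _ _ _) _; rewrite -(kap_sumB j).
by apply: ler_sum => i _; rewrite normrM spin_norm mulr1 ger0_norm.
Qed.

Lemma ham_swap_norm c j k : `|H (swap c j k) - H c| <= 8.
Proof.
rewrite ham_swap//; have := field_norm c j; have := field_norm c k.
have := kap_ge0 (j - k); have := kap_le1 (j - k).
move: (h c j) (h c k) (kap _) => x y p.
rewrite !ler_norml => p1 p0 /andP[? ?] /andP[? ?].
by case: (spin_cases R c j) => ->; case: (spin_cases R c k) => ->;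
  apply/andP; split; lra.
Qed.

Lemma tilt_bounds c j : expR (-1) <= u c j <= expR 1.
Proof.
have : `|- beta * (s c j * h c j)| <= 1.
  by rewrite !normrM normrN spin_norm mul1r mulr_ile1// field_norm.
by rewrite /tilt !ler_expR ler_norml.
Qed.

Lemma weight_swap_le (eta : R) c c' : `|H c' - H c| <= eta -> w c <= expR eta * w c'.
Proof.
move=> Heta; rewrite /weight -expRD ler_expR.
suff: `|beta * (H c' - H c)| <= eta by rewrite ler_norml => /andP[_]; lra.
by rewrite normrM; apply: le_trans Heta; rewrite ler_piMl.
Qed.

Variable q : config -> R.
Hypothesis q0 : forall c, 0 <= q c.
Hypothesis q2 : \sum_c q c <= 2.
Local Notation f := (fun c => q c / w c).
(** An expectation under [q], whose mass is allowed to be 2 because [q] will be the law at a given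
    time plus a small multiple of the weight. *)
Definition wexp (G : config -> R) := \sum_c q c * G c.
Local Notation E := wexp.

Lemma wexpD F G : E (fun c => F c + G c) = E F + E G.
Proof. by rewrite /wexp -big_split/=; apply: eq_bigr => c _; rewrite mulrDr. Qed.

Lemma wexpB F G : E (fun c => F c - G c) = E F - E G.
Proof. by rewrite /wexp -sumrB/=; apply: eq_bigr => c _; rewrite mulrBr. Qed.

Lemma wexpZ a F : E (fun c => a * F c) = a * E F.
Proof. by rewrite /wexp mulr_sumr; apply: eq_bigr => c _; rewrite mulrCA. Qed.

Lemma wexp_sum (I : finType) (P : pred I) (F : I -> config -> R) :
  E (fun c => \sum_(i | P i) F i c) = \sum_(i | P i) E (F i).
Proof.
by rewrite /wexp exchange_big/=; apply: eq_bigr => c _; rewrite mulr_sumr.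
Qed.

Lemma eq_wexp F G : F =1 G -> E F = E G.
Proof. by move=> FG; apply: eq_bigr => c _; rewrite FG. Qed.

Lemma le_wexp F G : (forall c, F c <= G c) -> E F <= E G.
Proof. by move=> FG; apply: ler_sum => c _; rewrite ler_wpM2l. Qed.

Lemma wexp_norm F b : (forall c, `|F c| <= b) -> `|E F| <= 2 * b.
Proof.
move=> Fb; apply: le_trans (ler_norm_sum _ _ _) _.
have b0 : 0 <= b by apply: le_trans (Fb [ffun=> true]); exact: normr_ge0.
apply: (@le_trans _ _ (\sum_c q c * b)).
  by apply: ler_sum => c _; rewrite normrM (ger0_norm (q0 c)) ler_wpM2l.
by rewrite -mulr_suml ler_wpM2r.
Qed.

(** The L1 asymmetry of the density q / w under an exchange. All replacement errors are expressed in
    it, and the entropy production controls it. *)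
Definition swap_var j k := \sum_c w c * `|f c - f (swap c j k)|.

Lemma swap_var_ge0 j k : 0 <= swap_var j k.
Proof. by apply: sumr_ge0 => c _; rewrite mulr_ge0// ltW ?weight_gt0. Qed.

Lemma swap_varC j k : swap_var j k = swap_var k j.
Proof. by apply: eq_bigr => c _; rewrite swapC. Qed.

Variable om : R.
Hypothesis om0 : 0 <= om.

Lemma sum_swap (F : config -> R) j k : \sum_c F c = \sum_c F (swap c j k).
Proof. by rewrite (reindex_inj (inv_inj (@swapK N j k))). Qed.

(** The weight times the two tilts is invariant under the exchange of j and k, while s_j - s_k is
    odd. Symmetrizing the sum leaves only the variation of the density, paid by [swap_var], and the
    variation of F, paid by [om]. *)
Lemma pair_exchange j k S b F : j != k -> weak om S b F ->
  j \notin S -> k \notin S ->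
  `|E (fun c => F c * (u c j * u c k * (s c j - s c k)))| <=
     expR 2 * b * (swap_var j k + 2 * om).
Proof.
move=> jk wF jS kS; have [Fb Fo] := wF; have b0 := weak_ge0 wF.
pose r c := w c * (u c j * u c k).
have r0 c : 0 <= r c by apply: mulr_ge0; [|apply: mulr_ge0]; apply: ltW; [exact: weight_gt0|exact: tilt_gt0..].
have rw c : r c <= expR 2 * w c.
  rewrite /r mulrC ler_wpM2r ?weight_ge0//.
  have -> : (2 : R) = 1 + 1 by ring.
  rewrite expRD; have /andP[? ?] := tilt_bounds c j.
  have /andP[? ?] := tilt_bounds c k.
  by apply: ler_pM => //; apply/ltW/tilt_gt0.
have rS c : r (swap c j k) = r c by exact: weight_tilt_swap.
have Ef c : q c = f c * w c by rewrite divfK// gt_eqF// weight_gt0.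
have f0 c : 0 <= f c by rewrite divr_ge0//; exact: weight_ge0.
pose A c := r c * (s c j - s c k) * (F c * f c).
have -> : E (fun c => F c * (u c j * u c k * (s c j - s c k))) = \sum_c A c.
  by apply: eq_bigr => c _; rewrite {1}Ef /A /r; ring.
have -> : \sum_c A c = 2^-1 * \sum_c (A c + A (swap c j k)).
  by rewrite big_split/= -sum_swap; field.
have AE c : A c + A (swap c j k) = r c * (s c j - s c k) *
    (F c * (f c - f (swap c j k)) + (F c - F (swap c j k)) * f (swap c j k)).
  by rewrite /A rS spin_swapl spin_swapr; ring.
rewrite normrM ger0_norm ?invr_ge0// ler_pdivrMl//.
apply: le_trans (ler_norm_sum _ _ _) _.
apply: (@le_trans _ _ (\sum_c (2 * (expR 2 * b) * (w c * `|f c - f (swap c j k)|)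
   + 2 * (b * om) * (r (swap c j k) * f (swap c j k))))).
  apply: ler_sum => c _; rewrite AE normrM normrM (ger0_norm (r0 c)).
  have sb : `|s c j - s c k| <= 2.
    by apply: le_trans (ler_normB _ _) _; rewrite !spin_norm.
  apply: (@le_trans _ _ (r c * 2 * (b * `|f c - f (swap c j k)| +
     b * om * f (swap c j k)))).
    apply: ler_pM => //; [exact: mulr_ge0|by apply: ler_wpM2l|].
    apply: le_trans (ler_normD _ _) _; apply: lerD; rewrite normrM.
      exact: ler_wpM2r.
    by rewrite (ger0_norm (f0 _)) ler_wpM2r ?f0// distrC Fo.
  rewrite rS mulrDr; apply: lerD; last by rewrite le_eqVlt; apply/orP; left; apply/eqP; ring.
  have -> : 2 * (expR 2 * b) * (w c * `|f c - f (swap c j k)|) =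
    expR 2 * w c * (2 * (b * `|f c - f (swap c j k)|)) by ring.
  by rewrite -mulrA ler_wpM2r// !mulr_ge0.
rewrite big_split/= -!mulr_sumr.
rewrite -(sum_swap (fun c => r c * f c)).
have -> : \sum_c w c * `|f c - f (swap c j k)| = swap_var j k by [].
have rf : \sum_c r c * f c <= expR 2 * 2.
  apply: (@le_trans _ _ (expR 2 * \sum_c q c)); last by rewrite ler_wpM2l ?expR_ge0.
  rewrite mulr_sumr; apply: ler_sum => c _; rewrite [in leRHS](Ef c) (mulrC (f c)).
  by rewrite [leRHS]mulrA; apply: ler_wpM2r.
have E2 := expR_ge0 (2 : R).
have : 0 <= b * om by rewrite mulr_ge0.
move/ler_wpM2l => /(_ _ _ rf); move: (\sum_c _) => X HX.
have -> : 2 * (expR 2 * b * (swap_var j k + 2 * om)) =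
 2 * (expR 2 * b) * swap_var j k + 2 * (b * om * (expR 2 * 2)) by ring.
by rewrite lerD2l -mulrA ler_wpM2l.
Qed.

Variable eta : R.
Hypothesis ham_exchange : forall c i, `|H (exchange c i) - H c| <= eta.

Definition bond_var i := swap_var i (succ_site i).
Local Notation J := bond_var.

Lemma succ_inord p : (p.+1 < n)%N -> succ_site (inord p : site) = inord p.+1.
Proof.
move=> pn; apply: val_inj; rewrite /succ_site/= !inordK ?(ltnW pn)//.
by rewrite modnDmr addn1 modn_small.
Qed.

(** The exchange of i and k is written as in [swap_conj], and each of the three variations is
    transported back to c at the price of a ratio of weights. The recursive term is shifted by the
    short exchange only, so it costs exp eta; the large factor exp 8 falls on the last bond and is
    not compounded by the induction. *)
Lemma swap_var_step i j k : i != j -> j != k -> i != k ->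
  (forall c, `|H (swap c j k) - H c| <= eta) ->
  swap_var i k <= expR eta * swap_var i j + (1 + expR eta * expR 8) * swap_var j k.
Proof.
move=> ij jk ik Heta.
pose c1 c := swap c j k; pose c2 c := swap (c1 c) i j.
have c3 c : swap (c2 c) j k = swap c i k by exact: swap_conj.
apply: (@le_trans _ _ (\sum_c (w c * `|f c - f (c1 c)| +
   w c * `|f (c1 c) - f (swap (c1 c) i j)| + w c * `|f (c2 c) - f (swap (c2 c) j k)|))).
  apply: ler_sum => c _; rewrite -!mulrDr ler_wpM2l ?weight_ge0//.
  rewrite c3 -/(c2 c).
  have -> : f c - f (swap c i k) = (f c - f (c1 c)) + (f (c1 c) - f (c2 c)) +
     (f (c2 c) - f (swap c i k)) by ring.
  apply: le_trans (ler_normD _ _) _; rewrite lerD2r; exact: ler_normD.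
rewrite !big_split/= -[X in X + _ + _]/(swap_var j k).
have -> : expR eta * swap_var i j + (1 + expR eta * expR 8) * swap_var j k =
 swap_var j k + expR eta * swap_var i j + expR eta * expR 8 * swap_var j k by ring.
apply: lerD; first (rewrite lerD2l).
  rewrite (sum_swap _ j k) mulr_sumr; apply: ler_sum => c _.
  rewrite /c1 swapK mulrA ler_wpM2r// weight_swap_le//.
  by rewrite distrC.
rewrite (sum_swap _ j k) (sum_swap _ i j) mulr_sumr; apply: ler_sum => c _.
rewrite /c2 /c1 !swapK mulrA ler_wpM2r//.
have := Heta (swap c i j); rewrite distrC => /weight_swap_le/le_trans; apply.
  by rewrite -mulrA ler_wpM2l ?expR_ge0// weight_swap_le// distrC ham_swap_norm.
Qed.

Lemma swap_var_path p d : (p + d < n)%N ->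
  swap_var (inord p) (inord (p + d)) <=
    expR eta ^+ d * ((1 + expR eta * expR 8) * \sum_(i < d) J (inord (p + i))).
Proof.
have e0 : 0 <= eta.
  by apply: le_trans (ham_exchange [ffun=> true] 0); exact: normr_ge0.
have e1 : 1 <= expR eta by rewrite -expR0 ler_expR.
elim: d => [|d IH] pd.
  rewrite addn0 big_ord0 mulr0 mulr0 /swap_var big1// => c _.
  by rewrite swapxx subrr normr0 mulr0.
rewrite addnS in pd; have bd : succ_site (inord (p + d) : site) = inord (p + d).+1.
  exact: succ_inord.
have neq a b : (a < b)%N -> (b < n)%N -> (inord a : site) != inord b.
  move=> ab bn; apply/eqP => /(congr1 val)/=; rewrite !inordK//; first by lia.
  exact: ltn_trans bn.
have C0 : 0 <= 1 + expR eta * expR 8 by rewrite addr_ge0// mulr_ge0 ?expR_ge0.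
have CJ : swap_var (inord (p + d)) (inord (p + d.+1)) = J (inord (p + d)).
  by rewrite /bond_var bd addnS.
rewrite big_ord_recr/= mulrDr mulrDr.
have last_le : (1 + expR eta * expR 8) * J (inord (p + d)) <=
   expR eta ^+ d.+1 * ((1 + expR eta * expR 8) * J (inord (p + d))).
  by rewrite ler_peMl// ?exprn_ege1// mulr_ge0// swap_var_ge0.
(* Across a single bond the three sites of [swap_var_step] are not distinct, so the case d = 1 is
   treated directly. *)
case: d => [|d] in IH pd bd CJ last_le *.
  rewrite big_ord0 !mulr0 add0r; apply: le_trans last_le.
  rewrite -CJ addn0 ler_peMl ?swap_var_ge0//.
  by rewrite lerDl mulr_ge0 ?expR_ge0.
apply: le_trans (swap_var_step (j := inord (p + d.+1)) _ _ _ _) _.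
- apply: neq; lia.
- apply: neq; lia.
- apply: neq; lia.
- by move=> c; rewrite [(p + d.+2)%N]addnS -bd -exchangeE.
rewrite CJ; apply: lerD; last exact: last_le.
rewrite exprS -mulrA ler_wpM2l ?expR_ge0// IH//; lia.
Qed.

Lemma sum_bond_le p d (P : pred site) :
  (forall i : site, (p <= i < p + d)%N -> P i) -> (p + d < n)%N ->
  \sum_(i < d) J (inord (p + i)) <= \sum_(i | P i) J i.
Proof.
move=> PP pd; rewrite -(big_mkord xpredT (fun i => J (inord (p + i)))).
have -> : \sum_(0 <= i < d) J (inord (p + i)) = \sum_(p <= i < p + d) J (inord i).
  have := @big_addn _ 0 +%R 0 (p + d) p xpredT (fun i => J (inord i)).
  rewrite add0n addKn => ->.
  by apply: eq_bigr => i _; rewrite addnC.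
have -> : \sum_(p <= i < p + d) J (inord i) =
   \sum_(i : site | (p <= i < p + d)%N) J i.
  rewrite (@big_nat_widen _ _ _ p (p + d) n) ?(ltnW pd)// (@big_nat_widenl _ _ _ p 0)//.
  rewrite big_mkord; apply: eq_big => [i|i _]; first by rewrite andTb andbC.
  by rewrite inord_val.
rewrite big_mkcond [leRHS]big_mkcond/=; apply: ler_sum => i _.
by case: ifP => [/PP ->//|_]; case: ifP => // _; exact: swap_var_ge0.
Qed.

End Replacement.

(** * The mean-field inequality for two local magnetizations *)

Section PairInequality.
Context (R : realType).

Lemma is_derive_continuous (f df : R -> R) : (forall x : R, is_derive x (1 : R) f (df x)) ->
  continuous f.
Proof.
move=> fd x; apply: differentiable_continuous; apply/derivable1_diffP.
by have [] := fd x.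
Qed.

Lemma derive_ge0_ge0 (f df : R -> R) : (forall x : R, is_derive x (1 : R) f (df x)) ->
  (forall x, 0 <= x -> 0 <= df x) -> 0 <= f 0 -> forall x, 0 <= x -> 0 <= f x.
Proof.
move=> fd df0 f0 x x0.
have [|c] := MVT_segment x0 (fun y _ => fd y).
  exact/continuous_subspaceT/is_derive_continuous.
rewrite in_itv/= => /andP[c0 _] fE.
have : 0 <= df c * (x - 0) by rewrite mulr_ge0 ?df0// subr0.
by rewrite -fE; lra.
Qed.

Lemma expR_cubic (z : R) : 0 <= z -> z ^+ 3 / 6 <= (z - 2) * expR z + z + 2.
Proof.
move=> z0.
pose f (z : R) := (z - 2) * expR z + z + 2 - z ^+ 3 / 6.
pose g (z : R) := (z - 1) * expR z + 1 - z ^+ 2 / 2.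
suff: 0 <= f z by rewrite /f; lra.
move: z z0; apply: (@derive_ge0_ge0 _ g).
- move=> x; rewrite /f /g; apply: is_derive_eq.
  by rewrite /GRing.scale/=; field.
- apply: (@derive_ge0_ge0 _ (fun x => x * expR x - x)).
  + move=> x; rewrite /g; apply: is_derive_eq.
    by rewrite /GRing.scale/=; field.
  + move=> x x0; rewrite subr_ge0 ler_peMr//.
    by apply: le_trans (expR_ge1Dx x); rewrite lerDl.
  + by rewrite /g expR0; lra.
- by rewrite /f expR0; lra.
Qed.

Definition cst_c : R := (6 * (expR 2 + 1))^-1.

Lemma cst_c_gt0 : 0 < cst_c.
Proof. by rewrite invr_gt0 mulr_gt0// addr_gt0 ?expR_gt0. Qed.

(** The last hypothesis is D <= 2 tanh(z / 2), freed of its denominator. [expR_cubic] provides a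
    gain of order z^3, and z <= 2 allows the factor exp z + 1 to be absorbed into [cst_c]. *)
Lemma half_tanh_le (z D : R) : 0 <= z <= 2 -> 0 <= D ->
  D * (expR z + 1) <= 2 * (expR z - 1) -> D <= z - cst_c * z ^+ 3.
Proof.
move=> /andP[z0 z2] D0 HD.
have e1 : 0 < expR z + 1 by rewrite addr_gt0 ?expR_gt0.
rewrite -(ler_pM2r e1); apply: le_trans HD _.
have cz : cst_c * z ^+ 3 * (expR z + 1) <= z ^+ 3 / 6.
  have -> : cst_c * z ^+ 3 * (expR z + 1) =
      z ^+ 3 / 6 * ((expR 2 + 1)^-1 * (expR z + 1)) by rewrite /cst_c invfM; ring.
  rewrite ler_piMr ?divr_ge0 ?exprn_ge0// mulrC ler_pdivrMr.
    by rewrite mul1r lerD2r ler_expR.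
  by rewrite addr_gt0 ?expR_gt0.
have := expR_cubic z0; move: (expR z) cz => e; nra.
Qed.

(* The local magnetization at scaled field x: tanh (x + artanh tau), in a form
   which also makes sense for tau = 1 and tau = -1. *)
Definition local_mag (tau x : R) :=
  ((1 + tau) * expR x - (1 - tau) * expR (- x)) /
  ((1 + tau) * expR x + (1 - tau) * expR (- x)).

Lemma local_mag_den (tau x : R) : `|tau| <= 1 ->
  0 < (1 + tau) * expR x + (1 - tau) * expR (- x).
Proof.
rewrite ler_norml => /andP[t1 t2].
have := expR_gt0 x; have := expR_gt0 (- x); move: (expR x) (expR (- x)) => a b b0 a0.
by have [|] := leP 0 tau => ?; nra.
Qed.

Lemma local_mag_norm (tau x : R) : `|tau| <= 1 -> `|local_mag tau x| <= 1.
Proof.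
move=> t1; have D0 := local_mag_den x t1.
rewrite normrM normfV (gtr0_norm D0) ler_pdivrMr// mul1r.
move: t1 {D0}; rewrite !ler_norml => /andP[t1 t2].
have := expR_gt0 x; have := expR_gt0 (- x); move: (expR x) (expR (- x)) => a b b0 a0.
by apply/andP; split; nra.
Qed.

(** Two values of tanh at arguments at distance z differ by at most 2 tanh(z / 2), the worst case
    being symmetric about 0. Hence D <= z - c z^3 <= z - c D^3, and multiplication by D gives the
    claim. Exponentials are used throughout in order to include tau = 1 and tau = -1. *)
Lemma local_mag_pair (tau x y : R) : `|tau| <= 1 -> `|x| <= 1 -> `|y| <= 1 ->
  cst_c * (local_mag tau x - local_mag tau y) ^+ 4 <=
  (x - y) * (local_mag tau x - local_mag tau y) -
  (local_mag tau x - local_mag tau y) ^+ 2.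
Proof.
move=> t1; wlog yx : x y / y <= x.
  move=> W x1 y1; have [yx|/ltW xy] := leP y x; first exact: W.
  have := W _ _ xy y1 x1; move: (local_mag _ x) (local_mag _ y) => a b; lra.
rewrite !ler_norml => /andP[x1 x2] /andP[y1 y2].
have Dx := local_mag_den x t1; have Dy := local_mag_den y t1.
set z := x - y; set D := _ - _.
have z02 : 0 <= z <= 2 by rewrite /z; apply/andP; split; lra.
have /andP[z0 z2] := z02.
have [D0 key] : 0 <= D /\ D * (expR z + 1) <= 2 * (expR z - 1).
  have Z1 : 1 <= expR z by rewrite -expR0 ler_expR.
  have Ez : expR x * expR (- y) = expR z by rewrite -expRD.
  have EzN : expR y * expR (- x) = expR (- z) by rewrite -expRD opprB.
  have Zz : expR z * expR (- z) = 1 by rewrite -expRD subrr expR0.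
  have Xx : expR x * expR (- x) = 1 by rewrite -expRD subrr expR0.
  have Yy : expR y * expR (- y) = 1 by rewrite -expRD subrr expR0.
  move: Dx Dy t1; rewrite ler_norml /D /local_mag.
  have a0 := expR_gt0 x; have p0 := expR_gt0 (- x).
  have b0 := expR_gt0 y; have r0 := expR_gt0 (- y).
  have W0 := expR_gt0 (- z).
  move: (expR x) (expR (- x)) (expR y) (expR (- y)) (expR z) (expR (- z))
    a0 p0 b0 r0 W0 Ez EzN Zz Xx Yy Z1.
  move=> a p b r Z W a0 p0 b0 r0 W0 Ez EzN ZW ap br Z1 Dx Dy /andP[t1 t2].
  set A := 1 + tau in Dx Dy *; set B := 1 - tau in Dx Dy *.
  have A0 : 0 <= A by rewrite /A; lra.
  have B0 : 0 <= B by rewrite /B; lra.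
  set S := (A * a + B * p) * (A * b + B * r).
  have S0 : 0 < S by rewrite mulr_gt0.
  have DE : (A * a - B * p) / (A * a + B * p) - (A * b - B * r) / (A * b + B * r) =
     2 * (A * B) * (Z - W) / S.
    rewrite -Ez -EzN /S; field; apply/andP; split; exact: lt0r_neq0.
  (* The inequality of arithmetic and geometric means: (a b)(p r) = 1, so A^2 a b + B^2 p r >= 2 A
     B. *)
  have SE : A * B * (2 + Z + W) <= S.
    have -> : S = A ^+ 2 * (a * b) + B ^+ 2 * (p * r) + A * B * (Z + W).
      by rewrite -Ez -EzN /S; ring.
    have : (a * b) * (p * r) = 1 by rewrite mulrACA ap br mulr1.
    have : 0 < a * b by rewrite mulr_gt0.
    have : 0 < p * r by rewrite mulr_gt0.
    move: (a * b) (p * r) => e f f0 e0 ef.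
    have : 0 <= (A * e - B) ^+ 2 * f by rewrite mulr_ge0 ?sqr_ge0// ltW.
    have -> : (A * e - B) ^+ 2 * f = A ^+ 2 * e * (e * f) - 2 * A * B * (e * f) + B ^+ 2 * f.
      by ring.
    rewrite ef; lra.
  have W1 : W <= 1 by nra.
  have AB0 : 0 <= A * B by rewrite mulr_ge0.
  rewrite DE; have D0' : 0 <= 2 * (A * B) * (Z - W) / S.
    apply: divr_ge0; last exact: ltW.
    by apply: mulr_ge0; [exact: mulr_ge0|rewrite subr_ge0 (le_trans W1)].
  have DS : 2 * (A * B) * (Z - W) / S * S = 2 * (A * B) * (Z - W).
    by rewrite divfK// gt_eqF.
  split=> //.
  move: (2 * (A * B) * (Z - W) / S) D0' DS => d d0 dS.
  have [AB|AB] := eqVneq (A * B) 0.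
    have : d * S = 0 by rewrite dS AB; ring.
    move/eqP; rewrite mulf_eq0 (gt_eqF S0) orbF => /eqP ->; lra.
  have AB1 : 0 < A * B by rewrite lt_neqAle eq_sym AB.
  have : d * (A * B * (2 + Z + W)) <= 2 * (A * B) * (Z - W).
    by rewrite -dS ler_wpM2l.
  have -> : d * (A * B * (2 + Z + W)) = A * B * (d * (2 + Z + W)) by ring.
  have -> : 2 * (A * B) * (Z - W) = A * B * (2 * (Z - W)) by ring.
  rewrite ler_pM2l// => H.
  have ZW1 : 0 < Z + 1 by lra.
  have : Z * (d * (2 + Z + W)) <= Z * (2 * (Z - W)) by rewrite ler_wpM2l//; lra.
  have -> : Z * (d * (2 + Z + W)) = d * (Z + 1) * (Z + 1) + d * (Z * W - 1) by ring.
  have -> : Z * (2 * (Z - W)) = 2 * (Z - 1) * (Z + 1) - 2 * (Z * W - 1) by ring.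
  by rewrite ZW subrr !mulr0 addr0 subr0 ler_pM2r.
have DZ := half_tanh_le z02 D0 key.
have c0 := cst_c_gt0.
have Dz : D <= z by apply: le_trans DZ _; rewrite gerBl mulr_ge0 ?exprn_ge0// ltW.
have D3 : D ^+ 3 <= z ^+ 3 by rewrite lerXn2r ?nnegrE.
have -> : z * D - D ^+ 2 = D * (z - D) by ring.
have -> : cst_c * D ^+ 4 = D * (cst_c * D ^+ 3) by ring.
rewrite ler_wpM2l//; apply: (@le_trans _ _ (cst_c * z ^+ 3)); last lra.
by rewrite ler_wpM2l// ltW.
Qed.

End PairInequality.

(* Explicit constants of the replacement estimates *)
Create HintDb nneg.
Ltac nneg := repeat first [done | by auto 1 with nneg nocore | exact: expR_ge0 | apply: mulr_ge0
  | apply: addr_ge0 | apply: exprn_ge0 | rewrite invr_ge0].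

Section Constants.
Context (R : realType).

(** [cst_m] is the lower bound of the tilts. Those from [cst_u] to [cst_tau] and from [cst_e] to
    [cst_t] are what the [weak] rules for exponentials, products, inverses and averages deliver;
    [cst_P], [cst_loc], [cst_chain] and [cst_eq] multiply errors. They keep the shape produced by
    these rules, so that terms built from the rules typecheck directly. *)
Definition cst_m : R := expR (-1).
Definition cst_u : R := expR 8 + expR 8 * 8.
Definition cst_v : R := 2 * 1 * cst_u.
Definition cst_iU : R := cst_m^-1 + cst_m^-1 * cst_m^-1 * (9 * cst_u).
Definition cst_tau : R := 2 * (9 * cst_v) * cst_iU.
Definition cst_P : R := expR 1 * (1 + expR 1 * expR 8).
Definition cst_loc : R := expR 2 * (2 * cst_iU) * (cst_P + 2) +
  8 * cst_m^-1 * expR 2.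
Definition cst_chain : R := cst_loc * (2 * cst_iU) + 8 * cst_m^-1 * expR 1.
Definition cst_e : R := expR 4 + expR 4 * 4.
Definition cst_D : R := 2 * (1 + cst_tau) * cst_e + 2 * (1 + cst_tau) * cst_e.
Definition cst_iD : R := (2 * cst_m)^-1 + (2 * cst_m)^-1 * (2 * cst_m)^-1 * cst_D.
Definition cst_k : R := 2 * 2 * cst_iD.
Definition cst_t : R := 2 * cst_D * cst_iD.
Definition cst_eq : R := cst_loc * (2 * cst_k) + 2 * cst_chain * (2 * (2 * cst_k) * cst_u).

Lemma cst_m_gt0 : 0 < cst_m. Proof. exact: expR_gt0. Qed.
Lemma cst_m_ge0 : 0 <= cst_m. Proof. exact: expR_ge0. Qed.
#[local] Hint Resolve cst_m_ge0 : nneg.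
Lemma cst_u_ge0 : 0 <= cst_u. Proof. by rewrite /cst_u; nneg. Qed.
#[local] Hint Resolve cst_u_ge0 : nneg.
Lemma cst_v_ge0 : 0 <= cst_v. Proof. by rewrite /cst_v; nneg. Qed.
#[local] Hint Resolve cst_v_ge0 : nneg.
Lemma cst_iU_ge0 : 0 <= cst_iU. Proof. by rewrite /cst_iU; nneg. Qed.
#[local] Hint Resolve cst_iU_ge0 : nneg.
Lemma cst_tau_ge0 : 0 <= cst_tau. Proof. by rewrite /cst_tau; nneg. Qed.
#[local] Hint Resolve cst_tau_ge0 : nneg.
Lemma cst_P_ge0 : 0 <= cst_P. Proof. by rewrite /cst_P; nneg. Qed.
#[local] Hint Resolve cst_P_ge0 : nneg.
Lemma cst_loc_ge0 : 0 <= cst_loc. Proof. by rewrite /cst_loc; nneg. Qed.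
#[local] Hint Resolve cst_loc_ge0 : nneg.
Lemma cst_chain_ge0 : 0 <= cst_chain. Proof. by rewrite /cst_chain; nneg. Qed.
#[local] Hint Resolve cst_chain_ge0 : nneg.
Lemma cst_e_ge0 : 0 <= cst_e. Proof. by rewrite /cst_e; nneg. Qed.
#[local] Hint Resolve cst_e_ge0 : nneg.
Lemma cst_D_ge0 : 0 <= cst_D. Proof. by rewrite /cst_D; nneg. Qed.
#[local] Hint Resolve cst_D_ge0 : nneg.
Lemma cst_iD_ge0 : 0 <= cst_iD. Proof. by rewrite /cst_iD; nneg. Qed.
#[local] Hint Resolve cst_iD_ge0 : nneg.
Lemma cst_k_ge0 : 0 <= cst_k. Proof. by rewrite /cst_k; nneg. Qed.
#[local] Hint Resolve cst_k_ge0 : nneg.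
Lemma cst_t_ge0 : 0 <= cst_t. Proof. by rewrite /cst_t; nneg. Qed.
#[local] Hint Resolve cst_t_ge0 : nneg.
Lemma cst_eq_ge0 : 0 <= cst_eq. Proof. by rewrite /cst_eq; nneg. Qed.
#[local] Hint Resolve cst_eq_ge0 : nneg.

End Constants.

(** * Local equilibrium in boxes and the two-point function *)

Section Boxes.
Context (R : realType) (K : R -> R) (N : nat) (gamma beta : R).
Local Notation n := (N.*2).+1.
Local Notation site := (site N).
Local Notation config := (config N).
Local Notation kap := (@kappa R K N gamma).
Local Notation H := (@hamiltonian R K N gamma).
Local Notation s := (@spin R N).
Local Notation h := (@local_field R K N gamma).
Local Notation w := (@weight R K N gamma beta).
Local Notation u := (@tilt R K N gamma beta).

Hypothesis kap0 : kap 0 = 0.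
Hypothesis kapN : forall i, kap (- i) = kap i.
Hypothesis kap_ge0 : forall i, 0 <= kap i.
Hypothesis kap_sum : \sum_i kap i = 1.
Hypothesis beta1 : `|beta| <= 1.

Variable q : config -> R.
Hypothesis q0 : forall c, 0 <= q c.
Hypothesis q2 : \sum_c q c <= 2.
Local Notation E := (wexp q).
Local Notation J := (bond_var K gamma beta q).

Variable om : R.
Hypothesis kap_om : forall i, kap i <= om.
Variable eta : R.
Hypothesis ham_exchange : forall c i, `|H (exchange c i) - H c| <= eta.
Variables (l nb : nat).
Hypothesis l_gt0 : (0 < l)%N.
Hypothesis nb_gt0 : (0 < nb)%N.
Hypothesis nb_le : (nb * l <= n)%N.
Hypothesis nb_ge : (n <= nb.+1 * l)%N.
Hypothesis l_om : l%:R^-1 <= om.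
Hypothesis eta_l : eta * (2 * l)%:R <= 1.

Local Notation li := (l%:R^-1 : R).

Lemma om_ge0 : 0 <= om.
Proof. exact: le_trans (kap_ge0 0) (kap_om 0). Qed.
Local Notation om0 := om_ge0.

Lemma li_ge0 : 0 <= li. Proof. by rewrite invr_ge0. Qed.

Lemma l_neq0 : l%:R != 0 :> R. Proof. by rewrite pnatr_eq0 -lt0n. Qed.

Definition scaled_field c j := beta * h c j.
Local Notation x := scaled_field.

Lemma scaled_field_norm c j : `|x c j| <= 1.
Proof. by rewrite normrM mulr_ile1// field_norm. Qed.

Lemma weak_scaled_field S j : weak om S 4 (x ^~ j).
Proof.
split=> [c|k m c _ _]; first by apply: le_trans (scaled_field_norm c j) _; rewrite ler1n.
rewrite /x local_field_swap -mulrBr [h c j + _]addrC addrK !normrM.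
apply: (@le_trans _ _ (1 * (2 * (om + om)))); last by lra.
apply: ler_pM; rewrite ?mulr_ge0//; apply: ler_pM => //.
  by apply: le_trans (ler_normB _ _) _; rewrite !spin_norm.
by apply: le_trans (ler_normB _ _) _; rewrite !ger0_norm// lerD.
Qed.

Lemma weak_tilt j S : j \in S -> weak om S (cst_u R) (u ^~ j).
Proof.
move=> jS; have -> : u ^~ j = fun c => expR (- (s c j * x c j)).
  by apply: funext => c; rewrite /u /x; congr expR; ring.
apply: (weak_exp om0 (b := 8) (F := fun c => - (s c j * x c j))); apply: weakN.
have -> : (8 : R) = 2 * 1 * 4 by ring.
exact: (weakM (weak_spin om0 jS) (weak_scaled_field S j)).
Qed.

Definition stilt c j := s c j * u c j.
Local Notation v := stilt.

Lemma weak_stilt j S : j \in S -> weak om S (cst_v R) (v ^~ j).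
Proof.
by move=> jS; exact: (weakM (weak_spin om0 jS) (weak_tilt jS)).
Qed.

Lemma stilt_norm c j : `|v c j| = u c j.
Proof. by rewrite normrM spin_norm mul1r gtr0_norm// tilt_gt0. Qed.

Definition box a (j : site) := (a * l <= j < a.+1 * l)%N.

Lemma sum_box a : (a < nb)%N -> \sum_(j | box a j) li = 1.
Proof.
move=> an; rewrite sumr_const.
suff E' : #|[pred j : site | box a j]| = l.
  by rewrite -[#|_|]/#|[pred j : site | box a j]| E' -(mulr_natr li) mulVf// l_neq0.
have an' : (a.+1 * l <= n)%N by apply: leq_trans nb_le; rewrite leq_mul2r an orbT.
rewrite -sum1_card big_mkcond/=.
rewrite -(big_mkord xpredT (fun i => if (a * l <= i < a.+1 * l)%N then 1 else 0)%N).
rewrite -big_mkcond/=.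
transitivity (\sum_(a * l <= i < a.+1 * l) 1)%N; last first.
  by rewrite sum_nat_const_nat muln1 mulSn addnK.
rewrite [RHS](big_nat_widen _ _ n)// (big_nat_widenl (a * l) 0)//.
by apply: eq_bigl => i; rewrite andTb andbC.
Qed.

Definition boxU a c := \sum_(j | box a j) li * u c j.
Definition boxV a c := \sum_(j | box a j) li * v c j.
Local Notation U := boxU.
Local Notation V := boxV.

Lemma boxU_ge a c : (a < nb)%N -> cst_m R <= U a c.
Proof.
move=> an; rewrite -[leLHS]mul1r -(sum_box an) mulr_suml; apply: ler_sum => j _.
by rewrite ler_wpM2l ?li_ge0//; case/andP: (tilt_bounds kap_ge0 kap_sum beta1 c j).
Qed.

Lemma boxU_gt0 a c : (a < nb)%N -> 0 < U a c.
Proof. by move=> an; apply: lt_le_trans (boxU_ge c an); exact: cst_m_gt0. Qed.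

Lemma boxV_le a c : `|V a c| <= U a c.
Proof.
apply: le_trans (ler_norm_sum _ _ _) _; apply: ler_sum => j _.
by rewrite normrM stilt_norm (ger0_norm li_ge0).
Qed.

Lemma sum_box_seq a (S : seq site) : \sum_(j | box a j && (j \in S)) li <= (size S)%:R * om.
Proof.
apply: (@le_trans _ _ (\sum_(j in S) li)).
  rewrite big_mkcond [leRHS]big_mkcond/=; apply: ler_sum => j _.
  by case: (box a j); case: ifP => // _; exact: li_ge0.
rewrite sumr_const -(mulr_natl li); apply: ler_pM; rewrite ?li_ge0//.
by rewrite ler_nat card_size.
Qed.

Lemma weak_box a b (F : site -> config -> R) : (a < nb)%N -> 0 <= b ->
  (forall j, weak om [:: j] b (F j)) ->
  weak om [::] (9 * b) (fun c => \sum_(j | box a j) li * F j c).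
Proof.
move=> an b0 wF; apply: (weak_avg om0 (S := fun j => [:: j])) => //.
  by rewrite sum_box.
move=> j; apply: le_trans (_ : 1 * om <= _); last by have := om0; lra.
apply: le_trans (sum_box_seq a [:: j]); rewrite le_eqVlt; apply/orP; left.
by apply/eqP; apply: eq_bigl => i; rewrite !inE (eq_sym i).
Qed.

Lemma weak_invU a S : (a < nb)%N -> weak om S (cst_iU R) (fun c => (U a c)^-1).
Proof.
move=> an; apply: weak_inv; rewrite ?cst_m_gt0 ?om0//.
  by move=> c; exact: boxU_ge.
apply: (@weak_sub _ _ _ om0 [::] _ (9 * cst_u R)) => //.
by apply: weak_box => //; [exact: cst_u_ge0|move=> j; apply: weak_tilt; rewrite inE].
Qed.

(** The mean of the spins of a box once their interaction is divided out: a spin of the box with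
    scaled field x then has mean [local_mag tau x]. *)
Definition tau a c := V a c / U a c.

Lemma weak_tau a S : (a < nb)%N -> weak om S (cst_tau R) (tau a).
Proof.
move=> an; apply: (weakM _ (weak_invU S an)).
apply: (@weak_sub _ _ _ om0 [::] _ (9 * cst_v R)) => //.
by apply: weak_box => //; [exact: cst_v_ge0|move=> j; apply: weak_stilt; rewrite inE].
Qed.

Lemma tau_norm a c : (a < nb)%N -> `|tau a c| <= 1.
Proof.
move=> an; rewrite normrM normfV (gtr0_norm (boxU_gt0 c an)).
by rewrite ler_pdivrMr ?boxU_gt0// mul1r boxV_le.
Qed.

(** Two consecutive boxes. This links the averages of neighbouring boxes, and for the last box it
    also covers the sites left over by the division of the torus. *)
Definition range a (j : site) := (a * l <= j < a.+2 * l)%N.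
Definition range_var a := \sum_(i | range a i) J i.

Lemma bond_var_ge0 i : 0 <= J i. Proof. exact: swap_var_ge0. Qed.

Lemma range_var_ge0 a : 0 <= range_var a.
Proof. by apply: sumr_ge0 => i _; exact: bond_var_ge0. Qed.

#[local] Hint Resolve range_var_ge0 om_ge0 : nneg.

Lemma eta_ge0 : 0 <= eta.
Proof. by apply: le_trans (ham_exchange [ffun=> true] 0); exact: normr_ge0. Qed.

(** Inside a range an exchange crosses at most 2 l bonds, so by [eta_l] the accumulated factor
    exp(eta d) is at most e. *)
Lemma swap_var_range a (j k : site) : range a j -> range a k ->
  swap_var K gamma beta q j k <= cst_P R * range_var a.
Proof.
wlog jk : j k / (j <= k)%N.
  move=> W rj rk; have [jk|/ltnW kj] := leqP j k; first exact: W.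
  by rewrite swap_varC; exact: W.
move=> /andP[aj _] /andP[_ ka].
have kn := ltn_ord k.
rewrite -(inord_val j) -{1}(inord_val k) -{1}(subnKC jk).
apply: le_trans (swap_var_path kap0 kapN kap_ge0 kap_sum beta1 q2 om0 ham_exchange _) _.
  by rewrite subnKC.
rewrite mulrA; apply: ler_pM.
- by rewrite mulr_ge0 ?exprn_ge0 ?addr_ge0 ?mulr_ge0 ?expR_ge0.
- by apply: sumr_ge0 => i _; exact: bond_var_ge0.
- have e1 : expR eta <= expR (1 : R).
    rewrite ler_expR; apply: le_trans eta_l; rewrite ler_peMr ?eta_ge0//.
    by rewrite ler1n muln_gt0.
  apply: ler_pM; rewrite ?exprn_ge0 ?addr_ge0 ?mulr_ge0 ?expR_ge0//.
    rewrite -expRM_natr ler_expR; apply: le_trans eta_l.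
    rewrite ler_wpM2l ?eta_ge0// ler_nat.
    move: aj ka; rewrite !mulSn; move: (nat_of_ord j) (nat_of_ord k) => j' k'.
    by clear; lia.
  by rewrite lerD2l ler_wpM2r ?expR_ge0.
- apply: sum_bond_le => //; last by rewrite subnKC.
  move=> i /andP[ji ik]; rewrite /range (leq_trans aj ji)/=.
  by apply: ltn_trans ka; rewrite subnKC in ik.
Qed.

Lemma range_boundP S b F (j m : site) a : range a j -> range a m ->
  j \notin S -> m \notin S -> weak om S b F ->
  `|E (fun c => F c * (u c j * u c m * (s c j - s c m)))| <=
    expR 2 * b * (cst_P R + 2) * (range_var a + om).
Proof.
move=> rj rm jS mS wF; have b0 := weak_ge0 wF.
have X0 : 0 <= expR 2 * b * (cst_P R + 2) * (range_var a + om).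
  by nneg.
have [->|jm] := eqVneq j m.
  by rewrite (_ : E _ = 0) ?normr0// /wexp big1// => c _; rewrite subrr !mulr0.
apply: le_trans (pair_exchange _ _ _ _ _ _ _ _ _ wF _ _) _ => //; first exact: om0.
rewrite -[leRHS]mulrA ler_wpM2l ?mulr_ge0 ?expR_ge0//.
have := swap_var_range rj rm; have := om0; have := range_var_ge0 a.
have := cst_P_ge0 R; nra.
Qed.

(** Multiplied by U, the difference v_j - tau u_j is the box average over m of u_j u_m (s_j - s_m),
    to which the exchange of j and m applies. The sites m of S, where F may depend strongly on the
    spin, fill at most a fraction 2 * om of the box and are bounded trivially. *)
Lemma local_equilibrium a S b F (j : site) : (a < nb)%N -> range a j ->
  j \notin S -> (size S <= 2)%N -> weak om S b F ->
  `|E (fun c => F c * (v c j - tau a c * u c j))| <=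
    cst_loc R * b * (range_var a + om).
Proof.
move=> an rj jS S2 wF; have b0 := weak_ge0 wF.
have wG := weakM wF (weak_invU S an).
pose G (m : site) c := F c * (U a c)^-1 * (u c j * u c m * (s c j - s c m)).
have -> : E (fun c => F c * (v c j - tau a c * u c j)) = \sum_(m | box a m) li * E (G m).
  under [RHS]eq_bigr do rewrite -wexpZ; rewrite -wexp_sum; apply: eq_wexp => c.
  have U0 : U a c != 0 by rewrite gt_eqF// boxU_gt0.
  transitivity (F c * (U a c)^-1 * (v c j * U a c - u c j * V a c)).
    by rewrite /tau; field.
  rewrite /U /V !mulr_sumr -sumrB mulr_sumr; apply: eq_bigr => m _.
  by rewrite /G /v; ring.
apply: le_trans (ler_norm_sum _ _ _) _.
pose A : R := expR 2 * (2 * b * cst_iU R) * (cst_P R + 2) * (range_var a + om).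
pose B : R := 4 * (b * (cst_m R)^-1 * expR 2).
have A0 : 0 <= A.
  by rewrite /A; nneg.
have B0 : 0 <= B by rewrite /B; nneg.
have GB m : `|E (G m)| <= B.
  have -> : B = 2 * (b * (cst_m R)^-1 * (expR 2 * 2)) by rewrite /B; ring.
  apply: wexp_norm => // c; have [Fb _] := wF.
  rewrite /G !normrM; apply: ler_pM; rewrite ?mulr_ge0//.
    apply: ler_pM => //; rewrite normfV (gtr0_norm (boxU_gt0 c an)).
    by rewrite lef_pV2 ?posrE ?boxU_gt0 ?cst_m_gt0// boxU_ge.
  rewrite !(gtr0_norm (tilt_gt0 _ _ _ _ _)).
  apply: ler_pM; rewrite ?mulr_ge0//; try exact/ltW/tilt_gt0.
    have -> : (2 : R) = 1 + 1 by ring.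
    rewrite expRD; have /andP[? ?] := tilt_bounds kap_ge0 kap_sum beta1 c j.
    have /andP[? ?] := tilt_bounds kap_ge0 kap_sum beta1 c m.
    by apply: ler_pM => //; apply/ltW/tilt_gt0.
  by apply: le_trans (ler_normB _ _) _; rewrite !spin_norm.
apply: (@le_trans _ _ (\sum_(m | box a m) li * A + \sum_(m | box a m && (m \in S)) li * B)).
  rewrite (bigID (fun m => m \in S))/= addrC; apply: lerD.
    rewrite [leRHS](bigID (fun m => m \in S))/=; apply: ler_wpDl.
      by apply: sumr_ge0 => m _; rewrite mulr_ge0 ?li_ge0.
    apply: ler_sum => m /andP[bm mS]; rewrite normrM (ger0_norm li_ge0).
    rewrite ler_wpM2l ?li_ge0//; apply: (range_boundP rj _ jS mS wG).
    rewrite /range; move: bm => /andP[-> /leq_trans -> //].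
    by rewrite leq_mul2r leqnSn orbT.
  by apply: ler_sum => m _; rewrite normrM (ger0_norm li_ge0) ler_wpM2l ?li_ge0.
rewrite -!mulr_suml sum_box// mul1r.
apply: (@le_trans _ _ (A + 2 * om * B)).
  rewrite lerD2l ler_wpM2r//; apply: le_trans (sum_box_seq a S) _.
  by rewrite ler_wpM2r ?om0// ler_nat.
rewrite /A /B /cst_loc; have := range_var_ge0 a.
have : 0 <= b * (cst_m R)^-1 * expR 2.
  by nneg.
move: (cst_m R)^-1 (cst_P R) (cst_iU R) (range_var a) => y p z r Y0 r0.
have -> : (expR 2 * (2 * z) * (p + 2) + 8 * y * expR 2) * b * (r + om) =
  expR 2 * (2 * b * z) * (p + 2) * (r + om) +
  2 * om * (4 * (b * y * expR 2)) + 8 * ((b * y * expR 2) * r) by ring.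
by rewrite lerDl mulr_ge0// mulr_ge0.
Qed.

(** tau_a - tau_(a+1) is, up to sign and the factor 1 / U_(a+1), the average over the box a + 1 of
    v_m - tau_a u_m; local equilibrium relative to the box a applies since a range contains both
    boxes. *)
Lemma chain_step a S b F : (a.+1 < nb)%N -> (size S <= 2)%N -> weak om S b F ->
  `|E (fun c => F c * (tau a c - tau a.+1 c))| <=
    cst_chain R * b * (range_var a + om).
Proof.
move=> an S2 wF; have b0 := weak_ge0 wF.
have wG := weakM wF (weak_invU S an).
have an' : (a < nb)%N by exact: ltn_trans an.
pose G (m : site) c := F c * (U a.+1 c)^-1 * (v c m - tau a c * u c m).
have -> : E (fun c => F c * (tau a c - tau a.+1 c)) =
    - \sum_(m | box a.+1 m) li * E (G m).
  under [X in - X]eq_bigr do rewrite -wexpZ.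
  rewrite -wexp_sum -[RHS]mulN1r -wexpZ; apply: eq_wexp => c.
  have U0 : U a.+1 c != 0 by rewrite gt_eqF// boxU_gt0.
  transitivity (- 1 * (F c * (U a.+1 c)^-1 * (V a.+1 c - tau a c * U a.+1 c))).
    by rewrite {2}/tau; field.
  rewrite /U /V !mulr_sumr -sumrB !mulr_sumr; apply: eq_bigr => m _.
  by rewrite /G; ring.
rewrite normrN; apply: le_trans (ler_norm_sum _ _ _) _.
pose A : R := cst_loc R * (2 * b * cst_iU R) * (range_var a + om).
pose B : R := 4 * (b * (cst_m R)^-1 * expR 1).
have A0 : 0 <= A by rewrite /A; nneg.
have B0 : 0 <= B by rewrite /B; nneg.
have GB m : `|E (G m)| <= B.
  have -> : B = 2 * (b * (cst_m R)^-1 * (2 * expR 1)) by rewrite /B; ring.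
  apply: wexp_norm => // c; have [Fb _] := wF.
  rewrite /G !normrM; apply: ler_pM; rewrite ?mulr_ge0//.
    apply: ler_pM => //; rewrite normfV (gtr0_norm (boxU_gt0 c an)).
    by rewrite lef_pV2 ?posrE ?boxU_gt0 ?cst_m_gt0// boxU_ge.
  apply: le_trans (ler_normB _ _) _; rewrite stilt_norm normrM.
  have /andP[_ ub] := tilt_bounds kap_ge0 kap_sum beta1 c m.
  rewrite (gtr0_norm (tilt_gt0 _ _ _ _ _)).
  have := tau_norm c an'; have := tilt_gt0 K gamma beta c m; move: ub.
  move: (u c m) `|tau a c| => y z; nra.
apply: (@le_trans _ _ (\sum_(m | box a.+1 m) li * A +
    \sum_(m | box a.+1 m && (m \in S)) li * B)).
  rewrite (bigID (fun m => m \in S))/= addrC; apply: lerD.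
    rewrite [leRHS](bigID (fun m => m \in S))/=; apply: ler_wpDl.
      by apply: sumr_ge0 => m _; rewrite mulr_ge0 ?li_ge0.
    apply: ler_sum => m /andP[bm mS]; rewrite normrM (ger0_norm li_ge0).
    rewrite ler_wpM2l ?li_ge0//; apply: (local_equilibrium an' _ mS S2 wG).
    rewrite /range; move: bm => /andP[+ ->]; rewrite andbT.
    by apply: leq_trans; rewrite leq_mul2r leqnSn orbT.
  by apply: ler_sum => m _; rewrite normrM (ger0_norm li_ge0) ler_wpM2l ?li_ge0.
rewrite -!mulr_suml sum_box// mul1r.
apply: (@le_trans _ _ (A + 2 * om * B)).
  rewrite lerD2l ler_wpM2r//; apply: le_trans (sum_box_seq a.+1 S) _.
  by rewrite ler_wpM2r ?om_ge0// ler_nat.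
rewrite /A /B /cst_chain; have := range_var_ge0 a.
have : 0 <= b * (cst_m R)^-1 * expR 1 by nneg.
move: (cst_m R)^-1 (cst_loc R) (cst_iU R) (range_var a) => y p z r Y0 r0.
have -> : (p * (2 * z) + 8 * y * expR 1) * b * (r + om) =
  p * (2 * b * z) * (r + om) +
  2 * om * (4 * (b * y * expR 1)) + 8 * ((b * y * expR 1) * r) by ring.
by rewrite lerDl mulr_ge0// mulr_ge0.
Qed.

Definition total_var := \sum_i J i.
(** Summed along all the boxes, the errors [range_var a + om] add up to this quantity, up to a
    factor 2. *)
Definition err := total_var + nb%:R * om.

Lemma total_var_ge0 : 0 <= total_var.
Proof. by apply: sumr_ge0 => i _; exact: bond_var_ge0. Qed.
#[local] Hint Resolve total_var_ge0 : nneg.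

Lemma err_ge0 : 0 <= err. Proof. by rewrite /err; nneg. Qed.
#[local] Hint Resolve err_ge0 : nneg.

Lemma range_var_le a : range_var a <= total_var.
Proof.
rewrite /range_var big_mkcond; apply: ler_sum => i _.
by case: ifP => // _; exact: bond_var_ge0.
Qed.

Lemma range_om_le a : range_var a + om <= err.
Proof.
rewrite /err lerD ?range_var_le// ler_peMl ?om_ge0//.
by rewrite ler1n.
Qed.

Lemma sum_box_var k : \sum_(a < k) \sum_(i | box a i) J i <= total_var.
Proof.
suff -> : \sum_(a < k) \sum_(i | box a i) J i = \sum_(i : site | (i < k * l)%N) J i.
  rewrite big_mkcond; apply: ler_sum => i _.
  by case: ifP => // _; exact: bond_var_ge0.
elim: k => [|k IH]; first by rewrite big_ord0 big_pred0.
rewrite big_ord_recr/= IH [RHS](bigID (fun i : site => (i < k * l)%N))/=.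
congr (_ + _); apply: eq_bigl => i.
  by rewrite andbC; apply/idP/andP => [ik|[]//]; split=> //; rewrite mulSn ltn_addl.
by rewrite /box andbC -leqNgt.
Qed.

Lemma sum_range_var k : \sum_(a < k) range_var a <= 2 * total_var.
Proof.
have E2 : 2 * total_var = total_var + total_var by ring.
rewrite E2; have H := sum_box_var k.+1.
apply: (@le_trans _ _ (\sum_(a < k) \sum_(i | box a i) J i +
   \sum_(a < k) \sum_(i | box a.+1 i) J i)).
  rewrite -big_split/=; apply: ler_sum => a _.
  rewrite /range_var (bigID (fun i : site => (i < a.+1 * l)%N))/=.
  apply: lerD; rewrite big_mkcond [leRHS]big_mkcond/=; apply: ler_sum => i _.
    rewrite /box /range; case: ifP => [/andP[/andP[-> _] ->]//|_].
    by case: ifP => // _; exact: bond_var_ge0.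
  rewrite /box /range -leqNgt; case: ifP => [/andP[/andP[_ ->] ->]//|_].
  by case: ifP => // _; exact: bond_var_ge0.
apply: lerD; first exact: sum_box_var.
apply: le_trans H; rewrite big_ord_recl lerDr; apply: sumr_ge0 => i _.
exact: bond_var_ge0.
Qed.

(** Telescoping from the box 0: every bond lies in at most two ranges, so the number of steps does
    not multiply [total_var]. *)
Lemma chain a S b F : (a < nb)%N -> (size S <= 2)%N -> weak om S b F ->
  `|E (fun c => F c * (tau 0 c - tau a c))| <= 2 * cst_chain R * b * err.
Proof.
move=> an S2 wF; have b0 := weak_ge0 wF.
apply: (@le_trans _ _ (cst_chain R * b * \sum_(i < a) (range_var i + om))).
  elim: a an => [|a IH] an.
    rewrite big_ord0 mulr0 (_ : E _ = 0) ?normr0//.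
    by rewrite /wexp big1// => c _; rewrite subrr !mulr0.
  rewrite big_ord_recr/= mulrDr.
  have -> : E (fun c => F c * (tau 0 c - tau a.+1 c)) =
     E (fun c => F c * (tau 0 c - tau a c)) + E (fun c => F c * (tau a c - tau a.+1 c)).
    by rewrite -wexpD; apply: eq_wexp => c; ring.
  apply: le_trans (ler_normD _ _) _; apply: lerD; last exact: (chain_step an S2 wF).
  by apply: IH; exact: ltn_trans an.
have -> : 2 * cst_chain R * b * err = cst_chain R * b * (2 * err) by ring.
rewrite ler_wpM2l ?mulr_ge0 ?cst_chain_ge0// big_split/= /err mulrDr.
apply: lerD; first exact: sum_range_var.
rewrite sumr_const card_ord -(mulr_natl om).
apply: (@le_trans _ _ (nb%:R * om)); first by rewrite ler_wpM2r ?om_ge0// ler_nat ltnW.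
by rewrite ler_peMl ?mulr_ge0 ?om_ge0// ler1n.
Qed.

Local Notation t := (fun c j => local_mag (tau 0 c) (x c j)).

Definition mag_den c j :=
  (1 + tau 0 c) * expR (x c j) + (1 - tau 0 c) * expR (- x c j).

Lemma mag_den_ge c j : 2 * cst_m R <= mag_den c j.
Proof.
have := tau_norm c nb_gt0; rewrite ler_norml => /andP[t1 t2].
have := scaled_field_norm c j; rewrite ler_norml => /andP[x1 x2].
have : cst_m R <= expR (x c j) by rewrite /cst_m ler_expR.
have : cst_m R <= expR (- x c j) by rewrite /cst_m ler_expR; lra.
rewrite /mag_den; move: (tau 0 c) (expR _) (expR (- _)) (cst_m R) t1 t2.
move=> y a b m t1 t2 mb ma; nra.
Qed.

Lemma weak_one (S : seq site) : weak om S 1 (fun=> 1 : R).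
Proof. by have := weak_cst om0 S (1 : R); rewrite normr1. Qed.

Lemma weak_tau1 S : weak om S (1 + cst_tau R) (fun c => 1 + tau 0 c).
Proof. exact: weakD (weak_one S) (weak_tau S nb_gt0). Qed.

Lemma weak_tau1N S : weak om S (1 + cst_tau R) (fun c => 1 - tau 0 c).
Proof. exact: weakD (weak_one S) (weakN (weak_tau S nb_gt0)). Qed.

Lemma weak_expx S j : weak om S (cst_e R) (fun c => expR (x c j)).
Proof. exact: (weak_exp om0 (weak_scaled_field S j)). Qed.

Lemma weak_expxN S j : weak om S (cst_e R) (fun c => expR (- x c j)).
Proof. exact: (weak_exp om0 (weakN (weak_scaled_field S j))). Qed.

Lemma weak_inv_den S j : weak om S (cst_iD R) (fun c => (mag_den c j)^-1).
Proof.
apply: (weak_inv om0); first by rewrite mulr_gt0 ?cst_m_gt0.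
  by move=> c; exact: mag_den_ge.
exact: (weakD (weakM (weak_tau1 S) (weak_expx S j)) (weakM (weak_tau1N S) (weak_expxN S j))).
Qed.

Lemma weak_mag S j : weak om S (cst_t R) (t ^~ j).
Proof.
apply: (weakM _ (weak_inv_den S j)).
exact: (weakD (weakM (weak_tau1 S) (weak_expx S j))
  (weakN (weakM (weak_tau1N S) (weak_expxN S j)))).
Qed.

Definition mag_fac c j := 2 * (mag_den c j)^-1.

Lemma weak_mag_fac S j : weak om S (cst_k R) (mag_fac ^~ j).
Proof.
rewrite /cst_k -[X in 2 * X * _](@ger0_norm R 2)//.
exact: (weakM (weak_cst om0 S 2) (weak_inv_den S j)).
Qed.

Lemma mag_norm c j : `|t c j| <= 1.
Proof. exact/local_mag_norm/tau_norm. Qed.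

(** An identity checked on the two values of the spin. It turns the relation between tilted
    quantities, v_j close to tau u_j, into the mean-field equation, s_j close to its local
    magnetization. *)
Lemma mag_facE c j : s c j - t c j = mag_fac c j * (v c j - tau 0 c * u c j).
Proof.
have D0 : mag_den c j != 0.
  by rewrite gt_eqF// (lt_le_trans _ (mag_den_ge c j))// mulr_gt0 ?cst_m_gt0.
rewrite /mag_fac /v /tilt /local_mag -/(mag_den c j).
have -> : - beta * (s c j * h c j) = - (s c j * x c j) by rewrite /x; ring.
rewrite /mag_den in D0 *.
by case: (spin_cases R c j) => ->; rewrite ?(mul1r, mulN1r) ?opprK; field.
Qed.

Lemma box_of (j : site) : exists2 a, (a < nb)%N & range a j.
Proof.
have jn := ltn_ord j; have [jl|jl] := ltnP j (nb * l).
  exists (j %/ l)%N; first by rewrite ltn_divLR.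
  rewrite /range leq_trunc_div/= mulSn ltn_addl//.
  by rewrite -ltn_divLR.
exists nb.-1; first by rewrite prednK.
rewrite /range; apply/andP; split.
  by apply: leq_trans jl; rewrite leq_mul2r leq_pred orbT.
by rewrite prednK//; exact: leq_trans jn nb_ge.
Qed.

(** The magnetization is the one built on the box 0 for every site: first the range of j is used,
    then the chain of boxes. In the second term the factor u_j makes j itself an exceptional site,
    which is why S may contain only one. *)
Lemma spin_equilibrium (j : site) S b F : j \notin S -> (size S <= 1)%N ->
  weak om S b F -> `|E (fun c => F c * (s c j - t c j))| <= cst_eq R * b * err.
Proof.
move=> jS S1 wF; have [a an rj] := box_of j; have b0 := weak_ge0 wF.
have -> : E (fun c => F c * (s c j - t c j)) =
  E (fun c => F c * mag_fac c j * (v c j - tau a c * u c j)) -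
  E (fun c => F c * mag_fac c j * u c j * (tau 0 c - tau a c)).
  by rewrite -wexpB; apply: eq_wexp => c; rewrite mag_facE; ring.
apply: le_trans (ler_normB _ _) _.
have wG := weakM wF (weak_mag_fac S j).
have sub : {subset S <= j :: S} by move=> i iS; rewrite inE iS orbT.
have wG' := weakM (weak_sub om0 sub (lexx _) wG) (weak_tilt (mem_head j S)).
have -> : cst_eq R * b * err = cst_loc R * (2 * b * cst_k R) * err +
   2 * cst_chain R * (2 * (2 * b * cst_k R) * cst_u R) * err.
  by rewrite /cst_eq; ring.
apply: lerD; last exact: chain wG'.
apply: le_trans (local_equilibrium an rj jS (leqW S1) wG) _.
rewrite ler_wpM2l ?range_om_le//; apply: mulr_ge0; first exact: cst_loc_ge0.
by apply: mulr_ge0; [exact: mulr_ge0|exact: cst_k_ge0].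
Qed.

Local Notation ni := (n%:R^-1 : R).
Hypothesis n_om : ni <= om.

Lemma ni_ge0 : 0 <= ni. Proof. by rewrite invr_ge0. Qed.
#[local] Hint Resolve ni_ge0 : nneg.

Lemma sum_ni : \sum_(j : site) ni = 1.
Proof. by rewrite sumr_const card_ord -(mulr_natr ni) mulVf// pnatr_eq0. Qed.

Lemma mean_equilibrium (r : site -> site) (S : site -> seq site) b
    (F : site -> config -> R) :
  (forall j, r j \notin S j) -> (forall j, size (S j) <= 1)%N ->
  (forall j, weak om (S j) b (F j)) ->
  `|E (fun c => \sum_j ni * (F j c * (s c (r j) - t c (r j))))| <= cst_eq R * b * err.
Proof.
move=> jS S1 wF; rewrite wexp_sum; apply: le_trans (ler_norm_sum _ _ _) _.
apply: (@le_trans _ _ (\sum_(j : site) ni * (cst_eq R * b * err))); last first.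
  by rewrite -mulr_suml sum_ni mul1r.
apply: ler_sum => j _; rewrite wexpZ normrM (ger0_norm ni_ge0) ler_wpM2l ?ni_ge0//.
exact: (spin_equilibrium (jS j)).
Qed.

Definition mean (F : site -> R) := \sum_j ni * F j.

Lemma mean_norm F b : (forall j, `|F j| <= b) -> `|mean F| <= b.
Proof.
move=> Fb; apply: le_trans (ler_norm_sum _ _ _) _.
apply: (@le_trans _ _ (\sum_(j : site) ni * b)); last first.
  by rewrite -mulr_suml sum_ni mul1r.
by apply: ler_sum => j _; rewrite normrM (ger0_norm ni_ge0) ler_wpM2l ?ni_ge0.
Qed.

Lemma mean_cst a : mean (fun=> a) = a.
Proof. by rewrite /mean -mulr_suml sum_ni mul1r. Qed.

Lemma meanD F G : mean (fun j => F j + G j) = mean F + mean G.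
Proof. by rewrite /mean -big_split; apply: eq_bigr => j _; rewrite mulrDr. Qed.

Lemma meanB F G : mean (fun j => F j - G j) = mean F - mean G.
Proof. by rewrite /mean -sumrB; apply: eq_bigr => j _; rewrite mulrBr. Qed.

Lemma meanZ a F : mean (fun j => a * F j) = a * mean F.
Proof. by rewrite /mean mulr_sumr; apply: eq_bigr => j _; rewrite mulrCA. Qed.

Lemma eq_mean F G : F =1 G -> mean F = mean G.
Proof. by move=> FG; apply: eq_bigr => j _; rewrite FG. Qed.

Lemma ler_mean F G : (forall j, F j <= G j) -> mean F <= mean G.
Proof. by move=> FG; apply: ler_sum => j _; rewrite ler_wpM2l ?ni_ge0. Qed.

Lemma ler_mean_norm F : `|mean F| <= mean (fun j => `|F j|).
Proof.
apply: le_trans (ler_norm_sum _ _ _) _; apply: ler_sum => j _.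
by rewrite normrM (ger0_norm ni_ge0).
Qed.

Lemma mean2_diff (x' y' : site -> R) :
  mean (fun j => mean (fun k => (x' j - x' k) * (y' j - y' k))) =
  2 * (mean (fun j => x' j * y' j) - mean x' * mean y').
Proof.
transitivity (mean (fun j => x' j * y' j + (mean (fun j => x' j * y' j)
   - x' j * mean y' - y' j * mean x'))).
  apply: eq_mean => j.
  transitivity (mean (fun k => (x' j * y' j + x' k * y' k) -
     (x' j * y' k + y' j * x' k))).
    by apply: eq_mean => k; ring.
  by rewrite meanB !meanD !meanZ mean_cst; ring.
rewrite meanD !meanB mean_cst.
have -> : mean (fun j => x' j * mean y') = mean x' * mean y'.
  by rewrite [RHS]mulrC -meanZ; apply: eq_mean => j; rewrite mulrC.
have -> : mean (fun j => y' j * mean x') = mean x' * mean y'.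
  by rewrite -meanZ; apply: eq_mean => j; rewrite mulrC.
by ring.
Qed.

Lemma weak_avg0 (a : site -> R) b (F : site -> config -> R) :
  (forall i, 0 <= a i) -> \sum_i a i = 1 -> 0 <= b ->
  (forall i, weak om [::] b (F i)) ->
  weak om [::] (9 * b) (fun c => \sum_i a i * F i c).
Proof.
move=> a0 a1 b0 wF; apply: (weak_avg om0 (S := fun=> [::])) => //.
- by rewrite a1.
- by move=> j; rewrite big_pred0 ?mulr_ge0 ?om_ge0// => i; rewrite in_nil andbF.
Qed.

Definition mean_spin c := mean (s c).
Definition mean_mag c := mean (t c).
Definition conv_mag c j := \sum_m kap (j - m) * t c m.

Lemma weak_mean_mag : weak om [::] (9 * cst_t R) mean_mag.
Proof.
apply: (weak_avg0 (a := fun=> ni)); rewrite ?sum_ni ?cst_t_ge0 ?ni_ge0//.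
by move=> j; exact: weak_mag.
Qed.

Lemma weak_conv_mag j : weak om [::] (9 * cst_t R) (conv_mag ^~ j).
Proof.
apply: (weak_avg0 (a := fun m => kap (j - m))); rewrite ?kap_sumB ?cst_t_ge0//.
by move=> m; exact: weak_mag.
Qed.

Let e9 := cst_eq R * (9 * cst_t R) * err.
Let ms := E (fun c => `|mean_spin c|).

Lemma mean_mag_norm c : `|mean_mag c| <= 1.
Proof. by apply: mean_norm => j; exact: mag_norm. Qed.

(** In the square of the mean magnetization, one factor is replaced by the mean spin, which is
    conserved by the dynamics. *)
Lemma wexp_mean_mag : E (fun c => mean_mag c ^+ 2) <= ms + e9.
Proof.
have := mean_equilibrium (r := id) (S := fun=> [::]) (fun=> isT) (fun=> isT)
  (fun=> weak_mean_mag).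
have -> : E (fun c => \sum_j ni * (mean_mag c * (s c j - t c j))) =
   E (fun c => mean_mag c * mean_spin c) - E (fun c => mean_mag c ^+ 2).
  rewrite -wexpB; apply: eq_wexp => c.
  rewrite -[LHS]/(mean (fun j => mean_mag c * (s c j - t c j))).
  by rewrite meanZ meanB -/(mean_mag c) -/(mean_spin c); ring.
rewrite ler_norml => /andP[+ _].
suff : E (fun c => mean_mag c * mean_spin c) <= ms by rewrite /e9; lra.
apply: le_wexp => // c; apply: le_trans (ler_norm _) _; rewrite normrM.
by rewrite ler_piMl// mean_mag_norm.
Qed.

(** By the symmetry of the kernel, the field tested against the magnetizations equals the spins
    tested against their convolution with the kernel; the spins are then replaced by
    magnetizations. *)
Lemma wexp_field_mag :
  `|E (fun c => mean (fun j => h c j * t c j)) -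
    E (fun c => mean (fun j => conv_mag c j * t c j))| <= e9.
Proof.
have := mean_equilibrium (r := id) (S := fun=> [::]) (fun=> isT) (fun=> isT)
  weak_conv_mag.
congr (`|_| <= _); rewrite -wexpB; apply: eq_wexp => c.
transitivity (mean (fun j => conv_mag c j * s c j) - mean (fun j => conv_mag c j * t c j)).
  by rewrite -meanB; apply: eq_mean => j; ring.
congr (_ - _); rewrite /mean -!mulr_sumr; congr (_ * _).
exact: (sum_field_sym kapN).
Qed.

(** The kernel is a probability, and |beta| <= 1 gives beta y z <= (y^2 + z^2) / 2: the interaction
    cannot exceed the quadratic entropy, even at criticality. *)
Lemma conv_mag_le c :
  beta * mean (fun j => conv_mag c j * t c j) <= mean (fun j => t c j ^+ 2).
Proof.
rewrite -meanZ.
apply: (@le_trans _ _ (mean (fun j =>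
   2^-1 * \sum_m kap (j - m) * (t c m ^+ 2 + t c j ^+ 2)))).
  apply: ler_mean => j; rewrite /conv_mag mulr_suml !mulr_sumr; apply: ler_sum => m _.
  have := kap_ge0 (j - m); have := beta1; rewrite ler_norml => /andP[b1 b2] k0.
  move: (t c m) (t c j) (kap _) k0 => y z k k0.
  have -> : beta * (k * y * z) = k * (beta * (y * z)) by ring.
  have -> : 2^-1 * (k * (y ^+ 2 + z ^+ 2)) = k * (2^-1 * (y ^+ 2 + z ^+ 2)) by ring.
  apply: ler_wpM2l => //.
  have : 0 <= (1 + beta) * (y - z) ^+ 2 by rewrite mulr_ge0 ?sqr_ge0//; lra.
  have : 0 <= (1 - beta) * (y + z) ^+ 2 by rewrite mulr_ge0 ?sqr_ge0//; lra.
  by rewrite !expr2; lra.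
rewrite meanZ.
have -> : mean (fun j => \sum_m kap (j - m) * (t c m ^+ 2 + t c j ^+ 2)) =
    mean (fun j => t c j ^+ 2) + mean (fun j => t c j ^+ 2).
  transitivity (mean (fun j => \sum_m kap (j - m) * t c m ^+ 2 + t c j ^+ 2)).
    apply: eq_mean => j; under eq_bigr do rewrite mulrDr.
    by rewrite big_split/= -mulr_suml kap_sumB// mul1r.
  rewrite meanD; congr (_ + _); rewrite /mean -!mulr_sumr; congr (_ * _).
  rewrite exchange_big/=; apply: eq_bigr => m _.
  by rewrite -mulr_suml kap_sumBl// mul1r.
by rewrite le_eqVlt; apply/orP; left; apply/eqP; field.
Qed.

Lemma mean_scaled_field c : mean (x c) = beta * mean_spin c.
Proof.
rewrite -[LHS]/(mean (fun j => beta * h c j)) meanZ; congr (_ * _).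
rewrite /mean_spin /mean -!mulr_sumr; congr (_ * _).
rewrite /local_field exchange_big/=; apply: eq_bigr => j _.
by rewrite -mulr_suml kap_sumBl// mul1r.
Qed.

Let dif4 := E (fun c => mean (fun j => mean (fun k => (t c j - t c k) ^+ 4))).

(* Free energy convexity: the mean-field interaction energy is at most the
   quadratic part of the entropy, so the quartic part has to vanish. *)
Lemma wexp_dif4 : cst_c R * dif4 <= 4 * (ms + e9).
Proof.
rewrite /dif4 -wexpZ.
apply: (@le_trans _ _ (E (fun c => 2 * (`|mean_spin c| + mean_mag c ^+ 2 +
   (beta * (mean (fun j => h c j * t c j) - mean (fun j => conv_mag c j * t c j))))))).
  apply: le_wexp => // c.
  have t1 := tau_norm c nb_gt0.
  apply: (@le_trans _ _ (mean (fun j => mean (fun k => (x c j - x c k) * (t c j - t c k)))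
     - mean (fun j => mean (fun k => (t c j - t c k) * (t c j - t c k))))).
    rewrite -meanB -meanZ; apply: ler_mean => j; rewrite -meanB -meanZ.
    by apply: ler_mean => k; rewrite -expr2 local_mag_pair ?scaled_field_norm.
  (* Both double averages are twice a covariance. The products of means only involve the mean spin
     and the mean magnetization, which are controlled by [ms] and [wexp_mean_mag]. *)
  rewrite !mean2_diff -mulrBr ler_wpM2l// mean_scaled_field -/(mean_mag c).
  have -> : mean (fun j => x c j * t c j) = beta * mean (fun j => h c j * t c j).
    by rewrite -meanZ; apply: eq_mean => j; rewrite mulrA.
  have := conv_mag_le c.
  have -> : mean (fun j => t c j * t c j) = mean (fun j => t c j ^+ 2) by [].
  have : - (beta * mean_spin c * mean_mag c) <= `|mean_spin c|.
    apply: le_trans (ler_norm _) _; rewrite normrN -mulrA mulrCA normrM ler_piMr//.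
    by rewrite normrM mulr_ile1// mean_mag_norm.
  move: (mean (fun j => t c j ^+ 2)) (mean_mag c) (mean_spin c) => a b d.
  move: (mean _) (mean _) => e f; rewrite expr2; lra.
rewrite wexpZ wexpD wexpD wexpZ wexpB -/ms.
have := wexp_mean_mag; have := wexp_field_mag.
set X := E _ - E _; set Y := E _ => HX HY.
have : beta * X <= e9.
  apply: le_trans (ler_norm _) _; rewrite normrM; apply: le_trans HX.
  by rewrite ler_piMl.
by lra.
Qed.

Hypothesis N_gt0 : (0 < N)%N.

Lemma succ_neq (i : site) : succ_site i != i.
Proof.
apply/eqP => /(congr1 val)/=; rewrite /succ_site/= modnDmr.
have := ltn_ord i; rewrite leq_eqVlt => /orP[/eqP [iE]|iN].
  rewrite iE addn1 modnn; lia.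
rewrite modn_small; lia.
Qed.

Variable g : site -> R.
Hypothesis g1 : forall i, `|g i| <= 1.

Definition two_point c := mean (fun i => g i * (s c i * s c (succ_site i))).
Local Notation Vc := two_point.

Lemma two_point_norm c : `|Vc c| <= 1.
Proof.
apply: mean_norm => i; rewrite !normrM !spin_norm !mulr1; exact: g1.
Qed.

Lemma succ_inj : injective (@succ_site N).
Proof. by move=> i j /addIr. Qed.

Lemma weak_two_point : weak om [::] (9 * 4) Vc.
Proof.
apply: (weak_avg om0 (S := fun i => [:: i; succ_site i])) => //.
- by rewrite sum_ni.
- move=> i _; apply: (@weak_sub _ _ _ om0 [:: i; succ_site i] _ (2 * `|g i| * (2 * 1 * 1))) => //.
    by have := g1 i; lra.
  apply: weakM; first exact: (weak_cst om0).
  by apply: weakM; apply: weak_spin; rewrite ?inE ?eqxx ?orbT ?om_ge0.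
move=> j; apply: (@le_trans _ _ (\sum_(i | j == i) ni + \sum_(i | j == succ_site i) ni)).
  rewrite big_mkcond [X in _ <= X + _]big_mkcond [X in _ <= _ + X]big_mkcond -big_split/=.
  apply: ler_sum => i _; rewrite !inE; have := ni_ge0; move: ni => y.
  by case: (j == i); case: (j == _) => /=; lra.
have -> : \sum_(i | j == i) ni = ni.
  by rewrite (eq_bigl (pred1 j)) ?big_pred1_eq// => i; rewrite eq_sym.
have -> : \sum_(i | j == succ_site i) ni = ni.
  rewrite (eq_bigl (pred1 (j - inZp 1))) ?big_pred1_eq// => i/=.
  by rewrite /succ_site -subr_eq eq_sym.
by have := n_om; move: ni => y; lra.
Qed.

Lemma le_theta4 (a th : R) : 0 < th -> `|a| <= th + th ^- 3 * a ^+ 4.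
Proof.
move=> th0; have [ath|tha] := leP `|a| th.
  apply: ler_wpDr => //; apply: mulr_ge0; last by rewrite exprn_even_ge0.
  by rewrite invr_ge0 exprn_ge0// ltW.
apply: ler_wpDl; first exact: ltW.
have -> : a ^+ 4 = `|a| ^+ 4 by rewrite -normrX ger0_norm// exprn_even_ge0.
rewrite mulrC ler_pdivlMr ?exprn_gt0// [leRHS]exprS ler_wpM2l// lerXn2r ?nnegrE// ltW//.
Qed.

Lemma le_theta2 (a th : R) : 0 < th -> `|a| <= th + th^-1 * a ^+ 2.
Proof.
move=> th0; have [ath|tha] := leP `|a| th.
  by apply: ler_wpDr => //; rewrite mulr_ge0 ?invr_ge0 ?sqr_ge0 ?(ltW th0).
apply: ler_wpDl; first exact: ltW.
rewrite -(real_normK (num_real a)) mulrC ler_pdivlMr// [leRHS]expr2 ler_wpM2l// ltW//.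
Qed.

(** Each magnetization is within its average distance to the others of their mean. The free
    parameter [th] converts the available second and fourth moments into first moments. *)
Lemma wexp_abs_mag (th : R) : 0 < th -> th <= 1 ->
  E (fun c => mean (fun j => `|t c j|)) <=
    4 * th + th ^- 3 * (1 + 4 / cst_c R) * (ms + e9).
Proof.
move=> th0 th1.
apply: (@le_trans _ _ (E (fun c => 2 * th + (th^-1 * mean_mag c ^+ 2 + th ^- 3 *
    mean (fun j => mean (fun k => (t c j - t c k) ^+ 4)))))).
  apply: le_wexp => // c.
  apply: (@le_trans _ _ (mean (fun j => `|mean_mag c| +
      mean (fun k => `|t c j - t c k|)))).
    apply: ler_mean => j.
    apply: (@le_trans _ _ (`|mean_mag c| + `|t c j - mean_mag c|)).
      by rewrite -lerBlDl; apply: le_trans (lerB_dist _ _).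
    rewrite lerD2l; apply: le_trans (ler_mean_norm _).
    by rewrite meanB mean_cst.
  rewrite meanD mean_cst.
  have -> : 2 * th + (th^-1 * mean_mag c ^+ 2 +
     th ^- 3 * mean (fun j => mean (fun k => (t c j - t c k) ^+ 4))) =
     (th + th^-1 * mean_mag c ^+ 2) + (th +
     th ^- 3 * mean (fun j => mean (fun k => (t c j - t c k) ^+ 4))) by ring.
  apply: lerD; first exact: le_theta2.
  rewrite -[X in _ <= X + _]mean_cst -meanZ -meanD; apply: ler_mean => j.
  rewrite -[X in _ <= X + _]mean_cst -meanZ -meanD; apply: ler_mean => k.
  exact: le_theta4.
rewrite wexpD wexpD !wexpZ -/dif4.
have H1 : E (fun=> th) <= 2 * th.
  by rewrite /wexp -mulr_suml ler_wpM2r// ltW.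
have H2 := wexp_mean_mag.
have H3 : dif4 <= 4 / cst_c R * (ms + e9).
  by rewrite mulrAC ler_pdivlMr ?cst_c_gt0// mulrC wexp_dif4.
have ms0 : 0 <= ms by apply: sumr_ge0 => c _; rewrite mulr_ge0.
have e0 : 0 <= e9.
  apply: mulr_ge0 err_ge0; apply: mulr_ge0; first exact: cst_eq_ge0.
  by apply: mulr_ge0; last exact: cst_t_ge0.
have -> : 4 * th + th ^- 3 * (1 + 4 / cst_c R) * (ms + e9) =
  2 * (2 * th) + (th ^- 3 * (ms + e9) + th ^- 3 * (4 / cst_c R * (ms + e9))) by ring.
apply: lerD; first by rewrite ler_wpM2l.
apply: lerD.
  apply: ler_pM => //; rewrite ?invr_ge0 ?(ltW th0)//.
    by apply: sumr_ge0 => c _; rewrite mulr_ge0// sqr_ge0.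
  rewrite lef_pV2 ?posrE ?exprn_gt0// -[leRHS]mulr1 exprS ler_pM2l//.
  by rewrite exprn_ile1// ltW.
by rewrite ler_wpM2l// invr_ge0 exprn_ge0// ltW.
Qed.

Definition cst_two : R := cst_eq R * (2 * (2 * (9 * 4) * 1) * 1).
Definition cst_fin : R :=
  cst_two + (1 + 4 / cst_c R) * (1 + cst_eq R * (9 * cst_t R)).

(** In V^2 = V * mean(g s_i s_(i+1)) the factor V is weak at every site and s_i only depends on i,
    so s_(i+1) may be replaced by its magnetization; what remains is bounded by the mean absolute
    magnetization. *)
Lemma wexp_two_point (th : R) : 0 < th -> th <= 1 ->
  E (fun c => Vc c ^+ 2) <= 4 * th + th ^- 3 * cst_fin * (ms + err).
Proof.
move=> th0 th1.
pose F i c := Vc c * g i * s c i.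
have wF i : weak om [:: i] (2 * (2 * (9 * 4) * 1) * 1) (F i).
  apply: weakM; last by apply: weak_spin; rewrite ?inE ?om_ge0.
  apply: weakM; first exact: (weak_sub om0 _ (lexx _) weak_two_point).
  by apply: (weak_sub om0 _ (g1 i) (weak_cst om0 [:: i] (g i))).
have := mean_equilibrium (r := @succ_site N) (S := fun i => [:: i]) _ (fun=> isT) wF.
move=> /(_ (fun j => _)) H.
have {}H := H (fun j => ltac:(rewrite inE; exact: succ_neq)).
have {H} : E (fun c => Vc c ^+ 2) <= cst_two * err + E (fun c => mean (fun j => `|t c j|)).
  have -> : E (fun c => Vc c ^+ 2) =
     E (fun c => \sum_j ni * (F j c * (s c (succ_site j) - t c (succ_site j)))) +
     E (fun c => Vc c * mean (fun i => g i * s c i * t c (succ_site i))).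
    rewrite -wexpD; apply: eq_wexp => c.
    rewrite -[X in _ = X + _]/(mean (fun j => F j c * (s c (succ_site j) - t c (succ_site j)))).
    rewrite expr2 {2}/two_point -!meanZ -meanD; apply: eq_mean => i.
    by rewrite /F; ring.
  apply: lerD; first exact: le_trans (ler_norm _) H.
  apply: le_wexp => // c; apply: le_trans (ler_norm _) _; rewrite normrM.
  apply: (@le_trans _ _ (1 * mean (fun j => `|t c (succ_site j)|))).
    apply: ler_pM => //; first exact: two_point_norm.
    apply: le_trans (ler_mean_norm _) _; apply: ler_mean => i.
    by rewrite !normrM spin_norm mulr1 ler_piMl.
  by rewrite mul1r /mean [leRHS](reindex_inj succ_inj).
move=> /le_trans; apply.
have H1 := wexp_abs_mag th0 th1.
have ms0 : 0 <= ms by apply: sumr_ge0 => c _; rewrite mulr_ge0.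
have t3 : 1 <= th ^- 3 by rewrite invf_ge1 ?exprn_gt0// exprn_ile1// ltW.
have c20 : 0 <= cst_two.
  by apply: mulr_ge0; [exact: cst_eq_ge0|rewrite !mulr_ge0].
have cc0 : 0 <= 4 / cst_c R by rewrite divr_ge0// ltW// cst_c_gt0.
have e0 := err_ge0.
have ce : 0 <= cst_eq R * (9 * cst_t R).
  apply: mulr_ge0; first exact: cst_eq_ge0.
  by apply: mulr_ge0; last exact: cst_t_ge0.
have A1 : cst_two * err <= th ^- 3 * (cst_two * (ms + err)).
  apply: (@le_trans _ _ (1 * (cst_two * (ms + err)))).
    by rewrite mul1r ler_wpM2l// lerDr.
  by rewrite ler_wpM2r// mulr_ge0// addr_ge0.
have A2 : ms + e9 <= (1 + cst_eq R * (9 * cst_t R)) * (ms + err).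
  rewrite /e9; have : 0 <= cst_eq R * (9 * cst_t R) * ms by rewrite mulr_ge0.
  by have := e0; move: (cst_eq R * (9 * cst_t R)) => ?; lra.
have A3 : th ^- 3 * (1 + 4 / cst_c R) * (ms + e9) <=
   th ^- 3 * (1 + 4 / cst_c R) * ((1 + cst_eq R * (9 * cst_t R)) * (ms + err)).
  by rewrite ler_wpM2l// mulr_ge0 ?addr_ge0// invr_ge0 exprn_ge0// ltW.
rewrite /cst_fin; lra.
Qed.

End Boxes.

(** * Entropy production *)

Section EntropyProduction.
Context (R : realType) (K : R -> R) (N : nat) (gamma beta : R).
Local Notation n := (N.*2).+1.
Local Notation site := (site N).
Local Notation config := (config N).
Local Notation kap := (@kappa R K N gamma).
Local Notation H := (@hamiltonian R K N gamma).
Local Notation w := (@weight R K N gamma beta).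
Local Notation r := (@rate R K N gamma beta).
Local Notation L := (@generator R K N gamma beta).

Lemma exchangeK i : involutive (fun c => @exchange N c i).
Proof. move=> c; exact: swapK. Qed.

Lemma sum_exchange (F : config -> R) i : \sum_c F c = \sum_c F (exchange c i).
Proof. by rewrite (reindex_inj (inv_inj (@exchangeK i))). Qed.

Lemma rate_gt0 c i : 0 < r c i.
Proof. by rewrite invr_gt0 addr_gt0 ?expR_gt0. Qed.

Lemma rate_le1 c i : r c i <= 1.
Proof. by rewrite invf_le1 ?addr_gt0 ?expR_gt0// lerDl expR_ge0. Qed.

(** With energies a and b of the two configurations, the product of weight and rate is 1 / (exp(beta
    a) + exp(beta b)), which is symmetric. *)
Lemma detailed_balance c i : w (exchange c i) * r (exchange c i) i = w c * r c i.
Proof.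
rewrite /rate exchangeK /weight.
set a := H c; set b := H (exchange c i).
have E x y : expR (- beta * x) * (1 + expR (beta * (y - x)))^-1 =
    (expR (beta * x) + expR (beta * y))^-1.
  rewrite mulNr expRN -invfM mulrDr mulr1 -expRD; congr (_ + expR _)^-1.
  by ring.
by rewrite !E addrC.
Qed.

Lemma sum_balance (F : config -> R) i :
  \sum_c w c * r c i * F (exchange c i) = \sum_c w c * r c i * F c.
Proof.
rewrite (sum_exchange _ i); apply: eq_bigr => c _.
by rewrite exchangeK detailed_balance.
Qed.

Lemma weight_invariant (F : config -> R) : \sum_c w c * L F c = 0.
Proof.
rewrite /generator; under eq_bigr do rewrite mulr_sumr.
rewrite exchange_big/= big1// => i _.
under eq_bigr do rewrite mulrA mulrBr.
by rewrite sumrB sum_balance subrr.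
Qed.

Definition dissipation (q : config -> R) := \sum_i \sum_c w c * r c i *
  ((q (exchange c i) / w (exchange c i) - q c / w c) *
   (ln (q (exchange c i) / w (exchange c i)) - ln (q c / w c))).

(** Detailed balance lets the sum be symmetrized over each exchange, which produces the factor
    1/2. *)
Lemma generator_dissipation (q : config -> R) :
  \sum_c q c * L (fun c => ln (q c / w c)) c = - (2^-1 * dissipation q).
Proof.
rewrite /generator /dissipation mulr_sumr -sumrN.
under eq_bigr do rewrite mulr_sumr.
rewrite exchange_big/=; apply: eq_bigr => i _.
pose f c := q c / w c.
have -> : \sum_c q c * (r c i * (ln (q (exchange c i) / w (exchange c i)) - ln (q c / w c)))
   = \sum_c w c * r c i * (f c * (ln (f (exchange c i)) - ln (f c))).
  apply: eq_bigr => c _; rewrite /f; have := weight_gt0 K gamma beta c.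
  by move: (ln _) (ln _) => A B w0; field; rewrite gt_eqF.
set A := \sum_c _; rewrite -mulrN.
suff -> : - \sum_c w c * r c i * ((f (exchange c i) - f c) *
     (ln (f (exchange c i)) - ln (f c))) = 2 * A by field.
have -> : 2 * A = A + A by ring.
rewrite {1}/A -(sum_balance (fun c => f c * (ln (f (exchange c i)) - ln (f c)))).
rewrite /A -big_split/= -sumrN; apply: eq_bigr => c _.
by rewrite exchangeK; ring.
Qed.

Lemma ln_le_sub1 (x : R) : 0 < x -> ln x <= x - 1.
Proof.
move=> x0; have := expR_ge1Dx (ln x); rewrite lnK ?posrE//; lra.
Qed.

Definition entropy (q : config -> R) := \sum_c q c * ln (q c / w c).

(** A finite-increment substitute for the derivative of the entropy: ln x <= x - 1 at x = q' / q
    leaves a remainder quadratic in the increment, of order h^2 for a time step h. *)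
Lemma entropy_step (q q' : config -> R) :
  (forall c, 0 < q c) -> (forall c, 0 < q' c) ->
  entropy q' - entropy q <=
   \sum_c (q' c - q c) * (1 + ln (q c / w c)) + \sum_c (q' c - q c) ^+ 2 / q c.
Proof.
move=> q0 q0'; rewrite /entropy -sumrB -big_split/=; apply: ler_sum => c _.
have w0 := weight_gt0 K gamma beta c.
rewrite !ln_div ?posrE//.
have HH := ln_le_sub1 (divr_gt0 (q0' c) (q0 c)).
rewrite ln_div ?posrE// -(ler_pM2l (q0' c)) in HH.
have -> : (q' c - q c) ^+ 2 / q c = q' c * (q' c / q c - 1) - (q' c - q c).
  by field; rewrite gt_eqF.
by move: HH; move: (ln _) (ln _) (ln _) (_ / _) => *; lra.
Qed.

Lemma ln_diff_ge (a b : R) : 0 < a -> 0 < b ->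
  (a - b) ^+ 2 / (a + b) <= (a - b) * (ln a - ln b).
Proof.
wlog ab : a b / b <= a.
  move=> W a0 b0; have [ab|/ltW ba] := leP b a; first exact: W.
  have := W _ _ ba b0 a0; rewrite (addrC b a).
  have -> : (b - a) ^+ 2 = (a - b) ^+ 2 by ring.
  by have -> : (b - a) * (ln b - ln a) = (a - b) * (ln a - ln b) by ring.
move=> a0 b0.
rewrite expr2 -mulrA ler_wpM2l ?subr_ge0//.
have := ln_le_sub1 (divr_gt0 b0 a0); rewrite ln_div ?posrE// => H0.
suff : (a - b) / (a + b) <= 1 - b / a by move: H0; move: (ln _) (ln _) => *; lra.
have -> : 1 - b / a = (a - b) / a by field; rewrite gt_eqF.
by rewrite ler_wpM2l ?subr_ge0// lef_pV2 ?posrE ?addr_gt0// lerDl ltW.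
Qed.

Hypothesis kap0 : kap 0 = 0.
Hypothesis kapN : forall i, kap (- i) = kap i.
Hypothesis kap_ge0 : forall i, 0 <= kap i.
Hypothesis kap_sum : \sum_i kap i = 1.
Hypothesis beta1 : `|beta| <= 1.

Lemma rate_ge c i : 1 <= (1 + expR 8) * r c i.
Proof.
rewrite /rate mulrC ler_pdivlMl ?addr_gt0 ?expR_gt0// mulr1 lerD2l ler_expR.
apply: le_trans (ler_norm _) _; rewrite normrM.
apply: le_trans (ham_swap_norm kap0 kapN kap_ge0 kap_sum c i (succ_site i)).
by rewrite ler_piMl.
Qed.

(** The inequality 2 |a - b| th <= (a - b)^2 / (a + b) + th^2 (a + b) replaces Cauchy-Schwarz: the
    bound stays linear in the dissipation and can be integrated in time, with [th] chosen at the
    end. *)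
Lemma total_var_le (q : config -> R) (th : R) : (forall c, 0 < q c) ->
  \sum_c q c <= 2 -> 0 < th ->
  total_var K gamma beta q <=
    (1 + expR 8) * (dissipation q / (2 * th) + 2 * th * n%:R).
Proof.
move=> q0 q2 th0.
pose f c := q c / w c.
have f0 c : 0 < f c by rewrite divr_gt0// weight_gt0.
have wf c : w c * f c = q c by rewrite mulrC divfK// gt_eqF// weight_gt0.
have wr c i : 0 <= w c * r c i by rewrite mulr_ge0 ?weight_ge0// ltW// rate_gt0.
pose D i := \sum_c w c * r c i * ((f (exchange c i) - f c) *
   (ln (f (exchange c i)) - ln (f c))).
suff H i : bond_var K gamma beta q i <= (1 + expR 8) * (D i / (2 * th) + 2 * th).
  apply: (@le_trans _ _ (\sum_i (1 + expR 8) * (D i / (2 * th) + 2 * th))).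
    by apply: ler_sum => i _; exact: H.
  rewrite -mulr_sumr big_split/= -mulr_suml sumr_const card_ord.
  by rewrite -(mulr_natr (2 * th)).
apply: (@le_trans _ _ ((1 + expR 8) * \sum_c w c * r c i * `|f c - f (exchange c i)|)).
  rewrite mulr_sumr; apply: ler_sum => c _; rewrite !mulrA ler_wpM2r//.
  rewrite mulrAC mulrC ler_peMr ?weight_ge0//; exact: rate_ge.
rewrite ler_wpM2l ?addr_ge0 ?expR_ge0//.
apply: (@le_trans _ _ (\sum_c (w c * r c i * ((f (exchange c i) - f c) *
     (ln (f (exchange c i)) - ln (f c))) / (2 * th) +
     w c * r c i * (th / 2 * (f c + f (exchange c i)))))).
  apply: ler_sum => c _; rewrite -(mulrA (w c * r c i)) -mulrDr ler_wpM2l//.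
  set a := f (exchange c i); set b := f c.
  have a0 : 0 < a by exact: f0. have b0 : 0 < b by exact: f0.
  have ab0 : 0 < b + a by rewrite addr_gt0.
  have HL := ln_diff_ge a0 b0.
  have th2 : 0 < 2 * th by rewrite mulr_gt0.
  apply: (@le_trans _ _ ((a - b) ^+ 2 / (b + a) / (2 * th) + th / 2 * (b + a))); last first.
    by rewrite lerD2r ler_pM2r ?invr_gt0// (addrC b).
  have -> : (a - b) ^+ 2 / (b + a) / (2 * th) + th / 2 * (b + a) =
     ((a - b) ^+ 2 + (th * (b + a)) ^+ 2) / (2 * th * (b + a)).
    by field; rewrite !gt_eqF.
  rewrite ler_pdivlMr ?mulr_gt0// distrC -(real_normK (num_real (a - b))).
  have := sqr_ge0 (`|a - b| - th * (b + a)); move: `|a - b| => y.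
  rewrite !expr2; lra.
rewrite big_split/= -mulr_suml lerD2l.
have -> : \sum_c w c * r c i * (th / 2 * (f c + f (exchange c i))) =
   th * \sum_c w c * r c i * f c.
  transitivity (th / 2 * (\sum_c w c * r c i * f c + \sum_c w c * r c i * f (exchange c i))).
    by rewrite -big_split/= mulr_sumr; apply: eq_bigr => c _; ring.
  by rewrite sum_balance; field.
rewrite (mulrC 2) ler_wpM2l ?(ltW th0)//; apply: le_trans q2; apply: ler_sum => c _.
by rewrite mulrAC wf ler_piMr ?rate_le1// ltW.
Qed.

(** There are 2^n configurations and the energy is at most n / 2 in absolute value; the mass between
    1 and 2 accounts for the rest of the constants. *)
Lemma entropy_bounds (q : config -> R) : (forall c, 0 < q c) -> 1 <= \sum_c q c <= 2 ->
  - (4 * n%:R) <= entropy q <= 3 * n%:R.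
Proof.
move=> q0 /andP[q1 q2].
have n1 : (1 : R) <= n%:R by rewrite ler1n.
have Hb c : `|beta * H c| <= 2^-1 * n%:R.
  rewrite normrM; apply: (@le_trans _ _ (1 * `|H c|)); first by rewrite ler_wpM2r.
  have h2 : 0 <= 2^-1 :> R by rewrite invr_ge0.
  rewrite mul1r hamE normrM normrN (ger0_norm h2) ler_wpM2l//.
  apply: le_trans (ler_norm_sum _ _ _) _.
  rewrite -[n in leRHS]card_ord -sum1_card natr_sum; apply: ler_sum => i _.
  by rewrite normrM spin_norm mulr1 field_norm.
have -> : entropy q = \sum_c q c * ln (q c) + \sum_c q c * (beta * H c).
  rewrite /entropy -big_split/=; apply: eq_bigr => c _.
  by rewrite ln_div ?posrE ?weight_gt0// /weight expRK; ring.
have E1 : `|\sum_c q c * (beta * H c)| <= n%:R.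
  apply: le_trans (ler_norm_sum _ _ _) _.
  apply: (@le_trans _ _ (\sum_c q c * (2^-1 * n%:R))).
    by apply: ler_sum => c _; rewrite normrM (gtr0_norm (q0 c)) ler_pM2l.
  rewrite -mulr_suml; apply: (@le_trans _ _ (2 * (2^-1 * n%:R))).
    by rewrite ler_wpM2r// mulr_ge0// ?invr_ge0.
  by rewrite mulrA divff// mul1r.
have ub : \sum_c q c * ln (q c) <= 2.
  apply: (@le_trans _ _ (\sum_c q c)) => //; apply: ler_sum => c _.
  rewrite ler_piMr ?(ltW (q0 c))//; apply: le_trans (ln_le_sub1 (q0 c)) _.
  have : q c <= \sum_c q c by rewrite (bigD1 c)//= lerDl sumr_ge0// => i _; exact/ltW.
  by lra.
(* The lower bound comes from comparison with the uniform probability, of mass [a] at each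
   configuration. *)
pose a : R := 2 ^- n.
have a0 : 0 < a by rewrite invr_gt0 exprn_gt0.
have lna : - n%:R <= ln a.
  rewrite /a lnV ?posrE ?exprn_gt0// lnXn// lerN2 -(mulr_natl (ln 2)).
  by rewrite ler_piMr//; apply: le_trans (ln_le_sub1 _) _ => //; lra.
have lb : - (2 * n%:R) <= \sum_c q c * ln (q c).
  apply: (@le_trans _ _ (\sum_c (q c * ln a + (q c - a)))).
    rewrite big_split/= -mulr_suml sumrB sumr_const card_ffun card_bool card_ord.
    have -> : a *+ (2 ^ n) = 1 by rewrite -(mulr_natr a) natrX mulVf// expf_neq0.
    have ln0 : ln a <= 0 by rewrite ln_le0// invf_le1 ?exprn_gt0// exprn_ege1// ler1n.
    nra.
  apply: ler_sum => c _; have HH := ln_le_sub1 (divr_gt0 a0 (q0 c)).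
  rewrite ln_div ?posrE// -(ler_pM2l (q0 c)) in HH; move: HH.
  have -> : q c * (a / q c - 1) = a - q c by field; rewrite gt_eqF.
  by move: (ln a) (ln _) => *; lra.
move: E1 ub lb; rewrite ler_norml; move: (\sum_c _) (\sum_c _) => A B /andP[? ?] ? ?.
by apply/andP; split; lra.
Qed.

End EntropyProduction.

(** * Bounded integrands and Riemann sums *)

Section BoundedIntegral.
Context d (T : measurableType d) (R : realType) (mu : {measure set T -> \bar R}).
Variable D : set T.
Hypothesis mD : measurable D.
Hypothesis fD : (mu D < +oo)%E.

(** Bounded measurable functions on a set of finite measure: a class closed under all the operations
    needed, so that integrability never has to be estimated. *)
Definition bdmeas (f : T -> R) :=
  measurable_fun D f /\ exists b, forall x, D x -> `|f x| <= b.

Local Notation I f := (Rintegral mu D f).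

Lemma bdmeas_integrable f : bdmeas f -> mu.-integrable D (EFin \o f).
Proof.
move=> [mf [b fb]]; apply: measurable_bounded_integrable => //.
exists b; split; first exact: num_real.
by move=> c bc x Dx; apply: le_trans (fb x Dx) (ltW bc).
Qed.

Lemma bdmeas_cst a : bdmeas (fun=> a).
Proof. by split; [exact: measurable_cst|exists `|a|]. Qed.

Lemma bdmeasD f g : bdmeas f -> bdmeas g -> bdmeas (fun x => f x + g x).
Proof.
move=> [mf [a fa]] [mg [b gb]]; split; first exact: measurable_funD.
by exists (a + b) => x Dx; apply: le_trans (ler_normD _ _) (lerD (fa x Dx) (gb x Dx)).
Qed.

Lemma bdmeasM f g : bdmeas f -> bdmeas g -> bdmeas (fun x => f x * g x).
Proof.
move=> [mf [a fa]] [mg [b gb]]; split; first exact: measurable_funM.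
by exists (a * b) => x Dx; rewrite normrM ler_pM ?fa ?gb.
Qed.

Lemma bdmeasZ a f : bdmeas f -> bdmeas (fun x => a * f x).
Proof. exact/bdmeasM/bdmeas_cst. Qed.

Lemma bdmeasN f : bdmeas f -> bdmeas (fun x => - f x).
Proof.
move=> /(bdmeasZ (-1)) bf; suff -> : (fun x => - f x) = (fun x => -1 * f x) by [].
by apply: funext => x; rewrite mulN1r.
Qed.

Lemma bdmeasB f g : bdmeas f -> bdmeas g -> bdmeas (fun x => f x - g x).
Proof. by move=> bf bg; apply: bdmeasD bf (bdmeasN bg). Qed.

Lemma bdmeasX n f : bdmeas f -> bdmeas (fun x => f x ^+ n).
Proof.
move=> bf; elim: n => [|n IH]; first exact: bdmeas_cst.
have -> : (fun x => f x ^+ n.+1) = (fun x => f x * f x ^+ n).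
  by apply: funext => x; rewrite exprS.
exact: bdmeasM.
Qed.

Lemma bdmeas_sum (J : Type) (s : seq J) (Q : pred J) (f : J -> T -> R) :
  (forall j, bdmeas (f j)) -> bdmeas (fun x => \sum_(j <- s | Q j) f j x).
Proof.
move=> bf; elim: s => [|j s IH].
  rewrite (_ : (fun x => _) = (fun=> 0)); first exact: bdmeas_cst.
  by apply: funext => x; rewrite big_nil.
rewrite (_ : (fun x => _) = (fun x => (if Q j then f j x else 0) +
    \sum_(j <- s | Q j) f j x)).
  by apply: bdmeasD IH; case: (Q j) => //; exact: bdmeas_cst.
by apply: funext => x; rewrite big_cons; case: (Q j) => //; rewrite add0r.
Qed.

Lemma bdmeas_norm f : bdmeas f -> bdmeas (fun x => `|f x|).
Proof.
move=> [mf [b fb]]; split; first exact: measurableT_comp.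
by exists b => x Dx; rewrite normr_id fb.
Qed.

Lemma bdmeas_continuous (phi : R -> R) f : continuous phi -> bdmeas f ->
  bdmeas (fun x => phi (f x)).
Proof.
move=> cphi [mf [b fb]]; split.
  by apply: measurableT_comp mf; exact: continuous_measurable_fun.
have := @compact_bounded _ _ (phi @` `[- b, b]%classic) _.
case.
  apply: continuous_compact; first exact: continuous_subspaceT.
  exact: segment_compact.
move=> M [_ HM]; exists (M + 1) => x Dx; apply: HM; first by rewrite ltrDl.
by exists (f x) => //=; rewrite in_itv/= -ler_norml fb.
Qed.

Lemma bdmeas_indic A : measurable A -> bdmeas (\1_A : T -> R).
Proof.
move=> mA; split; first exact: measurable_indic.
by exists 1 => x _; rewrite indicE; case: (_ \in _); rewrite ?normr1 ?normr0.
Qed.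

Lemma IntD f g : bdmeas f -> bdmeas g -> I (fun x => f x + g x) = I f + I g.
Proof. by move=> bf bg; rewrite RintegralD//; exact: bdmeas_integrable. Qed.

Lemma IntB f g : bdmeas f -> bdmeas g -> I (fun x => f x - g x) = I f - I g.
Proof. by move=> bf bg; rewrite RintegralB//; exact: bdmeas_integrable. Qed.

Lemma IntZ a f : bdmeas f -> I (fun x => a * f x) = a * I f.
Proof. by move=> bf; rewrite RintegralZl//; exact: bdmeas_integrable. Qed.

Lemma eq_Int f g : (forall x, D x -> f x = g x) -> I f = I g.
Proof. by move=> fg; apply: eq_Rintegral => x; rewrite inE => /fg. Qed.

Lemma Int0 : I (fun=> 0) = 0.
Proof. by rewrite Rintegral_cst// mul0r. Qed.

Lemma Int_sum (J : Type) (s : seq J) (Q : pred J) (f : J -> T -> R) :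
  (forall j, bdmeas (f j)) ->
  I (fun x => \sum_(j <- s | Q j) f j x) = \sum_(j <- s | Q j) I (f j).
Proof.
move=> bf; elim: s => [|j s IH].
  by rewrite big_nil -[RHS]Int0; apply: eq_Int => x _; rewrite big_nil.
rewrite big_cons (_ : (fun x => _) = (fun x => (if Q j then f j x else 0) +
    \sum_(j <- s | Q j) f j x)).
  rewrite IntD ?IH; first by case: (Q j) => //; rewrite Int0 add0r.
    by case: (Q j) => //; exact: bdmeas_cst.
  exact: bdmeas_sum.
by apply: funext => x; rewrite big_cons; case: (Q j) => //; rewrite add0r.
Qed.

Lemma le_Int f g : bdmeas f -> bdmeas g -> (forall x, D x -> f x <= g x) -> I f <= I g.
Proof. by move=> bf bg fg; apply: le_Rintegral => //; exact: bdmeas_integrable. Qed.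

Lemma Int_norm_le f b : bdmeas f -> (forall x, D x -> `|f x| <= b) ->
  `|I f| <= b * fine (mu D).
Proof.
move=> bf fb; apply: le_trans (le_normr_Rintegral _ _) _ => //.
  exact: bdmeas_integrable.
rewrite -Rintegral_cst//; apply: le_Int => //; first exact: bdmeas_norm.
exact: bdmeas_cst.
Qed.

Lemma Int_norm f : bdmeas f -> `|I f| <= I (fun x => `|f x|).
Proof. by move=> bf; apply: le_normr_Rintegral => //; exact: bdmeas_integrable. Qed.

Lemma Int_cvg (f_ : nat -> T -> R) f b : (forall n, measurable_fun D (f_ n)) ->
  (forall n x, D x -> `|f_ n x| <= b) ->
  (forall x, D x -> f_ ^~ x @ \oo --> f x) ->
  bdmeas f /\ (fun n => I (f_ n)) @ \oo --> I f.
Proof.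
move=> mf_ fb f_f.
have mf : measurable_fun D f by exact: measurable_fun_cvg mf_ f_f.
have fb' x : D x -> `|f x| <= b.
  move=> Dx; have := f_f x Dx => /(@cvg_norm _ R^o) cf.
  rewrite -(cvg_lim _ cf)//; apply: limr_le; first by apply/cvg_ex; eexists; exact: cf.
  by apply: nearW => n; exact: fb.
have bf : bdmeas f by split=> //; exists b.
split=> //.
have [//|||||_ _] := @dominated_convergence _ T R mu D mD
   (fun n => EFin \o f_ n) (EFin \o f) (fun=> b%:E).
- by move=> n; exact/measurable_EFinP.
- exact/measurable_EFinP.
- by apply: aeW => x Dx; apply: cvg_EFin; [exact: nearW|exact: f_f].
- exact: (bdmeas_integrable (bdmeas_cst b)).
- by apply: aeW => x n Dx; rewrite lee_fin fb.
move=> C; apply: fine_cvg.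
have -> : (I f)%:E = (\int[mu]_(x in D) (EFin \o f) x)%E; last exact: C.
by rewrite fineK//; apply: integrable_fin_num => //; exact: bdmeas_integrable.
Qed.

End BoundedIntegral.

(** * Taylor bounds and recursions in discrete time *)

Section TrigTaylor.
Context (R : realType).
Implicit Types x d : R.

Lemma sub_sin_ge0 d : 0 <= d -> 0 <= d - sin d.
Proof.
move: d; apply: (@derive_ge0_ge0 _ _ (fun d => 1 - cos d)).
all: try by move=> ?; apply: is_derive_eq; rewrite /GRing.scale/=; field.
- by move=> x _; rewrite subr_ge0 cos_le1.
- by rewrite sin0 subrr.
Qed.

Lemma cos_quad_ge0 d : 0 <= d -> 0 <= cos d - 1 + d ^+ 2 / 2.
Proof.
move: d; apply: (@derive_ge0_ge0 _ _ (fun d => d - sin d)).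
all: try by move=> ?; apply: is_derive_eq; rewrite /GRing.scale/=; field.
- exact: sub_sin_ge0.
- by rewrite cos0; lra.
Qed.

Lemma sin_cubic_ge0 d : 0 <= d -> 0 <= d ^+ 3 / 6 - d + sin d.
Proof.
move: d; apply: (@derive_ge0_ge0 _ _ (fun d => cos d - 1 + d ^+ 2 / 2)).
all: try by move=> ?; apply: is_derive_eq; rewrite /GRing.scale/=; field.
- exact: cos_quad_ge0.
- by rewrite sin0; lra.
Qed.

Lemma cos_cubic_ge0 d : 0 <= d -> 0 <= d ^+ 3 / 6 - (cos d - 1 + d ^+ 2 / 2).
Proof.
move: d; apply: (@derive_ge0_ge0 _ _ (fun d => d ^+ 2 / 2 - d + sin d)).
all: try by move=> ?; apply: is_derive_eq; rewrite /GRing.scale/=; field.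
- apply: (@derive_ge0_ge0 _ _ (fun d => d - 1 + cos d)).
  all: try by move=> ?; apply: is_derive_eq; rewrite /GRing.scale/=; field.
  + apply: (@derive_ge0_ge0 _ _ (fun d => 1 - sin d)).
    all: try by move=> ?; apply: is_derive_eq; rewrite /GRing.scale/=; field.
    * by move=> x _; rewrite subr_ge0 sin_le1.
    * by rewrite cos0; lra.
  + by rewrite sin0; lra.
- by rewrite cos0; lra.
Qed.

Lemma cos_taylor x d :
  `|cos (x + d) - (cos x - sin x * d - cos x / 2 * d ^+ 2)| <= `|d| ^+ 3.
Proof.
have H (e : R) : `|cos e - 1 + e ^+ 2 / 2| <= `|e| ^+ 3 / 6 /\ `|sin e - e| <= `|e| ^+ 3 / 6.
  wlog e0 : e / 0 <= e.
    move=> W; have [/W//|/ltW e0] := leP 0 e.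
    have := W (- e); rewrite oppr_ge0 cosN sinN sqrrN normrN => /(_ e0)[-> +].
    by rewrite -opprD normrN.
  rewrite (ger0_norm e0); have S := sin_cubic_ge0 e0; have C := cos_cubic_ge0 e0; split.
    by rewrite ger0_norm ?cos_quad_ge0//; lra.
  by rewrite distrC ger0_norm ?sub_sin_ge0//; lra.
have [H1 H2] := H d.
rewrite cosD.
have -> : cos x * cos d - sin x * sin d - (cos x - sin x * d - cos x / 2 * d ^+ 2) =
  cos x * (cos d - 1 + d ^+ 2 / 2) - sin x * (sin d - d) by field.
apply: le_trans (ler_normB _ _) _; rewrite !normrM.
have cx : `|cos x| <= 1 by rewrite ler_norml cos_geN1 cos_le1.
have sx : `|sin x| <= 1 by rewrite ler_norml sin_geN1 sin_le1.
apply: (@le_trans _ _ (1 * (`|d| ^+ 3 / 6) + 1 * (`|d| ^+ 3 / 6))).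
  by apply: lerD; apply: ler_pM.
have D3 : 0 <= `|d| ^+ 3 by rewrite exprn_ge0.
lra.
Qed.

Lemma expRN_quadratic x : 0 <= x -> `|1 - x - expR (- x)| <= x ^+ 2.
Proof.
move=> x0; rewrite distrC ger0_norm; last first.
  by have := expR_ge1Dx (- x); lra.
suff H (y : R) : 0 <= y -> 0 <= y ^+ 2 / 2 - (expR (- y) - 1 + y).
  have := H x x0; have := sqr_ge0 x; lra.
move: y; apply: (@derive_ge0_ge0 _ _ (fun y => y + expR (- y) - 1)).
all: try by move=> ?; apply: is_derive_eq; rewrite /GRing.scale/=; field.
- by move=> y _; have := expR_ge1Dx (- y); lra.
- by rewrite oppr0 expR0; lra.
Qed.

Lemma le_limit (a_ b_ : nat -> R) (a b : R) m : a_ @ \oo --> a -> b_ @ \oo --> b ->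
  (forall n, (m <= n)%N -> a_ n <= b_ n) -> a <= b.
Proof.
move=> ca cb H; rewrite -(cvg_lim _ ca)// -(cvg_lim _ cb)//.
apply: ler_lim; [by apply/cvg_ex; eexists; exact: ca|by apply/cvg_ex; eexists; exact: cb|].
by exists m => // n /= mn; exact: H.
Qed.

(** A discrete Duhamel formula: as the multiplier lies in [0, 1], errors add up without
    amplification. *)
Lemma affine_iter (a : R) (c rho : nat -> R) : 0 <= a <= 1 ->
  (forall k, `|c k.+1 - a * c k| <= rho k) ->
  forall k, `|c k - a ^+ k * c 0%N| <= \sum_(j < k) rho j.
Proof.
move=> /andP[a0 a1] step; elim=> [|k IH]; first by rewrite mul1r subrr normr0 big_ord0.
rewrite big_ord_recr/=.
have -> : c k.+1 - a ^+ k.+1 * c 0%N = a * (c k - a ^+ k * c 0%N) + (c k.+1 - a * c k).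
  by rewrite exprS; ring.
apply: le_trans (ler_normD _ _) _; apply: lerD; last exact: step.
by rewrite normrM (ger0_norm a0); apply: le_trans IH; rewrite ler_piMl.
Qed.

Lemma exp_sub_le (a e : R) m : 0 <= a <= 1 -> 0 <= e <= 1 ->
  `|a ^+ m - e ^+ m| <= m%:R * `|a - e|.
Proof.
move=> /andP[a0 a1] /andP[e0 e1].
elim: m => [|m IH]; first by rewrite !expr0 subrr normr0 mul0r.
have -> : a ^+ m.+1 - e ^+ m.+1 = a * (a ^+ m - e ^+ m) + (a - e) * e ^+ m.
  by rewrite !exprS; ring.
apply: le_trans (ler_normD _ _) _; rewrite -[m.+1%:R]natr1 (mulrDl m%:R) (mul1r `|_|) !normrM.
apply: lerD; first by rewrite (ger0_norm a0); apply: le_trans IH; rewrite ler_piMl.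
by rewrite ler_piMr// ger0_norm ?exprn_ge0// exprn_ile1.
Qed.

Lemma sum_affine (a b c : R) (e : nat -> R) n :
  \sum_(j < n) (a * e j + b + c) = a * \sum_(j < n) e j + n%:R * b + n%:R * c.
Proof.
elim: n => [|n IH]; first by rewrite !big_ord0; ring.
by rewrite !big_ord_recr/= IH -[n.+1%:R]natr1; ring.
Qed.

Lemma affine_bound (cn c0 a e S r1 r2 r3 : R) : `|cn - a * c0| <= S -> S <= r1 ->
  `|a - e| <= r2 -> `|c0| <= 1 -> r1 + r2 = r3 -> `|cn - e * c0| <= r3.
Proof.
move=> H1 H2 H3 H4 <-.
have -> : cn - e * c0 = (cn - a * c0) + (a - e) * c0 by ring.
apply: le_trans (ler_normD _ _) _; apply: lerD; first exact: le_trans H2.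
by rewrite normrM; apply: le_trans H3; rewrite ler_piMr.
Qed.

End TrigTaylor.

(** * Riemann sums of functions that are locally constant to the right *)

Section RiemannSums.
Context (R : realType).
Local Notation leb := (@lebesgue_measure R).

Lemma at_rightP (x : R) (P : R -> Prop) : (\forall v \near x^'+, P v) <->
  exists2 e, 0 < e & forall v, x < v < x + e -> P v.
Proof.
split=> [[e /= e0 H]|[e e0 H]].
  exists e => // v /andP[xv ve]; apply: H => //=.
  by rewrite /ball/= distrC gtr0_norm ?subr_gt0// ltrBlDl.
exists e => //= v; rewrite /ball/= => ve xv; apply: H; rewrite xv/=.
by move: ve; rewrite distrC gtr0_norm ?subr_gt0// ltrBlDl.
Qed.

Lemma at_leftP (x : R) (P : R -> Prop) : (\forall v \near x^'-, P v) <->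
  exists2 e, 0 < e & forall v, x - e < v < x -> P v.
Proof.
split=> [[e /= e0 H]|[e e0 H]].
  exists e => // v /andP[xv ve]; apply: H => //=.
  by rewrite /ball/= gtr0_norm ?subr_gt0// ltrBlDl -ltrBlDr.
exists e => //= v; rewrite /ball/= => ve xv; apply: H; rewrite xv andbT.
by move: ve; rewrite gtr0_norm ?subr_gt0// ltrBlDl -ltrBlDr.
Qed.

Definition rsum (g : R -> R) (s t : R) (n : nat) :=
  (t - s) / n.+1%:R * \sum_(k < n.+1) g (s + k.+1%:R * ((t - s) / n.+1%:R)).

Lemma itv_fin (s t : R) : (leb `[s, t[ < +oo)%E.
Proof. by rewrite lebesgue_measure_itv/=; case: ifP => _; rewrite -?EFinB ltry. Qed.

Lemma itvc_fin (s t : R) : (leb `[s, t] < +oo)%E.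
Proof. by rewrite lebesgue_measure_itv/=; case: ifP => _; rewrite -?EFinB ltry. Qed.

(** The sum is the integral of the step function equal, on each cell, to the value at its right end.
    At a given point this value is eventually the right one, since the right end falls into the
    interval where g is constant; bounded convergence concludes. Measurability of g is obtained as a
    limit on the way. *)
Lemma riemann_right (g : R -> R) (b s t : R) : s <= t -> (forall u, `|g u| <= b) ->
  (forall u, s <= u < t -> \forall v \near u^'+, g v = g u) ->
  bdmeas `[s, t] g /\ rsum g s t @ \oo --> Rintegral leb `[s, t] g.
Proof.
rewrite le_eqVlt => /predU1P[<- gb _|st gb gr].
  have E x : `[s, s]%classic x -> x = s.
    by rewrite /= in_itv/= -eq_le => /eqP.
  split.
    split; last by exists b.
    by rewrite set_itv1; exact: measurable_fun_set1.
  rewrite set_itv1 Rintegral_set1 (_ : rsum g s s = fun=> 0); first exact: cvg_cst.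
  by apply: funext => n; rewrite /rsum subrr !mul0r.
pose h n : R := (t - s) / n.+1%:R.
have h0 n : 0 < h n by rewrite divr_gt0 ?subr_gt0.
pose p n k : R := s + k%:R * h n.
pose J n k : set R := `[p n k, p n k.+1[%classic.
pose g_ n u := \sum_(k < n.+1) g (p n k.+1) * \1_(J n k) u.
have pS n k : p n k.+1 = p n k + h n by rewrite /p -natr1; ring.
have ple n i j : (p n i <= p n j) = (i <= j)%N.
  by rewrite /p lerD2l ler_pM2r// ler_nat.
have plt n i j : (p n i < p n j) = (i < j)%N by rewrite ltNge ple ltnNge.
have pn n : p n n.+1 = t.
  by rewrite /p /h mulrC divfK// ?subrKC// pnatr_eq0.
have p0 n : p n 0%N = s by rewrite /p mul0r addr0.
have locate n u : s <= u < t -> exists2 k, (k < n.+1)%N & p n k <= u < p n k.+1.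
  move=> /andP[su ut]; pose x := (u - s) / h n.
  have x0 : 0 <= x by rewrite divr_ge0 ?subr_ge0// ltW.
  have /andP[k1 k2] := truncn_itv x0; exists (Num.trunc x).
    rewrite -(@ltr_nat R); apply: le_lt_trans k1 _.
    rewrite ltr_pdivrMr// -(ltrD2l s) subrKC.
    by have := pn n; rewrite /p => ->.
  rewrite /p -lerBrDl -ler_pdivlMr// k1/= -ltrBlDl -ltr_pdivrMr//.
have gE n u k : (k < n.+1)%N -> p n k <= u < p n k.+1 -> g_ n u = g (p n k.+1).
  move=> kn uk; rewrite /g_ (bigD1 (Ordinal kn))//= indicE mem_set ?mulr1.
    rewrite big1 ?addr0// => i ik; rewrite indicE memNset ?mulr0//.
    rewrite /J/= in_itv/= => /andP[a1 a2]; move/andP: uk => [b1 b2].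
    have := le_lt_trans a1 b2; have := le_lt_trans b1 a2; rewrite !plt !ltnS => ki ik'.
    by move/negP: ik; apply; apply/eqP/val_inj/eqP => /=; rewrite eqn_leq ik' ki.
  by rewrite /J/= in_itv.
have b0 : 0 <= b by apply: le_trans (gb s); exact: normr_ge0.
have gout n u : s <= u < t -> `|g_ n u| <= b.
  by move=> /(locate n)[k kn uk]; rewrite (gE _ _ _ kn uk).
have bJ n k : bdmeas `[s, t[ (fun u => g (p n k.+1) * \1_(J n k) u).
  by apply: bdmeasZ; apply: bdmeas_indic; exact: measurable_itv.
have ms : measurable `[s, t[%classic by [].
have [||u su|bg C] := @Int_cvg _ _ R leb `[s, t[ ms (itv_fin s t) g_ g b.
- by move=> n; case: (bdmeas_sum (index_enum _) xpredT (fun k : 'I_n.+1 => bJ n k)).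
- by move=> n u /=; rewrite in_itv/=; exact: gout.
- move: su; rewrite /= in_itv/= => su.
  have /at_rightP[e e0 He] := gr u su.
  have hcvg : h n @[n --> \oo] --> (0 : R).
    rewrite -(mulr0 (t - s)); apply: cvgM; first exact: cvg_cst.
    exact: cvg_harmonic.
  apply/cvgrPdist_lt => d d0.
  have /cvgrPdist_lt/(_ _ e0) := hcvg; apply: filterS => n.
  rewrite sub0r normrN gtr0_norm// => hn.
  have [k kn uk] := locate n u su.
  rewrite (gE _ _ _ kn uk) He ?subrr ?normr0//.
  by move/andP: uk => [u1 ->]/=; rewrite pS; lra.
have Ig n : Rintegral leb `[s, t[ (g_ n) = rsum g s t n.
  rewrite /g_ (Int_sum _ (itv_fin s t))//; last by move=> k; exact: bJ.
  rewrite /rsum mulr_sumr; apply: eq_bigr => k _.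
  rewrite (@IntZ _ _ R leb _ ms (itv_fin s t)); last first.
    by apply: bdmeas_indic; exact: measurable_itv.
  rewrite [LHS]mulrC.
  congr (_ * _); rewrite /Rintegral integral_indic//; last exact: measurable_itv.
  have -> : J n k `&` `[s, t[ = J n k.
    apply/seteqP; split=> u; first by case.
    move=> Ju; split=> //; move: Ju; rewrite /J/= !in_itv/= => /andP[u1 u2].
    rewrite (le_trans _ u1) -?(p0 n) ?ple//= -(pn n) (lt_le_trans u2)// ple.
    exact: ltn_ord.
  have := @lebesgue_measure_itv R `[p n k, p n k.+1[.
  have E : p n k.+1 - p n k = h n by rewrite pS; ring.
  by rewrite /= lte_fin plt ltnSn -EFinB E => /(congr1 fine).
split.
  split; last by exists b.
  have -> : `[s, t]%classic = `[s, t[ `|` [set t].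
    apply/seteqP; split=> u /=; rewrite !in_itv/=.
      by rewrite [u <= t]le_eqVlt => /andP[-> /predU1P[->|->]]; [right|left].
    by move=> [/andP[-> /ltW]//|->]; rewrite lexx (ltW st).
  by apply/measurable_funU => //; split; [case: bg|exact: measurable_fun_set1].
rewrite -Rintegral_itv_bndo_bndc; last exact: (bdmeas_integrable _ (itv_fin s t)).
by rewrite (_ : rsum g s t = fun n => Rintegral leb `[s, t[ (g_ n)); [exact: C|
  apply: funext => n; rewrite Ig].
Qed.

End RiemannSums.

(** * Martingales of a finite jump process *)

Section JumpProcess.
Context (R : realType) (T I : finType) (jump : T -> I -> T) (r : T -> I -> R).
Local Notation leb := (@lebesgue_measure R).

Definition jump_gen (f : T -> R) x := \sum_i r x i * (f (jump x i) - f x).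
Definition fmax (f : T -> R) := \sum_c `|f c|.

Lemma fmaxP f c : `|f c| <= fmax f.
Proof. by rewrite /fmax (bigD1 c)//= lerDl sumr_ge0. Qed.

Lemma fmax_ge0 f : 0 <= fmax f. Proof. exact: sumr_ge0. Qed.

Context d (Om : measurableType d) (P : probability Om R) (X : R -> Om -> T).
Variable G : R -> set (set Om).
Local Notation F t := <<s G t >>.
Variable Ph : R -> (T -> R) -> T -> R.

(** An interface to the dynamics: a finite state space, right-constant paths, and a Markov property
    for operators [Ph] of which only the expansion to first order, with error h^2, is required. *)
Record jump_process : Prop := JumpProcess {
  jp_sub : forall (t : R) A, 0 <= t -> F t A -> measurable A;
  jp_X : forall (s t : R) c, 0 <= s <= t -> F t (X s @^-1` [set c]);
  jp_mono : forall (s t : R) A, 0 <= s <= t -> F s A -> F t A;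
  jp_right : forall (t : R) w, 0 <= t -> \forall s \near t^'+, X s w = X t w;
  jp_Ph : forall f, exists2 C : R, 0 <= C &
    forall (h : R) x, 0 <= h <= 1 -> `|Ph h f x - f x - h * jump_gen f x| <= C * h ^+ 2;
  jp_markov : forall (s h : R) B f, 0 <= s -> 0 <= h -> F s B ->
    (\int[P]_(w in B) (f (X (s + h) w))%:E = \int[P]_(w in B) (Ph h f (X s w))%:E)%E;
  jp_rate : forall x i, 0 <= r x i
}.

Hypothesis JP : jump_process.
Let F_sub := jp_sub JP.
Let F_X := jp_X JP.
Let F_mono := jp_mono JP.
Let X_right := jp_right JP.
Let PhE := jp_Ph JP.
Let markov := jp_markov JP.
Let r_ge0 := jp_rate JP.

Definition Ex (Z : Om -> R) := Rintegral P setT Z.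
Definition Fbd t (Z : Om -> R) := @bdmeas _ (g_sigma_algebraType (G t)) R setT Z.
Local Notation bd := (@bdmeas _ Om R setT).

Lemma P_fin : (P setT < +oo)%E. Proof. by rewrite probability_setT ltry. Qed.

Lemma Fbd_preimage t Z B : Fbd t Z -> measurable B -> F t (Z @^-1` B).
Proof. by move=> [mZ _] mB; have := mZ measurableT _ mB; rewrite setTI. Qed.

Lemma Fbd_bd t Z : 0 <= t -> Fbd t Z -> bd Z.
Proof.
move=> t0 bZ; split; last by case: bZ.
by move=> _ B mB; rewrite setTI; apply: (F_sub t0); exact: Fbd_preimage bZ mB.
Qed.

Lemma Fbd_mono s t Z : 0 <= s <= t -> Fbd s Z -> Fbd t Z.
Proof.
move=> st bZ; split; last by case: bZ.
by move=> _ B mB; rewrite setTI; apply: (F_mono st); exact: Fbd_preimage bZ mB.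
Qed.

Lemma Fbd_indic t A : F t A -> Fbd t (\1_A).
Proof. by move=> FA; apply: bdmeas_indic. Qed.

Lemma Fbd_X (f : T -> R) s t : 0 <= s <= t -> Fbd t (fun w => f (X s w)).
Proof.
move=> st.
have -> : (fun w => f (X s w)) =
    (fun w => \sum_c f c * (\1_(X s @^-1` [set c]) : Om -> R) w).
  apply: funext => w; rewrite (bigD1 (X s w))//= indicE mem_set// mulr1.
  by rewrite big1 ?addr0// => c cX; rewrite indicE memNset ?mulr0// => /= E;
    rewrite E eqxx in cX.
by apply: bdmeas_sum => c; apply: bdmeasZ; apply: Fbd_indic; exact: F_X.
Qed.

Lemma ExB Y Z : bd Y -> bd Z -> Ex (fun w => Y w - Z w) = Ex Y - Ex Z.
Proof. by move=> bY bZ; apply: IntB P_fin _ _ _ _. Qed.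
Lemma ExD Y Z : bd Y -> bd Z -> Ex (fun w => Y w + Z w) = Ex Y + Ex Z.
Proof. by move=> bY bZ; apply: IntD P_fin _ _ _ _. Qed.
Lemma ExZ a Z : bd Z -> Ex (fun w => a * Z w) = a * Ex Z.
Proof. by move=> bZ; apply: IntZ P_fin _ _ _. Qed.
Lemma Ex_sum (J : Type) (s : seq J) (Q : pred J) (f : J -> Om -> R) :
  (forall j, bd (f j)) ->
  Ex (fun x => \sum_(j <- s | Q j) f j x) = \sum_(j <- s | Q j) Ex (f j).
Proof. by move=> bf; apply: Int_sum P_fin _ _ _ _ bf. Qed.
Lemma le_Ex Y Z : bd Y -> bd Z -> (forall w, Y w <= Z w) -> Ex Y <= Ex Z.
Proof. by move=> bY bZ YZ; apply: le_Int P_fin _ _ _ _ _. Qed.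
Lemma Ex_norm_le Z b : bd Z -> (forall w, `|Z w| <= b) -> `|Ex Z| <= b.
Proof.
move=> bZ Zb; have := @Int_norm_le _ _ R P setT measurableT P_fin Z b bZ (fun w _ => Zb w).
by rewrite [fine _](_ : _ = 1) ?mulr1//= probability_setT.
Qed.
Lemma Ex_norm Z : bd Z -> `|Ex Z| <= Ex (fun w => `|Z w|).
Proof. by move=> bZ; apply: Int_norm P_fin _ _. Qed.
Lemma Ex_cst a : Ex (fun=> a) = a.
Proof.
rewrite /Ex Rintegral_cst// [fine _](_ : _ = 1) ?mulr1//=.
by have -> := @probability_setT _ _ _ P.
Qed.
Lemma Ex_cvg (f_ : nat -> Om -> R) f b : (forall n, measurable_fun setT (f_ n)) ->
  (forall n x, `|f_ n x| <= b) -> (forall x, f_ ^~ x @ \oo --> f x) ->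
  bd f /\ (fun n => Ex (f_ n)) @ \oo --> Ex f.
Proof.
move=> mf fb ff; apply: (@Int_cvg _ Om R P setT measurableT P_fin f_ f b) => //.
Qed.

(* Layer-cake approximation of Z by indicators of F s. *)
Lemma Ex_ortho s Y Z : 0 <= s -> bd Y ->
  (forall B, F s B -> Rintegral P B Y = 0) -> Fbd s Z ->
  Ex (fun w => Z w * Y w) = 0.
Proof.
move=> s0 bY YB bZ.
have ind B : F s B -> Ex (fun w => (\1_B : Om -> R) w * Y w) = 0.
  move=> FB; rewrite -(YB B FB) [RHS]Rintegral_mkcond; apply: eq_Rintegral => w _.
  by rewrite patchE indicE; case: ifP => _; rewrite ?mul1r ?mul0r.
have unit (W : Om -> R) : Fbd s W -> (forall w, 0 <= W w <= 1) ->
    Ex (fun w => W w * Y w) = 0.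
  move=> bW W01; have [_ [b Yb]] := bY.
  have b0 : 0 <= b by apply: le_trans (Yb point Logic.I) => //; exact: normr_ge0.
  pose A n (k : 'I_n.+1) := W @^-1` `[k.+1%:R / n.+1%:R, +oo[.
  pose W_ n w : R := n.+1%:R^-1 * \sum_(k < n.+1) (\1_(A n k) : Om -> R) w.
  have FA n k : F s (A n k) by apply: Fbd_preimage bW _; exact: measurable_itv.
  have bW_ n : Fbd s (W_ n).
    by apply: bdmeasZ; apply: bdmeas_sum => k; exact: (Fbd_indic (FA n k)).
  have E0 n : Ex (fun w => W_ n w * Y w) = 0.
    rewrite (_ : (fun w => _) = (fun w => n.+1%:R^-1 *
       \sum_(k < n.+1) ((\1_(A n k) : Om -> R) w * Y w))); last first.
      by apply: funext => w; rewrite /W_ -mulrA mulr_suml.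
    have bA k : bd (fun w => (\1_(A n k) : Om -> R) w * Y w).
      by apply: bdmeasM bY; apply: (Fbd_bd s0); apply: Fbd_indic; exact: FA.
    rewrite ExZ ?Ex_sum ?big1 ?mulr0//; last exact: bdmeas_sum.
    by move=> k _; exact: (ind _ (FA n k)).
  have WW n w : `|W w - W_ n w| <= n.+1%:R^-1.
    have /andP[W0 W1] := W01 w.
    pose x := W w * n.+1%:R.
    have x0 : 0 <= x by rewrite mulr_ge0.
    have /andP[m1 m2] := truncn_itv x0; set m := Num.trunc x in m1 m2.
    have mn : (m <= n.+1)%N.
      by rewrite -(ler_nat R); apply: le_trans m1 _; rewrite ler_piMl.
    have -> : W_ n w = m%:R / n.+1%:R.
      rewrite /W_ mulrC; congr (_ / _).
      transitivity (\sum_(k < n.+1 | (k < m)%N) (1 : R)).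
        rewrite [RHS]big_mkcond; apply: eq_bigr => k _; rewrite indicE.
        have -> : (w \in A n k) = (k < m)%N; last by case: ifP.
        apply/idP/idP.
          rewrite inE /A/= in_itv/= andbT ler_pdivrMr// -/x => kx.
          by have := le_lt_trans kx m2; rewrite ltr_nat ltnS.
        move=> km; rewrite inE /A/= in_itv/= andbT ler_pdivrMr// -/x.
        by apply: le_trans m1; rewrite ler_nat.
      rewrite -(big_ord_widen_cond _ xpredT (fun=> (1 : R)))//.
      by rewrite sumr_const card_ord.
    have -> : W w - m%:R / n.+1%:R = (x - m%:R) / n.+1%:R.
      by rewrite /x mulrBl mulfK.
    rewrite normrM [`|_^-1|]ger0_norm// ler_piMl// ger0_norm ?subr_ge0//.
    by rewrite lerBlDl; move: m2; rewrite -natr1 => /ltW.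
  have H n : `|Ex (fun w => W w * Y w)| <= b * n.+1%:R^-1.
    have -> : Ex (fun w => W w * Y w) = Ex (fun w => (W w - W_ n w) * Y w).
      rewrite (_ : (fun w => (W w - W_ n w) * Y w) =
         (fun w => W w * Y w - W_ n w * Y w)).
        rewrite ExB ?E0 ?subr0//; apply: bdmeasM bY; exact: (Fbd_bd s0).
      by apply: funext => w; rewrite mulrBl.
    apply: Ex_norm_le.
      by apply: bdmeasM bY; exact: (Fbd_bd s0 (bdmeasB bW (bW_ n))).
    by move=> w; rewrite normrM mulrC ler_pM// Yb.
  apply/eqP; rewrite -normr_le0; apply/ler_addgt0Pl => e e0; rewrite addr0.
  have [n] : exists n, b * n.+1%:R^-1 < e.
    exists (Num.trunc (b / e)); rewrite ltr_pdivrMr// mulrC -ltr_pdivrMr//.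
    exact: truncnS_gt.
  by move=> /ltW; apply: le_trans.
have [_ [c Zc]] := bZ.
pose b := c + 1; have c0 : 0 <= c by apply: le_trans (Zc point Logic.I); exact: normr_ge0.
have b0 : 0 < b by rewrite ltr_wpDl.
pose W w := (2 * b)^-1 * (Z w + b).
have bW : Fbd s W by apply: bdmeasZ; apply: bdmeasD bZ _; exact: bdmeas_cst.
have -> : (fun w => Z w * Y w) = (fun w => 2 * b * (W w * Y w) - b * Y w).
  by apply: funext => w; rewrite /W; field; rewrite gt_eqF.
have bWY := bdmeasM (Fbd_bd s0 bW) bY.
rewrite ExB; [|exact: bdmeasZ|exact: bdmeasZ].
rewrite !ExZ// unit//; last first.
  move=> w; have := Zc w Logic.I; rewrite ler_norml => /andP[z1 z2].
  rewrite /W; apply/andP; split.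
    by rewrite mulr_ge0 ?invr_ge0 ?mulr_ge0 ?(ltW b0)// /b; lra.
  by rewrite mulrC ler_pdivrMr ?mulr_gt0// mul1r /b; lra.
have := YB setT; rewrite -/(Ex Y) => ->; first by rewrite !mulr0 subr0.
by have : measurable (setT : set (g_sigma_algebraType (G s))) by [].
Qed.

Lemma Xbd (f : T -> R) t : 0 <= t -> bd (fun w => f (X t w)).
Proof. by move=> t0; apply: (Fbd_bd t0); apply: Fbd_X; rewrite t0 lexx. Qed.

Lemma markovZ s h f Z : 0 <= s -> 0 <= h -> Fbd s Z ->
  Ex (fun w => Z w * (f (X (s + h) w) - Ph h f (X s w))) = 0.
Proof.
move=> s0 h0 bZ.
have b1 : bd (fun w => f (X (s + h) w)) by apply: Xbd; exact: addr_ge0.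
have b2 : bd (fun w => Ph h f (X s w)) by exact: Xbd.
apply: (Ex_ortho s0) bZ; first exact: (bdmeasB b1 b2).
move=> B FB; have mB := F_sub s0 FB.
have PB : (P B < +oo)%E by apply: (le_lt_trans (probability_le1 P mB)); rewrite ltry.
have sub Y : bd Y -> @bdmeas _ Om R B Y.
  move=> [mY [b Yb]]; split; last by exists b => x _; exact: Yb.
  exact: measurable_funTS.
rewrite (IntB mB PB (sub _ b1) (sub _ b2)).
by rewrite /Rintegral (markov f s0 h0 FB) subrr.
Qed.

(** By the Markov property f(X_(s+h)) may be replaced by Ph f(X_s) against anything known at time s,
    and the expansion of [Ph] applies pointwise. *)
Lemma step1 f : exists2 C, 0 <= C & forall s h Z b, 0 <= s -> 0 <= h <= 1 ->
  Fbd s Z -> (forall w, `|Z w| <= b) ->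
  `|Ex (fun w => Z w * (f (X (s + h) w) - f (X s w) - h * jump_gen f (X s w)))|
     <= b * C * h ^+ 2.
Proof.
have [C C0 HC] := PhE f; exists C => // s h Z b s0 h01 bZ Zb.
have /andP[h0 h1] := h01.
have bZ' := Fbd_bd s0 bZ.
have b1 : bd (fun w => f (X (s + h) w)) by apply: Xbd; exact: addr_ge0.
have b2 : bd (fun w => Ph h f (X s w)) by exact: Xbd.
have b3 : bd (fun w => f (X s w)) by exact: Xbd.
have b4 : bd (fun w => h * jump_gen f (X s w)).
  by apply: bdmeasZ; exact: Xbd.
have -> : Ex (fun w => Z w * (f (X (s + h) w) - f (X s w) - h * jump_gen f (X s w))) =
   Ex (fun w => Z w * (Ph h f (X s w) - f (X s w) - h * jump_gen f (X s w))).
  rewrite -[RHS]add0r -{1}(markovZ f s0 h0 bZ) -ExD.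
  - by congr Ex; apply: funext => w; ring.
  - exact: bdmeasM bZ' (bdmeasB b1 b2).
  - exact: bdmeasM bZ' (bdmeasB (bdmeasB b2 b3) b4).
apply: Ex_norm_le; first exact: bdmeasM bZ' (bdmeasB (bdmeasB b2 b3) b4).
move=> w; rewrite normrM -mulrA; apply: ler_pM => //; exact: HC.
Qed.

Definition jump_mean (phi : T -> T -> R) x := \sum_i r x i * phi x (jump x i).

(** A function of the two states is reduced to [step1] by splitting over the finitely many values x
    of X_s, whose indicators are known at time s. *)
Lemma step2 (phi : T -> T -> R) : (forall x, phi x x = 0) ->
  exists2 C, 0 <= C & forall s h Z b, 0 <= s -> 0 <= h <= 1 ->
  Fbd s Z -> (forall w, `|Z w| <= b) ->
  `|Ex (fun w => Z w * (phi (X s w) (X (s + h) w) - h * jump_mean phi (X s w)))|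
     <= b * C * h ^+ 2.
Proof.
move=> phi0.
have /choice[C HC] : forall x, exists C, 0 <= C /\ forall s h Z b, 0 <= s -> 0 <= h <= 1 ->
  Fbd s Z -> (forall w, `|Z w| <= b) ->
  `|Ex (fun w => Z w * (phi x (X (s + h) w) - phi x (X s w) - h * jump_gen (phi x) (X s w)))|
     <= b * C * h ^+ 2.
  by move=> x; have [C C0 HC] := step1 (phi x); exists C.
exists (\sum_x C x); first by apply: sumr_ge0 => x _; case: (HC x).
move=> s h Z b s0 h01 bZ Zb; have /andP[h0 h1] := h01.
pose Zx x w := Z w * (\1_(X s @^-1` [set x]) : Om -> R) w.
have bZx x : Fbd s (Zx x).
  by apply: bdmeasM bZ _; apply: Fbd_indic; apply: F_X; rewrite s0 lexx.
have Zxb x w : `|Zx x w| <= b.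
  rewrite normrM; apply: le_trans (Zb w); rewrite ler_piMr// indicE.
  by case: (_ \in _); rewrite ?normr1 ?normr0.
pose Y x w := Zx x w * (phi x (X (s + h) w) - phi x (X s w) - h * jump_gen (phi x) (X s w)).
have bY x : bd (Y x).
  apply: bdmeasM; first exact: (Fbd_bd s0).
  apply: bdmeasB; first by apply: bdmeasB; [apply: (@Xbd (phi x)); exact: addr_ge0|exact: (@Xbd (phi x))].
  by apply: bdmeasZ; exact: Xbd.
have -> : Ex (fun w => Z w * (phi (X s w) (X (s + h) w) - h * jump_mean phi (X s w))) =
   \sum_x Ex (Y x).
  rewrite -Ex_sum//; congr Ex; apply: funext => w.
  rewrite (bigD1 (X s w))//= big1 ?addr0.
    rewrite /Y /Zx indicE mem_set// mulr1 phi0 subr0; congr (_ * (_ - h * _)).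
    by apply: eq_bigr => i _; rewrite phi0 subr0.
  by move=> x xX; rewrite /Y /Zx indicE memNset ?mulr0 ?mul0r// => /= E; rewrite E eqxx in xX.
apply: le_trans (ler_norm_sum _ _ _) _; rewrite mulr_sumr mulr_suml.
by apply: ler_sum => x _; have [_] := HC x; apply.
Qed.

Definition pint (f : T -> R) (s t : R) w := Rintegral leb `[s, t] (fun u => f (X u w)).

Lemma pint_rsum (f : T -> R) (s t : R) w : 0 <= s <= t ->
  bdmeas (`[s, t] : set R) (fun u => f (X u w)) /\
  rsum (fun u => f (X u w)) s t @ \oo --> pint f s t w.
Proof.
move=> /andP[s0 st]; apply: (@riemann_right _ _ (fmax f)) => //.
  by move=> u; exact: fmaxP.
move=> u /andP[su ut]; have := X_right w (le_trans s0 su).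
by apply: filterS => v ->.
Qed.

Lemma rsum_norm (g : R -> R) b s t n : s <= t -> (forall u, `|g u| <= b) ->
  `|rsum g s t n| <= b * (t - s).
Proof.
move=> st gb; rewrite /rsum normrM ger0_norm ?divr_ge0 ?subr_ge0//.
apply: (@le_trans _ _ ((t - s) / n.+1%:R * (b *+ n.+1))).
  rewrite ler_wpM2l ?divr_ge0 ?subr_ge0//; apply: le_trans (ler_norm_sum _ _ _) _.
  have -> : b *+ n.+1 = \sum_(k < n.+1) b by rewrite sumr_const card_ord.
  exact: ler_sum.
rewrite -(mulr_natr b) le_eqVlt; apply/orP; left; apply/eqP.
by field; rewrite addrC natr1 pnatr_eq0.
Qed.

Lemma lim_norm_le (a_ : nat -> R) (a b : R) : a_ @ \oo --> a ->
  (forall n, `|a_ n| <= b) -> `|a| <= b.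
Proof.
move=> /(@cvg_norm _ R^o) ca ab; rewrite -(cvg_lim _ ca)//.
by apply: limr_le; [apply/cvg_ex; eexists; exact: ca|exact: nearW].
Qed.

Lemma pint_norm f s t w : 0 <= s <= t -> `|pint f s t w| <= fmax f * (t - s).
Proof.
move=> st; have [_ c] := pint_rsum f w st; apply: (lim_norm_le c) => n.
by case/andP: st => _ st; apply: rsum_norm => // u; exact: fmaxP.
Qed.

Lemma rsum_itv (s t : R) n k : 0 <= s <= t -> (k <= n.+1)%N ->
  0 <= s + k%:R * ((t - s) / n.+1%:R) <= t.
Proof.
move=> /andP[s0 st] kn; rewrite addr_ge0 ?mulr_ge0 ?divr_ge0 ?subr_ge0//=.
rewrite -lerBrDl mulrCA ler_piMr ?subr_ge0// ler_pdivrMr// mul1r ler_nat//.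
Qed.

Lemma Fbd_rsum f s t n : 0 <= s <= t -> Fbd t (fun w => rsum (fun u => f (X u w)) s t n).
Proof.
move=> st; apply: bdmeasZ; apply: bdmeas_sum => k; apply: Fbd_X.
exact: rsum_itv.
Qed.

Lemma Fbd_pint f s t : 0 <= s <= t -> Fbd t (pint f s t).
Proof.
move=> st; split; last by exists (fmax f * (t - s)) => w _; exact: pint_norm.
apply: (@measurable_fun_cvg _ (g_sigma_algebraType (G t)) R setT
  (fun n w => rsum (fun u => f (X u w)) s t n)).
  by move=> n; case: (Fbd_rsum f n st).
by move=> w _; case: (pint_rsum f w st).
Qed.

Lemma pintD f a s t w : 0 <= a <= s -> s <= t ->
  pint f a t w = pint f a s w + pint f s t w.
Proof.
move=> /andP[a0 as_] st.
have at_ : 0 <= a <= t by rewrite a0 (le_trans as_).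
have ss : 0 <= s <= t by rewrite (le_trans a0).
have [bat _] := pint_rsum f w at_; have [bst _] := pint_rsum f w ss.
apply/eqP; rewrite addrC -subr_eq; apply/eqP.
rewrite /pint (@Rintegral_itvB _ _ (BLeft a) (BRight t) s).
- rewrite Rintegral_itv_obnd_cbnd//.
  apply: (@integrableS _ _ _ leb `[s, t]%classic) => //; first exact: subset_itv_oc_cc.
  by apply: (bdmeas_integrable _ (itvc_fin s t)).
- by apply: (bdmeas_integrable _ (itvc_fin a t)).
- by rewrite bnd_simp.
- by rewrite bnd_simp.
Qed.

Definition mart (f : T -> R) t w := f (X t w) - f (X 0 w) - pint (jump_gen f) 0 t w.

Lemma Fbd_mart f t : 0 <= t -> Fbd t (mart f t).
Proof.
move=> t0; apply: bdmeasB; last by apply: Fbd_pint; rewrite lexx.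
by apply: bdmeasB; apply: Fbd_X; rewrite ?lexx ?t0.
Qed.

Lemma martB f s t w : 0 <= s <= t -> mart f t w - mart f s w =
  f (X t w) - f (X s w) - pint (jump_gen f) s t w.
Proof.
by move=> /andP[s0 st]; rewrite /mart (@pintD _ 0 s t) ?lexx//; ring.
Qed.

Lemma lim_le_harmonic (a_ : nat -> R) (a e c : R) (m : nat) : a_ @ \oo --> a ->
  (forall n, (m <= n)%N -> `|a_ n| <= e + c * n.+1%:R^-1) -> `|a| <= e.
Proof.
move=> /(@cvg_norm _ R^o) ca H.
have cb : (fun n => e + c * (n.+1%:R^-1 : R)) @ \oo --> e.
  rewrite -[X in _ --> X]addr0 -(mulr0 c); apply: cvgD; first exact: cvg_cst.
  by apply: cvgM; [exact: cvg_cst|exact: cvg_harmonic].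
rewrite -(cvg_lim _ ca)// -(cvg_lim _ cb)//.
apply: ler_lim; [by apply/cvg_ex; eexists; exact: ca|by apply/cvg_ex; eexists; exact: cb|].
by exists m => // n /= mn; exact: H.
Qed.

Lemma grid_step (s t : R) n : s <= t -> (Num.trunc (t - s) <= n)%N ->
  0 <= (t - s) / n.+1%:R <= 1.
Proof.
move=> st tn; rewrite divr_ge0 ?subr_ge0//= ler_pdivrMr// mul1r.
by apply: le_trans (ltW (truncnS_gt _)) _; rewrite ler_nat.
Qed.

Section Grid.
Variables (s t : R) (n : nat).
Hypotheses (s0 : 0 <= s) (st : s <= t).
Let h := (t - s) / n.+1%:R.
Definition gridpt k : R := s + k%:R * ((t - s) / n.+1%:R).
Local Notation u := gridpt.

Lemma gridptS k : u k.+1 = u k + h.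
Proof. by rewrite /u -natr1 /h; ring. Qed.
Lemma gridpt0 : u 0 = s. Proof. by rewrite /u mul0r addr0. Qed.
Lemma gridptn : u n.+1 = t.
Proof. by rewrite /u mulrC divfK ?subrKC// pnatr_eq0. Qed.
Lemma gridpt_ge k : s <= u k.
Proof. by rewrite lerDl mulr_ge0 ?divr_ge0 ?subr_ge0. Qed.
Lemma gridpt_ge0 k : 0 <= u k. Proof. exact: le_trans (gridpt_ge k). Qed.
Lemma gridpt_itv k : 0 <= s <= u k. Proof. by rewrite s0 gridpt_ge. Qed.
Lemma gridpt_mono k : 0 <= u k <= u k.+1.
Proof. by rewrite gridpt_ge0 gridptS lerDl divr_ge0 ?subr_ge0. Qed.
Lemma gridpt_le k : (k <= n.+1)%N -> u k <= t.
Proof.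
have st0 : 0 <= s <= t by rewrite s0.
by move=> /(rsum_itv st0)/andP[].
Qed.

Lemma telescope (g : R -> R) : g t - g s = \sum_(k < n.+1) (g (u k.+1) - g (u k)).
Proof.
rewrite -(big_mkord xpredT (fun k => g (u k.+1) - g (u k))).
by rewrite telescope_sumr// gridptn gridpt0.
Qed.

(** Riemann sums use right ends because paths are right-continuous, whereas conditioning needs left
    ends; the difference is a boundary term of the size of one step. *)
Lemma rsum_left (g : R -> R) :
  rsum g s t n = \sum_(k < n.+1) h * g (u k) + h * (g t - g s).
Proof.
rewrite telescope mulr_sumr -big_split/= /rsum mulr_sumr.
by apply: eq_bigr => k _; rewrite -/h mulrBr subrKC.
Qed.

End Grid.

(** Each grid step contributes an error of order h^2, so their sum and the boundary term are both of
    order 1 / n, while the Riemann sums converge to the compensator. *)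
Lemma dynkin f s t Z : 0 <= s <= t -> Fbd s Z ->
  Ex (fun w => Z w * (mart f t w - mart f s w)) = 0.
Proof.
move=> st bZ; have /andP[s0 s_t] := st; have t0 := le_trans s0 s_t.
have [_ [b Zb]] := bZ; have {}Zb w : `|Z w| <= b by exact: Zb.
have b0 : 0 <= b by apply: le_trans (Zb point); exact: normr_ge0.
have bZ' := Fbd_bd s0 bZ.
pose D w := f (X t w) - f (X s w).
have bD : bd D by apply: bdmeasB; exact: Xbd.
pose a n := Ex (fun w => Z w * (D w - rsum (fun u => jump_gen f (X u w)) s t n)).
have bn n : bd (fun w => Z w * (D w - rsum (fun u => jump_gen f (X u w)) s t n)).
  by apply: bdmeasM bZ' _; apply: bdmeasB bD _; apply: (Fbd_bd t0); exact: Fbd_rsum.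
have ca : a @ \oo --> Ex (fun w => Z w * (mart f t w - mart f s w)).
  apply: (proj2 (@Ex_cvg _ _ (b * (2 * fmax f + fmax (jump_gen f) * (t - s))) _ _ _)).
  - by move=> n; case: (bn n).
  - move=> n w; rewrite normrM ler_pM//; apply: le_trans (ler_normB _ _) _.
    apply: lerD; last by apply: rsum_norm => // u; exact: fmaxP.
    by apply: le_trans (ler_normB _ _) _; rewrite mulr2n mulrDl mul1r lerD ?fmaxP.
  - move=> x; rewrite martB//; apply: cvgM; first exact: cvg_cst.
    by apply: cvgB; [exact: cvg_cst|case: (pint_rsum (jump_gen f) x st)].
have [C C0 HC] := step1 f.
apply/eqP; rewrite -normr_le0.
apply: (lim_le_harmonic (m := Num.trunc (t - s))
  (c := b * C * (t - s) ^+ 2 + b * (2 * fmax (jump_gen f)) * (t - s)) ca) => n tn.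
have h01 := grid_step s_t tn; set h := (t - s) / n.+1%:R in h01.
have /andP[h0 h1] := h01.
pose u := gridpt s t n.
pose Y k w := Z w * (f (X (u k + h) w) - f (X (u k) w) - h * jump_gen f (X (u k) w)).
pose W w := Z w * (jump_gen f (X t w) - jump_gen f (X s w)).
have u0 k : 0 <= u k by exact: gridpt_ge0.
have bY k : bd (Y k).
  apply: bdmeasM bZ' _; apply: bdmeasB; last by apply: bdmeasZ; exact: Xbd.
  by apply: bdmeasB; apply: Xbd => //; exact: addr_ge0.
have bW : bd W by apply: bdmeasM bZ' _; apply: bdmeasB; exact: Xbd.
have -> : a n = \sum_(k < n.+1) Ex (Y k) - h * Ex W.
  rewrite /a -Ex_sum// -ExZ// -ExB; [|exact: bdmeas_sum|exact: bdmeasZ].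
  congr Ex; apply: funext => w; rewrite /D.
  rewrite rsum_left (@telescope s t n (fun v => f (X v w))) /W /Y.
  rewrite opprD addrA -sumrB mulrDr mulrN mulrCA mulr_sumr; congr (_ - _).
  by apply: eq_bigr => k _; rewrite -/u {1}/u gridptS.
rewrite add0r; apply: le_trans (ler_normB _ _) _.
have hE : h = (t - s) * n.+1%:R^-1 by [].
rewrite mulrDl; apply: lerD.
  apply: le_trans (ler_norm_sum _ _ _) _.
  apply: (@le_trans _ _ (\sum_(k < n.+1) b * C * h ^+ 2)).
    apply: ler_sum => k _; apply: HC => //.
    by apply: Fbd_mono bZ; exact: gridpt_itv.
  rewrite sumr_const card_ord -(mulr_natr (b * C * h ^+ 2)) hE.
  rewrite le_eqVlt; apply/orP; left; apply/eqP; field; by rewrite addrC natr1 pnatr_eq0.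
rewrite -(mulrA _ (t - s)) -hE normrM (ger0_norm h0) mulrC; apply: ler_wpM2r => //.
apply: Ex_norm_le => // w; rewrite normrM ler_pM//.
by apply: le_trans (ler_normB _ _) _; rewrite mulr2n mulrDl mul1r lerD ?fmaxP.
Qed.

(** An increment has L1 size h; this makes increment times compensator of order h^2 in
    [cov_step]. *)
Lemma abs_step (g : T -> R) : exists2 C : R, 0 <= C & forall s h : R, 0 <= s -> 0 <= h <= 1 ->
  Ex (fun w => `|g (X (s + h) w) - g (X s w)|) <= C * h.
Proof.
pose phi x y := `|g y - g x|.
have [C C0 HC] := @step2 phi (fun x => ltac:(by rewrite /phi subrr normr0)).
exists (fmax (jump_mean phi) + C); first by rewrite addr_ge0 ?fmax_ge0.
move=> s h s0 h01; have /andP[h0 h1] := h01; have sh0 : 0 <= s + h by exact: addr_ge0.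
have b1 : bd (fun w => phi (X s w) (X (s + h) w)).
  by apply: bdmeas_norm; apply: bdmeasB; exact: Xbd.
have b2 : bd (fun w => h * jump_mean phi (X s w)) by apply: bdmeasZ; exact: Xbd.
have := HC s h (fun=> 1) 1 s0 h01 (bdmeas_cst _ 1) (fun=> ltac:(by rewrite normr1)).
have -> : Ex (fun w => 1 * (phi (X s w) (X (s + h) w) - h * jump_mean phi (X s w))) =
   Ex (fun w => phi (X s w) (X (s + h) w)) - Ex (fun w => h * jump_mean phi (X s w)).
  by rewrite -ExB//; congr Ex; apply: funext => w; rewrite mul1r.
have : `|Ex (fun w => h * jump_mean phi (X s w))| <= h * fmax (jump_mean phi).
  by apply: Ex_norm_le => // w; rewrite normrM (ger0_norm h0) ler_wpM2l// fmaxP.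
rewrite /phi mul1r !ler_norml => /andP[_ A] /andP[_ B].
have : C * h ^+ 2 <= C * h by rewrite ler_wpM2l// expr2 ler_piMl.
by move: A B; move: (Ex _) (Ex _) => a b; lra.
Qed.

Definition carre (f g : T -> R) x :=
  \sum_i r x i * ((f (jump x i) - f x) * (g (jump x i) - g x)).

Definition dmart f s t w := mart f t w - mart f s w.

Lemma dmart_bd f s t : 0 <= s -> 0 <= t -> bd (dmart f s t).
Proof.
move=> s0 t0; apply: bdmeasB.
  by apply: (Fbd_bd t0); exact: Fbd_mart.
by apply: (Fbd_bd s0); exact: Fbd_mart.
Qed.

Lemma Fbd_dmart f s t : 0 <= s <= t -> Fbd t (dmart f s t).
Proof.
move=> st; have /andP[s0 s_t] := st; apply: bdmeasB; first exact/Fbd_mart/(le_trans s0).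
by apply: (Fbd_mono st); exact: Fbd_mart.
Qed.

Lemma pint_bd f s t : 0 <= s <= t -> bd (pint f s t).
Proof.
move=> st; have /andP[s0 s_t] := st.
by apply: (Fbd_bd (le_trans s0 s_t)); exact: Fbd_pint.
Qed.

(** The product of two martingale increments has four terms: jump times jump, which gives the carre
    du champ by [step2], and three terms containing a compensator, all of order h^2. *)
Lemma cov_step f g : exists2 C : R, 0 <= C & forall (s h : R) Z (b : R), 0 <= s -> 0 <= h <= 1 ->
  Fbd s Z -> (forall w, `|Z w| <= b) ->
  `|Ex (fun w => Z w * (dmart f s (s + h) w * dmart g s (s + h) w - h * carre f g (X s w)))|
     <= b * C * h ^+ 2.
Proof.
pose phi x y := (f y - f x) * (g y - g x).
have [C C0 HC] := @step2 phi (fun x => ltac:(by rewrite /phi !subrr mul0r)).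
have [Cf Cf0 HCf] := abs_step f; have [Cg Cg0 HCg] := abs_step g.
pose lf := fmax (jump_gen f); pose lg := fmax (jump_gen g).
have lf0 : 0 <= lf by exact: fmax_ge0. have lg0 : 0 <= lg by exact: fmax_ge0.
exists (C + lf * Cg + lg * Cf + lf * lg).
  by apply: addr_ge0; [apply: addr_ge0; [apply: addr_ge0|]|]; rewrite ?mulr_ge0.
move=> s h Z b s0 h01 bZ Zb; have /andP[h0 h1] := h01.
have sh0 : 0 <= s + h by exact: addr_ge0.
have sh : 0 <= s <= s + h by rewrite s0 lerDl.
have b0 : 0 <= b by apply: le_trans (Zb point); exact: normr_ge0.
have bZ' := Fbd_bd s0 bZ.
pose df w := f (X (s + h) w) - f (X s w); pose dg w := g (X (s + h) w) - g (X s w).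
pose If := pint (jump_gen f) s (s + h); pose Ig := pint (jump_gen g) s (s + h).
have bdf : bd df by apply: bdmeasB; exact: Xbd.
have bdg : bd dg by apply: bdmeasB; exact: Xbd.
have bIf : bd If by exact: pint_bd. have bIg : bd Ig by exact: pint_bd.
have Ifh w : `|If w| <= lf * h.
  by have := pint_norm (jump_gen f) w sh; rewrite addrAC subrr add0r.
have Igh w : `|Ig w| <= lg * h.
  by have := pint_norm (jump_gen g) w sh; rewrite addrAC subrr add0r.
have bca : bd (fun w => h * carre f g (X s w)) by apply: bdmeasZ; exact: Xbd.
pose A w := Z w * (phi (X s w) (X (s + h) w) - h * jump_mean phi (X s w)).
pose B w := Z w * (If w * dg w). pose D w := Z w * (Ig w * df w).
pose E' w := Z w * (If w * Ig w).
have bA : bd A.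
  by apply: bdmeasM bZ' _; apply: bdmeasB; [exact: (bdmeasM bdf bdg)|exact: bca].
have bB : bd B by apply: bdmeasM bZ' _; exact: bdmeasM.
have bD : bd D by apply: bdmeasM bZ' _; exact: bdmeasM.
have bE : bd E' by apply: bdmeasM bZ' _; exact: bdmeasM.
have -> : Ex (fun w => Z w * (dmart f s (s + h) w * dmart g s (s + h) w -
    h * carre f g (X s w))) = Ex A - Ex B - Ex D + Ex E'.
  rewrite -ExB// -ExB//; last exact: bdmeasB.
  rewrite -ExD//; last by apply: bdmeasB bD; exact: bdmeasB.
  congr Ex; apply: funext => w; rewrite /dmart !martB//.
  by rewrite /A /B /D /E' /phi /df /dg /If /Ig /jump_mean -/(carre f g (X s w)); ring.
have HA : `|Ex A| <= b * C * h ^+ 2 by exact: HC.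
have bound Y l dk Ck : bd Y -> bd dk -> 0 <= l -> (forall w, `|Y w| <= l * h) ->
    Ex (fun w => `|dk w|) <= Ck * h ->
    `|Ex (fun w => Z w * (Y w * dk w))| <= b * (l * Ck) * h ^+ 2.
  move=> bY bdk l0 Yl dkC.
  apply: le_trans (Ex_norm _) _; first by apply: bdmeasM bZ' _; exact: bdmeasM.
  apply: (@le_trans _ _ (Ex (fun w => b * (l * h) * `|dk w|))).
    apply: le_Ex.
    - by apply: bdmeas_norm; apply: bdmeasM bZ' _; exact: bdmeasM.
    - by apply: bdmeasZ; exact: bdmeas_norm.
    - by move=> w; rewrite !normrM mulrA ler_wpM2r// ler_pM.
  rewrite ExZ; last exact: bdmeas_norm.
  have -> : b * (l * Ck) * h ^+ 2 = b * (l * h) * (Ck * h) by ring.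
  by rewrite ler_wpM2l ?mulr_ge0.
have HB : `|Ex B| <= b * (lf * Cg) * h ^+ 2 by apply: bound => //; exact: HCg.
have HD : `|Ex D| <= b * (lg * Cf) * h ^+ 2 by apply: bound => //; exact: HCf.
have HE : `|Ex E'| <= b * (lf * lg) * h ^+ 2.
  apply: Ex_norm_le => // w; rewrite normrM.
  have -> : b * (lf * lg) * h ^+ 2 = b * ((lf * h) * (lg * h)) by ring.
  by apply: ler_pM => //; rewrite normrM; apply: ler_pM.
have -> : b * (C + lf * Cg + lg * Cf + lf * lg) * h ^+ 2 = b * C * h ^+ 2 +
  b * (lf * Cg) * h ^+ 2 + b * (lg * Cf) * h ^+ 2 + b * (lf * lg) * h ^+ 2 by ring.
apply: le_trans (ler_normD _ _) _; apply: lerD HE.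
apply: le_trans (ler_normB _ _) _; apply: lerD HD.
by apply: le_trans (ler_normB _ _) _; apply: lerD.
Qed.

(** The product of the martingales is telescoped on a grid; by [dynkin] the cross terms between past
    values and new increments have zero expectation, and only products of increments remain. *)
Lemma cov_mart f g s t Z : 0 <= s <= t -> Fbd s Z ->
  Ex (fun w => Z w * (mart f t w * mart g t w - mart f s w * mart g s w -
    pint (carre f g) s t w)) = 0.
Proof.
move=> st bZ; have /andP[s0 s_t] := st; have t0 := le_trans s0 s_t.
have [_ [b Zb]] := bZ; have {}Zb w : `|Z w| <= b by exact: Zb.
have b0 : 0 <= b by apply: le_trans (Zb point); exact: normr_ge0.
have bZ' := Fbd_bd s0 bZ.
have bM (k : T -> R) u : 0 <= u -> bd (mart k u).
  by move=> u0; apply: (Fbd_bd u0); exact: Fbd_mart.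
pose D w := mart f t w * mart g t w - mart f s w * mart g s w.
have bD : bd D by apply: bdmeasB; apply: bdmeasM; exact: bM.
pose Gm := carre f g.
pose a n := Ex (fun w => Z w * (D w - rsum (fun u => Gm (X u w)) s t n)).
have brs n : bd (fun w => rsum (fun u => Gm (X u w)) s t n).
  by apply: (Fbd_bd t0); exact: Fbd_rsum.
have bn n : bd (fun w => Z w * (D w - rsum (fun u => Gm (X u w)) s t n)).
  by apply: bdmeasM bZ' _; exact: bdmeasB.
have [_ [bd' Db]] := bD; have {}Db w : `|D w| <= bd' by exact: Db.
have ca : a @ \oo --> Ex (fun w => Z w * (D w - pint Gm s t w)).
  apply: (proj2 (@Ex_cvg _ _ (b * (bd' + fmax Gm * (t - s))) _ _ _)).
  - by move=> n; case: (bn n).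
  - move=> n w; rewrite normrM ler_pM//; apply: le_trans (ler_normB _ _) _.
    by apply: lerD => //; apply: rsum_norm => // u; exact: fmaxP.
  - move=> x; apply: cvgM; first exact: cvg_cst.
    by apply: cvgB; [exact: cvg_cst|case: (pint_rsum Gm x st)].
have [C C0 HC] := cov_step f g.
apply/eqP; rewrite -normr_le0.
apply: (lim_le_harmonic (m := Num.trunc (t - s))
  (c := b * C * (t - s) ^+ 2 + b * (2 * fmax Gm) * (t - s)) ca) => n tn.
have h01 := grid_step s_t tn; set h := (t - s) / n.+1%:R in h01.
have /andP[h0 h1] := h01.
pose u := gridpt s t n.
have uS k : u k.+1 = u k + h by exact: gridptS.
have u0 k : 0 <= u k by exact: gridpt_ge0.
have um k : 0 <= u k <= u k.+1 by exact: gridpt_mono.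
have bZu k : Fbd (u k) Z by apply: Fbd_mono bZ; exact: gridpt_itv.
pose Y k w := Z w * (dmart f (u k) (u k + h) w * dmart g (u k) (u k + h) w - h * Gm (X (u k) w)).
pose Y1 k w := Z w * mart f (u k) w * dmart g (u k) (u k.+1) w.
pose Y2 k w := Z w * mart g (u k) w * dmart f (u k) (u k.+1) w.
pose W w := Z w * (Gm (X t w) - Gm (X s w)).
have bY k : bd (Y k).
  apply: bdmeasM bZ' _; apply: bdmeasB; last by apply: bdmeasZ; exact: Xbd.
  by apply: bdmeasM; apply: dmart_bd => //; exact: addr_ge0.
have bY1 k : bd (Y1 k).
  by apply: bdmeasM; [apply: bdmeasM bZ' _; exact: bM|exact: dmart_bd].
have bY2 k : bd (Y2 k).
  by apply: bdmeasM; [apply: bdmeasM bZ' _; exact: bM|exact: dmart_bd].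
have bW : bd W by apply: bdmeasM bZ' _; apply: bdmeasB; exact: Xbd.
have E1 k : Ex (Y1 k) = 0.
  by apply: dynkin => //; apply: bdmeasM (bZu k) _; exact: Fbd_mart.
have E2 k : Ex (Y2 k) = 0.
  by apply: dynkin => //; apply: bdmeasM (bZu k) _; exact: Fbd_mart.
have -> : a n = \sum_(k < n.+1) Ex (Y k) - h * Ex W.
  transitivity (\sum_(k < n.+1) (Ex (Y1 k) + Ex (Y2 k) + Ex (Y k)) - h * Ex W); last first.
    by congr (_ - _); apply: eq_bigr => k _; rewrite E1 E2 !add0r.
  have EY k : Ex (Y1 k) + Ex (Y2 k) + Ex (Y k) = Ex (fun w => Y1 k w + Y2 k w + Y k w).
    by rewrite ExD ?ExD//; exact: bdmeasD.
  rewrite /a; under eq_bigr do rewrite EY.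
  rewrite -Ex_sum; last by move=> k; apply: bdmeasD (bY k); exact: bdmeasD.
  rewrite -ExZ// -ExB; last 2 first.
  - by apply: bdmeas_sum => k; apply: bdmeasD (bY k); exact: bdmeasD.
  - exact: bdmeasZ.
  congr Ex; apply: funext => w; rewrite /D rsum_left.
  rewrite (@telescope s t n (fun v => mart f v w * mart g v w)) /W.
  rewrite opprD addrA -sumrB mulrDr mulrN mulrCA mulr_sumr; congr (_ - _).
  by apply: eq_bigr => k _; rewrite /Y1 /Y2 /Y /dmart -/h -/(u _) -/(u _) !uS; ring.
rewrite add0r; apply: le_trans (ler_normB _ _) _.
have hE : h = (t - s) * n.+1%:R^-1 by [].
rewrite mulrDl; apply: lerD.
  apply: le_trans (ler_norm_sum _ _ _) _.
  apply: (@le_trans _ _ (\sum_(k < n.+1) b * C * h ^+ 2)).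
    by apply: ler_sum => k _; apply: HC.
  rewrite sumr_const card_ord -(mulr_natr (b * C * h ^+ 2)) hE.
  rewrite le_eqVlt; apply/orP; left; apply/eqP; field; by rewrite addrC natr1 pnatr_eq0.
rewrite -(mulrA _ (t - s)) -hE normrM (ger0_norm h0) mulrC; apply: ler_wpM2r => //.
apply: Ex_norm_le => // w; rewrite normrM ler_pM//.
by apply: le_trans (ler_normB _ _) _; rewrite mulr2n mulrDl mul1r lerD ?fmaxP.
Qed.

Lemma var_mart f s t Z : 0 <= s <= t -> Fbd s Z ->
  Ex (fun w => Z w * dmart f s t w ^+ 2) = Ex (fun w => Z w * pint (carre f f) s t w).
Proof.
move=> st bZ; have /andP[s0 s_t] := st; have t0 := le_trans s0 s_t.
have bZ' := Fbd_bd s0 bZ.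
have bs : bd (mart f s) by apply: (Fbd_bd s0); exact: Fbd_mart.
have bt : bd (mart f t) by apply: (Fbd_bd t0); exact: Fbd_mart.
have bp : bd (pint (carre f f) s t) by exact: pint_bd.
have Fs : Fbd s (mart f s) by exact: Fbd_mart.
apply/eqP; rewrite -subr_eq0 -ExB.
- rewrite -(cov_mart f f st bZ) -[X in _ == X]addr0.
  rewrite -[X in _ == _ + X](mulr0 (-2)) -(dynkin f st (bdmeasM bZ Fs)) -ExZ.
    rewrite -ExD; first by apply/eqP; congr Ex; apply: funext => w; rewrite /dmart; ring.
      by apply: bdmeasM bZ' (bdmeasB (bdmeasB (bdmeasM bt bt) (bdmeasM bs bs)) bp).
    exact: bdmeasZ (bdmeasM (bdmeasM bZ' bs) (bdmeasB bt bs)).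
  exact: bdmeasM (bdmeasM bZ' bs) (bdmeasB bt bs).
- by apply: bdmeasM bZ' _; apply: bdmeasX; exact: dmart_bd.
- exact: bdmeasM.
Qed.

Lemma pint_le (g : T -> R) (a s t : R) w : (forall x, `|g x| <= a) -> 0 <= s <= t ->
  `|pint g s t w| <= a * (t - s).
Proof.
move=> ga st; have [_ c] := pint_rsum g w st; apply: (lim_norm_le c) => n.
by case/andP: st => _ st; apply: rsum_norm.
Qed.

Lemma Ex_ge0 Z : (forall w, 0 <= Z w) -> 0 <= Ex Z.
Proof. by move=> Z0; apply: Rintegral_ge0. Qed.

Variables (f : T -> R) (Dj Gm : R).
Hypothesis Dj_ge0 : 0 <= Dj.
Hypothesis jump_le : forall x i, `|f (jump x i) - f x| <= Dj.
Hypothesis carre_le : forall x, carre f f x <= Gm.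

Lemma carre_ge0 x : 0 <= carre f f x.
Proof. by apply: sumr_ge0 => i _; rewrite mulr_ge0// -expr2 sqr_ge0. Qed.

Lemma Gm_ge0 : 0 <= Gm. Proof. exact: le_trans (carre_ge0 (X 0 point)) (carre_le _). Qed.

Lemma norm_carre_le x : `|carre f f x| <= Gm.
Proof. by rewrite ger0_norm ?carre_ge0. Qed.

(** Of the p + 2 powers of a jump, p are bounded by [Dj] and the last two yield the carre du champ.
    The compensator contributes to order h^2 only; the factor 2^(p+2) separates it from the jump. *)
Lemma abs_moment_step p : exists2 C : R, 0 <= C &
  forall (s h : R) Z (b : R), 0 <= s -> 0 <= h <= 1 -> Fbd s Z ->
  (forall w, 0 <= Z w <= b) ->
  Ex (fun w => Z w * `|dmart f s (s + h) w| ^+ p.+2) <=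
    2 ^+ p.+2 * Dj ^+ p * Gm * h * Ex Z + b * C * h ^+ 2.
Proof.
pose phi x y := `|f y - f x| ^+ p.+2.
have [C C0 HC] := @step2 phi (fun x => ltac:(by rewrite /phi subrr normr0 expr0n)).
pose lf := fmax (jump_gen f); have lf0 : 0 <= lf by exact: fmax_ge0.
exists (2 ^+ p.+2 * (C + lf ^+ p.+2)); first by rewrite mulr_ge0 ?addr_ge0 ?exprn_ge0.
move=> s h Z b s0 h01 bZ Zb; have /andP[h0 h1] := h01.
have sh0 : 0 <= s + h by exact: addr_ge0.
have sh : 0 <= s <= s + h by rewrite s0 lerDl.
have bZ' := Fbd_bd s0 bZ.
have Z0 w : 0 <= Z w by case/andP: (Zb w).
have Zn w : `|Z w| <= b by rewrite ger0_norm//; case/andP: (Zb w).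
pose df w := f (X (s + h) w) - f (X s w).
pose If := pint (jump_gen f) s (s + h).
have bdf : bd df by apply: bdmeasB; exact: Xbd.
have bIf : bd If by exact: pint_bd.
have Ifh w : `|If w| <= lf * h.
  by have := pint_norm (jump_gen f) w sh; rewrite addrAC subrr add0r.
have bphi : bd (fun w => Z w * phi (X s w) (X (s + h) w)).
  by apply: bdmeasM bZ' _; apply: bdmeasX; exact: bdmeas_norm.
have bI : bd (fun w => Z w * `|If w| ^+ p.+2).
  by apply: bdmeasM bZ' _; apply: bdmeasX; exact: bdmeas_norm.
have bj : bd (fun w => Z w * (h * jump_mean phi (X s w))).
  by apply: bdmeasM bZ' _; apply: bdmeasZ; exact: Xbd.
apply: (@le_trans _ _ (2 ^+ p.+2 * (Ex (fun w => Z w * phi (X s w) (X (s + h) w)) +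
    Ex (fun w => Z w * `|If w| ^+ p.+2)))).
  rewrite -ExD// -ExZ; last exact: bdmeasD.
  apply: le_Ex.
  - by apply: bdmeasM bZ' _; apply: bdmeasX; apply: bdmeas_norm; exact: dmart_bd.
  - by apply: bdmeasZ; exact: bdmeasD.
  - move=> w; rewrite -mulrDr [leRHS]mulrCA; apply: ler_wpM2l => //.
    have -> : dmart f s (s + h) w = df w - If w by rewrite /dmart martB.
    rewrite /phi -/(df w); move: (df w) (If w) => a c.
    apply: (@le_trans _ _ ((`|a| + `|c|) ^+ p.+2)).
      by rewrite lerXn2r ?nnegrE ?addr_ge0// ler_normB.
    wlog ac : a c / `|a| <= `|c|.
      move=> W; have [ac|/ltW ca] := leP `|a| `|c|; first exact: W.
      by rewrite addrC [X in _ <= _ * X]addrC; exact: W.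
    apply: (@le_trans _ _ ((2 * `|c|) ^+ p.+2)).
      by rewrite lerXn2r ?nnegrE ?addr_ge0 ?mulr_ge0// mulr2n mulrDl mul1r lerD2r.
    by rewrite exprMn ler_wpM2l ?exprn_ge0// lerDr exprn_ge0.
have H1 : Ex (fun w => Z w * phi (X s w) (X (s + h) w)) <=
    Dj ^+ p * Gm * h * Ex Z + b * C * h ^+ 2.
  have := HC s h Z b s0 h01 bZ Zn.
  have -> : Ex (fun w => Z w * (phi (X s w) (X (s + h) w) - h * jump_mean phi (X s w))) =
     Ex (fun w => Z w * phi (X s w) (X (s + h) w)) -
     Ex (fun w => Z w * (h * jump_mean phi (X s w))).
    by rewrite -ExB//; congr Ex; apply: funext => w; rewrite mulrBr.
  rewrite ler_norml => /andP[_]; rewrite lerBlDl => /le_trans; apply.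
  rewrite lerD2r -ExZ//; apply: le_Ex => //; first exact: bdmeasZ.
  move=> w; rewrite [leRHS]mulrC; apply: ler_wpM2l => //.
  rewrite [leRHS]mulrC; apply: ler_wpM2l => //.
  apply: (@le_trans _ _ (Dj ^+ p * carre f f (X s w))); last first.
    by rewrite ler_wpM2l ?exprn_ge0.
  rewrite /carre mulr_sumr; apply: ler_sum => i _; rewrite [leRHS]mulrCA ler_wpM2l//.
  rewrite /phi -addn2 exprD real_normK ?num_real// -expr2.
  by rewrite ler_wpM2r ?sqr_ge0// lerXn2r ?nnegrE.
have H2 : Ex (fun w => Z w * `|If w| ^+ p.+2) <= b * lf ^+ p.+2 * h ^+ 2.
  apply: le_trans (ler_norm _) _; apply: Ex_norm_le => // w.
  rewrite normrM -mulrA; apply: ler_pM => //.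
  rewrite ger0_norm ?exprn_ge0//; apply: (@le_trans _ _ ((lf * h) ^+ p.+2)).
    by rewrite lerXn2r ?nnegrE ?mulr_ge0.
  rewrite exprMn ler_wpM2l ?exprn_ge0// -addn2 exprD ler_piMl ?sqr_ge0//.
  by rewrite exprn_ile1.
apply: (@le_trans _ _ (2 ^+ p.+2 * (Dj ^+ p * Gm * h * Ex Z + b * C * h ^+ 2 +
    b * lf ^+ p.+2 * h ^+ 2))).
  by rewrite ler_wpM2l ?exprn_ge0// lerD.
by rewrite le_eqVlt; apply/orP; left; apply/eqP; ring.
Qed.

Lemma second_moment_mart (s t : R) : 0 <= s <= t ->
  Ex (fun w => dmart f s t w ^+ 2) <= Gm * (t - s).
Proof.
move=> st; have /andP[s0 s_t] := st.
have := var_mart f st (bdmeas_cst _ 1).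
have -> : (fun w => 1 * dmart f s t w ^+ 2) = (fun w => dmart f s t w ^+ 2).
  by apply: funext => w; rewrite mul1r.
move=> ->; apply: le_trans (ler_norm _) _; apply: Ex_norm_le.
  by apply: bdmeasZ; exact: pint_bd.
by move=> w; rewrite mul1r; apply: pint_le => // x; exact: norm_carre_le.
Qed.

(** Its three terms come from the powers 2, 3 and 4 of the increment in the binomial expansion; the
    last two carry the jump size, so that small jumps leave a bound of order tau^2. *)
Definition fourth_bound (tau : R) :=
  tau * (6 * Gm ^+ 2 * tau + 32 * Dj * Gm * (1 + Gm * tau) + 16 * Dj ^+ 2 * Gm).

(** The fourth power of the increment is expanded along a grid: the linear term vanishes by
    [dynkin], the quadratic one uses the second moment of the past, and the cubic and quartic ones
    use [abs_moment_step]. *)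
Lemma fourth_moment_mart (s t : R) : 0 <= s <= t ->
  Ex (fun w => dmart f s t w ^+ 4) <= fourth_bound (t - s).
Proof.
move=> st; have /andP[s0 s_t] := st; set tau := t - s.
have tau0 : 0 <= tau by rewrite subr_ge0.
have G0 := Gm_ge0.
pose Y := 2 * fmax f + fmax (jump_gen f) * tau.
have Yb u w : s <= u <= t -> `|dmart f s u w| <= Y.
  move=> /andP[su ut]; have su0 : 0 <= s <= u by rewrite s0.
  rewrite /dmart martB//; apply: le_trans (ler_normB _ _) _; apply: lerD.
    by apply: le_trans (ler_normB _ _) _; rewrite mulr2n mulrDl mul1r lerD ?fmaxP.
  apply: le_trans (pint_norm _ _ su0) _.
  by rewrite ler_wpM2l ?fmax_ge0// lerD2r.
have Y0 : 0 <= Y by apply: le_trans (Yb s point _); rewrite ?lexx.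
have [C3 C30 H3] := abs_moment_step 1; have [C4 C40 H4] := abs_moment_step 2.
apply: le_trans (ler_norm _) _.
apply: (@lim_le_harmonic (fun=> Ex (fun w => dmart f s t w ^+ 4)) _ _
  (tau ^+ 2 * (4 * (Y * C3) + C4)) (Num.trunc tau)); first exact: cvg_cst.
move=> n tn; have h01 := grid_step s_t tn; set h := (t - s) / n.+1%:R in h01.
have /andP[h0 h1] := h01.
pose u := gridpt s t n.
have uS k : u k.+1 = u k + h by exact: gridptS.
have u0 k : 0 <= u k by exact: gridpt_ge0.
have us k : 0 <= s <= u k by exact: gridpt_itv.
have um k : 0 <= u k <= u k.+1 by exact: gridpt_mono.
have bdm k : bd (dmart f s (u k)) by apply: dmart_bd.
rewrite ger0_norm; last by apply: Ex_ge0 => w; rewrite exprn_even_ge0.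
pose K := 6 * Gm ^+ 2 * tau + 32 * Dj * Gm * (1 + Gm * tau) + 16 * Dj ^+ 2 * Gm.
have step k : (k <= n)%N -> Ex (fun w => dmart f s (u k.+1) w ^+ 4) <=
    Ex (fun w => dmart f s (u k) w ^+ 4) + (h * K + (4 * (Y * C3) + C4) * h ^+ 2).
  move=> kn; have ukt : s <= u k <= t.
    by case/andP: (us k) => _ ->/=; apply: gridpt_le => //; exact: leqW.
  pose y := dmart f s (u k); pose D := dmart f (u k) (u k + h).
  have by_ : bd y by exact: bdm.
  have bD : bd D by apply: dmart_bd => //; rewrite -uS.
  have Fy : Fbd (u k) y by exact: Fbd_dmart.
  have Fay : Fbd (u k) (fun w => `|y w|) by exact: bdmeas_norm.
  have uu : 0 <= u k <= u k + h by rewrite -uS.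
  have E1 : Ex (fun w => 4 * y w ^+ 3 * D w) = 0.
    apply: (dynkin f uu (Z := fun w => 4 * y w ^+ 3)).
    by apply: bdmeasZ; exact: bdmeasX.
  have E2 : Ex (fun w => y w ^+ 2 * D w ^+ 2) <= Gm * h * (Gm * tau).
    rewrite /D var_mart//; last exact: bdmeasX.
    apply: (@le_trans _ _ (Ex (fun w => Gm * h * y w ^+ 2))).
      apply: le_Ex.
      - by apply: bdmeasM; [exact: bdmeasX|exact: pint_bd].
      - by apply: bdmeasZ; exact: bdmeasX.
      - move=> w; rewrite mulrC ler_wpM2r ?sqr_ge0//.
        apply: le_trans (ler_norm _) _; apply: le_trans (pint_le _ _ uu) _.
          by move=> x; exact: norm_carre_le.
        by rewrite addrAC subrr add0r.
    rewrite ExZ; last exact: bdmeasX.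
    rewrite ler_wpM2l ?mulr_ge0//; apply: le_trans (second_moment_mart (us k)) _.
    by rewrite ler_wpM2l// lerD2r; case/andP: ukt.
  have Ey : Ex (fun w => `|y w|) <= 1 + Gm * tau.
    apply: (@le_trans _ _ (Ex (fun w => 1 + y w ^+ 2))).
      apply: le_Ex; first exact: bdmeas_norm.
        by apply: bdmeasD; [exact: bdmeas_cst|exact: bdmeasX].
      move=> w; rewrite -(real_normK (num_real (y w))).
      by have := sqr_ge0 (`|y w| - 1); rewrite !expr2; have := normr_ge0 (y w); nra.
    rewrite ExD; [|exact: bdmeas_cst|exact: bdmeasX].
    rewrite Ex_cst lerD2l; apply: le_trans (second_moment_mart (us k)) _.
    by rewrite ler_wpM2l// lerD2r; case/andP: ukt.
  have E3 : Ex (fun w => `|y w| * `|D w| ^+ 3) <=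
      8 * Dj * Gm * h * (1 + Gm * tau) + Y * C3 * h ^+ 2.
    apply: le_trans (H3 _ _ _ Y (u0 k) h01 Fay _) _.
      by move=> w; rewrite normr_ge0 Yb.
    rewrite lerD2r expr1 (_ : 2 ^+ 3 = 8 :> R); last by ring.
    by rewrite ler_wpM2l// !mulr_ge0.
  have E4 : Ex (fun w => 1 * `|D w| ^+ 4) <= 16 * Dj ^+ 2 * Gm * h + C4 * h ^+ 2.
    apply: le_trans (H4 _ _ (fun=> 1) 1 (u0 k) h01 (bdmeas_cst _ 1) _) _.
      by move=> w; rewrite ler01 lexx.
    by rewrite Ex_cst mulr1 mul1r (_ : 2 ^+ 4 = 16 :> R)//; ring.
  have b4 : bd (fun w => y w ^+ 4) by exact: bdmeasX.
  have bb1 : bd (fun w => 4 * y w ^+ 3 * D w).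
    by apply: bdmeasM => //; apply: bdmeasZ; exact: bdmeasX.
  have bb2 : bd (fun w => 6 * (y w ^+ 2 * D w ^+ 2)).
    by apply: bdmeasZ; apply: bdmeasM; exact: bdmeasX.
  have bb3 : bd (fun w => 4 * (`|y w| * `|D w| ^+ 3)).
    by apply: bdmeasZ; apply: bdmeasM; [|apply: bdmeasX]; exact: bdmeas_norm.
  have bb4 : bd (fun w => 1 * `|D w| ^+ 4).
    by apply: bdmeasZ; apply: bdmeasX; exact: bdmeas_norm.
  apply: (@le_trans _ _ (Ex (fun w => y w ^+ 4 + 4 * y w ^+ 3 * D w +
     6 * (y w ^+ 2 * D w ^+ 2) + 4 * (`|y w| * `|D w| ^+ 3) + 1 * `|D w| ^+ 4))).
    apply: le_Ex.
    - exact: bdmeasX.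
    - by do 4 (apply: bdmeasD => //).
    - move=> w; have -> : dmart f s (u k.+1) w = y w + D w.
        by rewrite /y /D /dmart uS; ring.
      have -> : `|D w| ^+ 4 = D w ^+ 4 by rewrite -normrX ger0_norm// exprn_even_ge0.
      have -> : (y w + D w) ^+ 4 = y w ^+ 4 + 4 * y w ^+ 3 * D w +
        6 * (y w ^+ 2 * D w ^+ 2) + 4 * (y w * D w ^+ 3) + 1 * D w ^+ 4 by ring.
      rewrite lerD2r lerD2l ler_wpM2l//; apply: le_trans (ler_norm _) _.
      by rewrite normrM normrX.
  rewrite ExD//; last by do 3 (apply: bdmeasD => //).
  rewrite ExD//; last by do 2 (apply: bdmeasD => //).
  rewrite ExD//; last by apply: bdmeasD.
  rewrite ExD// E1 addr0 ExZ; last by apply: bdmeasM; exact: bdmeasX.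
  rewrite ExZ; last by apply: bdmeasM; [|apply: bdmeasX]; exact: bdmeas_norm.
  rewrite -!addrA lerD2l !addrA.
  apply: (@le_trans _ _ (6 * (Gm * h * (Gm * tau)) +
    4 * (8 * Dj * Gm * h * (1 + Gm * tau) + Y * C3 * h ^+ 2) +
    (16 * Dj ^+ 2 * Gm * h + C4 * h ^+ 2))).
    by apply: lerD => //; apply: lerD; rewrite ler_wpM2l.
  by rewrite le_eqVlt /K; apply/orP; left; apply/eqP; ring.
have iter k : (k <= n.+1)%N -> Ex (fun w => dmart f s (u k) w ^+ 4) <=
    k%:R * (h * K + (4 * (Y * C3) + C4) * h ^+ 2).
  elim: k => [|k IH] kn.
    rewrite mul0r (_ : (fun w => _) = (fun=> 0)) ?Ex_cst//.
    by apply: funext => w; rewrite /u gridpt0 /dmart subrr expr0n.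
  apply: le_trans (step k kn) _; set e := h * K + _.
  have -> : k.+1%:R * e = k%:R * e + e by rewrite -natr1 mulrDl mul1r.
  rewrite lerD2r; apply: IH; exact: ltnW.
have := iter n.+1 (leqnn _); rewrite /u gridptn => /le_trans; apply.
have nh : n.+1%:R * h = tau by rewrite /h mulrC divfK// pnatr_eq0.
have -> : n.+1%:R * (h * K + (4 * (Y * C3) + C4) * h ^+ 2) =
  tau * K + tau * h * (4 * (Y * C3) + C4) by rewrite -nh; ring.
rewrite /fourth_bound -/K lerD2l.
by rewrite /h -/tau le_eqVlt; apply/orP; left; apply/eqP; ring.
Qed.

(** On a grid step, Taylor expansion gives the multiplier 1 - q h / 2: the sine term vanishes by
    [dynkin], the square of the increment becomes h times the carre du champ, and the latter becomes
    q at the price of their L1 distance. The cubic remainder is paid by the jump size, and the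
    powers of the multiplier converge to the exponential. *)
Lemma cos_step (s t q : R) y0 : 0 <= s <= t -> 0 <= q -> Fbd s y0 ->
  `|Ex (fun w => cos (y0 w + dmart f s t w)) -
    expR (- (q / 2 * (t - s))) * Ex (fun w => cos (y0 w))| <=
  2^-1 * Ex (pint (fun x => `|carre f f x - q|) s t) + 8 * Dj * Gm * (t - s).
Proof.
move=> st q0 Fy0; have /andP[s0 s_t] := st; set tau := t - s.
have tau0 : 0 <= tau by rewrite subr_ge0.
pose g x := `|carre f f x - q|.
have [C2 C20 H2] := cov_step f f; have [C3 C30 H3] := abs_moment_step 1.
have bcos y : bd y -> bd (fun w => cos (y w)).
  by apply: bdmeas_continuous; exact: continuous_cos.
pose rn n := Ex (fun w => rsum (fun u => g (X u w)) s t n).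
have cr : rn @ \oo --> Ex (pint g s t).
  apply: (proj2 (@Ex_cvg _ _ (fmax g * (t - s)) _ _ _)).
  - by move=> n; case: (Fbd_bd (le_trans s0 s_t) (Fbd_rsum g n st)).
  - by move=> n w; apply: rsum_norm => // u; exact: fmaxP.
  - by move=> w; case: (pint_rsum g w st).
pose c0 : R := tau * (fmax g + (C2 / 2 + C3) * tau) + (q / 2) ^+ 2 * tau ^+ 2.
have cb : (fun n => 2^-1 * rn n + 8 * Dj * Gm * tau + c0 * (n.+1%:R^-1 : R)) @ \oo -->
    2^-1 * Ex (pint g s t) + 8 * Dj * Gm * tau.
  rewrite -[X in _ --> X]addr0 -(mulr0 c0); apply: cvgD.
    by apply: cvgD; [apply: cvgM cr; exact: cvg_cst|exact: cvg_cst].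
  by apply: cvgM; [exact: cvg_cst|exact: cvg_harmonic].
(* The grid is taken fine enough for the step h and for q h / 2 to be at most 1, so that the
   multiplier lies in [0, 1]. *)
apply: (@le_limit _ (fun=> _) _ _ _ (maxn (Num.trunc tau) (Num.trunc (q / 2 * tau)))
  _ cb); first exact: cvg_cst.
move=> n; rewrite geq_max => /andP[tn qn].
have h01 := grid_step s_t tn; set h := (t - s) / n.+1%:R in h01.
have /andP[h0 h1] := h01.
have nh : n.+1%:R * h = tau by rewrite /h mulrC divfK// pnatr_eq0.
have hE : h = tau * n.+1%:R^-1 by [].
pose a : R := 1 - q / 2 * h.
have qh : q / 2 * h <= 1.
  rewrite hE mulrA ler_pdivrMr// mul1r; apply: le_trans (ltW (truncnS_gt _)) _.
  by rewrite ler_nat.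
have qh0 : 0 <= q / 2 * h by rewrite mulr_ge0 ?divr_ge0.
have a01 : 0 <= a <= 1 by rewrite /a subr_ge0 qh gerBl.
have /andP[a0 a1] := a01.
pose u := gridpt s t n.
have uS k : u k.+1 = u k + h by exact: gridptS.
have u0 k : 0 <= u k by exact: gridpt_ge0.
have us k : 0 <= s <= u k by exact: gridpt_itv.
pose c k := Ex (fun w => cos (y0 w + dmart f s (u k) w)).
pose rho k := 2^-1 * (h * Ex (fun w => g (X (u k) w))) + 8 * Dj * Gm * h +
  (C2 / 2 + C3) * h ^+ 2.
have step k : `|c k.+1 - a * c k| <= rho k.
  pose y w := y0 w + dmart f s (u k) w; pose D := dmart f (u k) (u k + h).
  have uu : 0 <= u k <= u k + h by rewrite u0 lerDl.
  have Fy : Fbd (u k) y by apply: bdmeasD (Fbd_mono (us k) Fy0) _; exact: Fbd_dmart.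
  have by_ : bd y by exact: (Fbd_bd (u0 k)).
  have bD : bd D by apply: dmart_bd => //; exact: addr_ge0.
  have Fc : Fbd (u k) (fun w => cos (y w)).
    by apply: bdmeas_continuous Fy; exact: continuous_cos.
  have Fs : Fbd (u k) (fun w => sin (y w)).
    by apply: bdmeas_continuous Fy; exact: continuous_sin.
  have bc := Fbd_bd (u0 k) Fc. have bs := Fbd_bd (u0 k) Fs.
  have c1 w : `|cos (y w)| <= 1 by rewrite ler_norml cos_geN1 cos_le1.
  have bG : bd (fun w => carre f f (X (u k) w)) by exact: Xbd.
  pose A w := cos (y w + D w) - (cos (y w) - sin (y w) * D w - cos (y w) / 2 * D w ^+ 2).
  pose B w := cos (y w) * (D w * D w - h * carre f f (X (u k) w)).
  pose E' w := cos (y w) * (carre f f (X (u k) w) - q).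
  have bA : bd A.
    apply: bdmeasB; first by apply: bcos; exact: bdmeasD.
    apply: bdmeasB; first by apply: bdmeasB => //; exact: bdmeasM.
    by apply: bdmeasM; [apply: bdmeasM bc _; exact: bdmeas_cst|exact: bdmeasX].
  have bB : bd B by apply: bdmeasM bc _; apply: bdmeasB; [exact: bdmeasM|exact: bdmeasZ].
  have bE : bd E' by apply: bdmeasM bc _; apply: bdmeasB bG _; exact: bdmeas_cst.
  have bsD : bd (fun w => sin (y w) * D w) by exact: bdmeasM.
  have E0 : Ex (fun w => sin (y w) * D w) = 0 by exact: (dynkin f uu Fs).
  have -> : c k.+1 - a * c k = Ex A - 2^-1 * Ex B - 2^-1 * h * Ex E'.
    rewrite /c -ExZ; last exact: bcos.
    rewrite -ExB; [|by apply: bcos; rewrite uS; apply: bdmeasD (Fbd_bd s0 Fy0) _;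
       apply: dmart_bd => //; rewrite -uS|by apply: bdmeasZ; exact: bcos].
    rewrite -!ExZ// -[LHS]addr0 -{1}E0 -ExD//; last first.
      apply: bdmeasB; last by apply: bdmeasZ; exact: bcos.
      apply: bcos; rewrite uS; apply: bdmeasD (Fbd_bd s0 Fy0) _.
      by apply: dmart_bd => //; rewrite -uS.
    rewrite -ExB//; last exact: bdmeasZ.
    rewrite -ExB//; [|by apply: bdmeasB bA _; exact: bdmeasZ|exact: bdmeasZ].
    congr Ex; apply: funext => w.
    have -> : y0 w + dmart f s (u k.+1) w = y w + D w.
      by rewrite /y /D /dmart uS; ring.
    by rewrite -/(y w) /A /B /E' /a; field.
  have HA : `|Ex A| <= 8 * Dj * Gm * h + C3 * h ^+ 2.
    apply: le_trans (Ex_norm bA) _.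
    apply: (@le_trans _ _ (Ex (fun w => 1 * `|D w| ^+ 3))).
      apply: le_Ex; first exact: bdmeas_norm.
        by apply: bdmeasZ; apply: bdmeasX; exact: bdmeas_norm.
      by move=> w; rewrite mul1r; exact: cos_taylor.
    apply: le_trans (H3 _ _ (fun=> 1) 1 (u0 k) h01 (bdmeas_cst _ 1) _) _.
      by move=> w; rewrite ler01 lexx.
    by rewrite Ex_cst mulr1 mul1r expr1 (_ : 2 ^+ 3 = 8 :> R)//; ring.
  have HB : `|Ex B| <= C2 * h ^+ 2.
    by have := H2 _ _ _ 1 (u0 k) h01 Fc c1; rewrite mul1r.
  have HE : `|Ex E'| <= Ex (fun w => g (X (u k) w)).
    apply: le_trans (Ex_norm bE) _; apply: le_Ex; first exact: bdmeas_norm.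
      exact: Xbd.
    by move=> w; rewrite normrM ler_piMl.
  apply: le_trans (ler_normB _ _) _.
  apply: (@le_trans _ _ ((8 * Dj * Gm * h + C3 * h ^+ 2) + 2^-1 * (C2 * h ^+ 2) +
     2^-1 * h * Ex (fun w => g (X (u k) w)))).
    have h2 : 0 <= 2^-1 :> R by rewrite invr_ge0.
    apply: lerD; last first.
      by rewrite normrM ger0_norm ?mulr_ge0// ler_wpM2l ?mulr_ge0.
    apply: le_trans (ler_normB _ _) _; apply: lerD => //.
    by rewrite normrM (ger0_norm h2) ler_wpM2l.
  by rewrite /rho le_eqVlt; apply/orP; left; apply/eqP; field.
have c0E : c 0%N = Ex (fun w => cos (y0 w)).
  by congr Ex; apply: funext => w; rewrite /u gridpt0 /dmart subrr addr0.
have cnE : c n.+1 = Ex (fun w => cos (y0 w + dmart f s t w)).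
  by rewrite /c /u gridptn.
have c01 : `|c 0%N| <= 1.
  rewrite c0E; apply: Ex_norm_le; first by apply: bcos; exact: (Fbd_bd s0).
  by move=> w; rewrite ler_norml cos_geN1 cos_le1.
have iter := @affine_iter R a c rho a01 step.
rewrite -cnE -c0E; move: c01 iter; clear step c0E cnE; clearbody c => c01 iter.
have sumrho : \sum_(j < n.+1) rho j <= 2^-1 * rn n + 8 * Dj * Gm * tau +
    tau * (fmax g + (C2 / 2 + C3) * tau) * n.+1%:R^-1.
  have -> : \sum_(j < n.+1) rho j = 2^-1 * (h * \sum_(j < n.+1) Ex (fun w => g (X (u j) w))) +
      n.+1%:R * (8 * Dj * Gm * h) + n.+1%:R * ((C2 / 2 + C3) * h ^+ 2).
    rewrite [2^-1 * (h * _)]mulrA; have <- := sum_affine (2^-1 * h) (8 * Dj * Gm * h) ((C2 / 2 + C3) * h ^+ 2)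
      (fun j => Ex (fun w => g (X (u j) w))) n.+1.
    by apply: eq_bigr => j _; rewrite /rho mulrA.
  have -> : n.+1%:R * (8 * Dj * Gm * h) = 8 * Dj * Gm * tau by rewrite -nh; ring.
  have -> : n.+1%:R * ((C2 / 2 + C3) * h ^+ 2) = (C2 / 2 + C3) * tau * h by rewrite -nh; ring.
  have -> : h * \sum_(j < n.+1) Ex (fun w => g (X (u j) w)) =
      rn n - h * Ex (fun w => g (X t w) - g (X s w)).
    rewrite -Ex_sum; last by move=> j; exact: Xbd.
    rewrite /rn -!ExZ; [|by apply: bdmeasB; apply: Xbd => //; exact: le_trans s_t|by
      apply: bdmeas_sum => j; exact: Xbd].
    rewrite -ExB; [|exact: (Fbd_bd (le_trans s0 s_t) (Fbd_rsum g n st))|by apply: bdmeasZ;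
       apply: bdmeasB; apply: Xbd => //; exact: le_trans s_t].
    congr Ex; apply: funext => w; rewrite rsum_left mulr_sumr -/h.
    by rewrite addrK.
  have : - (h * Ex (fun w => g (X t w) - g (X s w))) <= h * (2 * fmax g).
    rewrite -mulrN ler_wpM2l//; apply: le_trans (ler_norm _) _; rewrite normrN.
    apply: Ex_norm_le; first by apply: bdmeasB; apply: Xbd => //; exact: le_trans s_t.
    move=> w; apply: le_trans (ler_normB _ _) _.
    by rewrite mulr2n mulrDl mul1r lerD ?fmaxP.
  rewrite /tau; have -> : (t - s) * (fmax g + (C2 / 2 + C3) * (t - s)) / n.+1%:R =
     h * fmax g + (C2 / 2 + C3) * (t - s) * h by rewrite /h; ring.
  by move: (h * Ex _) => Z1 Z2; lra.
have pw : `|a ^+ n.+1 - expR (- (q / 2 * tau))| <= (q / 2) ^+ 2 * tau ^+ 2 * n.+1%:R^-1.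
  pose e : R := expR (- (q / 2 * h)).
  have e01 : 0 <= e <= 1 by rewrite expR_ge0 expR_le1 oppr_le0.
  have /andP[e0 e1] := e01.
  have -> : expR (- (q / 2 * tau)) = e ^+ n.+1.
    by rewrite /e -expRM_natl -nh; congr expR; ring.
  have ae : `|a - e| <= (q / 2 * h) ^+ 2 by exact: expRN_quadratic.
  apply: le_trans (exp_sub_le _ a01 e01) _; apply: (@le_trans _ _ (n.+1%:R * (q / 2 * h) ^+ 2)).
    by rewrite ler_wpM2l.
  rewrite le_eqVlt; apply/orP; left; apply/eqP.
  have -> : n.+1%:R * (q / 2 * h) ^+ 2 = (q / 2) ^+ 2 * (n.+1%:R * h) * h by ring.
  by rewrite nh hE; ring.
apply: (affine_bound (iter n.+1) sumrho pw c01).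
by rewrite /c0 (mulrDl _ _ n.+1%:R^-1) addrA.
Qed.

(** A 0-1 valued indicator of the event that the level eta is reached before the index k; the
    recursion makes its adaptedness an induction. *)
Fixpoint hit (y : nat -> Om -> R) (eta : R) k w : R :=
  if k is k'.+1 then (if eta <= `|y k' w| then 1 else hit y eta k' w) else 0.

Lemma hit01 y eta k w : hit y eta k w = 0 \/ hit y eta k w = 1.
Proof. by elim: k => [|k IH] /=; [left|case: ifP => _; [right|]]. Qed.

Lemma hit1P y eta k w : hit y eta k w = 1 <-> exists2 j, (j < k)%N & eta <= `|y j w|.
Proof.
elim: k => [|k [IH1 IH2]] /=.
  by split=> [/eqP|[]//]; rewrite eq_sym oner_eq0.
case: ifP => E; first by split=> // _; exists k.
split=> [/IH1[j jk jy]|[j]]; first by exists j => //; exact: ltnW.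
rewrite ltnS leq_eqVlt => /predU1P[->|jk jy]; first by rewrite E.
by apply: IH2; exists j.
Qed.

(** The maximal inequality on a grid, through the invariant that eta^4 E[hit] is at most E[hit y^4].
    The index n + 2 is there because a grid of n + 1 cells has n + 2 points. *)
Lemma doob (s t eta : R) n : 0 <= s <= t -> 0 < eta ->
  Fbd t (hit (fun k => dmart f s (gridpt s t n k)) eta n.+2) /\
  eta ^+ 4 * Ex (hit (fun k => dmart f s (gridpt s t n k)) eta n.+2) <=
  Ex (fun w => dmart f s t w ^+ 4).
Proof.
move=> st eta0; have /andP[s0 s_t] := st.
pose u := gridpt s t n; pose y k := dmart f s (u k).
have uS k : 0 <= u k <= u k.+1 by exact: gridpt_mono.
have us k : 0 <= s <= u k by exact: gridpt_itv.
have u0 k : 0 <= u k by exact: gridpt_ge0.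
have Fy k : Fbd (u k) (y k) by exact: Fbd_dmart.
have by_ k : bd (y k) := Fbd_bd (u0 k) (Fy k).
pose A k := (fun w => `|y k w|) @^-1` `[eta, +oo[.
have FA k : F (u k) (A k).
  by apply: Fbd_preimage (bdmeas_norm (Fy k)) _; exact: measurable_itv.
have AE k w : (\1_(A k) : Om -> R) w = if eta <= `|y k w| then 1 else 0.
  have E : A k w <-> eta <= `|y k w| by rewrite /A/= in_itv/= andbT.
  by case: (boolP (eta <= _)) => [/E|/negP] H; rewrite indicE; [rewrite mem_set|
    rewrite memNset// => /E].
have hS k : hit y eta k.+1 =
    (fun w => hit y eta k w + (1 - hit y eta k w) * (\1_(A k) : Om -> R) w).
  by apply: funext => w; rewrite AE /=; case: ifP => _ /=; ring.
have Fh k : Fbd (u k) (hit y eta k.+1).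
  elim: k => [|k IH]; rewrite hS.
    rewrite (_ : hit y eta 0 = fun=> 0)//; apply: bdmeasD; first exact: bdmeas_cst.
    by apply: bdmeasM; [apply: bdmeasB; exact: bdmeas_cst|exact: Fbd_indic].
  have IH' := Fbd_mono (uS k) IH; apply: bdmeasD => //; apply: bdmeasM.
    by apply: bdmeasB => //; exact: bdmeas_cst.
  exact: Fbd_indic.
have bh k : bd (hit y eta k.+1) := Fbd_bd (u0 k) (Fh k).
have b4 k : bd (fun w => y k w ^+ 4) by exact: bdmeasX.
have main k : eta ^+ 4 * Ex (hit y eta k.+1) <= Ex (fun w => hit y eta k.+1 w * y k w ^+ 4).
  elim: k => [|k IH].
    rewrite -ExZ//; apply: le_Ex; [exact: bdmeasZ|exact: bdmeasM|].
    move=> w /=; case: ifP => [H|_]; last by rewrite mulr0 mul0r.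
    rewrite mulr1 mul1r -(ger0_norm (exprn_even_ge0 (y 0%N w) (erefl (~~ odd 4)))) normrX.
    by rewrite lerXn2r// nnegrE ?ltW.
  have E0 : Ex (fun w => (hit y eta k.+1 w * (4 * y k w ^+ 3)) *
      (mart f (u k.+1) w - mart f (u k) w)) = 0.
    apply: (dynkin f (uS k) (Z := fun w => hit y eta k.+1 w * (4 * y k w ^+ 3))).
    by apply: (bdmeasM (Fh k)); apply: bdmeasZ; exact: (bdmeasX 3 (Fy k)).
  have bD : bd (fun w => mart f (u k.+1) w - mart f (u k) w) by exact: dmart_bd.
  have bZ : bd (fun w => (hit y eta k.+1 w * (4 * y k w ^+ 3)) *
      (mart f (u k.+1) w - mart f (u k) w)).
    by apply: bdmeasM bD; apply: bdmeasM => //; apply: bdmeasZ; exact: bdmeasX.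
  have bW : bd (fun w => eta ^+ 4 * (hit y eta k.+2 w - hit y eta k.+1 w)).
    by apply: bdmeasZ; apply: bdmeasB.
  have -> : eta ^+ 4 * Ex (hit y eta k.+2) = eta ^+ 4 * Ex (hit y eta k.+1) +
      Ex (fun w => eta ^+ 4 * (hit y eta k.+2 w - hit y eta k.+1 w)).
    by rewrite ExZ ?ExB//; [ring|exact: bdmeasB].
  have bY : bd (fun w => hit y eta k.+1 w * y k w ^+ 4) by exact: (bdmeasM (bh k)).
  have bYZ := bdmeasD bY bZ.
  have E1 := ExD bYZ bW; rewrite (ExD bY bZ) E0 addr0 in E1.
  apply: le_trans (lerD IH (lexx _)) _; rewrite -E1.
  apply: le_Ex; [exact: (bdmeasD bYZ bW)|exact: (bdmeasM (bh k.+1))|].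
  move=> w; have -> : mart f (u k.+1) w - mart f (u k) w = y k.+1 w - y k w.
    by rewrite /y /dmart; ring.
  (* The fourth power lies above its tangents: this submartingale inequality is combined with [E0],
     by which the tangent term has zero expectation. *)
  have conv (a x : R) : a ^+ 4 + 4 * a ^+ 3 * (x - a) <= x ^+ 4.
    rewrite -subr_ge0 (_ : _ - _ = (x - a) ^+ 2 * ((x + a) ^+ 2 + 2 * a ^+ 2)); last by ring.
    apply: mulr_ge0; first exact: sqr_ge0.
    apply: addr_ge0; first exact: sqr_ge0.
    by apply: mulr_ge0 => //; exact: sqr_ge0.
  have := conv (y k w) (y k.+1 w); rewrite /=; case: (boolP (eta <= `|y k.+1 w|)) => H.
    have H4 : eta ^+ 4 <= y k.+1 w ^+ 4.
      rewrite -(ger0_norm (exprn_even_ge0 (y k.+1 w) (erefl (~~ odd 4)))) normrX.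
      by rewrite lerXn2r// nnegrE ?ltW.
    by case: ifP => _; [|case: (hit01 y eta k w) => ->]; lra.
  by case: ifP => _; [|case: (hit01 y eta k w) => ->]; lra.
have un : u n.+1 = t by exact: gridptn.
split; first by have := Fh n.+1; rewrite un.
apply: le_trans (main n.+1) _; rewrite (_ : (fun w => dmart f s t w ^+ 4) =
  (fun w => y n.+1 w ^+ 4)); last by rewrite /y un.
apply: le_Ex => //; first exact: bdmeasM.
move=> w; rewrite ler_piMl// ?exprn_even_ge0//.
by case: (hit01 y eta n.+2 w) => ->.
Qed.

Lemma pint_bound (g : T -> R) (s t : R) w : 0 <= s <= t -> `|pint g s t w| <= fmax g * (t - s).
Proof. by move=> st; apply: pint_le => // x; exact: fmaxP. Qed.

Lemma dmart_right (s t : R) w e : 0 <= s -> 0 <= t -> 0 < e -> exists2 d, 0 < d &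
  forall v, t <= v < t + d -> `|dmart f s v w - dmart f s t w| < e.
Proof.
move=> s0 t0 e0; have /at_rightP[d1 d10 H1] := X_right w t0.
pose C := fmax (jump_gen f) + 1.
have C0 : 0 < C by rewrite ltr_wpDl ?fmax_ge0.
exists (Order.min d1 (e / C)); first by rewrite lt_min d10 divr_gt0.
move=> v /andP[tv]; rewrite -ltrBlDl lt_min => /andP[vd ve].
have tv0 : 0 <= t <= v by rewrite t0 tv.
have -> : dmart f s v w - dmart f s t w = - pint (jump_gen f) t v w.
  rewrite /dmart (_ : _ - _ = mart f v w - mart f t w); last by ring.
  rewrite martB//; have [->|tv'] := eqVneq t v; first by rewrite subrr sub0r.
  rewrite (H1 v) ?subrr ?sub0r//; move: vd tv tv'; rewrite lt_neqAle; lra.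
rewrite normrN; apply: le_lt_trans (pint_bound _ _ tv0) _.
move: ve; rewrite ltr_pdivlMr// mulrC; apply: le_lt_trans.
by rewrite ler_wpM2r ?subr_ge0// lerDl.
Qed.

(** The bound is transferred to continuous time along dyadic grids. They are nested, so the hitting
    indicators increase to a measurable Z. A strict excess over eta persists on a short interval to
    the right, which a fine enough grid meets. *)
Lemma sup_mart (s t eta : R) : 0 <= s <= t -> 0 < eta ->
  exists Z, [/\ Fbd t Z, forall w, 0 <= Z w <= 1,
    eta ^+ 4 * Ex Z <= fourth_bound (t - s) &
    forall w u, s <= u <= t -> eta < `|dmart f s u w| -> Z w = 1].
Proof.
move=> st eta0; have /andP[s0 s_t] := st; have t0 := le_trans s0 s_t.
pose n p := (2 ^ p).-1; have nS p : (n p).+1 = (2 ^ p)%N by rewrite prednK ?expn_gt0.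
pose y p k := dmart f s (gridpt s t (n p) k).
pose H p := hit (y p) eta (n p).+2.
have Hmono p w : H p w = 1 -> H p.+1 w = 1.
  move=> /hit1P[j jn jy]; apply/hit1P; exists j.*2.
    by move: jn; rewrite !nS expnS mul2n !ltnS leq_double.
  suff -> : y p.+1 j.*2 w = y p j w by [].
  rewrite /y /gridpt !nS expnS -mul2n !natrM; congr (dmart _ _ (_ + _) _).
  by field; rewrite pnatr_eq0 expn_eq0.
have Hle p m w : H p w = 1 -> H (p + m)%N w = 1.
  by move=> Hp; elim: m => [|m]; rewrite ?addn0 ?addnS// => /Hmono.
pose Z w : R := if `[< exists p, H p w = 1 >] then 1 else 0.
have cZ w : H ^~ w @ \oo --> Z w.
  rewrite /Z; case: asboolP => [[p Hp]|nH].
    by apply: cvg_near_cst; exists p => // m /= pm; rewrite -(subnKC pm); exact: Hle.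
  apply: cvg_near_cst; exists 0%N => // m _ /=.
  by case: (hit01 (y m) eta (n m).+2 w) => // h1; case: nH; exists m.
have D p := doob (n p) st eta0.
have H1 p w : `|H p w| <= 1.
  by rewrite /H; case: (hit01 (y p) eta (n p).+2 w) => ->; rewrite ?normr0 ?normr1.
have Z01 w : 0 <= Z w <= 1 by rewrite /Z; case: ifP => _; rewrite ?lexx ?ler01.
have bH p : bd (H p) := Fbd_bd t0 (D p).1.
have mH p : measurable_fun setT (H p) by case: (bH p).
have [_ EZ] := Ex_cvg mH H1 cZ.
have FZ : Fbd t Z.
  split; last by exists 1 => w _; case/andP: (Z01 w) => ? ?; rewrite ger0_norm.
  apply: (@measurable_fun_cvg _ (g_sigma_algebraType (G t)) R setT H) => //.
  - by move=> p; case: (D p) => -[].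
exists Z; split=> //.
  apply: (@le_limit _ (fun p => eta ^+ 4 * Ex (H p)) (fun=> _) _ _ 0%N).
  - by apply: cvgM EZ; exact: cvg_cst.
  - exact: cvg_cst.
  - move=> p _; apply: le_trans (D p).2 _; exact: fourth_moment_mart.
move=> w u /andP[su ut] yu; rewrite /Z; case: asboolP => // -[].
have e0 : 0 < `|dmart f s u w| - eta by rewrite subr_gt0.
have [de d0 Hd] := dmart_right w s0 (le_trans s0 su) e0.
have far v : u <= v < u + de -> eta <= `|dmart f s v w|.
  move=> /Hd; rewrite -[dmart f s v w](subrKC (dmart f s u w)).
  have := ler_dist_dist (dmart f s u w) (dmart f s v w).
  have := ler_norm (`|dmart f s u w| - `|dmart f s v w|).
  rewrite (distrC (dmart f s u w)) subrKC => A1 A2 A3; lra.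
have [tu|tu] := eqVneq u t.
  exists 0%N; apply/hit1P; exists (n 0%N).+1 => //.
  have -> : y 0%N (n 0%N).+1 = dmart f s u.
    by rewrite tu; congr (dmart f s _); exact: gridptn.
  by apply: far; rewrite lexx ltrDl.
have ut' : u < t by rewrite lt_neqAle tu.
have s_t' : 0 < t - s by rewrite subr_gt0 (le_lt_trans su).
pose p := Num.trunc ((t - s) / de); pose h : R := (t - s) / (2 ^ p)%:R.
have p0 : 0 < (2 ^ p)%:R :> R by rewrite ltr0n expn_gt0.
have h0 : 0 < h by rewrite divr_gt0.
have hd : h < de.
  rewrite ltr_pdivrMr// mulrC -ltr_pdivrMr//; apply: lt_le_trans (truncnS_gt _) _.
  by rewrite ler_nat ltn_expl.
have x0 : 0 <= (u - s) / h by rewrite divr_ge0 ?subr_ge0// ltW.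
have /andP[k1 k2] := truncn_itv x0; set m := Num.trunc ((u - s) / h) in k1 k2.
exists p; apply/hit1P; exists m.+1.
  rewrite nS !ltnS -(ltr_nat R); apply: le_lt_trans k1 _.
  rewrite ltr_pdivrMr// /h mulrC divfK ?gt_eqF//; lra.
rewrite /y /gridpt nS -/h; apply: far.
move: k1 k2; rewrite ler_pdivlMr// ltr_pdivrMr//.
have -> : m.+1%:R * h = m%:R * h + h by rewrite -[m.+1%:R]natr1; ring.
move: (m%:R * h) => z z1 z2; apply/andP; split; lra.
Qed.

End JumpProcess.

(** * Integrals of continuous functions over segments *)

Section Calculus.
Context (R : realType).
Local Notation leb := (@lebesgue_measure R).

Lemma cont_bdmeas (F : R -> R) (a b : R) : continuous F -> bdmeas (`[a, b] : set R) F.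
Proof.
move=> cF; split.
  by apply: measurable_funTS; exact: continuous_measurable_fun.
have [ab|ba] := leP a b; last first.
  exists 0 => x /=; rewrite in_itv/= => /andP[ax xb].
  by have := le_trans ax xb; rewrite leNgt ba.
have cN : {within `[a, b], continuous (fun x => `|F x|)}.
  by apply: continuous_subspaceT => x; apply: (@cvg_norm _ R^o); exact: cF.
have [c _ cmax] := EVT_max ab cN.
by exists `|F c| => x /= xab; exact: cmax.
Qed.

Lemma ftc (F f : R -> R) (a b : R) : a <= b -> (forall x, is_derive x (1 : R) F (f x)) ->
  continuous f -> Rintegral leb `[a, b] f = F b - F a.
Proof.
rewrite le_eqVlt => /predU1P[<- _ _|ab dF cf].
  by rewrite set_itv1 Rintegral_set1 subrr.
have cF : continuous F.
  by move=> x; apply: differentiable_continuous; apply/derivable1_diffP; case: (dF x).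
rewrite /Rintegral (@continuous_FTC2 _ f F)//.
- exact: continuous_subspaceT.
- split; first by move=> x _; case: (dF x).
    by apply: cvg_at_right_filter; exact: cF.
  by apply: cvg_at_left_filter; exact: cF.
- by move=> x _; rewrite derive1E; exact: derive_val.
Qed.

End Calculus.

(** * The exponential series of the generator *)

Section Semigroup.
Context (R : realType) (K : R -> R) (N : nat) (gamma beta : R).
Local Notation L := (generator K gamma beta).
Local Notation B := (2 * (N.*2).+1%:R : R).
Implicit Types f : config N -> R.

Lemma generator_le f (F : R) c : (forall c, `|f c| <= F) -> `|L f c| <= B * F.
Proof.
move=> fF; apply: le_trans (ler_norm_sum _ _ _) _.
apply: (@le_trans _ _ (\sum_(i : site N) 2 * F)).
  apply: ler_sum => i _; rewrite normrM ger0_norm ?(ltW (rate_gt0 _ _ _ _ _))//.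
  apply: (@le_trans _ _ (1 * `|f (exchange c i) - f c|)).
    by rewrite ler_wpM2r// rate_le1.
  rewrite mul1r; apply: le_trans (ler_normB _ _) _.
  by rewrite mulr2n mulrDl mul1r lerD.
by rewrite sumr_const card_ord -mulr_natl le_eqVlt; apply/orP; left; apply/eqP; ring.
Qed.

Lemma iter_generator_le f (F : R) k : (forall c, `|f c| <= F) ->
  forall c, `|iter k L f c| <= B ^+ k * F.
Proof.
move=> fF; elim: k => [|k IH] c /=; first by rewrite expr0 mul1r.
by rewrite exprS -mulrA; apply: generator_le.
Qed.

Lemma series_exp_le (x : R) n : 0 <= x -> series (exp_coeff x) n <= expR x.
Proof.
move=> x0; apply: nondecreasing_cvgn_le; last exact: is_cvg_series_exp_coeff.
by apply: nondecreasing_series => k _ _; exact: exp_coeff_ge0.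
Qed.

(** Since t <= a, the tail of the series is at most (t / a)^2 times the exponential series at a. The
    free scale a will be 1 / alpha, the unit of rescaled time. *)
Lemma semigroup_expansion f (F t a : R) c : (forall c, `|f c| <= F) -> 0 < a -> 0 <= t <= a ->
  `|semigroup K gamma beta t f c - f c - t * L f c| <= (t / a) ^+ 2 * (F * expR (a * B)).
Proof.
move=> fF a0 /andP[t0 ta].
have F0 : 0 <= F := le_trans (normr_ge0 _) (fF c).
have B0 : 0 <= B by rewrite mulr_ge0.
pose u k : R := t ^+ k / k`!%:R * iter k L f c.
have uE k : `|u k| <= F * exp_coeff (t * B) k.
  rewrite /u normrM ger0_norm ?divr_ge0 ?exprn_ge0// /exp_coeff/= exprMn.
  apply: (@le_trans _ _ (t ^+ k / k`!%:R * (B ^+ k * F))).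
    by rewrite ler_wpM2l ?divr_ge0 ?exprn_ge0//; exact: iter_generator_le.
  by rewrite le_eqVlt; apply/orP; left; apply/eqP; ring.
have cu : cvgn (series u).
  apply: normed_cvg; apply: (@series_le_cvg _ _ (fun k => F * exp_coeff (t * B) k)) => //.
  - by move=> k; rewrite /=.
  - by move=> k; rewrite mulr_ge0// exp_coeff_ge0// mulr_ge0.
  - rewrite (_ : (fun k => _) = F *: (exp_coeff (t * B) : R^o ^nat))//.
    by apply: is_cvg_seriesZ; exact: is_cvg_series_exp_coeff.
have -> : semigroup K gamma beta t f c = limn (series u) by [].
have cu2 : series u n.+2 @[n --> \oo] --> limn (series u).
  by rewrite (_ : (fun n => series u n.+2) = (fun n => series u (n + 2)%N));
    [rewrite cvg_shiftn|apply: funext => n; rewrite addn2].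
have cn : (fun n => `|series u n.+2 - f c - t * L f c|) @ \oo -->
    `|limn (series u) - f c - t * L f c|.
  apply: (@cvg_norm _ R^o); apply: cvgB; last exact: cvg_cst.
  by apply: cvgB cu2 _; exact: cvg_cst.
apply: (@le_limit R _ (fun=> _) _ _ 0%N cn (cvg_cst _)) => n _.
have -> : series u n.+2 - f c - t * L f c = \sum_(k < n) u k.+2.
  rewrite /series/= big_mkord !big_ord_recl/= /u /bump/= !fact0 !expr0 expr1.
  rewrite (_ : 1`! = 1%N)// !divr1.
  rewrite (eq_bigr (fun i : 'I_n => u i.+2)) => [|i _]; last by rewrite /u !add1n.
  by move: (\sum_(_ < _) _) => S; ring.
apply: le_trans (ler_norm_sum _ _ _) _.
apply: (@le_trans _ _ (\sum_(k < n) (t / a) ^+ 2 * F * exp_coeff (a * B) k.+2)).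
  apply: ler_sum => k _; apply: le_trans (uE _) _.
  rewrite /exp_coeff/=; apply: (@le_trans _ _ (F * (t ^+ 2 * a ^+ k * B ^+ k.+2 / k.+2`!%:R))).
    rewrite ler_wpM2l// ler_wpM2r ?invr_ge0// exprMn ler_wpM2r ?exprn_ge0//.
    rewrite -(addn2 k) exprD mulrC ler_wpM2l ?exprn_ge0//.
    by rewrite lerXn2r// nnegrE// ltW.
  rewrite le_eqVlt; apply/orP; left; apply/eqP; rewrite (exprMn _ a) -(addn2 k) (exprD a).
  have k0 : (k + 2)`!%:R != 0 :> R by rewrite pnatr_eq0 -lt0n fact_gt0.
  by field; rewrite k0 gt_eqF.
rewrite -mulr_sumr -mulrA ler_wpM2l ?sqr_ge0// ler_wpM2l//.
apply: le_trans (series_exp_le n.+2 (mulr_ge0 (ltW a0) B0)).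
rewrite /series/= big_mkord 2!big_ord_recl/= addrA lerDr.
by rewrite addr_ge0// exp_coeff_ge0// mulr_ge0// ltW.
Qed.

End Semigroup.

(** * Dominated convergence and derivatives *)

Section Calculus2.
Context (R : realType).
Local Notation leb := (@lebesgue_measure R).

Lemma dct d (T : measurableType d) (mu : {measure set T -> \bar R}) (f_ : nat -> T -> R)
  (f g : T -> R) : (forall n, measurable_fun setT (f_ n)) ->
  (forall x, f_ ^~ x @ \oo --> f x) -> mu.-integrable setT (EFin \o g) ->
  (forall n x, `|f_ n x| <= g x) ->
  mu.-integrable setT (EFin \o f) /\
  (fun n => Rintegral mu setT (f_ n)) @ \oo --> Rintegral mu setT f.
Proof.
move=> mf_ f_f ig fg.
have mf : measurable_fun setT f by apply: measurable_fun_cvg mf_ _ => x _; exact: f_f.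
have [//|||||intf _ C] := @dominated_convergence _ T R mu setT measurableT
   (fun n => EFin \o f_ n) (EFin \o f) (EFin \o g).
- by move=> n; exact/measurable_EFinP.
- exact/measurable_EFinP.
- by apply: aeW => x _; apply: cvg_EFin; [exact: nearW|exact: f_f].
- exact: ig.
- by apply: aeW => x n _ /=; rewrite lee_fin fg.
split=> //; apply: fine_cvg.
have -> : (Rintegral mu setT f)%:E = (\int[mu]_x (EFin \o f) x)%E; last exact: C.
by rewrite fineK//; apply: integrable_fin_num.
Qed.

(** A criterion for two situations without a formula: differentiation under the Gaussian integral,
    and the points where a bump function vanishes. *)
Lemma is_derive_quad (f : R -> R) (x l C de : R) : 0 < de ->
  (forall h, `|h| < de -> `|f (h + x) - f x - h * l| <= C * h ^+ 2) ->
  is_derive x (1 : R) f l.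
Proof.
move=> de0 H.
have C0 : 0 <= C.
  have := le_trans (normr_ge0 _) (H (de / 2) _).
  rewrite gtr0_norm ?divr_gt0// gtr_pMr// invf_lt1// ltr1n => /(_ isT).
  by rewrite pmulr_lge0// exprn_gt0// divr_gt0.
have c : (fun h => h^-1 *: (f (h *: 1 + x) - f x)) @ 0^' --> l.
  apply/cvgrPdist_le => e e0; near=> h.
  have h0 : h != 0 by near: h; exact: nbhs_dnbhs_neq.
  have hd : `|h| < de by near: h; apply: dnbhs0_lt.
  have he : `|h| < e / (C + 1).
    by near: h; apply: dnbhs0_lt; rewrite divr_gt0// ltr_wpDl.
  rewrite /GRing.scale/= mulr1 distrC.
  have -> : h^-1 * (f (h + x) - f x) - l = h^-1 * (f (h + x) - f x - h * l) by field.
  rewrite normrM normfV mulrC ler_pdivrMr ?normr_gt0//.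
  apply: le_trans (H _ hd) _; rewrite -(real_normK (num_real h)) expr2 mulrA.
  rewrite ler_wpM2r//; move: he; rewrite ltr_pdivlMr ?ltr_wpDl// => /ltW.
  by apply: le_trans; rewrite mulrC ler_wpM2l// lerDl.
by apply: DeriveDef; [apply: cvgP c|exact: cvg_lim c].
Unshelve. all: by end_near. Qed.

(** Integration by parts on the line: the integral over [-n, n] is a difference of values of F, and
    decay along the integers is enough. *)
Lemma Rintegral_deriv_eq0 (F f : R -> R) : (forall x, is_derive x (1 : R) F (f x)) ->
  continuous f -> leb.-integrable setT (EFin \o f) ->
  (fun n => F n.+1%:R) @ \oo --> (0 : R) -> (fun n => F (- n.+1%:R)) @ \oo --> (0 : R) ->
  Rintegral leb setT f = 0.
Proof.
move=> dF cf intf cp cm.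
pose D n : set R := `[- n.+1%:R, n.+1%:R]%classic.
pose f_ n := f \_ (D n).
have mf_ n : measurable_fun setT (f_ n).
  have mD : measurable (D n) by exact: measurable_itv.
  apply/(measurable_restrictT f mD); apply: measurable_funTS.
  exact: continuous_measurable_fun.
have ff x : f_ ^~ x @ \oo --> f x.
  apply: cvg_near_cst; exists (Num.trunc `|x|) => // n /= xn.
  rewrite /f_ patchE mem_set// /D/= in_itv/= -ler_norml.
  by apply: le_trans (ltW (truncnS_gt _)) _; rewrite ler_nat ltnS.
have fg n x : `|f_ n x| <= `|f x| by rewrite /f_ patchE; case: ifP; rewrite ?normr0.
have [_ C] := @dct _ _ leb f_ f (fun x => `|f x|) mf_ ff (integrable_norm intf) fg.
have E n : Rintegral leb setT (f_ n) = F n.+1%:R - F (- n.+1%:R).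
  rewrite /f_ -Rintegral_mkcond; apply: ftc => //.
  by apply: le_trans (ler0n _ _); rewrite oppr_le0.
have C2 : (fun n => Rintegral leb setT (f_ n)) @ \oo --> (0 : R).
  by rewrite (funext E) -(subrr 0); exact: cvgB.
by rewrite -(cvg_lim _ C)// (cvg_lim _ C2).
Qed.

Lemma sin_quad (x : R) : `|sin x - x| <= x ^+ 2.
Proof.
wlog x0 : x / 0 <= x.
  move=> W; have [/W//|/ltW] := leP 0 x; rewrite -oppr_ge0 => /W.
  by rewrite sinN -opprD normrN sqrrN.
rewrite distrC ger0_norm ?sub_sin_ge0//.
have H (y : R) : 0 <= y -> 0 <= y ^+ 2 / 2 - y + sin y.
  move: y; apply: (@derive_ge0_ge0 _ _ (fun d => d - 1 + cos d)).
  all: try by move=> ?; apply: is_derive_eq; rewrite /GRing.scale/=; field.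
  - apply: (@derive_ge0_ge0 _ _ (fun d => 1 - sin d)).
    all: try by move=> ?; apply: is_derive_eq; rewrite /GRing.scale/=; field.
    + by move=> y _; rewrite subr_ge0 sin_le1.
    + by rewrite cos0; lra.
  - by rewrite sin0; lra.
by have := H x x0; have := sqr_ge0 x; lra.
Qed.

Lemma Int_split_integrable (f : R -> R) (a b c : R) : a <= b <= c ->
  leb.-integrable `[a, c] (EFin \o f) ->
  Rintegral leb `[a, c] f = Rintegral leb `[a, b] f + Rintegral leb `[b, c] f.
Proof.
move=> /andP[ab bc] intf.
have -> : Rintegral leb `[b, c] f = Rintegral leb `]b, c] f.
  rewrite Rintegral_itv_obnd_cbnd//; apply: integrableS intf => //.
  by apply: subset_itv; rewrite bnd_simp.
rewrite -(@Rintegral_itvB _ f (BLeft a) (BRight c) b)//.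
by rewrite subrKC.
Qed.

Lemma Int_split (f : R -> R) (a b c : R) : a <= b <= c -> bdmeas (`[a, c] : set R) f ->
  Rintegral leb `[a, c] f = Rintegral leb `[a, b] f + Rintegral leb `[b, c] f.
Proof.
move=> abc bf; apply: Int_split_integrable => //.
by apply: (bdmeas_integrable _ (itvc_fin a c)) => //; exact: measurable_itv.
Qed.

End Calculus2.

(** * Gaussian and trigonometric functions *)

Section Gaussian.
Context (R : realType) (s : R).
Hypothesis s0 : 0 < s.
Local Notation leb := (@lebesgue_measure R).
Local Notation q := (normal_pdf 0 s).

Let sN0 : s != 0. Proof. by rewrite gt_eqF. Qed.

Lemma normal_pdf0E x : q x = normal_peak s * expR (- x ^+ 2 / (2 * s ^+ 2)).
Proof. by rewrite normal_pdfE// /normal_fun subr0 mulr_natl. Qed.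

Lemma is_derive_normal_pdf (x : R) : is_derive x (1 : R) q (- (x / s ^+ 2) * q x).
Proof.
rewrite (funext normal_pdf0E); apply: is_derive_eq.
by rewrite /GRing.scale/=; field.
Qed.

Lemma cont_normal_pdf : continuous q. Proof. exact: continuous_normal_pdf. Qed.

Let q0 x : 0 <= q x. Proof. exact: normal_pdf_ge0. Qed.

(** With y = x^2 / (4 s^2), the bound y exp(-y) <= 1 trades the factor x^2 for a Gaussian density of
    twice the variance, known to be integrable. *)
Lemma sqr_normal_pdf_le x :
  x ^+ 2 * q x <= 4 * s ^+ 2 * normal_peak s / normal_peak (s * Num.sqrt 2) *
     normal_pdf 0 (s * Num.sqrt 2) x.
Proof.
set s2 := s * Num.sqrt 2.
have s20 : 0 < s2 by rewrite mulr_gt0// sqrtr_gt0.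
have s2N0 : s2 != 0 by rewrite gt_eqF.
have s2E : s2 ^+ 2 = 2 * s ^+ 2 by rewrite /s2 exprMn sqr_sqrtr// mulrC.
have p2 : normal_peak s2 != 0 by rewrite gt_eqF// normal_peak_gt0.
rewrite normal_pdf0E normal_pdfE// /normal_fun subr0 -[s2 ^+ 2 *+ 2]mulr_natl s2E.
set y := x ^+ 2 / (4 * s ^+ 2).
have -> : - x ^+ 2 / (2 * (2 * s ^+ 2)) = - y by rewrite /y; field.
have -> : - x ^+ 2 / (2 * s ^+ 2) = - y + - y by rewrite /y; field.
have -> : x ^+ 2 = 4 * s ^+ 2 * y by rewrite /y; field.
rewrite expRD; set e := expR (- y).
have y0 : 0 <= y by rewrite divr_ge0 ?sqr_ge0// mulr_ge0 ?sqr_ge0.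
have ye : y * e <= 1.
  rewrite /e expRN ler_pdivrMr ?expR_gt0// mul1r.
  by have := expR_ge1Dx y; lra.
have -> : 4 * s ^+ 2 * normal_peak s / normal_peak s2 * (normal_peak s2 * e) =
   4 * s ^+ 2 * normal_peak s * e * 1 by field.
have -> : 4 * s ^+ 2 * y * (normal_peak s * (e * e)) =
   4 * s ^+ 2 * normal_peak s * e * (y * e) by ring.
apply: ler_wpM2l => //; apply: mulr_ge0; last exact: expR_ge0.
by apply: mulr_ge0; [apply: mulr_ge0; [|exact: sqr_ge0]|exact: normal_peak_ge0].
Qed.

Lemma integrable_dom (f g : R -> R) : continuous f -> leb.-integrable setT (EFin \o g) ->
  (forall x, `|f x| <= g x) -> leb.-integrable setT (EFin \o f).
Proof.
move=> cf ig fg; apply: (le_integrable _ _ _ ig) => //.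
  by apply/measurable_EFinP; exact: continuous_measurable_fun.
by move=> x _ /=; rewrite lee_fin; apply: le_trans (fg x) _; exact: ler_norm.
Qed.

Lemma integrable_q : leb.-integrable setT (EFin \o q).
Proof. exact: integrable_normal_pdf. Qed.

Let sq_cont : continuous (fun x : R => x ^+ 2 * q x).
Proof. by move=> x; apply: cvgM; [exact: exprn_continuous|exact: cont_normal_pdf]. Qed.

Lemma integrable_sqr_q : leb.-integrable setT (EFin \o (fun x => x ^+ 2 * q x)).
Proof.
apply: (integrable_dom (g := fun x => 4 * s ^+ 2 * normal_peak s /
  normal_peak (s * Num.sqrt 2) * normal_pdf 0 (s * Num.sqrt 2) x)) => //.
  apply: (integrableZl _ _ (integrable_normal_pdf 0 (s * Num.sqrt 2))) => //.
by move=> x; rewrite ger0_norm ?sqr_normal_pdf_le// mulr_ge0 ?sqr_ge0.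
Qed.

Let normDsq (x : R) : `|x| <= 1 + x ^+ 2.
Proof.
rewrite -(real_normK (num_real x)); have := sqr_ge0 (`|x| - 1); have := normr_ge0 x.
by move: (`|x|) => y; rewrite !expr2 => *; nra.
Qed.

Lemma integrable_bd (u : R -> R) (c : R) : continuous u ->
  (forall x, `|u x| <= c * (1 + x ^+ 2)) -> leb.-integrable setT (EFin \o (fun x => u x * q x)).
Proof.
move=> cu uc; apply: (integrable_dom (g := fun x => c * (q x + x ^+ 2 * q x))).
- by move=> x; apply: cvgM; [exact: cu|exact: cont_normal_pdf].
- pose Q2 x := x ^+ 2 * q x.
  have -> : EFin \o (fun x => c * (q x + x ^+ 2 * q x)) =
     (fun x : R => c%:E * ((EFin \o q) x + (EFin \o Q2) x))%E by [].
  apply: integrableZl => //; apply: integrableD => //.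
    exact: integrable_q.
  exact: integrable_sqr_q.
- move=> x; rewrite normrM (ger0_norm (q0 x)).
  have -> : c * (q x + x ^+ 2 * q x) = c * (1 + x ^+ 2) * q x by ring.
  by rewrite ler_wpM2r.
Qed.

Lemma normal_pdf_tail : exists2 C, 0 <= C & forall n x, `|x| = n.+1%:R ->
  `|x| * q x <= C * n.+1%:R^-1 /\ q x <= C * n.+1%:R^-1.
Proof.
set s2 := s * Num.sqrt 2; pose C : R := 4 * s ^+ 2 * normal_peak s / normal_peak s2 * normal_peak s2.
have s2N0 : s2 != 0 by rewrite gt_eqF// mulr_gt0// sqrtr_gt0.
have D0 : 0 <= 4 * s ^+ 2 * normal_peak s / normal_peak s2.
  apply: divr_ge0; last exact: normal_peak_ge0.
  by apply: mulr_ge0; [apply: mulr_ge0; [|exact: sqr_ge0]|exact: normal_peak_ge0].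
have C0 : 0 <= C by apply: mulr_ge0; last exact: normal_peak_ge0.
have H x : x ^+ 2 * q x <= C.
  by apply: le_trans (sqr_normal_pdf_le x) _; rewrite ler_wpM2l ?normal_pdf_ub.
exists C => // n x xn; have x0 : 0 < `|x| by rewrite xn.
have := H x; rewrite -(real_normK (num_real x)) -xn => Hx.
have x1 : 1 <= `|x| by rewrite xn ler1n.
have A : `|x| * q x <= C / `|x| by rewrite ler_pdivlMr// mulrAC -expr2.
by split=> //; apply: le_trans A; rewrite ler_peMl.
Qed.

Lemma cvg_tail (u : R -> R) : (forall x, `|u x| <= (`|x| + 1) * q x) ->
  (fun n => u n.+1%:R) @ \oo --> (0 : R) /\ (fun n => u (- n.+1%:R)) @ \oo --> (0 : R).
Proof.
move=> uq; have [C C0 H] := normal_pdf_tail.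
have key (e : nat -> R) : (forall n, `|e n| = n.+1%:R) -> (fun n => u (e n)) @ \oo --> (0 : R).
  move=> en; apply/norm_cvg0P.
  apply: (@squeeze_cvgr _ _ _ _ (fun=> 0) (fun n => 2 * C * n.+1%:R^-1)).
  - apply: nearW => n; rewrite normr_ge0/=; apply: le_trans (uq _) _.
    have [h1 h2] := H n _ (en n); rewrite mulrDl mul1r; apply: le_trans (lerD h1 h2) _.
    by rewrite le_eqVlt; apply/orP; left; apply/eqP; ring.
  - exact: cvg_cst.
  - by rewrite -(mulr0 (2 * C)); apply: cvgM; [exact: cvg_cst|exact: cvg_harmonic].
by split; apply: key => n; rewrite ?normrN ger0_norm.
Qed.

Let dq := is_derive_normal_pdf.

(** The derivative of x q(x) is q - (x^2 / s^2) q, and its integral vanishes. *)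
Lemma normal_variance : Rintegral leb setT (fun x => x ^+ 2 * q x) = s ^+ 2.
Proof.
pose f x := q x - (x ^+ 2 / s ^+ 2) * q x.
have cf : continuous f.
  move=> x; apply: cvgB; first exact: cont_normal_pdf.
  by apply: cvgM; [apply: cvgM; [exact: exprn_continuous|exact: cvg_cst]|exact: cont_normal_pdf].
have i1 := integrable_q; have i2 := integrable_sqr_q.
have fE : f = fun x => q x - (s ^+ 2)^-1 * (x ^+ 2 * q x).
  by apply: funext => x; rewrite /f; ring.
have i3 : leb.-integrable setT (EFin \o (fun x => (s ^+ 2)^-1 * (x ^+ 2 * q x))).
  by apply: (integrableZl _ _ i2).
have If : Rintegral leb setT f = 0.
  have bx x : `|x * q x| <= (`|x| + 1) * q x.
    by rewrite normrM (ger0_norm (q0 x)) ler_wpM2r// lerDl.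
  have [c1 c2] := @cvg_tail (fun x => x * q x) bx.
  apply: (@Rintegral_deriv_eq0 _ (fun x => x * q x)) => //.
    by move=> x; have dqx := dq x; apply: is_derive_eq; rewrite /GRing.scale/= /f; field.
  by rewrite fE; exact: (integrableB measurableT i1 i3).
have I1 : Rintegral leb setT q = 1.
  by rewrite /Rintegral integral_normal_pdf.
move: If; rewrite fE RintegralB// RintegralZl// I1.
move/eqP; rewrite subr_eq0 => /eqP H.
by rewrite -[RHS]mulr1 [X in _ * X]H mulrA divff ?mul1r// expf_neq0.
Qed.

Lemma cos_quad (y d : R) : `|cos (y + d) - cos y + d * sin y| <= 2 * d ^+ 2.
Proof.
have H : `|cos d - 1| <= d ^+ 2.
  have h (e : R) : 0 <= e -> `|cos e - 1| <= e ^+ 2.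
    move=> e0; have := cos_quad_ge0 e0; have := cos_le1 e; have := sqr_ge0 e => ? ? ?.
    by rewrite ler0_norm ?subr_le0//; lra.
  by have [/h//|/ltW] := leP 0 d; rewrite -oppr_ge0 => /h; rewrite cosN sqrrN.
rewrite cosD; have -> : cos y * cos d - sin y * sin d - cos y + d * sin y =
  cos y * (cos d - 1) - sin y * (sin d - d) by ring.
apply: le_trans (ler_normB _ _) _; rewrite !normrM mulr2n mulrDl mul1r.
have cx : `|cos y| <= 1 by rewrite ler_norml cos_geN1 cos_le1.
have sx : `|sin y| <= 1 by rewrite ler_norml sin_geN1 sin_le1.
apply: lerD; [apply: le_trans H|apply: le_trans (sin_quad d)]; by rewrite ler_piMl.
Qed.

(** Gaussian integration by parts gives the differential equation I' = - th s^2 I, so I(th) exp(th^2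
    s^2 / 2) is constant. The phase b stands for the imaginary part of the characteristic
    function. *)
Lemma normal_cos_fun (b th : R) :
  Rintegral leb setT (fun x => cos (th * x + b) * q x) = expR (- (th ^+ 2 * s ^+ 2 / 2)) * cos b.
Proof.
pose I th := Rintegral leb setT (fun x => cos (th * x + b) * q x).
have ccos (th' : R) : continuous (fun x : R => cos (th' * x + b)).
  move=> x; apply: (@continuous_comp _ _ _ (fun x => th' * x + b) cos); last exact: continuous_cos.
  by apply: cvgD; [apply: cvgM; [exact: cvg_cst|exact: cvg_id]|exact: cvg_cst].
have csin (th' : R) : continuous (fun x : R => sin (th' * x + b)).
  move=> x; apply: (@continuous_comp _ _ _ (fun x => th' * x + b) sin); last exact: continuous_sin.
  by apply: cvgD; [apply: cvgM; [exact: cvg_cst|exact: cvg_id]|exact: cvg_cst].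
have c1 x : `|cos x| <= 1 :> R by rewrite ler_norml cos_geN1 cos_le1.
have s1 x : `|sin x| <= 1 :> R by rewrite ler_norml sin_geN1 sin_le1.
have ic th' : leb.-integrable setT (EFin \o (fun x => cos (th' * x + b) * q x)).
  apply: (@integrable_bd _ 1) => // x; rewrite mul1r; apply: le_trans (c1 _) _.
  by rewrite lerDl sqr_ge0.
have is_ th' : leb.-integrable setT (EFin \o (fun x => (x * sin (th' * x + b)) * q x)).
  apply: (@integrable_bd _ 1).
    by move=> x; apply: cvgM; [exact: cvg_id|exact: csin].
  by move=> x; rewrite mul1r normrM; apply: le_trans (normDsq x); rewrite ler_piMr.
have parts th' : Rintegral leb setT (fun x => (x * sin (th' * x + b)) * q x) =
    th' * s ^+ 2 * I th'.
  pose f x := th' * (cos (th' * x + b) * q x) - (s ^+ 2)^-1 * ((x * sin (th' * x + b)) * q x).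
  have i1 : leb.-integrable setT (EFin \o (fun x => th' * (cos (th' * x + b) * q x))).
    exact: (integrableZl _ _ (ic th')).
  have i2 : leb.-integrable setT (EFin \o (fun x => (s ^+ 2)^-1 * ((x * sin (th' * x + b)) * q x))).
    exact: (integrableZl _ _ (is_ th')).
  have If : Rintegral leb setT f = 0.
    have bx x : `|sin (th' * x + b) * q x| <= (`|x| + 1) * q x.
      rewrite normrM (ger0_norm (q0 x)) ler_wpM2r//.
      by apply: le_trans (s1 _) _; rewrite lerDr.
    have [t1 t2] := @cvg_tail (fun x => sin (th' * x + b) * q x) bx.
    apply: (@Rintegral_deriv_eq0 _ (fun x => sin (th' * x + b) * q x)) => //.
    - by move=> x; have dqx := dq x; apply: is_derive_eq; rewrite /GRing.scale/= /f; field.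
    - move=> x; apply: cvgB; (apply: cvgM; first exact: cvg_cst).
        by apply: cvgM; [exact: ccos|exact: cont_normal_pdf].
      by apply: cvgM; [apply: cvgM; [exact: cvg_id|exact: csin]|exact: cont_normal_pdf].
    - exact: (integrableB measurableT i1 i2).
  move: If; rewrite /f RintegralB// (@RintegralZl _ _ _ leb setT _ th' measurableT (ic th')).
  rewrite (@RintegralZl _ _ _ leb setT _ _ measurableT (is_ th')).
  rewrite -/(I th') => /eqP; rewrite subr_eq0 => /eqP H.
  by rewrite mulrAC H mulrAC mulVf ?mul1r// expf_neq0.
have dI th' : is_derive th' (1 : R) I (- (th' * s ^+ 2) * I th').
  apply: (@is_derive_quad _ _ _ _ (2 * s ^+ 2) 1) => // h _.
  rewrite mulNr mulrN opprK -parts -(@RintegralZl _ _ _ leb setT _ h measurableT (is_ th')).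
  have iB := integrableB measurableT (ic (h + th')) (ic th').
  have iS : leb.-integrable setT (EFin \o (fun x => h * ((x * sin (th' * x + b)) * q x))).
    exact: (integrableZl _ _ (is_ th')).
  rewrite /I -(RintegralB measurableT (ic _) (ic _)) -(RintegralD measurableT iB iS).
  pose F x := (cos ((h + th') * x + b) - cos (th' * x + b) + h * x * sin (th' * x + b)) * q x.
  rewrite (_ : Rintegral _ _ _ = Rintegral leb setT F); last first.
    by apply: eq_Rintegral => x _; rewrite /F; ring.
  have FB x : `|F x| <= 2 * h ^+ 2 * (x ^+ 2 * q x).
    rewrite /F normrM (ger0_norm (q0 x)) mulrA ler_wpM2r//.
    have -> : (h + th') * x + b = (th' * x + b) + h * x by ring.
    by apply: le_trans (cos_quad _ _) _; rewrite exprMn mulrA.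
  have cF : continuous F.
    move=> x; apply: cvgM; last exact: cont_normal_pdf.
    apply: cvgD; first by apply: cvgB; exact: ccos.
    by apply: cvgM; [apply: cvgM; [exact: cvg_cst|exact: cvg_id]|exact: csin].
  have ig : leb.-integrable setT (EFin \o (fun x => 2 * h ^+ 2 * (x ^+ 2 * q x))).
    exact: (integrableZl _ _ integrable_sqr_q).
  have iF := integrable_dom cF ig FB.
  apply: le_trans (le_normr_Rintegral _ iF) _ => //.
  apply: (@le_trans _ _ (Rintegral leb setT (fun x => 2 * h ^+ 2 * (x ^+ 2 * q x)))).
    by apply: le_Rintegral => //; exact: integrable_norm.
  rewrite RintegralZl//; last exact: integrable_sqr_q.
  by rewrite normal_variance le_eqVlt; apply/orP; left; apply/eqP; ring.
pose J x := I x * expR (x ^+ 2 * s ^+ 2 / 2).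
have dJ x : is_derive x (1 : R) J 0.
  by have dIx := dI x; apply: is_derive_eq; rewrite /GRing.scale/=; field.
have J0 : J th = cos b.
  rewrite (is_derive_0_is_cst th 0 dJ) /J expr0n/= !mul0r expR0 mulr1 /I.
  rewrite (_ : Rintegral _ _ _ = Rintegral leb setT (fun x => cos b * q x)); last first.
    by apply: eq_Rintegral => x _; rewrite mul0r add0r.
  rewrite RintegralZl//; last exact: integrable_q.
  by rewrite /Rintegral integral_normal_pdf mulr1.
by rewrite -J0 /J mulrCA -expRD addNr expR0 mulr1.
Qed.

End Gaussian.

(** * Trigonometric polynomials in several variables *)

Section Trigonometric.
Context (R : realType) (I : finType).
Implicit Types S T : (I -> R) -> R.

(** Finite combinations of cosines with phases: the phases include sines, and the product formula
    for cosines makes the class an algebra. *)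
Definition trig T := exists l : seq (R * (I -> R) * R), forall v,
  T v = \sum_(x <- l) x.1.1 * cos (\sum_i x.1.2 i * v i + x.2).

Lemma eq_trig S T : S =1 T -> trig S -> trig T.
Proof. by move=> /funext ->. Qed.

Lemma trig_cos (a : I -> R) (b : R) : trig (fun v => cos (\sum_i a i * v i + b)).
Proof. by exists [:: (1, a, b)] => v; rewrite big_seq1/= mul1r. Qed.

Lemma trigD S T : trig S -> trig T -> trig (fun v => S v + T v).
Proof. by move=> [l lE] [m mE]; exists (l ++ m) => v; rewrite big_cat/= lE mE. Qed.

Lemma trigZ c T : trig T -> trig (fun v => c * T v).
Proof.
move=> [l lE]; exists [seq (c * x.1.1, x.1.2, x.2) | x <- l] => v.
by rewrite big_map lE mulr_sumr; apply: eq_bigr => x _ /=; rewrite mulrA.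
Qed.

Lemma trig_cst c : trig (fun=> c).
Proof.
apply: (eq_trig _ (trigZ c (trig_cos (fun=> 0) 0))) => v /=.
by rewrite big1 ?addr0 ?cos0 ?mulr1// => i _; rewrite mul0r.
Qed.

Lemma trig_sum (J : Type) (s : seq J) (F : J -> (I -> R) -> R) :
  (forall j, trig (F j)) -> trig (fun v => \sum_(j <- s) F j v).
Proof.
move=> tF; elim: s => [|j s IH].
  by apply: (eq_trig _ (trig_cst 0)) => v; rewrite big_nil.
by apply: (eq_trig _ (trigD (tF j) IH)) => v; rewrite big_cons.
Qed.

Lemma trigM S T : trig S -> trig T -> trig (fun v => S v * T v).
Proof.
move=> [l lE] [m mE].
apply: (@eq_trig (fun v => \sum_(x <- l) \sum_(y <- m)
  (x.1.1 * y.1.1) * (cos (\sum_i x.1.2 i * v i + x.2) * cos (\sum_i y.1.2 i * v i + y.2)))).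
  move=> v; rewrite lE mE mulr_suml; apply: eq_bigr => x _.
  by rewrite mulr_sumr; apply: eq_bigr => y _; ring.
apply: trig_sum => x; apply: trig_sum => y; apply: trigZ.
apply: (@eq_trig (fun v => 2^-1 *
  (cos (\sum_i (x.1.2 i + y.1.2 i) * v i + (x.2 + y.2)) +
   cos (\sum_i (x.1.2 i - y.1.2 i) * v i + (x.2 - y.2))))); last first.
  by apply: trigZ; apply: trigD; exact: trig_cos.
move=> v; set A := \sum_i x.1.2 i * v i; set B := \sum_i y.1.2 i * v i.
have -> : \sum_i (x.1.2 i + y.1.2 i) * v i + (x.2 + y.2) = (A + x.2) + (B + y.2).
  rewrite (eq_bigr (fun i => x.1.2 i * v i + y.1.2 i * v i)) => [|i _]; last by rewrite mulrDl.
  by rewrite big_split/= -/A -/B; ring.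
have -> : \sum_i (x.1.2 i - y.1.2 i) * v i + (x.2 - y.2) = (A + x.2) - (B + y.2).
  rewrite (eq_bigr (fun i => x.1.2 i * v i - y.1.2 i * v i)) => [|i _]; last by rewrite mulrBl.
  by rewrite sumrB -/A -/B; ring.
by rewrite cosD cosB; field.
Qed.

Lemma trig_prod (J : Type) (s : seq J) (F : J -> (I -> R) -> R) :
  (forall j, trig (F j)) -> trig (fun v => \prod_(j <- s) F j v).
Proof.
move=> tF; elim: s => [|j s IH].
  by apply: (eq_trig _ (trig_cst 1)) => v; rewrite big_nil.
by apply: (eq_trig _ (trigM (tF j) IH)) => v; rewrite big_cons.
Qed.

Lemma trigX T n : trig T -> trig (fun v => T v ^+ n).
Proof.
move=> tT; elim: n => [|n IH]; first exact: (eq_trig _ (trig_cst 1)).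
by apply: (eq_trig _ (trigM tT IH)) => v; rewrite exprS.
Qed.

Lemma trig_sin i (L : R) : trig (fun v => sin (v i / L)).
Proof.
apply: (eq_trig _ (trig_cos (fun j => if j == i then L^-1 else 0) (- (pi / 2)))) => v.
rewrite (bigD1 i)//= eqxx big1 ?addr0; last by move=> j /negbTE ->; rewrite mul0r.
by rewrite cosB cos_pihalf sin_pihalf mulr0 mulr1 add0r mulrC.
Qed.

End Trigonometric.

(** * Approximation of Lipschitz functions by trigonometric polynomials *)

Section Bernstein.
Context (R : realType).
Implicit Types (p x : R) (f : nat -> R).

Definition bernw n p j : R := 'C(n, j)%:R * p ^+ j * (1 - p) ^+ (n - j).
Definition bern n f p : R := \sum_(j < n.+1) bernw n p j * f j.

Lemma bernS n f p : bern n.+1 f p = p * bern n (f \o S) p + (1 - p) * bern n f p.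
Proof.
rewrite /bern big_ord_recl/=.
rewrite (eq_bigr (fun j : 'I_n.+1 => p * (bernw n p j * f j.+1) +
   (1 - p) * ('C(n, j.+1)%:R * p ^+ j.+1 * (1 - p) ^+ (n - j.+1) * f j.+1))); last first.
  move=> j _; rewrite /bernw /bump/= add1n binS natrD subSS.
  case: (ltnP j n) => jn.
    by rewrite -[in (1 - p) ^+ (n - j)](subnSK jn) !exprS; ring.
  by rewrite (bin_small (_ : (n < j.+1)%N))// exprS; ring.
rewrite big_split/= -!mulr_sumr addrCA; congr (_ + _).
rewrite [in RHS]big_ord_recl/= mulrDr big_ord_recr/= (bin_small (ltnSn n)).
rewrite !mul0r addr0; congr (_ + _); first by rewrite /bernw !bin0 !subn0 exprS !expr0; ring.
Qed.

(** The variance of a binomial law. The shift c is there for the induction: the recursion [bernS]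
    changes the centre. *)
Lemma bern_var n (c : R) p :
  bern n (fun j => (j%:R + c - n%:R * p) ^+ 2) p = n%:R * (p * (1 - p)) + c ^+ 2.
Proof.
elim: n c => [|n IH] c.
  by rewrite /bern big_ord1 /bernw bin0 subnn /= !expr0; ring.
rewrite bernS.
have -> : (fun j => (j%:R + c - n.+1%:R * p) ^+ 2) = fun j => (j%:R + (c - p) - n%:R * p) ^+ 2.
  by apply: funext => j /=; rewrite -[n.+1%:R]natr1; ring.
have -> : (fun j => (j%:R + (c - p) - n%:R * p) ^+ 2) \o S =
    fun j => (j%:R + (1 + c - p) - n%:R * p) ^+ 2.
  by apply: funext => j /=; rewrite -[j.+1%:R]natr1; ring.
by rewrite !IH -[n.+1%:R]natr1; ring.
Qed.

Lemma bern1 n p : bern n (fun=> 1) p = 1.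
Proof.
elim: n => [|n IH]; first by rewrite /bern big_ord1 /bernw bin0 subnn /= !expr0; ring.
by rewrite bernS (_ : _ \o S = fun=> 1)// IH; ring.
Qed.

Lemma bernw_ge0 n p j : 0 <= p <= 1 -> 0 <= bernw n p j.
Proof.
by move=> /andP[p0 p1]; rewrite /bernw !mulr_ge0 ?exprn_ge0 ?subr_ge0.
Qed.

(** The success probability of a binomial law whose rescaled mean, through [bnode], is L sin(x / L),
    hence close to x for large L. A Bernstein polynomial evaluated at [sinp] is a trigonometric
    polynomial defined on the whole line. *)
Definition sinp (L x : R) := (1 + sin (x / L)) / 2.
Definition bnode (L : R) n (j : nat) : R := L * (2 * j%:R / n%:R - 1).

Lemma sinp01 L x : 0 <= sinp L x <= 1.
Proof.
have := sin_geN1 (x / L); have := sin_le1 (x / L); rewrite /sinp => ? ?.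
by apply/andP; split; lra.
Qed.

(** The three terms are the binomial variance divided by de, the threshold de below which deviations
    are simply accepted, and the error of L sin(x / L) against x. *)
Lemma bern_error (L de x : R) n : 0 < L -> 0 < de ->
  bern n.+1 (fun j => `|bnode L n.+1 j - x|) (sinp L x) <=
  L ^+ 2 / (n.+1%:R * de) + de + x ^+ 2 / L.
Proof.
move=> L0 de0; set p := sinp L x; have p01 : 0 <= p <= 1 by exact: sinp01.
have n0 : n.+1%:R != 0 :> R by rewrite pnatr_eq0.
pose a : R := 4 * L ^+ 2 / (n.+1%:R ^+ 2 * de).
pose b : R := de + x ^+ 2 / L.
have pt j : `|bnode L n.+1 j - x| <= a * (j%:R + 0 - n.+1%:R * p) ^+ 2 + b * 1.
  have -> : bnode L n.+1 j - x = (bnode L n.+1 j - L * sin (x / L)) + L * (sin (x / L) - x / L).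
    by field; rewrite gt_eqF.
  apply: le_trans (ler_normD _ _) _.
  have -> : bnode L n.+1 j - L * sin (x / L) = 2 * L / n.+1%:R * (j%:R - n.+1%:R * p).
    by rewrite /bnode /p /sinp; field.
  set y := 2 * L / n.+1%:R * _.
  have Y : `|y| <= y ^+ 2 / de + de.
    have [yd|yd] := leP `|y| de.
      by apply: le_trans yd _; rewrite lerDr divr_ge0 ?sqr_ge0// ltW.
    apply: (@le_trans _ _ (y ^+ 2 / de)); last by rewrite lerDl ltW.
    by rewrite ler_pdivlMr// -[y ^+ 2]real_normK ?num_real// expr2 ler_wpM2l// ltW.
  have X : `|L * (sin (x / L) - x / L)| <= x ^+ 2 / L.
    rewrite normrM (gtr0_norm L0); apply: (@le_trans _ _ (L * (x / L) ^+ 2)).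
      by rewrite ler_pM2l// sin_quad.
    by rewrite le_eqVlt; apply/orP; left; apply/eqP; field; rewrite gt_eqF.
  apply: le_trans (lerD Y X) _; rewrite le_eqVlt; apply/orP; left; apply/eqP.
  rewrite /a /b /y; move: (n.+1%:R : R) n0 (p) => m m0 z.
  by field; rewrite m0 !gt_eqF.
apply: (@le_trans _ _ (a * bern n.+1 (fun j => (j%:R + 0 - n.+1%:R * p) ^+ 2) p +
    b * bern n.+1 (fun=> 1) p)).
  rewrite /bern !mulr_sumr -big_split/=; apply: ler_sum => j _.
  rewrite (mulrCA a) (mulrCA b) -mulrDr ler_wpM2l ?bernw_ge0//.
rewrite bern_var bern1 mulr1 /b addrA lerD2r lerD2r expr0n addr0.
have pp : 4 * (p * (1 - p)) <= 1.
  by rewrite -subr_ge0 (_ : _ - _ = (1 - 2 * p) ^+ 2) ?sqr_ge0//; ring.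
have -> : a * (n.+1%:R * (p * (1 - p))) = L ^+ 2 / (n.+1%:R * de) * (4 * (p * (1 - p))).
  rewrite /a; move: (n.+1%:R : R) n0 (p) => m m0 z.
  by field; rewrite m0 gt_eqF.
by rewrite ler_piMr// divr_ge0 ?sqr_ge0 ?mulr_ge0// ltW.
Qed.

Context (I : finType).

(** Products of one-dimensional Bernstein weights form a probability on the grid of nodes whose
    marginals are the one-dimensional weights ([wtm]), so the errors add over the coordinates. *)
Lemma trig_approx_err (g : (I -> R) -> R) (Lip L de : R) n :
  (forall u v, `|g u - g v| <= Lip * \sum_i `|u i - v i|) -> 0 <= Lip -> 0 < L -> 0 < de ->
  exists2 T, trig T & forall v,
    `|T v - g v| <= Lip * \sum_i (L ^+ 2 / (n.+1%:R * de) + de + v i ^+ 2 / L).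
Proof.
move=> gL Lip0 L0 de0.
pose wt (B : {ffun I -> 'I_n.+2}) (v : I -> R) := \prod_i bernw n.+1 (sinp L (v i)) (B i).
pose nd (B : {ffun I -> 'I_n.+2}) i := bnode L n.+1 (B i).
have wt0 B v : 0 <= wt B v by apply: prodr_ge0 => i _; apply: bernw_ge0; exact: sinp01.
have wt1 v : \sum_B wt B v = 1.
  rewrite /wt -(bigA_distr_bigA (fun i (j : 'I_n.+2) => bernw n.+1 (sinp L (v i)) j)).
  rewrite big1// => i _; rewrite -[RHS](bern1 n.+1 (sinp L (v i))).
  by apply: eq_bigr => j _; rewrite mulr1.
have wtm v i (h : nat -> R) : \sum_B wt B v * h (B i) = bern n.+1 h (sinp L (v i)).
  transitivity (\sum_(B : {ffun I -> 'I_n.+2}) \prod_l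
      (bernw n.+1 (sinp L (v l)) (B l) * (if l == i then h (B l) else 1))).
    apply: eq_bigr => B _; rewrite big_split/=; congr (_ * _).
    rewrite (bigD1 i)//= eqxx big1 ?mulr1// => l /negbTE -> //.
  rewrite -(bigA_distr_bigA (fun l (j : 'I_n.+2) => bernw n.+1 (sinp L (v l)) j *
      (if l == i then h j else 1))).
  rewrite (bigD1 i)//= [X in _ * X]big1 ?mulr1.
    by apply: eq_bigr => j _; rewrite eqxx.
  move=> l /negbTE li; rewrite -[RHS](bern1 n.+1 (sinp L (v l))).
  by apply: eq_bigr => j _; rewrite li.
exists (fun v => \sum_B g (nd B) * wt B v).
  apply: trig_sum => B; apply: trigZ; apply: trig_prod => i.
  have tp : trig (fun v : I -> R => sinp L (v i)).
    apply: (eq_trig _ (trigZ 2^-1 (trigD (trig_cst I 1) (trig_sin i L)))) => v.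
    by rewrite /sinp mulrC.
  apply: trigM; first by apply: trigZ; exact: trigX.
  apply: trigX; apply: (eq_trig _ (trigD (trig_cst I 1) (trigZ (-1) tp))) => v.
  by rewrite mulN1r.
move=> v.
have -> : \sum_B g (nd B) * wt B v - g v = \sum_B (g (nd B) - g v) * wt B v.
  rewrite [RHS](eq_bigr (fun B => g (nd B) * wt B v - g v * wt B v)) => [|B _]; last by rewrite mulrBl.
  by rewrite sumrB -mulr_sumr wt1 mulr1.
apply: le_trans (ler_norm_sum _ _ _) _.
apply: (@le_trans _ _ (\sum_B Lip * \sum_i wt B v * `|nd B i - v i|)).
  apply: ler_sum => B _; rewrite normrM (ger0_norm (wt0 B v)) -mulr_sumr.
  by rewrite (mulrCA Lip) mulrC ler_wpM2l.
rewrite -mulr_sumr ler_wpM2l// exchange_big/=; apply: ler_sum => i _.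
rewrite (wtm v i (fun j => `|bnode L n.+1 j - v i|)).
exact: bern_error.
Qed.

(** The approximation is not uniform: its error grows quadratically, which second moment bounds can
    absorb. The choices are L = 1 / c, de = c / 2, and n so large that the variance term is at most
    c / 2. *)
Lemma trig_approx (g : (I -> R) -> R) (Lip e : R) :
  (forall u v, `|g u - g v| <= Lip * \sum_i `|u i - v i|) -> 0 <= Lip -> 0 < e ->
  exists2 T, trig T & forall v, `|T v - g v| <= e * \sum_i (1 + v i ^+ 2).
Proof.
move=> gL Lip0 e0; pose c := e / (Lip + 1).
have Lip1 : 0 < Lip + 1 by rewrite ltr_wpDl.
have c0 : 0 < c by rewrite divr_gt0.
have cE : Lip * c <= e by rewrite /c mulrA ler_pdivrMr// mulrC ler_pM2l//; lra.
clearbody c; pose n := Num.trunc (4 * c^-1 ^+ 2 / c ^+ 2).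
have ci : 0 < c^-1 by rewrite invr_gt0.
have c20 : 0 < c / 2 by rewrite divr_gt0.
have [T tT TE] := @trig_approx_err g Lip c^-1 (c / 2) n gL Lip0 ci c20.
exists T => // v; apply: le_trans (TE v) _.
apply: (@le_trans _ _ (Lip * (c * \sum_i (1 + v i ^+ 2)))).
  rewrite ler_wpM2l// mulr_sumr; apply: ler_sum => i _.
  rewrite invrK mulrDr mulr1 [v i ^+ 2 * c]mulrC lerD2r.
  apply: (@le_trans _ _ (c / 2 + c / 2)); last lra.
  rewrite lerD2r.
  rewrite ler_pdivrMr ?mulr_gt0 ?divr_gt0//.
  have := ltW (truncnS_gt (4 * c^-1 ^+ 2 / c ^+ 2)); rewrite -/n ler_pdivrMr ?exprn_gt0//.
  by move: (n.+1%:R) => y Hy; nra.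
by rewrite mulrA ler_wpM2r// sumr_ge0// => i _; rewrite addr_ge0 ?sqr_ge0.
Qed.

End Bernstein.

(** * The Kac kernel *)

Section Bump.
Context (R : realType) (q : {poly R}) (c : R).
Hypothesis c0 : 0 < c.
Implicit Types p : {poly R}.

(** The functions p q^-m exp(-c / q) on the set q > 0, extended by 0: a family closed under
    derivation, which turns smoothness into an induction on p and m. *)
Definition bump_fun p m (u : R) : R :=
  if 0 < q.[u] then p.[u] * q.[u]^-1 ^+ m * expR (- (c / q.[u])) else 0.

Lemma is_derive_horner p (x : R) : is_derive x (1 : R) (fun u => p.[u]) (p^`()).[x].
Proof.
elim/poly_ind: p => [|p a IH].
  rewrite deriv0 horner0 (_ : (fun u => _) = cst 0); first exact: is_derive_cst.
  by apply: funext => u; rewrite horner0.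
rewrite (_ : (fun u => _) = fun u => p.[u] * u + a); last first.
  by apply: funext => u; rewrite hornerMXaddC.
by apply: is_derive_eq; rewrite derivMXaddC !hornerE /GRing.scale/=; ring.
Qed.

Lemma continuous_poly p : continuous (fun u : R => p.[u]).
Proof.
move=> x; apply: differentiable_continuous; apply/derivable1_diffP.
by case: (is_derive_horner p x).
Qed.

Lemma flat_bound m : exists2 C : R, 0 <= C &
  forall y : R, 0 < y -> y^-1 ^+ m * expR (- (c / y)) <= C * y ^+ 2.
Proof.
exists ((m.+2)`!%:R / c ^+ m.+2); first by rewrite divr_ge0// exprn_ge0// ltW.
move=> y y0; have z0 : 0 <= c / y by rewrite divr_ge0// ltW.
have := expR_ge1Dxn m.+1 z0; rewrite expRN => H.
rewrite ler_pdivrMr ?expR_gt0//; apply: (@le_trans _ _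
  ((m.+2)`!%:R / c ^+ m.+2 * y ^+ 2 * ((c / y) ^+ m.+2 / m.+2`!%:R))).
  rewrite le_eqVlt; apply/orP; left; apply/eqP.
  have k0 : m.+2`!%:R != 0 :> R by rewrite pnatr_eq0 -lt0n fact_gt0.
  rewrite expr_div_n exprVn -(addn2 m) [y ^+ (m + 2)]exprD.
  have cm : c ^+ (m + 2) != 0 by rewrite expf_neq0// gt_eqF.
  have ym : y ^+ m != 0 by rewrite expf_neq0// gt_eqF.
  rewrite addn2 in k0 cm *; field.
  by rewrite k0 cm ym gt_eqF.
rewrite ler_wpM2l//; last by lra.
by rewrite mulr_ge0 ?sqr_ge0// divr_ge0// exprn_ge0// ltW.
Qed.

(** The numerator of the derivative of p q^-m exp(-c / q) over the denominator q^(m+2). *)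
Definition bump_step p m : {poly R} :=
  p^`() * q ^+ 2 - m%:R *: (p * q^`() * q) + c *: (p * q^`()).

(** At a root x of q, the factorization of q by X - x and the flatness of exp(-c / q) bound the
    values nearby by a multiple of h^2, so the derivative is 0. Elsewhere the sign of q is locally
    constant. *)
Lemma is_derive_bump p m (x : R) :
  is_derive x (1 : R) (bump_fun p m) (bump_fun (bump_step p m) m.+2 x).
Proof.
have cq := @continuous_poly q x.
have [q0|q0|q0] := ltgtP q.[x] 0.
- apply: (@near_eq_is_derive _ _ _ (cst 0)); last first.
    by rewrite /bump_fun ltNge (ltW q0)/=; exact: is_derive_cst.
  near=> u; rewrite /bump_fun ltNge ltW//.
  by near: u; apply: cvgr_lt q0; exact: cq.
- have qx := is_derive_horner q x; have px := is_derive_horner p x.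
  have qN : q.[x] != 0 by rewrite gt_eqF.
  pose v u := q.[u]^-1; pose w u := p.[u].
  have vx : is_derive x (1 : R) v (- (q.[x] ^- 2 * q^`().[x])).
    by rewrite -mulNr; exact: is_deriveV.
  have wx : is_derive x (1 : R) w p^`().[x] by exact: px.
  pose z u := v u ^+ m.
  have zx : is_derive x (1 : R) z (m%:R * v x ^+ m.-1 * - (q.[x] ^- 2 * q^`().[x])).
    rewrite /z; elim: (m) => [|k IH].
      rewrite !mul0r (_ : (fun u => _) = cst 1); first exact: is_derive_cst.
      by apply: funext => u; rewrite expr0.
    rewrite (_ : (fun u => _) = fun u => v u * v u ^+ k); last first.
      by apply: funext => u; rewrite exprS.
    apply: is_derive_eq; rewrite /GRing.scale/=.
    move: (v x) (- (q.[x] ^- 2 * q^`().[x])) => a b.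
    case: (k) => [|j] /=; first by rewrite !expr0; ring.
    by rewrite exprS -[j.+2%:R]natr1; ring.
  apply: (@near_eq_is_derive _ _ _ (fun u => w u * z u * expR (- (c * v u)))).
    near=> u; rewrite /bump_fun ifT//.
    by near: u; apply: cvgr_gt q0; exact: cq.
  have zE : z x = q.[x]^-1 ^+ m by [].
  have vE : v x = q.[x]^-1 by [].
  have wE : w x = p.[x] by [].
  rewrite vE in zx.
  clearbody z v w; apply: is_derive_eq.
  have qS : q.[x]^-1 ^+ m.+2 = q.[x]^-1 * (q.[x]^-1 * q.[x]^-1 ^+ m) by rewrite !exprS.
  have qP : m%:R * q.[x]^-1 ^+ m.-1 = m%:R * (q.[x] * q.[x]^-1 ^+ m).
    by case: (m) => [|k]; rewrite ?mul0r// [in RHS]exprS mulVKf.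
  rewrite zE vE wE /bump_fun q0 /bump_step qS qP !hornerE.
  move: (q.[x]^-1 ^+ m) (expR _) (m%:R) => a b n.
  by rewrite /GRing.scale/=; field.
- rewrite /bump_fun [in X in is_derive _ _ _ X]q0 ltxx.
  have [C C0 H] := flat_bound m.
  have /factor_theorem[q1 q1E] : root q x by apply/rootP.
  pose M : R := (`|p.[x]| + 1) * C * (`|q1.[x]| + 1) ^+ 2.
  have : \forall u \near x, `|p.[u]| < `|p.[x]| + 1 /\ `|q1.[u]| < `|q1.[x]| + 1.
    have cc r : (fun u => `|r.[u]|) @ x --> `|r.[x]|.
      by apply: (@cvg_norm _ R^o); exact: continuous_poly.
    near=> u; split.
      by near: u; apply: (cvgr_lt _ (cc p)); rewrite ltrDl.
    by near: u; apply: (cvgr_lt _ (cc q1)); rewrite ltrDl.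
  move=> [de /= de0 near_x].
  apply: (@is_derive_quad _ _ _ _ M de) => // h hd.
  rewrite mulr0 subr0 q0 ltxx subr0.
  have [|pu qu] := near_x (h + x).
    by rewrite /ball/= opprD addrCA subrr addr0 normrN.
  have M0 : 0 <= M * h ^+ 2.
    by rewrite mulr_ge0 ?sqr_ge0// mulr_ge0 ?sqr_ge0// mulr_ge0// addr_ge0.
  case: ifP => qp; last by rewrite normr0.
  rewrite -mulrA normrM (ger0_norm (mulr_ge0 _ _)) ?expR_ge0 ?exprn_ge0 ?invr_ge0 ?(ltW qp)//.
  apply: (@le_trans _ _ ((`|p.[x]| + 1) * (C * q.[h + x] ^+ 2))).
    apply: ler_pM => //; last exact: H.
      by rewrite mulr_ge0 ?expR_ge0// exprn_ge0// invr_ge0 ltW.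
    exact: ltW.
  rewrite /M -!mulrA ler_wpM2l ?addr_ge0// ler_wpM2l//.
  have -> : q.[h + x] = q1.[h + x] * h by rewrite [in LHS]q1E !hornerE addrK.
  rewrite mulrA -expr2 exprMn ler_wpM2r ?sqr_ge0//.
  rewrite -(real_normK (num_real q1.[_])) lerXn2r// ?nnegrE ?addr_ge0//; exact: ltW.
Unshelve. all: by end_near. Qed.

Lemma derive1_bump p m : derive1 (bump_fun p m) = bump_fun (bump_step p m) m.+2.
Proof.
apply: funext => x; rewrite derive1E; have := is_derive_bump p m x => d.
exact: derive_val.
Qed.

Lemma smooth_bump p m : smooth (bump_fun p m).
Proof.
move=> n x; have [p' [m' ->]] : exists p' m', derive1n n (bump_fun p m) = bump_fun p' m'.
  elim: n => [|n [p' [m' E]]]; first by exists p, m.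
  by exists (bump_step p' m'), m'.+2; rewrite derive1nS E derive1_bump.
by case: (is_derive_bump p' m' x).
Qed.

End Bump.

(** * From the weak derivative to the increments of the kernel *)

Section WeakDerivative.
Context (R : realType).
Local Notation leb := (@lebesgue_measure R).

(** On an interval where phi is monotone, in the direction given by [sg], the derivative of phi is a
    measure of constant sign and K may be replaced by any constant k close to it. *)
Lemma sign_mass (K phi phi' : R -> R) (a b k eta sg : R) : a <= b -> continuous K ->
  (forall u, is_derive u (1 : R) phi (phi' u)) -> continuous phi' ->
  (forall u, a <= u <= b -> 0 <= sg * phi' u) -> `|sg| = 1 ->
  (forall u, a <= u <= b -> `|K u - k| <= eta) ->
  `|Rintegral leb `[a, b] (fun u => K u * phi' u) - k * (phi b - phi a)| <=
   eta * (sg * (phi b - phi a)).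
Proof.
move=> ab cK dphi cphi' sphi sg1 Kk; have mI := measurable_itv `[a, b] : measurable `[a,b]%classic.
have fI := itvc_fin a b.
have b1 : bdmeas (`[a, b] : set R) phi' by exact: cont_bdmeas.
have bK : bdmeas (`[a, b] : set R) K by exact: cont_bdmeas.
have bKp := bdmeasM bK b1.
have bk := bdmeasZ k b1.
pose IZ c f := @IntZ _ _ R leb `[a, b]%classic mI fI c f.
rewrite -(ftc ab dphi cphi') -(IZ sg _ b1) -(IZ k _ b1).
rewrite -(IZ eta _ (bdmeasZ sg b1)) -(@IntB _ _ R leb _ mI fI _ _ bKp bk).
apply: le_trans (@Int_norm _ _ R leb _ mI fI _ (bdmeasB bKp bk)) _.
apply: (@le_Int _ _ R leb _ mI fI) => //; [exact: bdmeas_norm (bdmeasB bKp bk)|exact: bdmeasZ (bdmeasZ sg b1)|].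
move=> u /=; rewrite in_itv/= => uab.
rewrite -mulrBl normrM; have -> : sg * phi' u = `|phi' u|.
  by rewrite -[LHS]ger0_norm ?sphi// normrM sg1 mul1r.
by rewrite ler_wpM2r// Kk.
Qed.

Lemma dist_right (x u de d : R) : x <= u <= x + de -> de < d -> `|u - x| < d.
Proof. by move=> /andP[xu ud] dd; rewrite ger0_norm ?subr_ge0//; lra. Qed.

Lemma dist_left (y u de d : R) : y - de <= u <= y -> de < d -> `|u - y| < d.
Proof. by move=> /andP[xu ud] dd; rewrite ler0_norm ?subr_le0//; lra. Qed.

Lemma mass_balance (I1 I2 I3 I4 kx ky e e1 e2 B G eta pm : R) :
  `|I1 - kx * (e - 0)| <= e1 * (1 * (e - 0)) ->
  `|I2 - 0 * (pm - e)| <= B * (1 * (pm - e)) ->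
  `|I3 - 0 * (e - pm)| <= B * (-1 * (e - pm)) ->
  `|I4 - ky * (0 - e)| <= e1 * (-1 * (0 - e)) ->
  `|I1 + I2 + (I3 + I4)| <= G -> `|kx - ky| <= 2 * B ->
  0 <= e <= 1 -> 1 - e2 <= e -> pm <= 1 -> 0 <= B -> 0 <= e1 -> 0 <= e2 ->
  2 * e1 + 4 * (B * e2) <= eta -> `|kx - ky| <= eta + G.
Proof.
move=> L1 L2 L3 L4 HG Kx /andP[e_0 e_1] e_ge mid1 B0 e10 e20 small.
have T1 : B * (pm - e) <= B * e2 by apply: ler_wpM2l => //; lra.
have T2 : e1 * e <= e1 by rewrite ler_piMr.
have T3 : (1 - e) * `|kx - ky| <= e2 * (2 * B) by apply: ler_pM => //; lra.
have T4 : `|e * (kx - ky)| <= G + 2 * e1 + 2 * (B * e2).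
  have -> : e * (kx - ky) = (I1 + I2 + (I3 + I4)) - (I1 - kx * (e - 0)) -
    (I2 - 0 * (pm - e)) - (I3 - 0 * (e - pm)) - (I4 - ky * (0 - e)) by ring.
  apply: (@le_trans _ _ (G + e1 * (1 * (e - 0)) + B * (1 * (pm - e)) + B * (-1 * (e - pm)) +
     e1 * (-1 * (0 - e)))).
    by do 4 (apply: le_trans (ler_normB _ _) _; apply: lerD => //).
  clear - T1 T2; have -> : G + e1 * (1 * (e - 0)) + B * (1 * (pm - e)) + B * (-1 * (e - pm)) +
     e1 * (-1 * (0 - e)) = G + 2 * (e1 * e) + 2 * (B * (pm - e)) by ring.
  by move: (e1 * e) (B * (pm - e)) (B * e2) T1 T2 => a b c; lra.
have -> : `|kx - ky| = e * `|kx - ky| + (1 - e) * `|kx - ky| by ring.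
have <- : `|e * (kx - ky)| = e * `|kx - ky| by rewrite normrM (ger0_norm e_0).
have E : e2 * (2 * B) = 2 * (B * e2) by ring.
rewrite E in T3; move: T3 T4 small; clear.
by move: ((1 - e) * _) (`|e * _|) (B * e2) => a b c; lra.
Qed.

(** The test function exp(-c / ((u - x)(y - u))) with small c approximates the indicator of [x, y];
    integrated against its derivative, K yields nearly K x - K y. *)
Lemma weak_deriv_le (K g : R -> R) (x y : R) : continuous K ->
  leb.-integrable setT (EFin \o g) -> weak_derivative K g -> x < y ->
  `|K x - K y| <= Rintegral leb `[x, y] (fun u => `|g u|).
Proof.
move=> cK ig wK xy; apply/ler_addgt0Pl => eta eta0.
have [_ [B KB]] := cont_bdmeas x y cK.
have B0 : 0 <= B by apply: le_trans (KB x _); rewrite //= in_itv/= lexx ltW.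
pose e1 : R := eta / 4; pose e2 : R := eta / (8 * (B + 1)).
have e10 : 0 < e1 by rewrite divr_gt0.
have B1 : 0 < B + 1 by rewrite ltr_wpDl.
have e20 : 0 < e2 by rewrite divr_gt0// mulr_gt0.
have Be : 4 * (B * e2) <= eta / 2.
  have -> : e2 = eta / 8 * (B + 1)^-1 by rewrite /e2; field; rewrite gt_eqF.
  have : B * (B + 1)^-1 <= 1 by rewrite ler_pdivrMr// mul1r lerDl.
  move: ((B + 1)^-1) => b Hb; have H : eta / 8 * (B * b) <= eta / 8 * 1.
    by rewrite ler_wpM2l// divr_ge0// ltW.
  have -> : 4 * (B * (eta / 8 * b)) = 4 * (eta / 8 * (B * b)) by ring.
  by move: (eta / 8 * (B * b)) H => z; clear; lra.
have near_K z : exists2 de, 0 < de & forall u, `|u - z| < de -> `|K u - K z| <= e1.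
  have /cvgrPdist_le/(_ _ e10)[de /= de0 H] := cK z.
  by exists de => // u uz; rewrite distrC; apply: H; rewrite /ball/= distrC.
have [d1 d10 H1] := near_K x; have [d2 d20 H2] := near_K y.
pose de : R := Order.min d1 (Order.min d2 (y - x)) / 2.
have m0 : 0 < Order.min d1 (Order.min d2 (y - x)) by rewrite !lt_min d10 d20 subr_gt0.
have de0 : 0 < de by rewrite divr_gt0.
have [de1 de2 de3] : [/\ de < d1, de < d2 & 2 * de <= y - x].
  have mde : Order.min d1 (Order.min d2 (y - x)) = 2 * de by rewrite /de; field.
  have : 2 * de <= Order.min d1 (Order.min d2 (y - x)) by rewrite mde.
  by rewrite !le_min => /and3P[h1 h2 h3]; split=> //; lra.
pose mid := (x + y) / 2.
have [xm my] : x + de <= mid /\ mid <= y - de by rewrite /mid; split; lra.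
pose q : {poly R} := ('X - x%:P) * (y%:P - 'X).
have qE u : q.[u] = (u - x) * (y - u) by rewrite !hornerE.
have qdE u : q^`().[u] = x + y - 2 * u.
  by rewrite derivM derivXsubC derivB derivC derivX !hornerE; ring.
clearbody q; pose q0 : R := de * (y - x - de).
have q00 : 0 < q0 by rewrite mulr_gt0//; lra.
(* This makes phi equal to exp(-e2), nearly 1, at distance de from both ends. *)
pose c : R := q0 * e2; have c0 : 0 < c by rewrite mulr_gt0.
pose phi := bump_fun q c 1 0.
pose phi' := bump_fun q c (bump_step q c 1 0) 2.
have xx' : x <= x + de by rewrite lerDl ltW.
have yy' : y - de <= y by rewrite gerBl ltW.
have xm' := le_trans xx' xm; have my' := le_trans my yy'.
have dphi u : is_derive u (1 : R) phi (phi' u) by exact: is_derive_bump.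
have cphi' : continuous phi'.
  move=> u; apply: differentiable_continuous; apply/derivable1_diffP.
  by case: (is_derive_bump q c0 (bump_step q c 1 0) 2 u).
have phiE u : phi u = if 0 < q.[u] then expR (- (c / q.[u])) else 0.
  by rewrite /phi /bump_fun hornerC expr0 !mul1r.
have phi01 u : 0 <= phi u <= 1.
  rewrite phiE; case: ifP => qu; rewrite ?lexx ?ler01// expR_ge0/= expR_le1 oppr_le0.
  by rewrite divr_ge0// ltW.
have out u : ~~ (x <= u <= y) -> q.[u] <= 0.
  rewrite negb_and -!ltNge qE => /orP[ux|yu].
    by rewrite nmulr_rle0 ?subr_lt0// subr_ge0 ltW// (lt_trans ux).
  by rewrite nmulr_lle0 ?subr_lt0// subr_ge0 ltW// (lt_trans xy).
have phi0 u : ~~ (x <= u <= y) -> phi u = 0.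
  by move=> /out; rewrite phiE leNgt => /negbTE ->.
have phi'0 u : ~~ (x <= u <= y) -> phi' u = 0.
  by move=> /out; rewrite /phi' /bump_fun leNgt => /negbTE ->.
have phix : phi x = 0 by rewrite phiE qE subrr mul0r ltxx.
have phiy : phi y = 0 by rewrite phiE qE subrr mulr0 ltxx.
have phi'E u : 0 < q.[u] -> phi' u = (x + y - 2 * u) * (c * q.[u]^-1 ^+ 2 * expR (- (c / q.[u]))).
  move=> qu; rewrite /phi' /bump_fun qu /bump_step derivC mul0r scale0r subr0 add0r mul1r.
  by rewrite hornerZ qdE; ring.
have pos u : 0 < q.[u] -> 0 <= c * q.[u]^-1 ^+ 2 * expR (- (c / q.[u])).
  move=> qu; apply: mulr_ge0; last exact: expR_ge0.
  by apply: mulr_ge0; [exact: ltW|exact: sqr_ge0].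
have inc u : u <= mid -> 0 <= 1 * phi' u.
  move=> um; rewrite mul1r; case: (ltP 0 q.[u]) => qu.
    by rewrite phi'E// mulr_ge0 ?pos//; move: um; rewrite /mid; lra.
  by rewrite /phi' /bump_fun ltNge qu.
have dec u : mid <= u -> 0 <= (-1) * phi' u.
  move=> um; rewrite mulN1r; case: (ltP 0 q.[u]) => qu.
    rewrite phi'E// -mulNr mulr_ge0 ?pos//; move: um; rewrite /mid; lra.
  by rewrite /phi' /bump_fun ltNge qu oppr0.
have tphi : test_function phi.
  split; first exact: smooth_bump.
  exists (`|x| + `|y|) => u hu; apply: phi0; apply/negP => /andP[xu uy].
  move: hu; rewrite ltNge => /negP; apply; rewrite ler_norml.
  have := ler_norm x; have := ler_norm (- x); have := ler_norm y; have := ler_norm (- y).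
  rewrite !normrN => *; apply/andP; split; have := normr_ge0 x; have := normr_ge0 y; lra.
pose e := phi (x + de).
have eE : e = expR (- e2).
  rewrite /e phiE qE.
  have -> : (x + de - x) * (y - (x + de)) = q0 by rewrite /q0; ring.
  by rewrite q00 /c mulrAC divff ?mul1r// gt_eqF.
have eE2 : phi (y - de) = e.
  rewrite /e !phiE !qE.
  have -> : (x + de - x) * (y - (x + de)) = q0 by rewrite /q0; ring.
  by have -> : (y - de - x) * (y - (y - de)) = q0 by rewrite /q0; ring.
have e_ge : 1 - e2 <= e by rewrite eE; have := expR_ge1Dx (- e2); lra.
have /andP[e_0 e_1] := phi01 (x + de); rewrite -/e in e_0 e_1.
have /andP[_ mid1] := phi01 mid.
have bK : bdmeas (`[x, y] : set R) (fun u => K u * phi' u).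
  by apply: bdmeasM; exact: cont_bdmeas.
have sub a b : x <= a -> b <= y -> bdmeas (`[a, b] : set R) (fun u => K u * phi' u).
  by move=> _ _; apply: bdmeasM; exact: cont_bdmeas.
have S : Rintegral leb `[x, y] (fun u => K u * phi' u) =
  Rintegral leb `[x, x + de] (fun u => K u * phi' u) +
  Rintegral leb `[x + de, mid] (fun u => K u * phi' u) +
  (Rintegral leb `[mid, y - de] (fun u => K u * phi' u) +
   Rintegral leb `[y - de, y] (fun u => K u * phi' u)).
  rewrite (Int_split (b := mid))//; last by rewrite xm' my'.
  rewrite (@Int_split _ _ x (x + de) mid); [|by rewrite xx' xm|by
    apply: bdmeasM; exact: cont_bdmeas].
  rewrite (@Int_split _ _ mid (y - de) y)//; [by rewrite my yy'|by
    apply: bdmeasM; exact: cont_bdmeas].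
have KB' u : x <= u <= y -> `|K u - 0| <= B by rewrite subr0 => xu; apply: KB; rewrite /= in_itv.
have L1 : `|Rintegral leb `[x, x + de] (fun u => K u * phi' u) - K x * (e - 0)| <= e1 * (1 * (e - 0)).
  rewrite -[X in _ - _ * (_ - X)]phix -[X in _ <= _ * (_ * (_ - X))]phix.
  apply: sign_mass => //.
  - by move=> u /andP[xu ux]; apply: inc; exact: le_trans xm.
  - by rewrite normr1.
  - by move=> u ux; apply: H1; exact: dist_right ux de1.
have L2 : `|Rintegral leb `[x + de, mid] (fun u => K u * phi' u) - 0 * (phi mid - e)| <= B * (1 * (phi mid - e)).
  apply: sign_mass => //.
  - by move=> u /andP[xu ux]; apply: inc.
  - by rewrite normr1.
  - by move=> u /andP[xu ux]; apply: KB'; rewrite (le_trans xx' xu) (le_trans ux my').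
have L3 : `|Rintegral leb `[mid, y - de] (fun u => K u * phi' u) - 0 * (e - phi mid)| <= B * (-1 * (e - phi mid)).
  rewrite -eE2; apply: sign_mass => //.
  - by move=> u /andP[xu ux]; apply: dec.
  - by rewrite normrN1.
  - by move=> u /andP[xu ux]; apply: KB'; rewrite (le_trans xm' xu) (le_trans ux yy').
have L4 : `|Rintegral leb `[y - de, y] (fun u => K u * phi' u) - K y * (0 - e)| <= e1 * (-1 * (0 - e)).
  rewrite -[X in _ - _ * (X - _)]phiy -[X in _ <= _ * (_ * (X - _))]phiy -eE2.
  apply: sign_mass => //.
  - by move=> u /andP[xu ux]; apply: dec; exact: le_trans xu.
  - by rewrite normrN1.
  - by move=> u ux; apply: H2; exact: dist_left ux de2.
have wI : Rintegral leb setT (fun u => K u * derive1 phi u) =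
    Rintegral leb `[x, y] (fun u => K u * phi' u).
  rewrite [RHS]Rintegral_mkcond; apply: eq_Rintegral => u _.
  rewrite derive1_bump// patchE; case: ifP => // /negbT; rewrite notin_setE/= in_itv/= => /negP h.
  by rewrite -/(phi' u) phi'0 ?mulr0.
have mphi : measurable_fun setT phi.
  apply: continuous_measurable_fun => u; apply: differentiable_continuous.
  by apply/derivable1_diffP; case: (dphi u).
have mg : measurable_fun setT g by have /integrableP[/measurable_EFinP] := ig.
have igphi : leb.-integrable setT (EFin \o (fun u => g u * phi u)).
  apply: (le_integrable _ _ _ ig) => //.
    by apply/measurable_EFinP; exact: measurable_funM.
  move=> u _ /=; rewrite lee_fin normrM; have /andP[p0 p1] := phi01 u.
  by rewrite (ger0_norm p0) ler_piMr.
have G : `|Rintegral leb setT (fun u => g u * phi u)| <= Rintegral leb `[x, y] (fun u => `|g u|).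
  apply: le_trans (le_normr_Rintegral _ igphi) _ => //.
  rewrite [leRHS]Rintegral_mkcond; apply: le_Rintegral => //.
  - exact: integrable_norm.
  - have -> : EFin \o ((fun u => `|g u|) \_ `[x, y]) = (EFin \o (fun u => `|g u|)) \_ `[x, y].
      by rewrite restrict_EFin.
    apply/(integrable_mkcond _ _).1 => //; apply: integrableS (integrable_norm ig) => //.
  - move=> u _; rewrite normrM patchE; have /andP[p0 p1] := phi01 u.
    rewrite (ger0_norm p0); case: ifP => [_|/negbT]; first by rewrite ler_piMr.
    by rewrite notin_setE/= in_itv/= => /negP h; rewrite phi0 ?mulr0.
have := wK phi tphi; rewrite wI S => W.
move: G; rewrite -[Rintegral leb setT _]opprK -W normrN.
have Kx : `|K x - K y| <= 2 * B.
  apply: le_trans (ler_normB _ _) _; rewrite mulr2n mulrDl mul1r.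
  by apply: lerD; apply: KB; rewrite /= in_itv/= lexx ltW.
move=> G'; apply: (mass_balance L1 L2 L3 L4 G' Kx _ e_ge mid1 B0 (ltW e10) (ltW e20)).
  by rewrite e_0.
by rewrite /e1; clear - Be; lra.
Qed.

End WeakDerivative.

(** * Size and total variation of the discretized kernel *)

Section KernelVariation.
Context (R : realType) (K g : R -> R).
Local Notation leb := (@lebesgue_measure R).
Hypotheses (cK : continuous K) (ig : leb.-integrable setT (EFin \o g)).
Hypotheses (wK : weak_derivative K g) (K0 : K 0 = 0) (Keven : forall u, K (- u) = K u).

Definition deriv_mass := Rintegral leb setT (fun u => `|g u|).

Lemma deriv_mass_ge0 : 0 <= deriv_mass. Proof. exact: Rintegral_ge0. Qed.

Lemma itv_variation (x y : R) : Rintegral leb `[x, y] (fun u => `|g u|) <= deriv_mass.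
Proof.
rewrite Rintegral_mkcond; apply: le_Rintegral => //.
- rewrite -restrict_EFin; apply/(integrable_mkcond _ _).1 => //.
  exact: integrableS (integrable_norm ig).
- exact: integrable_norm.
- by move=> u _; rewrite patchE; case: ifP => // _; exact: normr_ge0.
Qed.

(** The value at u is an increment from 0, where the kernel vanishes. *)
Lemma kernel_bound u : `|K u| <= deriv_mass.
Proof.
wlog u0 : u / 0 < u.
  move=> W; have [/W//|u0|<-] := ltgtP 0 u; last by rewrite K0 normr0 deriv_mass_ge0.
  by rewrite -Keven W// oppr_gt0.
rewrite -[K u]subr0 -K0 distrC; apply: le_trans (weak_deriv_le cK ig wK u0) _.
exact: itv_variation.
Qed.

Lemma kernel_increments (gamma : R) n : 0 < gamma ->
  \sum_(z < n) `|K (gamma * z.+1%:R) - K (gamma * z%:R)| <= deriv_mass.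
Proof.
move=> g0; apply: le_trans (itv_variation 0 (gamma * n%:R)).
elim: n => [|n IH]; first by rewrite big_ord0; apply: Rintegral_ge0.
have lt1 : gamma * n%:R < gamma * n.+1%:R by rewrite ltr_pM2l// ltr_nat.
rewrite big_ord_recr/= (@Int_split_integrable _ _ 0 (gamma * n%:R)); last first.
- exact: integrableS (integrable_norm ig).
- by rewrite mulr_ge0 ?(ltW g0)//= ltW.
by apply: lerD IH _; rewrite distrC; exact: weak_deriv_le.
Qed.

Context (N : nat) (gamma : R).
Hypothesis gamma0 : 0 < gamma.
Local Notation n := (N.*2).+1.

Definition torus_dist (i : nat) := minn i (n - i).

Lemma kappa_dist (i : site N) : kappa K gamma i = gamma * K (gamma * (torus_dist i)%:R).
Proof.
rewrite /kappa /kappaZ /centered /torus_dist; case: ifP => iN.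
  by rewrite (minn_idPl _)//; have := ltn_ord i; lia.
rewrite (minn_idPr _); last by have := ltn_ord i; lia.
have -> : i%:Z - n%:Z = - ((n - i)%N%:Z) by have := ltn_ord i; lia.
by rewrite mulrNz mulrN Keven -pmulrn.
Qed.

Lemma kappaN_ (i : site N) : kappa K gamma (- i) = kappa K gamma i.
Proof.
rewrite !kappa_dist; congr (_ * K (_ * _%:R)); rewrite /torus_dist /=.
have [->|i0] := eqVneq (i : nat) 0%N; first by rewrite subn0 modnn.
by rewrite modn_small; have := ltn_ord i; lia.
Qed.

Lemma kappa0 : kappa K gamma (0 : site N) = 0.
Proof. by rewrite kappa_dist /torus_dist/= min0n mulr0 K0 mulr0. Qed.

Lemma kappa_bound (i : site N) : kappa K gamma i <= gamma * deriv_mass.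
Proof.
rewrite kappa_dist ler_pM2l//; apply: le_trans (kernel_bound _); exact: ler_norm.
Qed.

Lemma val_succ_site (i : site N) : succ_site i = (i.+1 %% n)%N :> nat.
Proof. by rewrite /succ_site/= modnDmr addn1. Qed.

(** By evenness the kernel depends on the distance to 0 only: along the torus it runs twice through
    the values on {0, ..., N}, and the step from N to N + 1, that is to -N, contributes nothing. *)
Lemma kappa_variation :
  \sum_(i : site N) `|kappa K gamma (succ_site i) - kappa K gamma i| <= 2 * gamma * deriv_mass.
Proof.
pose a z := gamma * K (gamma * z%:R); pose b z := `|a z.+1 - a z|.
have E (i : site N) : `|kappa K gamma (succ_site i) - kappa K gamma i| =
    if (i < N)%N then b i else if i == N :> nat then 0 else b (N.*2 - i)%N.
  rewrite !kappa_dist -/(a _) -/(a (torus_dist i)) val_succ_site.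
  have iN := ltn_ord i; have [->|i2] := eqVneq (i : nat) N.*2.
    rewrite modnn /torus_dist subn0 min0n subSn// subnn.
    case: ifP => [?|_]; first by rewrite /b; lia.
    case: eqP => [N2|N2]; last by rewrite distrC /b (minn_idPr _)//; lia.
    have N0 : N.*2 = 0%N by lia.
    by rewrite N0 min0n subrr normr0.
  rewrite modn_small /torus_dist; last by move/eqP: i2 => i2; lia.
  case: ifP => [iN'|niN]; first by rewrite !(minn_idPl _)//; lia.
  case: eqP => [->|nE].
    have -> : minn N.+1 (n - N.+1) = N by lia.
    have -> : minn N (n - N) = N by lia.
    by rewrite subrr normr0.
  move/eqP: i2 => i2.
  have -> : minn i.+1 (n - i.+1) = (N.*2 - i)%N by lia.
  have -> : minn i (n - i) = (N.*2 - i).+1 by lia.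
  by rewrite distrC.
have S : \sum_(z < N) b z <= gamma * deriv_mass.
  rewrite /b /a (eq_bigr (fun z : 'I_N => gamma * `|K (gamma * z.+1%:R) - K (gamma * z%:R)|)).
    by rewrite -mulr_sumr ler_pM2l//; exact: kernel_increments.
  by move=> z _; rewrite -mulrBr normrM gtr0_norm.
rewrite (eq_bigr _ (fun i _ => E i)).
pose f z := if (z < N)%N then b z else if z == N :> nat then 0 else b (N.*2 - z)%N.
rewrite -(big_mkord xpredT f) (@big_cat_nat _ _ _ N)//=; last by lia.
rewrite (big_ltn (_ : (N < n)%N)); last by lia.
rewrite big_mkord (eq_bigr (fun z : 'I_N => b z)); last by move=> z _; rewrite /f ltn_ord.
rewrite {1}/f ltnn eqxx add0r -{1}[N.+1]add0n big_addn (_ : (n - N.+1 = N)%N); last by lia.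
rewrite big_mkord; have -> : \sum_(z < N) f (z + N.+1)%N = \sum_(z < N) b z.
  rewrite [RHS](reindex_inj rev_ord_inj)/=; apply: eq_bigr => z _; have zN := ltn_ord z.
  rewrite /f ifF; last by lia.
  by rewrite ifF; [congr b; lia|lia].
by rewrite mulr2n !mulrDl !mul1r; exact: lerD.
Qed.

End KernelVariation.

(** * Time-averaged two-point functions *)

Section EntropyProduction.
Context (R : realType) (K : R -> R) (N : nat) (gamma beta alpha : R).
Hypothesis kap0 : kappa K gamma (0 : site N) = 0.
Hypothesis kapN : forall i : site N, kappa K gamma (- i) = kappa K gamma i.
Hypothesis kap_ge0 : forall i : site N, 0 <= kappa K gamma i.
Hypothesis kap_sum : \sum_(i : site N) kappa K gamma i = 1.
Hypothesis beta1 : `|beta| <= 1.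
Hypothesis alpha0 : 0 < alpha.
Context d (Om : measurableType d) (P : probability Om R) (X : R -> Om -> config N).
Context (G : R -> set (set Om)) (Ph : R -> (config N -> R) -> config N -> R).
Local Notation r := (fun (c : config N) (i : site N) => alpha^-1 * rate K gamma beta c i).
Hypothesis JP : jump_process (@exchange N) r P X G Ph.
Local Notation E := (Ex P).
Local Notation w := (@weight R K N gamma beta).
Local Notation L := (generator K gamma beta).
Local Notation n := (N.*2).+1.
Local Notation ind c := (fun y : config N => (y == c)%:R : R).

Definition law (t : R) (c : config N) : R := E (fun om => (X t om == c)%:R).

Lemma law_sum (F : config N -> R) t : 0 <= t -> \sum_c law t c * F c = E (fun om => F (X t om)).
Proof.
move=> t0; rewrite (eq_bigr (fun c => E (fun om => F c * ind c (X t om)))).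
  rewrite -Ex_sum; last by move=> c; apply: bdmeasZ; exact: (Xbd JP (ind c) t0).
  congr (Ex P _); apply: funext => om; rewrite (bigD1 (X t om))//= eqxx mulr1.
  by rewrite big1 ?addr0// => c /negbTE cX; rewrite eq_sym cX mulr0.
by move=> c _; rewrite ExZ 1?mulrC//; exact: (Xbd JP (ind c) t0).
Qed.

Lemma law_ge0 t c : 0 <= law t c.
Proof. by apply: Ex_ge0 => om; rewrite ler0n. Qed.

Lemma law1 t : 0 <= t -> \sum_c law t c = 1.
Proof.
move=> t0; rewrite -(Ex_cst P 1) -(@law_sum (fun=> 1) t t0).
by apply: eq_bigr => c _; rewrite mulr1.
Qed.

Lemma jump_genE F c : jump_gen (@exchange N) r F c = alpha^-1 * L F c.
Proof. by rewrite /generator mulr_sumr; apply: eq_bigr => i _; rewrite mulrA. Qed.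

Lemma generator_sum (F : config N -> R) x : L F x = \sum_c F c * L (ind c) x.
Proof.
have FE y : F y = \sum_c F c * ind c y.
  rewrite (bigD1 y)//= eqxx mulr1 big1 ?addr0// => c /negbTE cy.
  by rewrite eq_sym cy mulr0.
rewrite /generator (eq_bigr (fun c => \sum_i F c * (rate K gamma beta x i *
   (ind c (exchange x i) - ind c x)))) => [|c _]; last by rewrite mulr_sumr.
rewrite exchange_big/=; apply: eq_bigr => i _.
rewrite [F (exchange x i)]FE [F x]FE -sumrB mulr_sumr; apply: eq_bigr => c _; ring.
Qed.

Lemma law_step : exists2 C : R, 0 <= C & forall (t h : R) c, 0 <= t -> 0 <= h <= 1 ->
  `|law (t + h) c - law t c - h * \sum_x law t x * (alpha^-1 * L (ind c) x)| <= C * h ^+ 2.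
Proof.
pose Cc c := cid2 (step1 JP (ind c)).
have C0 c : 0 <= s2val (Cc c) by case: (Cc c).
exists (\sum_c s2val (Cc c)) => [|t h c t0 h01]; first exact: sumr_ge0.
have h0 : 0 <= h by case/andP: h01.
have th0 : 0 <= t + h by exact: addr_ge0.
have one1 (x : Om) : `|1 : R| <= 1 by rewrite normr1.
have H := (s2valP' (Cc c)) t h (fun=> 1) 1 t0 h01 (bdmeas_cst _ 1) one1; rewrite mul1r in H.
apply: (@le_trans _ _ (s2val (Cc c) * h ^+ 2)); last first.
  by rewrite ler_wpM2r ?sqr_ge0// (bigD1 c)//= lerDl sumr_ge0.
have bL : bdmeas setT (fun om => jump_gen (@exchange N) r (ind c) (X t om)).
  exact: (Xbd JP _ t0).
have bc u : 0 <= u -> bdmeas setT (fun om => ind c (X u om)) by exact: (Xbd JP (ind c)).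
apply: le_trans H; rewrite le_eqVlt; apply/orP; left; apply/eqP; congr `|_|.
rewrite (_ : (fun om => 1 * _) = fun om => ind c (X (t + h) om) - ind c (X t om) -
   h * jump_gen (@exchange N) r (ind c) (X t om)); last by apply: funext => om; rewrite mul1r.
rewrite ExB; [|by apply: bdmeasB; exact: bc|exact: bdmeasZ].
rewrite ExB; [|exact: bc|exact: bc].
rewrite ExZ//; congr (_ - _ * _).
rewrite -(law_sum (fun x => jump_gen (@exchange N) r (ind c) x) t0).
by apply: eq_bigr => x _; rewrite jump_genE.
Qed.

Section Smoothed.
Context (eta : R).
Hypothesis eta0 : 0 < eta.
Hypothesis eta1 : eta * \sum_c w c <= 1.

(** The added multiple of the weight keeps the density above eta, hence its logarithm bounded; the
    weight being invariant, the entropy production is not affected. *)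
Definition smoothed t c := law t c + eta * w c.
Local Notation q := smoothed.

Let w0 c : 0 < w c. Proof. exact: weight_gt0. Qed.

Lemma smoothed_gt0 t c : 0 < q t c.
Proof. by rewrite /q ltr_wpDl ?law_ge0// mulr_gt0. Qed.

Lemma smoothed_sum t : 0 <= t -> \sum_c q t c = 1 + eta * \sum_c w c.
Proof. by move=> t0; rewrite big_split/= law1// mulr_sumr. Qed.

Let ws0 : 0 <= eta * \sum_c w c.
Proof. by rewrite mulr_ge0 ?(ltW eta0)// sumr_ge0// => c _; exact: ltW. Qed.

Lemma smoothed_sum12 t : 0 <= t -> 1 <= \sum_c q t c <= 2.
Proof.
move=> t0; rewrite smoothed_sum//; move: (eta * _) eta1 ws0 => z z1 z0.
by apply/andP; split; lra.
Qed.

Lemma smoothed_le2 t c : 0 <= t -> q t c <= 2.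
Proof.
move=> /smoothed_sum12/andP[_]; apply: le_trans.
by rewrite (bigD1 c)//= lerDl sumr_ge0// => x _; rewrite ltW ?smoothed_gt0.
Qed.

(** [entropy_step] is fed with the first-order expansion of the law. The constant C depends on eta
    through bounds on logarithms, but multiplies h^2 and disappears as the grid is refined. *)
Lemma entropy_production : exists2 C : R, 0 <= C & forall t h : R, 0 <= t -> 0 <= h <= 1 ->
  entropy K gamma beta (q (t + h)) - entropy K gamma beta (q t) <=
  - (h * (alpha^-1 * 2^-1 * dissipation K gamma beta (q t))) + C * h ^+ 2.
Proof.
have [C0 C00 H] := law_step.
pose Fb c : R := 1 + `|ln eta| + `|ln (2 / w c)|.
pose B : R := alpha^-1 * (2 * n%:R * 1) + C0.
have ai : 0 <= alpha^-1 by rewrite invr_ge0 ltW.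
have B0 : 0 <= B by rewrite /B addr_ge0// mulr_ge0.
exists (C0 * \sum_c Fb c + \sum_c B ^+ 2 / (eta * w c)).
  apply: addr_ge0.
    by rewrite mulr_ge0// sumr_ge0// => c _; rewrite /Fb !addr_ge0.
  by apply: sumr_ge0 => c _; rewrite divr_ge0 ?sqr_ge0// ltW// mulr_gt0.
move=> t h t0 h01; have /andP[h0 h1] := h01.
have th0 : 0 <= t + h by exact: addr_ge0.
apply: le_trans (entropy_step K gamma beta (smoothed_gt0 t) (smoothed_gt0 (t + h))) _.
pose F c := 1 + ln (q t c / w c).
pose D c := law (t + h) c - law t c.
pose Dm c := h * \sum_x law t x * (alpha^-1 * L (ind c) x).
have qD c : q (t + h) c - q t c = D c by rewrite /q /D; ring.
have FF c : `|F c| <= Fb c.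
  have z1 : eta <= q t c / w c by rewrite ler_pdivlMr// lerDr law_ge0.
  have z2 : q t c / w c <= 2 / w c by rewrite ler_pM2r ?invr_gt0// smoothed_le2.
  have z0 := lt_le_trans eta0 z1.
  have l1 : ln eta <= ln (q t c / w c) by rewrite ler_ln.
  have l2 : ln (q t c / w c) <= ln (2 / w c) by rewrite ler_ln// posrE (lt_le_trans z0).
  rewrite /F /Fb; apply: le_trans (ler_normD _ _) _; rewrite normr1 -addrA lerD2l.
  move: l1 l2; move: (ln eta) (ln (2 / w c)) (ln (q t c / w c)) => a b z l1 l2.
  have := ler_norm (- a); have := ler_norm b; rewrite normrN => h2 h3.
  have := normr_ge0 a; have := normr_ge0 b => h4 h5.
  by rewrite ler_norml; apply/andP; split; lra.
have Lc c x : `|L (ind c) x| <= 2 * n%:R * 1.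
  by apply: generator_le => y; case: eqP => _; rewrite ?normr0 ?normr1.
have Dmb c : `|Dm c| <= h * (alpha^-1 * (2 * n%:R * 1)).
  rewrite /Dm normrM (ger0_norm h0) ler_wpM2l//; apply: le_trans (ler_norm_sum _ _ _) _.
  have -> : alpha^-1 * (2 * n%:R * 1) = \sum_x law t x * (alpha^-1 * (2 * n%:R * 1)).
    by rewrite -mulr_suml law1// mul1r.
  apply: ler_sum => x _.
  by rewrite !normrM (ger0_norm (law_ge0 t x)) (ger0_norm ai) ler_wpM2l ?law_ge0// ler_wpM2l.
have DD c : `|D c - Dm c| <= C0 * h ^+ 2 by exact: H.
have Db c : `|D c| <= h * B.
  rewrite -[D c](subrK (Dm c)); apply: le_trans (ler_normD _ _) _.
  rewrite /B mulrDr addrC; apply: lerD => //; apply: le_trans (DD c) _.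
  by rewrite mulrC ler_wpM2r// expr2 ler_piMl.
have SF : \sum_c Dm c * F c = - (h * (alpha^-1 * 2^-1 * dissipation K gamma beta (q t))).
  rewrite (eq_bigr (fun c => h * \sum_x law t x * (alpha^-1 * (F c * L (ind c) x)))); last first.
    move=> c _; rewrite /Dm -mulrA; congr (_ * _); rewrite mulr_suml.
    by apply: eq_bigr => x _; ring.
  rewrite -mulr_sumr exchange_big/=.
  rewrite (eq_bigr (fun x => alpha^-1 * (law t x * L F x))); last first.
    move=> x _; rewrite [L F x]generator_sum !mulr_sumr; apply: eq_bigr => c _; ring.
  rewrite -mulr_sumr -mulrN; congr (_ * _); rewrite -mulrA -mulrN; congr (_ * _).
  have -> : \sum_x law t x * L F x = \sum_x q t x * L (fun c => ln (q t c / w c)) x.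
    have LF x : L F x = L (fun c => ln (q t c / w c)) x.
      by apply: eq_bigr => i _; rewrite /F; ring.
    rewrite (eq_bigr (fun x => law t x * L (fun c => ln (q t c / w c)) x)) => [|x _]; last by rewrite LF.
    rewrite [RHS](eq_bigr (fun x => law t x * L (fun c => ln (q t c / w c)) x +
      eta * (w x * L (fun c => ln (q t c / w c)) x))) => [|x _]; last by rewrite /q; ring.
    by rewrite big_split/= -mulr_sumr weight_invariant mulr0 addr0.
  by rewrite generator_dissipation.
have S1 : \sum_c (q (t + h) c - q t c) * (1 + ln (q t c / w c)) <=
    - (h * (alpha^-1 * 2^-1 * dissipation K gamma beta (q t))) + C0 * \sum_c Fb c * h ^+ 2.
  rewrite -SF -lerBlDl -sumrB mulr_sumr; apply: ler_sum => c _.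
  rewrite qD -/(F c) -mulrBl; apply: le_trans (ler_norm _) _; rewrite normrM.
  have -> : C0 * (Fb c * h ^+ 2) = C0 * h ^+ 2 * Fb c by ring.
  exact: ler_pM.
have S2 : \sum_c (q (t + h) c - q t c) ^+ 2 / q t c <= \sum_c B ^+ 2 / (eta * w c) * h ^+ 2.
  apply: ler_sum => c _; rewrite qD.
  have -> : B ^+ 2 / (eta * w c) * h ^+ 2 = (h * B) ^+ 2 / (eta * w c) by ring.
  apply: ler_pM; [exact: sqr_ge0|by rewrite invr_ge0 ltW ?smoothed_gt0| |].
    rewrite -(real_normK (num_real (D c))) lerXn2r// nnegrE ?mulr_ge0//.
  by rewrite lef_pV2 ?posrE ?smoothed_gt0 ?mulr_gt0// lerDr law_ge0.
apply: le_trans (lerD S1 S2) _; rewrite -!mulr_suml mulrDl addrA.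
by rewrite !mulrA.
Qed.

(** The production telescopes; 7 n is the gap 3 n + 4 n between the two bounds of
    [entropy_bounds]. *)
Lemma dissipation_sum : exists2 C : R, 0 <= C & forall (h : R) m, 0 <= h <= 1 ->
  h * (alpha^-1 * 2^-1) * \sum_(k < m) dissipation K gamma beta (q (k%:R * h)) <=
  7 * n%:R + m%:R * (C * h ^+ 2).
Proof.
have [C C0 H] := entropy_production; exists C => // h m h01; have /andP[h0 h1] := h01.
have tele k : h * (alpha^-1 * 2^-1) * \sum_(j < k) dissipation K gamma beta (q (j%:R * h)) <=
    entropy K gamma beta (q 0) - entropy K gamma beta (q (k%:R * h)) + k%:R * (C * h ^+ 2).
  elim: k => [|k IH]; first by rewrite big_ord0 mulr0 !mul0r subrr addr0.
  have kh : 0 <= k%:R * h by rewrite mulr_ge0.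
  have := H _ _ kh h01; have -> : k%:R * h + h = k.+1%:R * h by rewrite -[k.+1%:R]natr1; ring.
  rewrite big_ord_recr/= mulrDr => Hk.
  have E1 : k.+1%:R * (C * h ^+ 2) = k%:R * (C * h ^+ 2) + C * h ^+ 2.
    by rewrite -[k.+1%:R]natr1; ring.
  rewrite E1; move: IH Hk; rewrite -!mulrA; move: (dissipation _ _ _ _) => dk.
  have -> : h * (alpha^-1 * (2^-1 * dk)) = h * (alpha^-1 * 2^-1) * dk by ring.
  set a := h * (alpha^-1 * 2^-1).
  move: (a * dk) (a * _) (C * _) (k%:R * _) (entropy _ _ _ _) (entropy _ _ _ _) (entropy _ _ _ _).
  by move=> *; lra.
apply: le_trans (tele m) _; rewrite lerD2r.
have mh : 0 <= m%:R * h by rewrite mulr_ge0.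
have /andP[e1 e2] := entropy_bounds kap_ge0 kap_sum beta1 (smoothed_gt0 0) (smoothed_sum12 (lexx 0)).
have /andP[e3 e4] := entropy_bounds kap_ge0 kap_sum beta1 (smoothed_gt0 (m%:R * h)) (smoothed_sum12 mh).
by move: e2 e3; move: (n%:R : R) (entropy _ _ _ _) (entropy _ _ _ _) => a b e; lra.
Qed.

End Smoothed.

Context (om etaH : R) (l nb : nat).
Hypothesis kap_om : forall i : site N, kappa K gamma i <= om.
Hypothesis ham_ex : forall (c : config N) (i : site N),
  `|hamiltonian K gamma (exchange c i) - hamiltonian K gamma c| <= etaH.
Hypotheses (l0 : (0 < l)%N) (nb0 : (0 < nb)%N) (nbl : (nb * l <= n)%N) (nbl1 : (N.*2 < nb.+1 * l)%N).
Hypotheses (lom : l%:R^-1 <= om) (etal : etaH * (2 * l)%:R <= 1) (nom : n%:R^-1 <= om) (N0 : (0 < N)%N).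
Context (mN : R).
Hypothesis conserved : forall t (x : Om), 0 <= t -> mean_spin R (X t x) = mN.

(** The first line integrates the static errors over [0, T]. The second is the total dissipation, at
    most 14 n alpha, divided by 2 theta. *)
Definition two_point_bound (T th theta : R) : R :=
  T * (4 * th + th ^- 3 * cst_fin R * (`|mN| + om + nb%:R * om + (1 + expR 8) * (2 * theta * n%:R))) +
  th ^- 3 * cst_fin R * ((1 + expR 8) * (7 * n%:R * alpha / theta)).

Lemma cst_fin_ge0 : 0 <= cst_fin R.
Proof.
have e0 := cst_eq_ge0 R; have t0 := cst_t_ge0 R; have c0 := ltW (cst_c_gt0 R).
rewrite /cst_fin /cst_two; apply: addr_ge0; first by rewrite !mulr_ge0.
have A1 : 0 <= 1 + 4 / cst_c R by rewrite addr_ge0// divr_ge0.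
have A2 : 0 <= cst_eq R * (9 * cst_t R) by apply: mulr_ge0 => //; apply: mulr_ge0.
by rewrite mulr_ge0// addr_ge0.
Qed.

(** The static bound holds at every time with the dissipation of that time; it is summed over a grid
    and the dissipations are added up by [dissipation_sum]. *)
Lemma two_point_average (g : site N -> R) (T th theta : R) : (forall i, `|g i| <= 1) ->
  0 < th <= 1 -> 0 < theta -> 0 <= T ->
  E (pint X (fun c => two_point g c ^+ 2) 0 T) <= two_point_bound T th theta.
Proof.
move=> g1 /andP[th0 th1] theta0 T0.
have om0 : 0 < om by apply: lt_le_trans nom; rewrite invr_gt0.
pose W := \sum_c w c.
have W0 : 0 < W.
  rewrite /W (bigD1 [ffun=> true])//= ltr_pwDl ?weight_gt0// sumr_ge0// => c _.
  by rewrite ltW ?weight_gt0.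
(* The added mass is then at most 1, as the total mass 2 requires, and at most [om], so it costs no
   more than the errors already present. *)
pose eta : R := Order.min 1 om / W.
have m0 : 0 < Order.min 1 om by rewrite lt_min ltr01 om0.
have eta0 : 0 < eta by rewrite divr_gt0.
have etaW : eta * \sum_c w c = Order.min 1 om by rewrite /eta divfK// gt_eqF.
have eta1 : eta * \sum_c w c <= 1 by rewrite etaW ge_min lexx.
have etaom : eta * \sum_c w c <= om by rewrite etaW ge_min lexx orbT.
have [C C0 HD] := dissipation_sum eta0 eta1.
pose q := smoothed eta; pose F c := two_point g c ^+ 2.
have th3 : 0 <= th ^- 3 * cst_fin R.
  by rewrite mulr_ge0 ?cst_fin_ge0// invr_ge0 exprn_ge0// ltW.
have e8 : 0 <= 1 + expR 8 :> R by rewrite addr_ge0// expR_ge0.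
pose A : R := 4 * th + th ^- 3 * cst_fin R * (`|mN| + om + nb%:R * om + (1 + expR 8) * (2 * theta * n%:R)).
pose B : R := th ^- 3 * cst_fin R * ((1 + expR 8) / (2 * theta)).
have B0 : 0 <= B by rewrite mulr_ge0// divr_ge0// mulr_ge0// ltW.
have one t : 0 <= t -> E (fun x => F (X t x)) <= A + B * dissipation K gamma beta (q t).
  move=> t0; have q_gt0 := smoothed_gt0 eta0 t.
  have /andP[_ q2] := smoothed_sum12 eta0 eta1 t0.
  have q_ge0 c : 0 <= q t c by exact: ltW.
  apply: (@le_trans _ _ (wexp (q t) F)).
    rewrite -law_sum//; apply: ler_sum => c _; rewrite ler_wpM2r ?sqr_ge0//.
    by rewrite lerDl mulr_ge0// ltW ?weight_gt0.
  apply: le_trans (wexp_two_point kap0 kapN kap_ge0 kap_sum beta1 q_ge0 q2 kap_om ham_ex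
    l0 nb0 nbl nbl1 lom etal nom N0 g1 th0 th1) _.
  have wm : wexp (q t) (fun c => `|mean_spin R c|) <= `|mN| + om.
    rewrite /wexp /q /smoothed.
    rewrite (eq_bigr (fun c => law t c * `|mean_spin R c| + eta * (w c * `|mean_spin R c|))) => [|c _]; last by ring.
    rewrite big_split/=; apply: lerD.
      rewrite (law_sum (fun c => `|mean_spin R c|))// (_ : (fun x => _) = fun=> `|mN|) ?Ex_cst//.
      by apply: funext => x; rewrite conserved.
    apply: le_trans etaom; rewrite -mulr_sumr ler_pM2l//; apply: ler_sum => c _.
    rewrite ler_piMr ?(ltW (weight_gt0 _ _ _ _))// /mean_spin /mean.
    apply: le_trans (ler_norm_sum _ _ _) _.
    apply: (@le_trans _ _ (\sum_(j : site N) (n%:R^-1 : R))).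
      by apply: ler_sum => j _; rewrite normrM spin_norm mulr1 ger0_norm.
    by rewrite sumr_const card_ord -[X in X <= _]mulr_natr mulVf ?pnatr_eq0.
  have tv := total_var_le kap0 kapN kap_ge0 kap_sum beta1 q_gt0 q2 theta0.
  rewrite /A /B -addrA lerD2l -(mulrA (th ^- 3 * _)) -mulrDr ler_wpM2l//.
  rewrite /err; have := lerD wm tv; move: (wexp _ _) (total_var _ _ _ _) => a b.
  have -> : (1 + expR 8) * (dissipation K gamma beta (q t) / (2 * theta) + 2 * theta * n%:R) =
     (1 + expR 8) / (2 * theta) * dissipation K gamma beta (q t) + (1 + expR 8) * (2 * theta * n%:R) by ring.
  by move: (nb%:R * om) (_ * dissipation _ _ _ _) (_ * (2 * theta * _)) => e f k; lra.
pose rn m := E (fun x => rsum (fun u => F (X u x)) 0 T m).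
have cr : rn @ \oo --> E (pint X F 0 T).
  have T00 : (0 : R) <= 0 <= T by rewrite lexx.
  apply: (proj2 (@Ex_cvg _ _ _ P _ _ (fmax F * (T - 0)) _ _ _)).
  - by move=> m; case: (Fbd_bd JP T0 (Fbd_rsum JP F m T00)).
  - by move=> m x; apply: rsum_norm => // u; exact: fmaxP.
  - by move=> x; case: (pint_rsum JP F x T00).
pose c1 : R := B * (2 * alpha * (2 * (C * T ^+ 2))).
have cb : (fun m : nat => T * A + B * (2 * alpha * (7 * n%:R)) + c1 * (m.+1%:R^-1 : R)) @ \oo -->
    T * A + B * (2 * alpha * (7 * n%:R)).
  rewrite -[X in _ --> X]addr0 -(mulr0 c1); apply: cvgD; first exact: cvg_cst.
  by apply: cvgM; [exact: cvg_cst|exact: cvg_harmonic].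
have -> : two_point_bound T th theta = T * A + B * (2 * alpha * (7 * n%:R)).
  rewrite /two_point_bound -/A /B; congr (_ + _); move: (th ^- 3 * _) => z.
  by field; rewrite gt_eqF.
apply: (@le_limit R _ _ _ _ (Num.trunc (T - 0)) cr cb) => m Tm.
have h01 := grid_step T0 Tm; set h := (T - 0) / m.+1%:R in h01; have /andP[h0 h1] := h01.
have hE : h = T / m.+1%:R by rewrite /h subr0.
have mh : m.+1%:R * h = T by rewrite hE mulrC divfK// pnatr_eq0.
have rnE : rn m = h * \sum_(k < m.+1) E (fun x => F (X (k.+1%:R * h) x)).
  rewrite /rn -Ex_sum; last by move=> k; apply: (Xbd JP); rewrite mulr_ge0.
  rewrite -ExZ; last by apply: bdmeas_sum => k; apply: (Xbd JP); rewrite mulr_ge0.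
  congr (Ex P _); apply: funext => x; rewrite /rsum -/h; congr (_ * _).
  by apply: eq_bigr => k _; rewrite add0r.
have dis0 t : 0 <= t -> 0 <= dissipation K gamma beta (q t).
  move=> t0; apply: sumr_ge0 => i _; apply: sumr_ge0 => c _.
  have a0 e : 0 < q t e / w e by rewrite divr_gt0 ?smoothed_gt0 ?weight_gt0.
  apply: mulr_ge0.
    by rewrite mulr_ge0 ?(ltW (weight_gt0 _ _ _ _)) ?(ltW (rate_gt0 _ _ _ _ _)).
  move: (a0 c) (a0 (exchange c i)).
  move: (q t c / w c) (q t (exchange c i) / w (exchange c i)) => a b a0' b0'.
  have [ab|/ltW ba] := leP a b.
    by rewrite mulr_ge0// subr_ge0// ler_ln.
  by rewrite -mulrNN mulr_ge0// opprB subr_ge0// ler_ln.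
have sumd : h * \sum_(k < m.+1) dissipation K gamma beta (q (k.+1%:R * h)) <=
    2 * alpha * (7 * n%:R + m.+2%:R * (C * h ^+ 2)).
  have := HD h m.+2 h01; rewrite big_ord_recl/= => H.
  have H' : h * (alpha^-1 * 2^-1) * \sum_(k < m.+1) dissipation K gamma beta (q (k.+1%:R * h)) <=
      7 * n%:R + m.+2%:R * (C * h ^+ 2).
    apply: le_trans H; apply: ler_wpM2l.
      by rewrite mulr_ge0// mulr_ge0// invr_ge0 ltW.
    rewrite -[leLHS]add0r; apply: lerD; first by apply: dis0; rewrite mulr_ge0.
    by apply: ler_sum => k _; rewrite /bump/= add1n.
  have a2 : 0 < 2 * alpha by rewrite mulr_gt0.
  rewrite -ler_pdivrMl//; apply: le_trans H'; rewrite le_eqVlt; apply/orP; left; apply/eqP.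
  by field; rewrite gt_eqF.
rewrite rnE; apply: (@le_trans _ _ (h * \sum_(k < m.+1) (A + B * dissipation K gamma beta (q (k.+1%:R * h))))).
  by rewrite ler_wpM2l//; apply: ler_sum => k _; apply: one; rewrite mulr_ge0.
rewrite big_split/= sumr_const card_ord -(mulr_natl A) -mulr_sumr mulrDr mulrA (mulrC h) mh mulrCA.
rewrite -addrA lerD2l; apply: (@le_trans _ _ (B * (2 * alpha * (7 * n%:R + m.+2%:R * (C * h ^+ 2))))).
  by rewrite ler_wpM2l.
rewrite /c1 -!(mulrA B) -mulrDr ler_wpM2l// -!(mulrA 2) -mulrDr ler_wpM2l//.
rewrite -!(mulrA alpha) -mulrDr ler_wpM2l ?(ltW alpha0)// lerD2l.
have -> : 2 * (C * T ^+ 2) / m.+1%:R = 2 * m.+1%:R * (C * h ^+ 2).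
  have alg (M a b : R) : M != 0 -> 2 * (a * b ^+ 2) / M = 2 * M * (a * (b / M) ^+ 2).
    by move=> M0; field.
  by rewrite hE; apply: alg; rewrite pnatr_eq0.
apply: ler_wpM2r; first exact: (mulr_ge0 C0 (sqr_ge0 h)).
by rewrite -natrM ler_nat mul2n doubleS !ltnS -addnn leq_addr.
Qed.

End EntropyProduction.

(** * The Kawasaki dynamics in rescaled time as a jump process *)

Section KawasakiModel.
Context (R : realType) (K : R -> R) (N : nat) (gamma beta alpha : R) (m : int).
Context d (Om : measurableType d) (P : probability Om R).
Context (init : config N -> R) (sigma : R -> Om -> config N).
Hypothesis alpha0 : 0 < alpha.
Hypothesis hsigma : kawasaki_process P K gamma beta m init sigma.
Local Notation r := (fun (c : config N) (i : site N) => alpha^-1 * rate K gamma beta c i).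

(** The generating sets of [natural_filtration] at time t / alpha, so that the generated
    sigma-algebra is the same by unfolding. *)
Definition history (t : R) : set (set Om) :=
  [set B | exists s c, 0 <= s <= t / alpha /\ B = sigma s @^-1` [set c]].

Lemma kawasaki_jump_process : jump_process (@exchange N) r P (fun t => sigma (t / alpha))
  history (fun h => semigroup K gamma beta (h / alpha)).
Proof.
have [h1 h2 h3 h4 h5] := hsigma; have ai : 0 < alpha^-1 by rewrite invr_gt0.
split.
- move=> t A t0; apply: (smallest_sub (C := sigma_algebra setT)) => [|B [s [c [/andP[s0 _] ->]]]].
    exact: sigma_algebra_measurable.
  exact: h1.
- move=> s t c /andP[s0 st]; apply: sub_sigma_algebra; exists (s / alpha), c; split=> //.
  by rewrite divr_ge0// ?(ltW alpha0)//= ler_pM2r.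
- move=> s t A /andP[s0 st]; apply: sub_sigma_algebra2 => B [u [c [/andP[u0 us] ->]]].
  by exists u, c; split=> //; rewrite u0 (le_trans us)// ler_pM2r.
- move=> t x t0; have ta : 0 <= t / alpha by rewrite divr_ge0// ltW.
  have /at_rightP[e e0 H] := (h3 x).1 _ ta; apply/at_rightP.
  exists (e * alpha) => [|v /andP[tv ve]]; first exact: mulr_gt0.
  by apply: H; rewrite ltr_pM2r// tv/= ltr_pdivrMr// mulrDl divfK// gt_eqF.
- move=> f; pose F := \sum_c `|f c|.
  have fF c : `|f c| <= F by rewrite /F (bigD1 c)//= lerDl sumr_ge0.
  exists (F * expR (alpha^-1 * (2 * (N.*2).+1%:R))).
    by rewrite mulr_ge0 ?expR_ge0// sumr_ge0.
  move=> h x /andP[h0 h1'].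
  have tt : 0 <= h / alpha <= alpha^-1.
    by rewrite divr_ge0 ?(ltW alpha0)//= ler_piMl// ltW.
  have := semigroup_expansion K gamma beta x fF ai tt.
  have -> : h / alpha / alpha^-1 = h by field; rewrite gt_eqF.
  by move=> H; rewrite [leRHS]mulrC jump_genE (mulrA h alpha^-1).
- move=> s h B f s0 h0 FB; rewrite (mulrDl s h alpha^-1).
  by apply: h5 => //; rewrite divr_ge0// ltW.
- by move=> c i; rewrite mulr_ge0 ?(ltW ai)// ltW ?rate_gt0.
Qed.

Lemma dynkin_martE (delta : R) (phi : R -> R) t x :
  dynkin_martingale K gamma beta alpha delta sigma phi t x =
  mart (@exchange N) r (fun t => sigma (t / alpha)) (field_observable K gamma delta phi) t x.
Proof.
rewrite /dynkin_martingale /mart; congr (_ - _); apply: eq_Rintegral => s _.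
by rewrite jump_genE.
Qed.

Lemma conserved_spin t x : 0 <= t -> mean_spin R (sigma (t / alpha) x) = eps R N * m%:~R.
Proof.
have [_ h2 _ _ _] := hsigma => t0.
rewrite /mean_spin /mean -mulr_sumr; congr (_ * _).
by apply: h2; rewrite divr_ge0// ltW.
Qed.

End KawasakiModel.

(** * Increments of the field and the carre du champ *)

Section FieldGradient.
Context (R : realType) (K : R -> R) (N : nat) (gamma beta alpha delta : R).
Local Notation n := (N.*2).+1.
Local Notation e := (eps R N).
Local Notation s := (spin R).
Local Notation kap := (@kappa R K N gamma).
Hypothesis alpha0 : 0 < alpha.
Hypothesis kap0 : kap 0 = 0.
Hypothesis kapN : forall i : site N, kap (- i) = kap i.
Hypothesis kap_ge0 : forall i : site N, 0 <= kap i.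
Hypothesis kap_sum : \sum_(i : site N) kap i = 1.
Hypothesis beta1 : `|beta| <= 1.

Lemma eps_gt0 : 0 < e. Proof. by rewrite invr_gt0. Qed.

Definition on_site (phi : R -> R) (i : site N) := phi (e * (i : nat)%:R).

(** The discrete gradient of phi averaged by the kernel: the convolution in the field is moved onto
    the test function. *)
Definition field_grad phi i : R :=
  \sum_z kap z * (e^-1 * (on_site phi (succ_site i + z) - on_site phi (i + z))).

Lemma field_obs_exchange phi c i :
  field_observable K gamma delta phi (exchange c i) - field_observable K gamma delta phi c =
  e ^+ 2 / delta * (s c i - s c (succ_site i)) * field_grad phi i.
Proof.
have e0 : e != 0 by rewrite gt_eqF ?eps_gt0.
have -> : field_grad phi i = e^-1 * (\sum_j kap (j - succ_site i) * on_site phi j -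
    \sum_j kap (j - i) * on_site phi j).
  have sh k : \sum_j kap (j - k) * on_site phi j = \sum_z kap z * on_site phi (k + z).
    rewrite (reindex_inj (addrI k)); apply: eq_bigr => z _.
    by rewrite addrAC subrr add0r.
  rewrite !sh /field_grad -sumrB mulr_sumr; apply: eq_bigr => z _; ring.
rewrite /field_observable /pairing -mulrBr -sumrB.
rewrite (eq_bigr (fun j => (s c i - s c (succ_site i)) / delta *
   (kap (j - succ_site i) * on_site phi j - kap (j - i) * on_site phi j))); last first.
  move=> j _; rewrite /rescaled_field exchangeE local_field_swap /on_site.
  by move: (local_field _ _ _ _) (kap _) (kap _) (phi _) delta^-1 => *; ring.
rewrite -mulr_sumr sumrB; move: (\sum_j _ * _) (\sum_j _ * _) => a b.
transitivity (e * (e / e) * ((s c i - s c (succ_site i)) / delta * (b - a))); last by ring.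
by rewrite divff// mulr1.
Qed.

Definition noise_coef := e ^+ 3 / (alpha * delta ^+ 2).

(** The square of s_i - s_(i+1) is 2 (1 - s_i s_(i+1)): this is how the two-point function
    enters. *)
Lemma carre_field phi psi c :
  carre (@exchange N) (fun c i => alpha^-1 * rate K gamma beta c i)
    (field_observable K gamma delta phi) (field_observable K gamma delta psi) c =
  noise_coef * \sum_i e * (2 * rate K gamma beta c i * (1 - s c i * s c (succ_site i)) *
     (field_grad phi i * field_grad psi i)).
Proof.
rewrite /carre mulr_sumr; apply: eq_bigr => i _; rewrite !field_obs_exchange.
have E : (s c i - s c (succ_site i)) ^+ 2 = 2 * (1 - s c i * s c (succ_site i)).
  have -> : (s c i - s c (succ_site i)) ^+ 2 = s c i ^+ 2 - 2 * (s c i * s c (succ_site i)) + s c (succ_site i) ^+ 2 by ring.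
  by rewrite !(expr2 (s c _)) !spin_sq; ring.
rewrite /noise_coef; move: (rate _ _ _ _ _) (field_grad _ _) (field_grad _ _) => a b' b.
have -> : alpha^-1 * a * (e ^+ 2 / delta * (s c i - s c (succ_site i)) * b *
   (e ^+ 2 / delta * (s c i - s c (succ_site i)) * b')) =
   alpha^-1 * a * e ^+ 4 * delta^-1 ^+ 2 * (s c i - s c (succ_site i)) ^+ 2 * b * b' by ring.
by rewrite E invfM exprVn; ring.
Qed.

Lemma rate_half (c : config N) i (eta : R) :
  `|hamiltonian K gamma (exchange c i) - hamiltonian K gamma c| <= eta ->
  `|2 * rate K gamma beta c i - 1| <= eta.
Proof.
move=> He; apply: le_trans He; rewrite /rate; set D := hamiltonian _ _ (exchange c i) - _.
apply: (@le_trans _ _ `|beta * D|); last by rewrite normrM ler_piMl.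
move: (beta * D) => x; have E0 := expR_gt0 x; have E1 : 0 < 1 + expR x by rewrite addr_gt0.
have -> : 2 * (1 + expR x)^-1 - 1 = (1 - expR x) / (1 + expR x) by field; rewrite gt_eqF.
rewrite normrM normfV (gtr0_norm E1) ler_pdivrMr//.
have [x0|/ltW x0] := leP 0 x.
  rewrite (ger0_norm x0) ler0_norm ?subr_le0; last by rewrite -expR0 ler_expR.
  have := expR_ge1Dx (- x); rewrite expRN => H.
  have : (1 - x) * expR x <= 1 by rewrite -ler_pdivlMr// mul1r; lra.
  by nra.
rewrite (ler0_norm x0) ger0_norm ?subr_ge0; last by rewrite -expR0 ler_expR.
by have := expR_ge1Dx x; nra.
Qed.

(** Twice a rate is 1 up to the energy of the exchange, of order [gamma]. The division by L2 brings
    the coefficients of the two-point function below 1. *)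
Lemma carre_approx phi psi (L2 eta : R) c : 0 < L2 ->
  (forall i, `|field_grad phi i * field_grad psi i| <= L2) ->
  (forall (c : config N) (i : site N),
    `|hamiltonian K gamma (exchange c i) - hamiltonian K gamma c| <= eta) -> 0 <= noise_coef ->
  `|carre (@exchange N) (fun c i => alpha^-1 * rate K gamma beta c i)
    (field_observable K gamma delta phi) (field_observable K gamma delta psi) c -
   noise_coef * \sum_i e * (field_grad phi i * field_grad psi i)| <=
  noise_coef * (L2 * (`|two_point (fun i => (field_grad phi i * field_grad psi i) / L2) c| + 2 * eta)).
Proof.
move=> L20 aL He n0; rewrite carre_field -mulrBr normrM (ger0_norm n0) ler_wpM2l//.
pose a i := field_grad phi i * field_grad psi i.
have -> : \sum_i e * (2 * rate K gamma beta c i * (1 - s c i * s c (succ_site i)) * a i) - \sum_i e * a i =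
  - L2 * two_point (fun i => a i / L2) c +
  \sum_i e * ((2 * rate K gamma beta c i - 1) * (1 - s c i * s c (succ_site i)) * a i).
  rewrite /two_point /mean -sumrB mulr_sumr -big_split/=; apply: eq_bigr => i _.
  by rewrite -/e; field; rewrite gt_eqF.
apply: le_trans (ler_normD _ _) _; rewrite normrM normrN (gtr0_norm L20) mulrDr lerD2l.
apply: le_trans (ler_norm_sum _ _ _) _.
apply: (@le_trans _ _ (\sum_(i : site N) e * (L2 * (2 * eta)))); last first.
  by rewrite sumr_const card_ord -[X in X <= _]mulr_natl mulrA /eps divff ?mul1r ?pnatr_eq0.
apply: ler_sum => i _; rewrite normrM (gtr0_norm eps_gt0) ler_pM2l ?eps_gt0//.
rewrite normrM mulrC ler_pM//; first exact: aL.
rewrite normrM mulrC ler_pM//; last exact: rate_half (He c i).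
by case: (spin_cases R c i) => ->; case: (spin_cases R c (succ_site i)) => ->;
  rewrite ler_norml; apply/andP; split; lra.
Qed.

(** The fields of two neighbours differ by at most the total variation of the kernel, which is of
    order [gamma] although the kernel has total mass 1. *)
Lemma ham_exchange_le (kmax tv : R) (c : config N) i : (forall j : site N, kap j <= kmax) ->
  \sum_(j : site N) `|kap (succ_site j) - kap j| <= tv ->
  `|hamiltonian K gamma (exchange c i) - hamiltonian K gamma c| <= 2 * tv + 4 * kmax.
Proof.
move=> km tvE; rewrite exchangeE ham_swap//.
have sd : `|s c i - s c (succ_site i)| <= 2.
  by case: (spin_cases R c i) => ->; case: (spin_cases R c (succ_site i)) => ->;
    rewrite ler_norml; apply/andP; split; lra.
apply: le_trans (ler_normD _ _) _; apply: lerD.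
  rewrite normrM; apply: ler_pM => //; apply: le_trans tvE.
  rewrite distrC /local_field -sumrB; apply: le_trans (ler_norm_sum _ _ _) _.
  rewrite (reindex_inj (h := fun j => i - j)) /=; last by move=> x y /addrI/oppr_inj.
  apply: ler_sum => j _; rewrite -mulrBl normrM spin_norm mulr1.
  have -> : succ_site i - (i - j) = succ_site j.
    by apply/eqP; rewrite subr_eq /succ_site [j + _]addrC -addrA subrKC addrC.
  by rewrite subKr.
rewrite normrM (ger0_norm (kap_ge0 _)) mulrC; apply: ler_pM => //.
rewrite normrX (_ : 4 = 2 ^+ 2 :> R); last by ring.
by rewrite lerXn2r// nnegrE.
Qed.

End FieldGradient.

(** * Smooth test functions and the discrete gradient *)

Section SmoothTorus.
Context (R : realType).
Local Notation leb := (@lebesgue_measure R).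
Implicit Types f g : R -> R.

Lemma smooth_is_derive f (x : R) : smooth f -> is_derive x (1 : R) f (derive1 f x).
Proof.
move=> sf; apply: DeriveDef; first exact: (sf 0%N x).
by rewrite derive1E.
Qed.

Lemma smooth_derive1 f : smooth f -> smooth (derive1 f).
Proof. by move=> sf n x; have := sf n.+1 x; rewrite /derive1n iterSr. Qed.

Lemma smooth_continuous f : smooth f -> continuous f.
Proof.
by move=> sf x; apply: differentiable_continuous; apply/derivable1_diffP; exact: (sf 0%N x).
Qed.

Lemma derive1_lin a f g : smooth f -> smooth g ->
  derive1 (fun x => a * f x + g x) = fun x => a * derive1 f x + derive1 g x.
Proof.
move=> sf sg; apply: funext => x.
have df := smooth_is_derive x sf; have dg := smooth_is_derive x sg.
have d : is_derive x (1 : R) (fun x => a * f x + g x) (a * derive1 f x + derive1 g x).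
  by apply: is_derive_eq; rewrite /GRing.scale/=; ring.
by rewrite [LHS]derive1E; exact: derive_val.
Qed.

Lemma smooth_lin a f g : smooth f -> smooth g -> smooth (fun x => a * f x + g x).
Proof.
move=> sf sg n; elim: n f g sf sg => [|n IH] f g sf sg x.
  have df := smooth_is_derive x sf; have dg := smooth_is_derive x sg.
  have d : is_derive x (1 : R) (fun x => a * f x + g x) (a * derive1 f x + derive1 g x).
    by apply: is_derive_eq; rewrite /GRing.scale/=; ring.
  by case: d.
rewrite /derive1n iterSr (derive1_lin a sf sg).
exact: (IH _ _ (smooth_derive1 sf) (smooth_derive1 sg) x).
Qed.

Lemma smooth_cst (c : R) : smooth (fun=> c).
Proof.
move=> n; elim: n c => [|n IH] c x; first exact: derivable_cst.
rewrite /derive1n iterSr (_ : derive1 (fun=> c) = fun=> 0); first exact: IH.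
by apply: funext => y; rewrite derive1E; exact: derive_cst.
Qed.

Lemma torus_lin a f g : smooth_torus f -> smooth_torus g ->
  smooth_torus (fun x => a * f x + g x).
Proof.
by move=> [sf pf] [sg pg]; split=> [|x]; [exact: smooth_lin|rewrite pf pg].
Qed.

Lemma torus_sum (J : Type) (s : seq J) (a : J -> R) (F : J -> R -> R) :
  (forall j, smooth_torus (F j)) -> smooth_torus (fun x => \sum_(j <- s) a j * F j x).
Proof.
move=> tF; elim: s => [|j s IH].
  rewrite (_ : (fun x => _) = fun=> 0); last by apply: funext => x; rewrite big_nil.
  by split=> // x; exact: smooth_cst.
rewrite (_ : (fun x => _) = fun x => a j * F j x + \sum_(j <- s) a j * F j x).
  exact: torus_lin.
by apply: funext => x; rewrite big_cons.
Qed.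

Lemma derive1_sum (J : Type) (s : seq J) (a : J -> R) (F : J -> R -> R) :
  (forall j, smooth_torus (F j)) ->
  derive1 (fun x => \sum_(j <- s) a j * F j x) = fun x => \sum_(j <- s) a j * derive1 (F j) x.
Proof.
move=> tF; elim: s => [|j s IH].
  rewrite (_ : (fun x => _) = fun=> 0); last by apply: funext => x; rewrite big_nil.
  by apply: funext => x; rewrite big_nil derive1E; exact: derive_cst.
rewrite (_ : (fun x => \sum_(_ <- _) _) = fun x => a j * F j x + \sum_(j <- s) a j * F j x).
  rewrite derive1_lin; [|by case: (tF j)|by case: (torus_sum s a tF)].
  by rewrite IH; apply: funext => x; rewrite big_cons.
by apply: funext => x; rewrite big_cons.
Qed.

Lemma torus_derive1 f : smooth_torus f -> smooth_torus (derive1 f).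
Proof.
move=> [sf pf]; split=> [|x]; first exact: smooth_derive1.
have dx1 := smooth_is_derive (x + 1) sf.
have d : is_derive x (1 : R) (f \o (fun y => y + 1)) (derive1 f (x + 1) * 1).
  apply: is_derive1_comp; apply: is_derive_eq; by rewrite addr0.
have E : f \o (fun y => y + 1) = f by apply: funext => y; exact: pf.
rewrite E in d; rewrite [RHS]derive1E.
by have := @derive_val _ _ _ _ _ _ _ d => ->; rewrite mulr1.
Qed.

Lemma periodic_nat f x (k : nat) : (forall x, f (x + 1) = f x) -> f (x + k%:R) = f x.
Proof.
move=> pf; elim: k => [|k IH]; first by rewrite addr0.
by rewrite -[k.+1%:R]natr1 addrA pf.
Qed.

Lemma torus_bounded f : smooth_torus f -> exists2 B : R, 0 <= B & forall x, `|f x| <= B.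
Proof.
move=> [sf pf]; have cf := smooth_continuous sf.
have [_ [B HB]] := cont_bdmeas 0 1 cf.
exists B => [|x]; first by apply: le_trans (HB 0 _); rewrite //= in_itv/= lexx ler01.
pose k := (Num.trunc `|x|).+1; have xk : `|x| < k%:R by exact: truncnS_gt.
have y0 : 0 <= x + k%:R by move: (ler_norm (- x)); rewrite normrN; lra.
have /andP[h1 h2] := truncn_itv y0; set m := Num.trunc _ in h1 h2.
rewrite -(periodic_nat x k pf) -(subrK m%:R (x + k%:R)) (periodic_nat _ m pf).
apply: HB; rewrite /= in_itv/= subr_ge0 h1/=.
by move: h2; rewrite -[m.+1%:R]natr1; lra.
Qed.

Lemma smooth_lip f B (x y : R) : smooth f -> (forall x, `|derive1 f x| <= B) ->
  `|f x - f y| <= B * `|x - y|.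
Proof.
move=> sf fB; wlog xy : x y / x < y.
  move=> W; have [/W//|/W|->] := ltgtP x y; last by rewrite !subrr !normr0 mulr0.
  by rewrite distrC (distrC x).
have cf : {within `[x, y], continuous f}.
  by apply: continuous_subspaceT; exact: smooth_continuous.
have [c _ E] := @MVT _ f (derive1 f) x y xy (fun z _ => smooth_is_derive z sf) cf.
by rewrite distrC E normrM (distrC x) ler_wpM2r.
Qed.

Lemma smooth_taylor f B (x h : R) : smooth f -> (forall x, `|derive1 (derive1 f) x| <= B) ->
  0 < h -> `|h^-1 * (f (x + h) - f x) - derive1 f x| <= B * h.
Proof.
move=> sf fB h0; have xh : x < x + h by rewrite ltrDl.
have cf : {within `[x, x + h], continuous f}.
  by apply: continuous_subspaceT; exact: smooth_continuous.
have [c cI E] := @MVT _ f (derive1 f) x (x + h) xh (fun z _ => smooth_is_derive z sf) cf.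
have -> : h^-1 * (f (x + h) - f x) = derive1 f c.
  by rewrite E addrAC subrr add0r mulrC mulfK// gt_eqF.
apply: le_trans (smooth_lip c x (smooth_derive1 sf) fB) _.
have B0 : 0 <= B := le_trans (normr_ge0 _) (fB 0).
move: cI; rewrite in_itv/= => /andP[xc ch]; rewrite ler_wpM2l// ger0_norm; first lra.
by rewrite subr_ge0 ltW.
Qed.

Lemma dirichlet_sum (J : finType) (a b : J -> R) (F : J -> R -> R) :
  (forall j, smooth_torus (F j)) ->
  dirichlet_form (fun x => \sum_j a j * F j x) (fun x => \sum_j b j * F j x) =
  \sum_i \sum_j a i * b j * dirichlet_form (F i) (F j).
Proof.
move=> tF; rewrite /dirichlet_form !derive1_sum//.
have mI := measurable_itv `[0%R, 1%R] : measurable (`[0, 1]%classic : set R).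
have cF i : continuous (derive1 (F i)) := smooth_continuous (smooth_derive1 (tF i).1).
have bij i j : bdmeas (`[0, 1] : set R) (fun x => derive1 (F i) x * derive1 (F j) x).
  by apply: bdmeasM; exact: cont_bdmeas.
have bZ i j : bdmeas (`[0, 1] : set R) (fun x => a i * b j * (derive1 (F i) x * derive1 (F j) x)).
  exact: bdmeasZ.
have bs i : bdmeas (`[0, 1] : set R)
    (fun x => \sum_j a i * b j * (derive1 (F i) x * derive1 (F j) x)).
  exact: bdmeas_sum.
rewrite (@eq_Rintegral _ _ _ leb _ (fun x => \sum_i \sum_j a i * b j * (derive1 (F i) x * derive1 (F j) x))); last first.
  move=> x _; rewrite mulr_suml; apply: eq_bigr => i _.
  by rewrite mulr_sumr; apply: eq_bigr => j _; ring.
rewrite (@Int_sum _ _ R leb _ mI (itvc_fin 0 1)); last exact: bs.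
apply: eq_bigr => i _; rewrite (@Int_sum _ _ R leb _ mI (itvc_fin 0 1)); last exact: bZ.
by apply: eq_bigr => j _; rewrite (@IntZ _ _ R leb _ mI (itvc_fin 0 1) _ _ (bij i j)).
Qed.

Lemma riemann_lip (h : R -> R) (Lip e : R) k : 0 < e -> continuous h ->
  (forall x y, `|h x - h y| <= Lip * `|x - y|) ->
  `|Rintegral leb `[0, k%:R * e] h - \sum_(i < k) e * h (e * i%:R)| <= k%:R * (Lip * e ^+ 2).
Proof.
move=> e0 ch hL.
have L0 : 0 <= Lip.
  have := le_trans (normr_ge0 _) (hL 1 0); rewrite subr0 normr1 mulr1; exact.
elim: k => [|k IH].
  by rewrite !mul0r set_itv1 Rintegral_set1 big_ord0 subrr normr0.
have kS : k.+1%:R * e = k%:R * e + e by rewrite -[k.+1%:R]natr1; ring.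
have ke : 0 <= k%:R * e by rewrite mulr_ge0// ltW.
have keS : k%:R * e <= k.+1%:R * e by rewrite kS lerDl ltW.
rewrite (@Int_split _ _ 0 (k%:R * e)); [|by rewrite ke keS|exact: cont_bdmeas].
rewrite big_ord_recr/=.
have I1 : `|Rintegral leb `[k%:R * e, k.+1%:R * e] h - e * h (e * k%:R)| <= Lip * e ^+ 2.
  have mI := measurable_itv `[k%:R * e, k.+1%:R * e] : measurable (`[k%:R * e, k.+1%:R * e]%classic : set R).
  have bh : bdmeas (`[k%:R * e, k.+1%:R * e] : set R) h by exact: cont_bdmeas.
  have fine_e : fine (leb `[k%:R * e, k.+1%:R * e]) = e.
    rewrite lebesgue_measure_itv/= lte_fin kS ltrDl e0 -EFinB/=; ring.
  have -> : e * h (e * k%:R) = Rintegral leb `[k%:R * e, k.+1%:R * e] (fun=> h (e * k%:R)).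
    by rewrite Rintegral_cst// fine_e mulrC.
  rewrite -(@IntB _ _ R leb _ mI (itvc_fin _ _) _ _ bh (bdmeas_cst _ _)).
  have := @Int_norm_le _ _ R leb _ mI (itvc_fin _ _) _ (Lip * e)
    (bdmeasB bh (bdmeas_cst _ (h (e * k%:R)))).
  rewrite fine_e -mulrA -expr2; apply => x /=; rewrite in_itv/= => /andP[x1 x2].
  apply: le_trans (hL _ _) _; rewrite ler_wpM2l// (mulrC e) ger0_norm ?subr_ge0//.
  by rewrite lerBlDl -kS.
have -> : k.+1%:R * (Lip * e ^+ 2) = k%:R * (Lip * e ^+ 2) + Lip * e ^+ 2.
  by rewrite -[k.+1%:R]natr1; ring.
move: IH I1; move: (Rintegral leb _ h) (Rintegral leb _ h) (\sum_(_ < k) _) => b a c IH I1.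
have -> : a + b - (c + e * h (e * k%:R)) = (a - c) + (b - e * h (e * k%:R)) by ring.
by apply: le_trans (ler_normD _ _) _; exact: lerD.
Qed.

End SmoothTorus.

(** * Convergence of the averaged discrete gradient *)

Section GradientLimit.
Context (R : realType) (K : R -> R) (N : nat) (gamma : R).
Local Notation n := (N.*2).+1.
Local Notation e := (eps R N).
Local Notation kap := (@kappa R K N gamma).
Hypothesis kap_ge0 : forall i : site N, 0 <= kap i.
Hypothesis kap_sum : \sum_(i : site N) kap i = 1.
Local Notation grad := (field_grad K gamma).

Let e0 : 0 < e. Proof. exact: eps_gt0. Qed.
Let en : e * n%:R = 1. Proof. by rewrite /eps mulVf// pnatr_eq0. Qed.

Lemma on_site_mod (f : R -> R) (k : nat) : (forall x, f (x + 1) = f x) ->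
  f (e * (k %% n)%N%:R) = f (e * k%:R).
Proof.
move=> pf; rewrite {2}(divn_eq k n) natrD mulrDr natrM.
have -> : e * ((k %/ n)%N%:R * n%:R) = (k %/ n)%N%:R by rewrite mulrCA en mulr1.
by rewrite addrC periodic_nat.
Qed.

Lemma on_site_shift (f : R -> R) (i z : site N) : (forall x, f (x + 1) = f x) ->
  on_site f (i + z) = f (e * (i : nat)%:R + e * (centered z)%:~R).
Proof.
move=> pf; rewrite /on_site /= on_site_mod// natrD mulrDr /centered; case: ifP => // zN.
rewrite intrD rmorphN/= -[RHS]pf; congr f.
by rewrite -!pmulrn mulrBr en; ring.
Qed.

Lemma on_site_succ (f : R -> R) (i : site N) : (forall x, f (x + 1) = f x) ->
  on_site f (succ_site i) = f (e * (i : nat)%:R + e).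
Proof.
move=> pf; rewrite /on_site val_succ_site on_site_mod//; congr f.
by rewrite -[i.+1%:R]natr1; ring.
Qed.

Lemma field_gradE (f : R -> R) (i : site N) : (forall x, f (x + 1) = f x) ->
  grad f i = \sum_z kap z * (e^-1 * (f (e * (i : nat)%:R + e * (centered z)%:~R + e) -
    f (e * (i : nat)%:R + e * (centered z)%:~R))).
Proof.
move=> pf; apply: eq_bigr => z _; congr (_ * (_ * (_ - _))); last exact: on_site_shift.
have -> : succ_site i + z = succ_site (i + z) by rewrite /succ_site addrAC.
rewrite on_site_succ//.
have := @on_site_shift (fun x => f (x + e)) i z; rewrite /on_site => ->//.
by move=> x; rewrite addrAC pf.
Qed.

Lemma field_grad_bound (f : R -> R) B (i : site N) : smooth_torus f -> (forall x, `|derive1 f x| <= B) ->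
  `|grad f i| <= B.
Proof.
move=> [sf pf] fB; rewrite field_gradE//; apply: le_trans (ler_norm_sum _ _ _) _.
rewrite -[leRHS]mul1r -kap_sum mulr_suml; apply: ler_sum => z _.
rewrite normrM (ger0_norm (kap_ge0 z)) ler_wpM2l// normrM normfV (gtr0_norm e0) ler_pdivrMl//.
apply: le_trans (smooth_lip _ _ sf fB) _.
by rewrite addrAC subrr add0r gtr0_norm// mulrC.
Qed.

(** The kernel displaces the argument by a random v; the bound |v| <= rho + v^2 / rho uses only the
    second moment of the kernel, and rho is left free. *)
Lemma field_grad_approx (f : R -> R) B (rho : R) (i : site N) : smooth_torus f ->
  (forall x, `|derive1 (derive1 f) x| <= B) -> 0 < rho -> 0 < gamma ->
  `|grad f i - derive1 f (e * (i : nat)%:R)| <=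
  B * (e + rho + e ^+ 2 * second_moment K N gamma / (gamma ^+ 2 * rho)).
Proof.
move=> [sf pf] fB r0 g0.
have B0 : 0 <= B := le_trans (normr_ge0 _) (fB 0).
pose x := e * (i : nat)%:R; pose S := \sum_(z : site N) (centered z)%:~R ^+ 2 * kap z.
have -> : e ^+ 2 * second_moment K N gamma / (gamma ^+ 2 * rho) = e ^+ 2 / rho * S.
  by rewrite /second_moment -/S; field; rewrite !gt_eqF.
rewrite field_gradE// -/x.
have -> : \sum_z kap z * (e^-1 * (f (x + e * (centered z)%:~R + e) - f (x + e * (centered z)%:~R))) -
    derive1 f x = \sum_z kap z * (e^-1 * (f (x + e * (centered z)%:~R + e) -
      f (x + e * (centered z)%:~R)) - derive1 f x).
  rewrite [RHS](eq_bigr (fun z => kap z * (e^-1 * (f (x + e * (centered z)%:~R + e) -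
     f (x + e * (centered z)%:~R))) - kap z * derive1 f x)) => [|z _]; last by rewrite mulrBr.
  by rewrite sumrB -mulr_suml kap_sum mul1r.
apply: le_trans (ler_norm_sum _ _ _) _.
have -> : B * (e + rho + e ^+ 2 / rho * S) =
    \sum_(z : site N) kap z * (B * (e + rho + e ^+ 2 / rho * (centered z)%:~R ^+ 2)).
  rewrite [RHS](eq_bigr (fun z : site N => B * (e + rho) * kap z +
     B * (e ^+ 2 / rho) * ((centered z)%:~R ^+ 2 * kap z))) => [|z _]; last by ring.
  rewrite big_split/=.
  have -> : \sum_(z : site N) B * (e + rho) * kap z = B * (e + rho).
    by rewrite -mulr_sumr kap_sum mulr1.
  have -> : \sum_(z : site N) B * (e ^+ 2 / rho) * ((centered z)%:~R ^+ 2 * kap z) =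
      B * (e ^+ 2 / rho) * S by rewrite -mulr_sumr.
  by clear; clearbody S; ring.
apply: ler_sum => z _; rewrite normrM (ger0_norm (kap_ge0 z)) ler_wpM2l//.
set c : R := (centered z)%:~R; set y := x + e * c.
have -> : e^-1 * (f (y + e) - f y) - derive1 f x =
  (e^-1 * (f (y + e) - f y) - derive1 f y) + (derive1 f y - derive1 f x) by ring.
have EB (X : R) : B * (e + rho + X) = B * e + B * (rho + X) by ring.
apply: le_trans (ler_normD _ _) _; rewrite EB; apply: lerD.
  exact: smooth_taylor.
apply: le_trans (smooth_lip y x (smooth_derive1 sf) fB) _; rewrite ler_wpM2l//.
rewrite /y addrAC subrr add0r.
have -> : e ^+ 2 / rho * c ^+ 2 = (e * c) ^+ 2 / rho by ring.
move: (e * c) => v; have [vr|rv] := leP `|v| rho.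
  by apply: le_trans vr _; rewrite lerDl divr_ge0 ?sqr_ge0// ltW.
apply: (@le_trans _ _ (v ^+ 2 / rho)); last by rewrite lerDr ltW.
by rewrite ler_pdivlMr// -(real_normK (num_real v)) expr2 ler_wpM2l// ltW.
Qed.

Lemma gradient_sum (f g : R -> R) B (rho : R) : smooth_torus f -> smooth_torus g ->
  (forall x, `|derive1 f x| <= B) -> (forall x, `|derive1 g x| <= B) ->
  (forall x, `|derive1 (derive1 f) x| <= B) -> (forall x, `|derive1 (derive1 g) x| <= B) ->
  0 < rho -> 0 < gamma ->
  `|\sum_(i : site N) e * (grad f i * grad g i) - dirichlet_form f g| <=
  2 * B ^+ 2 * (e + rho + e ^+ 2 * second_moment K N gamma / (gamma ^+ 2 * rho)) + 2 * B ^+ 2 * e.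
Proof.
move=> tf tg f1 g1 f2 g2 r0 g0; set W := e + rho + _.
have B0 : 0 <= B := le_trans (normr_ge0 _) (f1 0).
pose h x := derive1 f x * derive1 g x.
have cf := smooth_continuous (smooth_derive1 tf.1).
have cg := smooth_continuous (smooth_derive1 tg.1).
have ch : continuous h by move=> x; apply: cvgM; [exact: cf|exact: cg].
have hL x y : `|h x - h y| <= 2 * B ^+ 2 * `|x - y|.
  have -> : h x - h y = derive1 f x * (derive1 g x - derive1 g y) +
     (derive1 f x - derive1 f y) * derive1 g y by rewrite /h; ring.
  apply: le_trans (ler_normD _ _) _; rewrite !normrM.
  have -> : 2 * B ^+ 2 * `|x - y| = B * (B * `|x - y|) + (B * `|x - y|) * B by ring.
  apply: lerD; apply: ler_pM => //.
    exact: smooth_lip (smooth_derive1 tg.1) g2.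
  exact: smooth_lip (smooth_derive1 tf.1) f2.
have := @riemann_lip _ h (2 * B ^+ 2) e n e0 ch hL.
have -> : n%:R * e = 1 by rewrite mulrC.
have -> : n%:R * (2 * B ^+ 2 * e ^+ 2) = 2 * B ^+ 2 * e.
  have -> : n%:R * (2 * B ^+ 2 * e ^+ 2) = 2 * B ^+ 2 * (e * n%:R) * e by ring.
  by rewrite en mulr1.
rewrite -/(dirichlet_form f g) => HR.
have HS : `|\sum_(i : site N) e * (grad f i * grad g i) - \sum_(i < n) e * h (e * i%:R)| <= 2 * B ^+ 2 * W.
  rewrite -sumrB; apply: le_trans (ler_norm_sum _ _ _) _.
  apply: (@le_trans _ _ (\sum_(i : site N) e * (2 * B ^+ 2 * W))); last first.
    by rewrite sumr_const card_ord -[X in X <= _]mulr_natl mulrA (mulrC n%:R) en mul1r.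
  apply: ler_sum => i _; rewrite -mulrBr normrM (gtr0_norm e0) ler_pM2l//.
  set x := e * i%:R.
  have -> : grad f i * grad g i - h x = grad f i * (grad g i - derive1 g x) +
     (grad f i - derive1 f x) * derive1 g x by rewrite /h; ring.
  apply: le_trans (ler_normD _ _) _; rewrite !normrM.
  have -> : 2 * B ^+ 2 * W = B * (B * W) + (B * W) * B by ring.
  apply: lerD; apply: ler_pM => //.
  - exact: field_grad_bound.
  - exact: field_grad_approx.
  - exact: field_grad_approx.
move: HS HR; move: (\sum_i _) (\sum_(i < n) _) (dirichlet_form f g) => b a c HS HR.
have -> : a - c = (a - b) - (c - b) by ring.
by apply: le_trans (ler_normB _ _) _; exact: lerD.
Qed.

End GradientLimit.

(** * The scaling limit *)

Section KacLimit.
Context (R : realType) (G : set R) (N : R -> nat) (K : R -> R)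
  (alpha delta beta : R -> R) (nu chi sigmastar A Mbar : R) (M : nat -> int).
Hypothesis hG : G `<=` `]0, 1 / 4[.
Hypothesis hN : N g @[g --> kac_limit G] --> \oo.
Hypothesis hpos : forall g, G g -> 0 < alpha g /\ 0 < delta g.
Hypothesis hA : assumption_kernel G N K.
Hypothesis hB : assumption_scaling G N K alpha delta beta nu chi sigmastar A.
Hypothesis hM : (delta g)^-1 * (eps R (N g) * (M (N g))%:~R) @[g --> kac_limit G] --> Mbar.
Local Notation F := (kac_limit G).
Local Notation e g := (eps R (N g)).

#[local] Instance kac_filter : Filter F. Proof. exact: within_filter. Qed.

(** The unit in which all scales are integer powers: eps = p^4, [delta] ~ p, [gamma] ~ p^3, [alpha]
    ~ p^10. *)
Definition mesh (g : R) : R := e g `^ (1 / 4).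
Local Notation p := mesh.

Lemma mesh_gt0 g : 0 < p g. Proof. by rewrite powR_gt0// eps_gt0. Qed.

Lemma meshX (g a : R) k : a = 1 / 4 * k%:R -> e g `^ a = p g ^+ k.
Proof. by move=> ->; rewrite powRrM powR_mulrn// powR_ge0. Qed.

Lemma mesh4 g : e g = p g ^+ 4.
Proof. by rewrite -(@meshX g 1) ?powRr1 ?(ltW (eps_gt0 _ _))//; field. Qed.

Lemma near_G : \forall g \near F, G g.
Proof. exact: withinT. Qed.

Lemma eps_small (c : R) : 0 < c -> \forall g \near F, e g <= c /\ (0 < N g)%N.
Proof.
move=> c0; pose k := (Num.trunc c^-1).+1.
have H : \forall g \near F, (k <= N g)%N by exact: (hN (nbhs_infty_ge k)).
apply: filterS H => g kN; split; last exact: leq_trans kN.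
rewrite /eps -[c]invrK lef_pV2 ?posrE ?invr_gt0//; apply: le_trans (ltW (truncnS_gt _)) _.
by rewrite ler_nat; apply: leq_trans kN _; lia.
Qed.

Lemma mesh_small (c : R) : 0 < c -> \forall g \near F, p g <= c.
Proof.
move=> c0; have c4 : 0 < c ^+ 4 by rewrite exprn_gt0.
apply: filterS (eps_small c4) => g [ec _].
have := ec; rewrite mesh4 ler_pXn2r// nnegrE ltW//; exact: mesh_gt0.
Qed.

(** All that is retained of the limits in the scaling: later errors are bounded by constants times
    c, and statements along the filter become statements on small c. *)
Record good (c Cm CM g : R) : Prop := Good {
  good_G : G g;
  good_p : p g <= c;
  good_p1 : p g <= 1;
  good_alpha : alpha g <= 2 * p g ^+ 10;
  good_delta : p g / 2 <= delta g;
  good_gamma : p g ^+ 3 / 2 <= g <= 2 * p g ^+ 3;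
  good_beta : `|beta g| <= 1;
  good_noise : `|noise_coef (N g) (alpha g) (delta g) - sigmastar ^+ 2| <= c;
  good_m2 : e g ^+ 2 * second_moment K (N g) g / g ^+ 2 <= Cm * p g ^+ 2;
  good_mass : `|e g * (M (N g))%:~R| <= CM * p g;
  good_N : (0 < N g)%N
}.

Lemma good_le c c' Cm CM g : c <= c' -> good c Cm CM g -> good c' Cm CM g.
Proof.
by move=> cc [h1 h2 h3 h4 h5 h6 h7 h8 h9 h10 h11]; split=> //; exact: le_trans cc.
Qed.

Lemma ratio_near (u v : R -> R) : (forall g, 0 < v g) -> u g / v g @[g --> F] --> (1 : R) ->
  \forall g \near F, v g / 2 <= u g <= 2 * v g.
Proof.
move=> v0 uv; have h2 : 0 < 1 / 2 :> R by [].
have /cvgrPdist_le/(_ _ h2) := uv; apply: filterS => g; rewrite ler_norml => /andP[h3 h4].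
have E : u g = (u g / v g) * v g by rewrite divfK// gt_eqF.
rewrite E; move: (u g / v g) h3 h4 => z z1 z2; apply/andP; split.
  by rewrite mulrC ler_pM2r//; lra.
by rewrite ler_pM2r//; lra.
Qed.

Lemma limit_near (u : R -> R) (l c : R) : 0 < c -> u g @[g --> F] --> l ->
  \forall g \near F, `|u g - l| <= c.
Proof.
by move=> c0 /cvgrPdist_le/(_ _ c0); apply: filterS => g; rewrite distrC.
Qed.

(** The scaled second moment is 4 nu alpha / eps^2 in the limit, hence of order p^2, and the mean
    spin is of order [delta], hence of order p; the constants double the limits to leave a
    margin. *)
Lemma eventually_good : exists Cm CM : R, [/\ 0 <= Cm, 0 <= CM &
  forall c, 0 < c -> \forall g \near F, good c Cm CM g].
Proof.
have [[ra rd rg] [nu0 chi0 s0 A0] rnu [rchi rsig] rA] := hB.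
exists (8 * (nu + 1)), (2 * (`|Mbar| + 1)); split.
- by rewrite mulr_ge0// addr_ge0// ltW.
- by rewrite mulr_ge0// addr_ge0.
move=> c c0.
have pX k g : 0 < p g ^+ k by rewrite exprn_gt0// mesh_gt0.
have na : \forall g \near F, p g ^+ 10 / 2 <= alpha g <= 2 * p g ^+ 10.
  apply: (ratio_near (pX 10%N)); rewrite (_ : (fun g => _) = fun g => alpha g / e g `^ (5 / 2))//.
  by apply: funext => g; rewrite (@meshX g _ 10)//; field.
have nd : \forall g \near F, p g / 2 <= delta g <= 2 * p g.
  by apply: ratio_near rd; exact: mesh_gt0.
have ng : \forall g \near F, p g ^+ 3 / 2 <= g <= 2 * p g ^+ 3.
  apply: (ratio_near (pX 3%N)); rewrite (_ : (fun g => _) = fun g => g / e g `^ (3 / 4))//.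
  by apply: funext => g; rewrite (@meshX g _ 3)//; field.
have np := mesh_small c0.
have np1 := mesh_small ltr01.
have nsig := limit_near c0 rsig.
have nnu := limit_near ltr01 rnu.
have nchi := limit_near chi0 rchi.
have nA := limit_near A0 rA.
have nM := limit_near ltr01 hM.
have [_ n0] : True /\ \forall g \near F, e g <= 1 /\ (0 < N g)%N by split=> //; exact: eps_small.
near=> g.
have Gg : G g by near: g; exact: near_G.
have [a0 d0] := hpos Gg.
have /andP[a1 a2] : p g ^+ 10 / 2 <= alpha g <= 2 * p g ^+ 10 by near: g.
have /andP[d1 d2] : p g / 2 <= delta g <= 2 * p g by near: g.
have gg : p g ^+ 3 / 2 <= g <= 2 * p g ^+ 3 by near: g.
have p0 := mesh_gt0 g; have eE := mesh4 g; have e0 : 0 < e g by exact: eps_gt0.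
have := hG Gg; rewrite /= in_itv/= => /andP[g0 _].
split=> //.
- by near: g.
- by near: g.
(* The positivity of [chi] makes beta eventually nonnegative, and that of [A] makes it at most 1. *)
- have k1 : 0 <= kappaZ K g 1.
    by have [[K0 _] _ _ _ _] := hA; rewrite mulr_ge0// ltW.
  have ea : 0 < e g ^+ 2 / alpha g by rewrite divr_gt0// exprn_gt0.
  have h1 : `|beta g / 6 * (e g ^+ 2 * delta g ^+ 2 / alpha g) - chi| <= chi by near: g.
  have h2 : `|e g ^+ 2 / alpha g * (1 / 2 - beta g * kappaZ K g 1 - beta g / 2) - A| <= A by near: g.
  move: h1 h2; rewrite !ler_norml => /andP[h1 _] /andP[h2 _].
  have b0 : 0 <= beta g.
    have : 0 <= beta g / 6 * (e g ^+ 2 * delta g ^+ 2 / alpha g) by lra.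
    by rewrite pmulr_lge0 ?divr_gt0 ?mulr_gt0 ?exprn_gt0//; lra.
  have : 0 <= e g ^+ 2 / alpha g * (1 / 2 - beta g * kappaZ K g 1 - beta g / 2) by lra.
  rewrite pmulr_rge0// => h3.
  have : 0 <= beta g * kappaZ K g 1 by rewrite mulr_ge0.
  by move: (beta g * kappaZ K g 1) h3 => z h3 z0; apply/andP; split; lra.
- by near: g.
- have h1 : `|second_moment K (N g) g / 4 * (e g ^+ 4 / (alpha g * g ^+ 2)) - nu| <= 1 by near: g.
  have h2 : second_moment K (N g) g / 4 * (e g ^+ 4 / (alpha g * g ^+ 2)) <= nu + 1.
    by move: h1; rewrite ler_norml => /andP[_]; lra.
  have -> : e g ^+ 2 * second_moment K (N g) g / g ^+ 2 =
     4 * (second_moment K (N g) g / 4 * (e g ^+ 4 / (alpha g * g ^+ 2))) * (alpha g / e g ^+ 2).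
    by field; rewrite !gt_eqF.
  apply: (@le_trans _ _ (4 * (nu + 1) * (alpha g / e g ^+ 2))).
    by rewrite ler_wpM2r ?ler_wpM2l// divr_ge0 ?sqr_ge0// ltW.
  have -> : 8 * (nu + 1) * p g ^+ 2 = 4 * (nu + 1) * (2 * p g ^+ 10 / e g ^+ 2).
    by rewrite eE; field; rewrite gt_eqF.
  rewrite ler_wpM2l//; first by rewrite mulr_ge0// addr_ge0// ltW.
  by rewrite ler_pM2r// invr_gt0 exprn_gt0.
- have h1 : `|(delta g)^-1 * (e g * (M (N g))%:~R) - Mbar| <= 1 by near: g.
  set mm := e g * _ in h1 *.
  have h2 : `|(delta g)^-1 * mm| <= `|Mbar| + 1.
    rewrite -[_ * mm](subrK Mbar); apply: le_trans (ler_normD _ _) _.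
    by rewrite addrC lerD2l.
  rewrite normrM normfV (gtr0_norm d0) ler_pdivrMl// in h2.
  apply: le_trans h2 _.
  have -> : 2 * (`|Mbar| + 1) * p g = 2 * p g * (`|Mbar| + 1) by ring.
  by rewrite ler_wpM2r// addr_ge0.
- have : e g <= 1 /\ (0 < N g)%N by near: g.
  by case.
Unshelve. all: by end_near. Qed.

End KacLimit.

(** * The two-point function along the scaling *)

Section Replacement.
Context (R : realType) (G : set R) (N : R -> nat) (K gK : R -> R)
  (alpha delta beta : R -> R) (sigmastar : R) (M : nat -> int).
Context (d : R -> measure_display) (Om : forall g : R, measurableType (d g))
    (P : forall g : R, probability (Om g) R)
    (sigma : forall g : R, R -> Om g -> config (N g))
    (init : forall g : R, config (N g) -> R).
Record kac_model : Prop := KacModel {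
  km_G : G `<=` `]0, 1 / 4[;
  km_pos : forall g, G g -> 0 < alpha g /\ 0 < delta g;
  km_kernel : assumption_kernel G N K;
  km_int : (@lebesgue_measure R).-integrable setT (EFin \o gK);
  km_weak : weak_derivative K gK;
  km_process : forall g, G g ->
    kawasaki_process (P g) K g (beta g) (M (N g)) (@init g) (@sigma g)
}.
Hypothesis KM : kac_model.
Let hG := km_G KM.
Let hpos := km_pos KM.
Let hA := km_kernel KM.
Let igK := km_int KM.
Let wK := km_weak KM.
Let hsigma := km_process KM.
Local Notation e g := (eps R (N g)).
Local Notation p := (mesh N).
Let V1 : R := deriv_mass gK + 1.
Local Notation good := (good G N K alpha delta beta sigmastar M).
Local Notation r g := (fun (c : config (N g)) (i : site (N g)) => (alpha g)^-1 * rate K g (beta g) c i).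
Local Notation X g := (fun t => @sigma g (t / alpha g)).

Section Pointwise.
Context (g : R).
Hypothesis Gg : G g.

Lemma kac_gt0 : 0 < g.
Proof. by have := hG Gg; rewrite /= in_itv/= => /andP[]. Qed.

Let g0 := kac_gt0.
Let cK : continuous K. Proof. by case: hA => _ []. Qed.
Let K0 : K 0 = 0. Proof. by case: hA. Qed.
Let Keven u : K (- u) = K u. Proof. by case: hA => -[]. Qed.

Lemma model_kap0 : kappa K g (0 : site (N g)) = 0. Proof. by rewrite (kappa0 igK K0 Keven _ g0). Qed.
Lemma model_kapN (i : site (N g)) : kappa K g (- i) = kappa K g i.
Proof. by rewrite (kappaN_ igK Keven g0). Qed.
Lemma model_kap_ge0 (i : site (N g)) : 0 <= kappa K g i.
Proof. by case: hA => -[KK _] _ _ _ _; rewrite mulr_ge0// ltW. Qed.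
Lemma model_kap_sum : \sum_(i : site (N g)) kappa K g i = 1.
Proof. by case: hA => _ _ _ H _; exact: H. Qed.

Lemma V1_ge1 : 1 <= V1. Proof. by rewrite lerDr; exact: deriv_mass_ge0. Qed.

Lemma model_kap_le (i : site (N g)) : kappa K g i <= g * V1.
Proof.
apply: le_trans (kappa_bound cK igK wK K0 Keven g0 i) _.
by rewrite ler_pM2l// lerDl.
Qed.

Lemma model_ham (c : config (N g)) (i : site (N g)) :
  `|hamiltonian K g (exchange c i) - hamiltonian K g c| <= 8 * g * V1.
Proof.
have -> : 8 * g * V1 = 2 * (2 * g * V1) + 4 * (g * V1) by ring.
apply: ham_exchange_le => //.
- exact: model_kap0.
- exact: model_kapN.
- exact: model_kap_ge0.
- exact: model_kap_le.
- apply: le_trans (kappa_variation cK igK wK Keven (N g) g0) _.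
  by rewrite ler_wpM2l ?lerDl// mulr_ge0// ltW.
Qed.

Lemma model_jump_process : jump_process (@exchange (N g)) (r g) (P g) (X g)
  (history (alpha g) (@sigma g)) (fun h => semigroup K g (beta g) (h / alpha g)).
Proof. by have [a0 _] := hpos Gg; exact: kawasaki_jump_process a0 (hsigma Gg). Qed.

End Pointwise.

Definition replacement_cst (CM : R) : R := CM + 64 * V1 + (64 * V1) ^+ 2 + (1 + expR 8) * 2.

(** The box length, the influence [om] and theta = p^5 are chosen so that every error in
    [two_point_bound], apart from the term in [th] alone, is of order p. *)
Lemma two_point_rate (Cm CM c T th : R) g gf : 0 <= CM -> good c Cm CM g ->
  c <= (64 * V1)^-1 -> (forall i, `|gf i| <= 1) -> 0 < th <= 1 -> 0 <= T ->
  Ex (P g) (pint (X g) (fun cc => two_point gf cc ^+ 2) 0 T) <=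
  T * (4 * th + th ^- 3 * cst_fin R * (replacement_cst CM * p g)) +
  th ^- 3 * cst_fin R * ((1 + expR 8) * (14 * p g)).
Proof.
move=> CM0 gd cV gf1 th01 T0.
have [Gg pc p1 a2 d1 /andP[g1 g2] b1 nz m2 mm N0] := gd.
have [a0 d0] := hpos Gg; have g0 := kac_gt0 Gg; have p0 := mesh_gt0 N g.
have v1 := V1_ge1; have v0 : 0 < V1 by apply: lt_le_trans v1.
have pX k : 0 < p g ^+ k by rewrite exprn_gt0.
have pX1 k : p g ^+ k <= 1 by rewrite exprn_ile1// ltW.
have eE : e g = p g ^+ 4 by exact: mesh4.
set n := (N g).*2.+1; have nE : n%:R = (p g ^+ 4)^-1 :> R by rewrite -eE /eps invrK.
have p32 : p g ^+ 3 <= p g by rewrite -[leRHS]mulr1 exprS ler_pM2l.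
have gsm : 32 * g * V1 <= 1.
  have : p g * (64 * V1) <= 1 by rewrite -ler_pdivlMr ?mulr_gt0// div1r (le_trans pc).
  have : g * V1 <= 2 * p g * V1 by rewrite ler_wpM2r// ?(ltW v0)//; lra.
  have -> : p g * (64 * V1) = 64 * (p g * V1) by ring.
  have -> : 2 * p g * V1 = 2 * (p g * V1) by ring.
  have -> : 32 * g * V1 = 32 * (g * V1) by ring.
  by move: (g * V1) (p g * V1) => u v; lra.
(* An exchange costs at most 8 g V1, so l <= x is the requirement that 2 l exchanges cost at most 1;
   then 1 / l <= 2 / x = [om]. *)
pose x : R := (16 * g * V1)^-1.
have x0 : 0 < x by rewrite invr_gt0 !mulr_gt0.
have x2 : 2 <= x.
  rewrite /x -[2]invrK lef_pV2 ?posrE ?invr_gt0 ?mulr_gt0//.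
  have -> : 16 * g * V1 = 2^-1 * (32 * g * V1) by field.
  by rewrite ler_piMr.
have /andP[l1 l2] := truncn_itv (ltW x0); set l := Num.trunc x in l1 l2.
have lx : x / 2 <= l%:R by move: l2; rewrite -[l.+1%:R]natr1; lra.
have l0 : (0 < l)%N by rewrite -(ltr_nat R); apply: lt_le_trans lx; rewrite divr_gt0.
pose om : R := 32 * g * V1.
have om0 : 0 < om by rewrite !mulr_gt0.
have lom : l%:R^-1 <= om.
  rewrite -[om]invrK lef_pV2 ?posrE ?invr_gt0 ?ltr0n//; apply: le_trans lx.
  by rewrite /x /om le_eqVlt; apply/orP; left; apply/eqP; field; rewrite !gt_eqF.
have etal : 8 * g * V1 * (2 * l)%:R <= 1.
  rewrite natrM; have -> : 8 * g * V1 * (2 * l%:R) = l%:R * (16 * g * V1) by ring.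
  by rewrite -ler_pdivlMr ?mulr_gt0// div1r.
have nom : n%:R^-1 <= om.
  rewrite nE invrK /om; apply: (@le_trans _ _ (16 * p g ^+ 3 * 1)).
    rewrite mulr1 exprS mulrC; have := pX 3%N; have : p g ^+ 3 * p g <= p g ^+ 3 * 1 by rewrite ler_pM2l.
    by move: (p g ^+ 3 * p g) (p g ^+ 3) => u v; lra.
  by apply: ler_pM => //; [rewrite mulr_ge0// ltW|lra].
have ln : (l <= n)%N.
  rewrite -(ler_nat R) nE; apply: le_trans l1 _.
  rewrite /x lef_pV2 ?posrE ?mulr_gt0//; apply: (@le_trans _ _ (16 * g * 1)); last by rewrite ler_pM2l ?mulr_gt0.
  rewrite mulr1 exprS mulrC; have := pX 3%N; have : p g ^+ 3 * p g <= p g ^+ 3 * 1 by rewrite ler_pM2l.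
  by move: (p g ^+ 3 * p g) (p g ^+ 3) g1 => u v; lra.
pose nb := (n %/ l)%N.
have nb0 : (0 < nb)%N by rewrite divn_gt0.
have nbl : (nb * l <= n)%N by exact: leq_divM.
have nbl1 : ((N g).*2 < nb.+1 * l)%N by apply: ltn_trans (ltnSn _) _; exact: ltn_ceil.
have nbom : nb%:R * om <= (64 * V1) ^+ 2 * p g.
  have nb1 : nb%:R <= (p g ^+ 4)^-1 * om.
    apply: (@le_trans _ _ (n%:R * l%:R^-1)).
      by rewrite ler_pdivlMr ?ltr0n// -natrM ler_nat.
    by rewrite nE ler_wpM2l// invr_ge0 ltW.
  have om2 : om <= 64 * V1 * p g ^+ 3.
    rewrite /om; have -> : 64 * V1 * p g ^+ 3 = 32 * (2 * p g ^+ 3) * V1 by ring.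
    by rewrite ler_pM2r// ler_pM2l.
  apply: (@le_trans _ _ ((p g ^+ 4)^-1 * om * om)); first by rewrite ler_wpM2r// ltW.
  apply: (@le_trans _ _ ((p g ^+ 4)^-1 * (64 * V1 * p g ^+ 3) ^+ 2)).
    by rewrite -mulrA -expr2 ler_wpM2l ?invr_ge0 ?(ltW (pX _))// lerXn2r// nnegrE ltW// !mulr_gt0.
  have -> : (p g ^+ 4)^-1 * (64 * V1 * p g ^+ 3) ^+ 2 = (64 * V1) ^+ 2 * p g ^+ 2.
    by field; rewrite gt_eqF.
  by rewrite ler_wpM2l ?sqr_ge0// expr2 ler_piMr// ltW.
have cons t w : 0 <= t -> mean_spin R (X g t w) = e g * (M (N g))%:~R.
  by move=> t0; exact: (conserved_spin a0 (hsigma Gg)).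
(* The value of theta: theta n and n alpha / theta, with n = p^-4 and alpha of order p^10, are then
   both of order p. *)
have thp : 0 < p g ^+ 5 by [].
apply: le_trans (two_point_average (model_kap0 Gg) (model_kapN Gg) (model_kap_ge0 Gg) (model_kap_sum Gg) b1 a0
  (model_jump_process Gg) (om := om) (etaH := 8 * g * V1) _ (model_ham Gg) l0 nb0 nbl nbl1 lom etal nom N0
  cons gf1 th01 thp T0) _.
  move=> i; apply: le_trans (model_kap_le Gg i) _; rewrite /om.
  by apply: ler_wpM2r; [exact: ltW|rewrite ler_peMl ?(ltW g0)// ler1n].
have th3 : 0 <= th ^- 3 * cst_fin R.
  by case/andP: th01 => th0 _; rewrite mulr_ge0 ?cst_fin_ge0// invr_ge0 exprn_ge0// ltW.
have e8 : 0 <= 1 + expR 8 :> R by rewrite addr_ge0// expR_ge0.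
rewrite /two_point_bound; apply: lerD.
  rewrite ler_wpM2l// lerD2l ler_wpM2l// /replacement_cst -/V1.
  rewrite [leRHS]mulrDl [Y in _ <= Y + _]mulrDl [Y in _ <= Y + _ + _]mulrDl.
  have omp : om <= 64 * V1 * p g.
    apply: (@le_trans _ _ (64 * V1 * p g ^+ 3)); last by rewrite ler_pM2l// mulr_gt0.
    rewrite /om; have -> : 64 * V1 * p g ^+ 3 = 32 * (2 * p g ^+ 3) * V1 by ring.
    by rewrite ler_pM2r// ler_pM2l.
  rewrite -/n; have -> : (1 + expR 8) * (2 * p g ^+ 5 * n%:R) = (1 + expR 8) * 2 * p g.
    by rewrite nE; field; rewrite gt_eqF.
  by do 3 (apply: lerD => //).
rewrite ler_wpM2l// ler_wpM2l//.
have -> : 14 * p g = 7 * (p g ^+ 4)^-1 * (2 * p g ^+ 10) / p g ^+ 5 by field; rewrite gt_eqF.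
by rewrite nE ler_pM2r ?invr_gt0// ler_wpM2l// mulr_ge0// invr_ge0 ltW.
Qed.

End Replacement.

Lemma two_halves (R : realType) (T th a q x : R) : 0 <= th -> 0 <= q -> th * (8 * (T + 1)) <= x ->
  q * (2 * (a + 1)) <= x -> 4 * (T * th) + a * q <= x.
Proof. by nra. Qed.

Lemma third_part (R : realType) (T z c x : R) : 0 <= T -> 0 <= z -> 0 <= c ->
  c * (3 * (T + 1) * (z + 1)) <= x -> z * c * T <= x / 3.
Proof.
move=> T0 z0 c0 H; have : 0 <= c * (T + z + 1) by rewrite mulr_ge0// !addr_ge0.
by move: H; nra.
Qed.

Section PathIntegral.
Context (R : realType) (T I : finType) (jump : T -> I -> T) (r : T -> I -> R).
Context d (Om : measurableType d) (P : probability Om R) (X : R -> Om -> T).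
Context (G : R -> set (set Om)) (Ph : R -> (T -> R) -> T -> R).
Hypothesis JP : jump_process jump r P X G Ph.
Local Notation leb := (@lebesgue_measure R).

Lemma pint_affine (h k : T -> R) (a b s t : R) w : (forall x, h x <= a + b * k x) -> 0 <= s <= t ->
  pint X h s t w <= a * (t - s) + b * pint X k s t w.
Proof.
move=> hk st; have /andP[_ st'] := st.
have [bh _] := pint_rsum JP h w st; have [bk _] := pint_rsum JP k w st.
have mI : measurable (`[s, t] : set R) by exact: measurable_itv.
apply: (@le_trans _ _ (Rintegral leb `[s, t] (fun u => a + b * k (X u w)))).
  apply: (@le_Int _ _ R leb _ mI (itvc_fin _ _) _ _ bh); last by move=> u _; exact: hk.
  by apply: bdmeasD; [exact: bdmeas_cst|exact: bdmeasZ].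
rewrite (@IntD _ _ R leb _ mI (itvc_fin _ _)); [|exact: bdmeas_cst|exact: bdmeasZ].
rewrite (@IntZ _ _ R leb _ mI (itvc_fin _ _))// Rintegral_cst//.
rewrite [fine _](_ : _ = t - s); first exact: lexx.
have := @lebesgue_measure_itv R `[s, t]; rewrite /= lte_fin => E.
transitivity (fine (if (s < t)%R then t%:E + (- s)%:E else 0)%E); first by congr fine; exact: E.
by case: ltgtP st' => // ->; rewrite subrr.
Qed.

Lemma Ex_pint_affine (h k : T -> R) (a b s t : R) : (forall x, h x <= a + b * k x) -> 0 <= s <= t ->
  Ex P (pint X h s t) <= a * (t - s) + b * Ex P (pint X k s t).
Proof.
move=> hk st; have bk := pint_bd JP k st.
apply: (@le_trans _ _ (Ex P (fun w => a * (t - s) + b * pint X k s t w))).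
  apply: le_Ex; [exact: (pint_bd JP)|by apply: bdmeasD; [exact: bdmeas_cst|exact: bdmeasZ]|].
  by move=> w; exact: pint_affine.
by rewrite ExD ?Ex_cst ?ExZ//; [exact: bdmeas_cst|exact: bdmeasZ].
Qed.

Lemma pint_ge0 (k : T -> R) (s t : R) w : (forall x, 0 <= k x) -> 0 <= pint X k s t w.
Proof. by move=> k0; apply: Rintegral_ge0 => u _; exact: k0. Qed.

Lemma Ex_pint_mono (k : T -> R) (s t t' : R) : (forall x, 0 <= k x) -> 0 <= s <= t -> t <= t' ->
  Ex P (pint X k s t) <= Ex P (pint X k 0 t').
Proof.
move=> k0 /andP[s0 st] tt.
have t0 : 0 <= t by apply: le_trans st.
have t0' : 0 <= t' by apply: le_trans tt.
apply: le_Ex => [||w]; [by apply: (pint_bd JP); rewrite s0|by apply: (pint_bd JP); rewrite lexx|].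
rewrite (pintD JP k w (a := 0) (s := s) (t := t')) ?lexx//; last exact: le_trans tt.
rewrite (pintD JP k w (a := s) (s := t) (t := t')) ?s0//.
have := pint_ge0 0 s w k0; have := pint_ge0 t t' w k0.
by move: (pint _ _ 0 s w) (pint _ _ t t' w) => u v; lra.
Qed.

End PathIntegral.

(** * The carre du champ becomes deterministic *)

Section CarreLimit.
Context (R : realType) (G : set R) (N : R -> nat) (K gK : R -> R)
  (alpha delta beta : R -> R) (sigmastar : R) (M : nat -> int).
Context (d : R -> measure_display) (Om : forall g : R, measurableType (d g))
    (P : forall g : R, probability (Om g) R)
    (sigma : forall g : R, R -> Om g -> config (N g))
    (init : forall g : R, config (N g) -> R).
Hypothesis KM : kac_model G K gK alpha delta beta M P sigma init.
Variables (Cm CM : R).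
Hypothesis Cm0 : 0 <= Cm.
Hypothesis CM0 : 0 <= CM.
Local Notation e g := (eps R (N g)).
Local Notation p := (mesh N).
Let V1 : R := deriv_mass gK + 1.
Local Notation good := (good G N K alpha delta beta sigmastar M).
Local Notation r g := (fun (c : config (N g)) (i : site (N g)) => (alpha g)^-1 * rate K g (beta g) c i).
Local Notation X g := (fun t => @sigma g (t / alpha g)).
Local Notation obs g phi := (field_observable K g (delta g) phi).
Local Notation Gam g phi psi := (carre (@exchange (N g)) (r g) (obs g phi) (obs g psi)).

Lemma V1_gt0 : 0 < V1. Proof. exact: lt_le_trans (V1_ge1 gK). Qed.

(** First [th] is fixed small, which makes the factor th^-3 a constant, and then c is chosen. *)
Lemma two_point_vanish (T e : R) : 0 <= T -> 0 < e -> exists2 c : R, 0 < c &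
  forall g (gf : site (N g) -> R), good c Cm CM g -> (forall i, `|gf i| <= 1) ->
  Ex (P g) (pint (X g) (fun cc => two_point gf cc ^+ 2) 0 T) <= e.
Proof.
move=> T0 e0; pose th := Num.min 1 (e / (8 * (T + 1))).
have T1 : 0 < T + 1 by lra.
have th0 : 0 < th by rewrite lt_min ltr01/= divr_gt0// mulr_gt0.
have th1 : th <= 1 by rewrite ge_min lexx.
have the : th * (8 * (T + 1)) <= e by rewrite -ler_pdivlMr ?mulr_gt0// ge_min lexx orbT.
pose A : R := th ^- 3 * cst_fin R * (T * replacement_cst gK CM + (1 + expR 8) * 14).
have rc0 : 0 <= replacement_cst gK CM.
  rewrite /replacement_cst; have := V1_gt0; rewrite /V1; move: (_ + 1) => v v0.
  have e8 := expR_gt0 (8 : R); apply: addr_ge0; last by rewrite mulr_ge0// addr_ge0// ltW.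
  by apply: addr_ge0; [apply: addr_ge0 => //; rewrite mulr_ge0// ltW|exact: sqr_ge0].
have A0 : 0 <= A.
  have e8 := expR_gt0 (8 : R).
  apply: mulr_ge0; first by rewrite mulr_ge0 ?cst_fin_ge0// invr_ge0 exprn_ge0// ltW.
  by apply: addr_ge0; [exact: mulr_ge0|rewrite mulr_ge0// addr_ge0// ltW].
exists (Num.min (64 * V1)^-1 (e / (2 * (A + 1)))).
  by rewrite lt_min invr_gt0 mulr_gt0 ?V1_gt0//= divr_gt0// mulr_gt0// ltr_wpDl.
move=> g gf gd gf1.
apply: le_trans (two_point_rate KM CM0 gd _ gf1 (th := th) _ T0) _.
- by rewrite ge_min lexx.
- by rewrite th0.
have := good_p gd; rewrite le_min => /andP[_]; rewrite ler_pdivlMr ?mulr_gt0 ?ltr_wpDl// => pA.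
have p0 : 0 < p g by exact: mesh_gt0.
have -> : T * (4 * th + th ^- 3 * cst_fin R * (replacement_cst gK CM * p g)) +
  th ^- 3 * cst_fin R * ((1 + expR 8) * (14 * p g)) = 4 * (T * th) + A * p g.
  by rewrite /A; move: (th ^- 3) (cst_fin R) (replacement_cst _ _) (expR 8) => a b x y; ring.
by apply: two_halves pA => //; exact: ltW.
Qed.

(** A jump is of size eps^2 / delta, about p^7, times a bounded gradient; the weaker order c is all
    that is needed later. *)
Lemma good_jump (phi : R -> R) (B c : R) g : smooth_torus phi -> (forall x, `|derive1 phi x| <= B) ->
  good c Cm CM g -> forall (x : config (N g)) (i : site (N g)), `|obs g phi (exchange x i) - obs g phi x| <= 4 * B * c.
Proof.
move=> sphi phiB gd x i; have [Gg pc p1 _ d1 _ _ _ _ _ _] := gd.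
have p0 : 0 < p g by exact: mesh_gt0.
have B0 : 0 <= B by apply: le_trans (phiB 0).
have [_ d0] := km_pos KM Gg.
rewrite field_obs_exchange normrM normrM mulrAC.
rewrite [`|_ / delta g|]ger0_norm ?divr_ge0 ?exprn_ge0 ?(ltW (eps_gt0 _ _)) ?(ltW d0)// mesh4 -exprM.
have s2 : `|spin R x i - spin R x (succ_site i)| <= 2.
  by case: (spin_cases R x i) => ->; case: (spin_cases R x (succ_site i)) => ->;
    rewrite ler_norml; apply/andP; split; lra.
have gB := field_grad_bound (model_kap_ge0 KM Gg) (model_kap_sum KM Gg) i sphi phiB.
have q : p g ^+ 8 / delta g <= 2 * c.
  rewrite ler_pdivrMr//; apply: (@le_trans _ _ (2 * p g * (p g / 2))).
    have -> : 2 * p g * (p g / 2) = p g ^+ 2 by field.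
    by rewrite ler_wiXn2l// ltW.
  by apply: ler_pM => //; [rewrite mulr_ge0// ltW|rewrite divr_ge0// ltW|rewrite ler_pM2l].
apply: (@le_trans _ _ (2 * c * B * 2)); last by rewrite le_eqVlt; apply/orP; left; apply/eqP; ring.
apply: ler_pM => //; first by rewrite mulr_ge0// divr_ge0 ?exprn_ge0// ltW.
by apply: ler_pM => //; rewrite divr_ge0 ?exprn_ge0// ltW.
Qed.

Lemma noise_coef_ge0 g : G g -> 0 <= noise_coef (N g) (alpha g) (delta g).
Proof.
move=> Gg; have [a0 d0] := km_pos KM Gg.
by rewrite divr_ge0 ?exprn_ge0 ?mulr_ge0 ?sqr_ge0 ?(ltW (eps_gt0 _ _))// ltW.
Qed.

(** Three errors: the two-point function with the energy cost of an exchange, the Riemann sum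
    against the Dirichlet form with rho = p, and the noise coefficient against its limit. *)
Lemma carre_dev (phi psi : R -> R) (B c : R) g (cc : config (N g)) : smooth_torus phi -> smooth_torus psi ->
  (forall x, `|derive1 phi x| <= B) -> (forall x, `|derive1 psi x| <= B) ->
  (forall x, `|derive1 (derive1 phi) x| <= B) -> (forall x, `|derive1 (derive1 psi) x| <= B) ->
  0 < B -> c <= 1 -> good c Cm CM g ->
  `|Gam g phi psi cc - sigmastar ^+ 2 * dirichlet_form phi psi| <=
  (sigmastar ^+ 2 + 1) * B ^+ 2 * `|two_point (fun i : site (N g) =>
      field_grad K g phi i * field_grad K g psi i / B ^+ 2) cc| +
  ((sigmastar ^+ 2 + 1) * B ^+ 2 * (32 * V1 + 2 * (3 + Cm)) + `|dirichlet_form phi psi|) * c.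
Proof.
move=> sphi spsi pB qB pB' qB' B0 c1 gd.
have [Gg pc p1 _ d1 /andP[_ g2] b1 nz m2 _ _] := gd.
have p0 : 0 < p g by exact: mesh_gt0.
have g0 := kac_gt0 KM Gg.
have k0 := model_kap_ge0 KM Gg; have k1 := model_kap_sum KM Gg.
have aL (i : site (N g)) : `|field_grad K g phi i * field_grad K g psi i| <= B ^+ 2.
  by rewrite normrM expr2 ler_pM// (field_grad_bound k0 k1).
have n0 := noise_coef_ge0 Gg.
have H1 := carre_approx (alpha := alpha g) (delta := delta g) b1 cc (exprn_gt0 2 B0) aL (model_ham KM Gg) n0.
have H2 := gradient_sum k0 k1 sphi spsi pB qB pB' qB' p0 g0.
set tp := two_point _ _ in H1 *; set C := Gam g phi psi cc in H1 *.
set S := \sum_i _ in H1 H2; set D := dirichlet_form _ _ in H2 *.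
set nc := noise_coef _ _ _ in nz n0 H1.
have nc1 : nc <= sigmastar ^+ 2 + 1 by move: nz; rewrite ler_norml => /andP[_]; lra.
have p2 : p g ^+ 3 <= p g by rewrite -[leRHS]mulr1 exprS ler_pM2l// exprn_ile1// ltW.
have p4 : p g ^+ 4 <= p g by rewrite -[leRHS]mulr1 exprS ler_pM2l// exprn_ile1// ltW.
have v0 := V1_gt0.
have H3 : `|S - D| <= B ^+ 2 * (2 * (3 + Cm)) * c.
  apply: le_trans H2 _; rewrite -mulrDr.
  have -> : B ^+ 2 * (2 * (3 + Cm)) * c = 2 * B ^+ 2 * ((3 + Cm) * c) by ring.
  rewrite ler_wpM2l ?mulr_ge0 ?sqr_ge0 ?(ltW B0)//.
  have : e g ^+ 2 * second_moment K (N g) g / (g ^+ 2 * p g) <= Cm * p g.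
    rewrite invfM mulrA ler_pdivrMr//; apply: le_trans m2 _.
    by rewrite -mulrA -expr2.
  have : Cm * p g <= Cm * c by rewrite ler_wpM2l.
  by rewrite mesh4 mulrDl; move: (p g ^+ 4) p4 (_ / (_ * p g)) (Cm * c) => x x1 y z; lra.
have -> : C - sigmastar ^+ 2 * D = (C - nc * S) + nc * (S - D) + (nc - sigmastar ^+ 2) * D by ring.
apply: le_trans (ler_normD _ _) _; rewrite [Y in _ <= _ + Y]mulrDl addrA; apply: lerD; last first.
  by rewrite normrM mulrC ler_wpM2l.
apply: le_trans (ler_normD _ _) _.
have -> : (sigmastar ^+ 2 + 1) * B ^+ 2 * `|tp| + (sigmastar ^+ 2 + 1) * B ^+ 2 * (32 * V1 + 2 * (3 + Cm)) * c =
  (sigmastar ^+ 2 + 1) * (B ^+ 2 * (`|tp| + 32 * V1 * c)) + (sigmastar ^+ 2 + 1) * (B ^+ 2 * (2 * (3 + Cm)) * c) by ring.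
apply: lerD; last by rewrite normrM (ger0_norm n0); apply: ler_pM.
apply: le_trans H1 _; apply: ler_pM => //.
  by rewrite mulr_ge0 ?sqr_ge0// addr_ge0// !mulr_ge0// ltW.
rewrite ler_wpM2l ?sqr_ge0// lerD2l.
have -> : 2 * (8 * g * (deriv_mass gK + 1)) = 16 * V1 * g by rewrite /V1; ring.
have -> : 32 * V1 * c = 16 * V1 * (2 * c) by ring.
by rewrite ler_pM2l ?mulr_gt0//; lra.
Qed.

(** [two_point_vanish] bounds a square, so |x| <= e1 + x^2 / e1 is used; e1, then e2, then c make
    the three contributions at most e / 3 each. *)
Lemma carre_L1 (phi psi : R -> R) (T e : R) : smooth_torus phi -> smooth_torus psi -> 0 <= T -> 0 < e ->
  exists2 c : R, 0 < c & forall g, good c Cm CM g ->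
  Ex (P g) (pint (X g) (fun cc => `|Gam g phi psi cc - sigmastar ^+ 2 * dirichlet_form phi psi|) 0 T) <= e.
Proof.
move=> sphi spsi T0 e0.
have [B [B0 pB qB pB' qB']] : exists B : R, [/\ 0 < B, forall x, `|derive1 phi x| <= B,
  forall x, `|derive1 psi x| <= B, forall x, `|derive1 (derive1 phi) x| <= B
  & forall x, `|derive1 (derive1 psi) x| <= B].
  have tp := torus_derive1 sphi; have tq := torus_derive1 spsi.
  have [B1 b1 h1] := torus_bounded tp; have [B2 b2 h2] := torus_bounded tq.
  have [B3 b3 h3] := torus_bounded (torus_derive1 tp); have [B4 b4 h4] := torus_bounded (torus_derive1 tq).
  exists (B1 + B2 + B3 + B4 + 1); split=> [|x|x|x|x]; first lra.
  - by apply: le_trans (h1 x) _; lra.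
  - by apply: le_trans (h2 x) _; lra.
  - by apply: le_trans (h3 x) _; lra.
  - by apply: le_trans (h4 x) _; lra.
have T1 : 0 < T + 1 by lra.
pose Y : R := (sigmastar ^+ 2 + 1) * B ^+ 2.
have Y0 : 0 < Y by rewrite mulr_gt0 ?exprn_gt0// ltr_wpDl// sqr_ge0.
pose Z : R := Y * (32 * V1 + 2 * (3 + Cm)) + `|dirichlet_form phi psi|.
have Z0 : 0 <= Z.
  by rewrite addr_ge0// mulr_ge0 ?(ltW Y0)// addr_ge0 ?mulr_ge0 ?(ltW V1_gt0)// addr_ge0.
pose e1 : R := e / (3 * (T + 1) * Y).
have e10 : 0 < e1 by rewrite /e1; apply: divr_gt0 => //; apply: mulr_gt0 => //; exact: mulr_gt0.
pose e2 : R := e * e1 / (3 * Y).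
have e20 : 0 < e2 by rewrite /e2; apply: divr_gt0; exact: mulr_gt0.
have [c0 c00 H] := two_point_vanish T0 e20.
have z3 : 0 < 3 * (T + 1) * (Z + 1) by apply: mulr_gt0; [exact: mulr_gt0|rewrite ltr_wpDl].
exists (Num.min (Num.min c0 1) (e / (3 * (T + 1) * (Z + 1)))).
  by rewrite !lt_min c00 ltr01/= divr_gt0.
set c := Num.min _ _ => g gd.
have cc0 : c <= c0 by rewrite !ge_min lexx.
have cc1 : c <= 1 by rewrite !ge_min lexx orbT.
have c0' : 0 < c by apply: lt_le_trans (good_p gd); exact: mesh_gt0.
have ccZ : c * (3 * (T + 1) * (Z + 1)) <= e by rewrite -ler_pdivlMr// ge_min lexx orbT.
pose gf (i : site (N g)) : R := field_grad K g phi i * field_grad K g psi i / B ^+ 2.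
have gf1 i : `|gf i| <= 1.
  have Gg := good_G gd; have gb := field_grad_bound (model_kap_ge0 KM Gg) (model_kap_sum KM Gg) i.
  rewrite normrM normfV [`|B ^+ 2|]ger0_norm ?sqr_ge0// ler_pdivrMr ?exprn_gt0// mul1r normrM expr2.
  by rewrite ler_pM// gb.
have JP := model_jump_process KM (good_G gd).
apply: (@le_trans _ _ ((Y * e1 + Z * c) * (T - 0) + Y / e1 *
    Ex (P g) (pint (X g) (fun cc => two_point gf cc ^+ 2) 0 T))).
  apply: (Ex_pint_affine JP) => [cc|]; last by rewrite lexx.
  apply: le_trans (carre_dev cc sphi spsi pB qB pB' qB' B0 cc1 gd) _.
  rewrite -/Y -/gf -/Z addrAC lerD2r -mulrA -mulrDr ler_pM2l// mulrC -real_normK ?num_real//.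
  move: (normr_ge0 (two_point gf cc)); move: (`|_|) => x x0.
  have [xe|ex] := leP x e1; first by rewrite (le_trans xe)// lerDl divr_ge0 ?sqr_ge0// ltW.
  by apply: (@le_trans _ _ (x ^+ 2 / e1)); [rewrite ler_pdivlMr// expr2 ler_wpM2l// ltW|rewrite lerDr ltW].
have := H g gf (good_le cc0 gd) gf1; move: (Ex _ _) => E Ee.
have h1 : Y * e1 * T <= e / 3.
  have -> : Y * e1 * T = e / 3 * (T / (T + 1)) by rewrite /e1; field; rewrite !gt_eqF.
  by rewrite ler_piMr ?divr_ge0 ?(ltW e0)// ler_pdivrMr// mul1r; lra.
have h2 : Z * c * T <= e / 3 by apply: third_part ccZ => //; exact: ltW.
have h3 : Y / e1 * E <= e / 3.
  apply: (@le_trans _ _ (Y / e1 * e2)); first by rewrite ler_wpM2l// divr_ge0// ltW.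
  by rewrite /e2 le_eqVlt; apply/orP; left; apply/eqP; field; rewrite !gt_eqF.
by rewrite subr0 mulrDl; lra.
Qed.

Lemma good_carre (phi : R -> R) : smooth_torus phi -> exists2 Gm : R, 0 <= Gm &
  forall c g, good c Cm CM g -> c <= 1 -> forall x, Gam g phi phi x <= Gm.
Proof.
move=> sphi; have [B b0 h] := torus_bounded (torus_derive1 sphi).
exists (4 * (sigmastar ^+ 2 + 1) * B ^+ 2).
  by rewrite mulr_ge0 ?sqr_ge0// mulr_ge0// addr_ge0// sqr_ge0.
move=> c g gd c1 x; have Gg := good_G gd; rewrite carre_field.
have n0 := noise_coef_ge0 Gg; have := good_noise gd; set nc := noise_coef _ _ _ in n0 *.
rewrite ler_norml => /andP[_ nz].
have -> : 4 * (sigmastar ^+ 2 + 1) * B ^+ 2 = (sigmastar ^+ 2 + 1) * \sum_(i : site (N g)) e g * (4 * B ^+ 2).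
  have -> : \sum_(i : site (N g)) e g * (4 * B ^+ 2) = 4 * B ^+ 2.
    by rewrite sumr_const card_ord -[LHS]mulr_natl mulrA /eps divff ?mul1r ?pnatr_eq0.
  ring.
apply: (@le_trans _ _ (nc * \sum_(i : site (N g)) e g * (4 * B ^+ 2))); last first.
  rewrite ler_wpM2r//; last by lra.
  by apply: sumr_ge0 => i _; rewrite mulr_ge0 ?mulr_ge0 ?sqr_ge0// ltW// eps_gt0.
rewrite ler_wpM2l//; apply: ler_sum => i _; rewrite ler_pM2l ?eps_gt0// -expr2.
apply: ler_pM; rewrite ?sqr_ge0//.
- apply: mulr_ge0; first by rewrite mulr_ge0// ltW// rate_gt0.
  by case: (spin_cases R x i) => ->; case: (spin_cases R x (succ_site i)) => ->; lra.
- have := rate_le1 K g (beta g) x i; have := rate_gt0 K g (beta g) x i; move: (rate _ _ _ _ _) => a a0 a1.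
  by case: (spin_cases R x i) => ->; case: (spin_cases R x (succ_site i)) => ->; lra.
rewrite -real_normK ?num_real// lerXn2r ?nnegrE//.
exact: (field_grad_bound (model_kap_ge0 KM Gg) (model_kap_sum KM Gg)).
Qed.

End CarreLimit.

(** * Predictable covariation *)

Section NonmeasurableIntegral.
Context d (T : measurableType d) (R : realType) (mu : {measure set T -> \bar R}).

(** The integral of a nonnegative function is a supremum over the simple functions below it, hence
    monotone without measurability. Suprema over time and functionals of paths will be integrated in
    this sense. *)
Lemma le_integral_ge0T (f g : T -> \bar R) : (forall x, 0 <= f x)%E -> (forall x, f x <= g x)%E ->
  (\int[mu]_x f x <= \int[mu]_x g x)%E.
Proof.
move=> f0 fg; rewrite !ge0_integralTE//; last by move=> x; apply: le_trans (fg x).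
by apply: le_ereal_sup => _ [h hf <-]; exists h => // x; apply: le_trans (fg x); exact: hf.
Qed.

Lemma le_integralT (f g : T -> \bar R) : (forall x, f x <= g x)%E ->
  (\int[mu]_x f x <= \int[mu]_x g x)%E.
Proof.
move=> fg; rewrite [leLHS]integralE [leRHS]integralE; apply: leeB; apply: le_integral_ge0T => x.
- exact: funepos_ge0.
- by rewrite !funeposE le_max2.
- exact: funeneg_ge0.
- by rewrite !funenegE le_max2// leeN2.
Qed.

End NonmeasurableIntegral.

Section Predictability.
Context (R : realType).

Lemma sigma_trace (T : Type) (D : set T) (G : set (set T)) S : (forall C, G C -> C `<=` D) ->
  <<s G >> S -> <<s D, G >> (D `&` S).
Proof.
move=> GD; have [s0 sC sU] := smallest_sigma_algebra D G.
move: S; apply: (smallest_sub (C := sigma_algebra setT) (X := [set S | <<s D, G >> (D `&` S)])) => [|C GC].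
  split; first by rewrite /= setI0.
  - move=> A /= sA; rewrite (_ : D `&` _ = D `\` (D `&` A)); first exact: sC.
    by apply/seteqP; split => x /=; tauto.
  - by move=> A sA; rewrite /= setI_bigcupr; exact: sU.
by rewrite /= setIidr; [exact: sub_sigma_algebra|exact: GD].
Qed.

(** Cells open on the left and closed on the right: freezing a process at the left end of such a
    cell gives predictable rectangles. *)
Lemma left_node : exists node : R -> nat, forall x : R,
  if 0 < x then is_true ((node x)%:R < x <= (node x).+1%:R) else node x = 0%N.
Proof.
have H (x : R) : exists k : nat, if 0 < x then is_true (k%:R < x <= k.+1%:R) else k = 0%N.
  case: (boolP (0 < x)) => x0; last by exists 0%N.
  have /andP[m1 m2] := truncn_itv (ltW x0); move: m1 m2; set m := Num.trunc x => m1 m2.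
  have [mx|xm] := ltP m%:R x; first by exists m; rewrite mx ltW.
  have mE : x = m%:R by apply/eqP; rewrite eq_le xm m1.
  case: m mE {m1 m2 xm} => [E|k ->]; first by move: x0; rewrite E ltxx.
  by exists k; rewrite ltr_nat ltnSn lexx.
by have [node P] := choice H; exists node.
Qed.

Context d (Om : measurableType d) (F : R -> set (set Om)).

(** A is the limit of its values frozen at left grid points, which are combinations of predictable
    rectangles by adaptedness; the Lipschitz bound gives an error L / n. *)
Lemma lipschitz_predictable (A : R -> Om -> R) (L : R) : adapted F A ->
  (forall w s t, 0 <= s <= t -> `|A t w - A s w| <= L * (t - s)) -> predictable F A.
Proof.
move=> adA lipA B mB; pose D : set (R * Om) := `[0, +oo[ `*` setT.
have L0 : 0 <= L.
  have := lipA point 0 1; rewrite lexx ler01 subr0 mulr1 => /(_ isT); exact: le_trans.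
have rD C : predictable_rectangle F C -> C `<=` D.
  move=> [[Y _ <-] [t w]/= [-> _]|[s [t [Y [/andP[s0 st] _ ->]]]] [u w]/= [+ _]].
    by split=> //=; rewrite in_itv/= lexx.
  by rewrite in_itv/= => /andP[su _]; split=> //=; rewrite in_itv/= (le_trans s0 (ltW su)).
rewrite (_ : [set p : R * Om | _] = D `&` (D `&` (fun p => A p.1 p.2) @^-1` B)); last first.
  by rewrite /D; apply/seteqP; split => -[t w]/=; rewrite in_itv/= andbT; [move=> [? ?]|move=> [[? _] [_ ?]]].
apply: sigma_trace => //.
have [node nodeP] := left_node.
pose T' := g_sigma_algebraType (predictable_rectangle F).
pose h (n : nat) : R := n.+1%:R.
have h0 n : 0 < h n by [].
pose An (n : nat) (p : T') : R := A ((node (p.1 * h n))%:R / h n) p.2.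
have mAn n : measurable_fun (D : set T') (An n).
  move=> _ Y mY; rewrite (_ : _ `&` _ = ([set 0] `*` (A 0 @^-1` Y)) `|`
     \bigcup_k (`](k%:R / h n), (k.+1%:R / h n)] `*` (A (k%:R / h n) @^-1` Y))); last first.
    rewrite /D; apply/seteqP; split => -[t w]/=.
      rewrite in_itv/= andbT /An/= => -[[t0 _] Yt].
      have := nodeP (t * h n); rewrite pmulr_lgt0//; case: ifPn => [tp /andP[n1 n2]|].
        right; exists (node (t * h n)) => //=; split=> //.
        by rewrite in_itv/= ltr_pdivrMr// n1 ler_pdivlMr.
      rewrite -leNgt => tn nE; left; have tE : t = 0 by apply/eqP; rewrite eq_le tn t0.
      by split=> //; move: Yt; rewrite nE mul0r.
    move=> [[-> Yt]|[k _ [/=]]].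
      split; first by rewrite in_itv/= lexx.
      by rewrite /An/= mul0r; have := nodeP 0; rewrite ltxx => ->; rewrite mul0r.
    rewrite in_itv/= ltr_pdivrMr// ler_pdivlMr// => /andP[k1 k2] Yt.
    have th : 0 < t * h n by apply: le_lt_trans k1.
    have t0 : 0 < t by move: th; rewrite pmulr_lgt0.
    split; first by rewrite in_itv/= andbT ltW.
    rewrite /An/=; have := nodeP (t * h n); rewrite th => /andP[n1 n2].
    suff -> : node (t * h n) = k by [].
    have := lt_le_trans n1 k2; have := lt_le_trans k1 n2; rewrite !ltr_nat !ltnS => a b.
    by apply/eqP; rewrite eqn_leq a b.
  apply: measurableU.
    by apply: sub_sigma_algebra; left; exists (A 0 @^-1` Y) => //; apply: adA.
  apply: bigcup_measurable => k _; apply: sub_sigma_algebra; right.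
  have k0 : 0 <= k%:R / h n by rewrite divr_ge0.
  exists (k%:R / h n), (k.+1%:R / h n), (A (k%:R / h n) @^-1` Y); split=> //.
    by rewrite k0/= ler_pM2r ?invr_gt0// ler_nat.
  exact: adA.
have mD : measurable (D : set T').
  have -> : D = (An 0%N @^-1` setT) `&` D by rewrite preimage_setT setTI.
  rewrite setIC (_ : D = ([set 0] `*` (A 0 @^-1` setT)) `|`
     \bigcup_k (`]0, (k.+1%:R)] `*` (A 0 @^-1` setT))); last first.
    rewrite /D; apply/seteqP; split => -[t w]/=.
      rewrite in_itv/= andbT => -[]; rewrite le_eqVlt => /orP[/eqP<- _|t0 _]; first by left.
      right; exists (Num.trunc t) => //=; split=> //; rewrite in_itv/= t0 ltW//.
      by have /andP[] := truncn_itv (ltW t0).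
    move=> [[-> _]|[k _ [/=]]]; first by rewrite in_itv/= lexx.
    by rewrite !in_itv/= andbT => /andP[t0 _] _; rewrite ltW.
  rewrite preimage_setT setIT; apply: measurableU.
    by apply: sub_sigma_algebra; left; exists (A 0 @^-1` setT) => //; apply: adA.
  apply: bigcup_measurable => k _; apply: sub_sigma_algebra; right.
  exists 0, k.+1%:R, (A 0 @^-1` setT); split=> //; first by rewrite lexx/=.
  exact: adA.
have mA : measurable_fun (D : set T') (fun p : T' => A p.1 p.2).
  apply: (measurable_fun_cvg mAn) => -[t w]/= [t0 _].
  move: t0; rewrite /= in_itv/= andbT => t0.
  have L0' : (fun n => L * (n.+1%:R)^-1) @ \oo --> (0 : R).
    by rewrite -(mulr0 L); apply: cvgMr; exact: cvg_harmonic.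
  apply/cvgrPdist_le => e e0; move/cvgrPdist_le : L0' => /(_ _ e0).
  apply: filterS => n; rewrite sub0r normrN ger0_norm; last by rewrite mulr_ge0.
  apply: le_trans; rewrite /An/=.
  have := nodeP (t * h n); rewrite pmulr_lgt0//; case: ifPn => [tp /andP[n1 n2]|].
    apply: le_trans (lipA w _ _ _) _; first by rewrite divr_ge0//= ler_pdivrMr// ltW.
    have -> : t - (node (t * h n))%:R / h n = (t * h n - (node (t * h n))%:R) / h n.
      by rewrite mulrBl mulfK// gt_eqF.
    rewrite ler_wpM2l// -[leRHS]mul1r ler_pM2r ?invr_gt0//.
    by rewrite lerBlDr addrC natr1.
  rewrite -leNgt => tn ->; have -> : t = 0 by apply/eqP; rewrite eq_le tn t0.
  by rewrite mul0r subrr normr0 mulr_ge0.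
exact: mA.
Qed.

Lemma lipschitz_cadlag (x : R -> R) (L T : R) : 0 <= L ->
  (forall s t, 0 <= s <= t -> `|x t - x s| <= L * (t - s)) -> cadlag T x.
Proof.
move=> L0 lipx; have L1 : 0 < L + 1 by rewrite ltr_wpDl.
have sm (e z : R) : 0 < e -> 0 <= z -> z <= e / (L + 1) -> L * z <= e.
  move=> e0 z0; rewrite ler_pdivlMr// => H; apply: le_trans H.
  by rewrite mulrC ler_wpM2l// lerDl.
split=> t /andP[t0 tT].
  apply/cvgrPdist_le => e e0; apply/at_rightP; exists (e / (L + 1)); first exact: divr_gt0.
  move=> u /andP[tu ut]; rewrite distrC; apply: le_trans (lipx t u _) _; first by rewrite t0 ltW.
  by apply: sm => //; [rewrite subr_ge0 ltW|rewrite lerBlDl ltW].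
apply/cvg_ex; exists (x t); apply/cvgrPdist_le => e e0; apply/at_leftP.
exists (Num.min t (e / (L + 1))); first by rewrite lt_min t0 divr_gt0.
move=> u /andP[tu ut].
have u0 : 0 <= u by apply: le_trans (ltW tu); rewrite subr_ge0 ge_min lexx.
apply: le_trans (lipx u t _) _; first by rewrite u0 ltW.
apply: sm => //; first by rewrite subr_ge0 ltW.
have : Num.min t (e / (L + 1)) <= e / (L + 1) by rewrite ge_min lexx orbT.
by move: (Num.min _ _) tu => m tu mm; apply: le_trans mm; lra.
Qed.

Lemma lipschitz_bounded_variation (x : R -> R) (L T : R) : 0 <= L -> 0 < T ->
  (forall s t, 0 <= s <= t -> `|x t - x s| <= L * (t - s)) -> bounded_variation 0 T x.
Proof.
move=> L0 T0 lipx.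
have -> : x = (fun t => x t + L * t) \+ (\- (fun t => L * t)).
  by apply: funext => t /=; rewrite addrK.
apply: bounded_variationD => //; last apply: bounded_variationN;
  apply: nondecreasing_bounded_variation => s t; rewrite !in_itv/= => /andP[s0 _] _ st.
  have := lipx s t; rewrite s0 st => /(_ isT); rewrite ler_norml => /andP[+ _].
  by rewrite mulrBr; move: (L * t) (L * s) => a b; lra.
by rewrite ler_wpM2l.
Qed.

End Predictability.

Section Covariation.
Context (R : realType) (T I : finType) (jump : T -> I -> T) (r : T -> I -> R).
Context d (Om : measurableType d) (P : probability Om R) (X : R -> Om -> T).
Context (G : R -> set (set Om)) (Ph : R -> (T -> R) -> T -> R).
Hypothesis JP : jump_process jump r P X G Ph.

Lemma is_martingale_bd (Y : R -> Om -> R) : (forall t, 0 <= t -> Fbd G t (Y t)) ->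
  (forall s t Z, 0 <= s <= t -> Fbd G s Z -> Ex P (fun w => Z w * (Y t w - Y s w)) = 0) ->
  is_martingale P (fun t => <<s G t >>) Y.
Proof.
move=> bY oY.
have iY t : 0 <= t -> P.-integrable setT (EFin \o Y t).
  by move=> t0; apply: (bdmeas_integrable _ (P_fin P)) => //; apply: (Fbd_bd JP t0); exact: bY.
split=> // [t t0 B mB|s t st B FB]; first by apply: Fbd_preimage mB; exact: bY.
have /andP[s0 st'] := st; have t0 : 0 <= t by apply: le_trans st'.
have mB : measurable B := jp_sub JP s0 FB.
have RE u : 0 <= u -> (\int[P]_(w in B) (Y u w)%:E)%E = (Ex P (fun w => (\1_B : Om -> R) w * Y u w))%:E.
  move=> u0; rewrite -[LHS]fineK; last first.
    by apply: integrable_fin_num => //; apply: integrableS (iY u u0).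
  congr EFin; rewrite -/(Rintegral P B (Y u)) Rintegral_mkcond; apply: eq_Rintegral => w _.
  by rewrite patchE indicE; case: ifP => _; rewrite ?mul1r ?mul0r.
rewrite !RE//; congr EFin; apply/eqP; rewrite -subr_eq0; apply/eqP.
rewrite -(oY s t _ st (Fbd_indic FB)) -ExB.
- by apply: eq_Rintegral => w _; rewrite mulrBr.
- by apply: bdmeasM; [apply: bdmeas_indic|apply: (Fbd_bd JP t0); exact: bY].
- by apply: bdmeasM; [apply: bdmeas_indic|apply: (Fbd_bd JP s0); exact: bY].
Qed.

Lemma mart_square_integrable (f : T -> R) :
  is_martingale P (fun t => <<s G t >>) (mart jump r X f) /\ square_integrable P (mart jump r X f).
Proof.
have bM t : 0 <= t -> Fbd G t (mart jump r X f t) by move=> t0; exact: (Fbd_mart JP).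
split; first by apply: is_martingale_bd => // s t Z st bZ; exact: (dynkin JP).
move=> t t0; apply: (bdmeas_integrable _ (P_fin P)) => //.
by apply: bdmeasX; apply: (Fbd_bd JP t0); exact: bM.
Qed.

Lemma pint_lip (f : T -> R) w s t : 0 <= s <= t ->
  `|pint X f 0 t w - pint X f 0 s w| <= fmax f * (t - s).
Proof.
move=> st; have /andP[s0 st'] := st.
by rewrite (pintD JP f w (a := 0) (s := s)) ?lexx//= addrAC subrr add0r; exact: (pint_bound JP).
Qed.

(** The time integral of the carre du champ is adapted and Lipschitz in time, which yields
    predictability, regularity and bounded variation at once; [cov_mart] is the martingale
    property. *)
Lemma jump_covariation (f g : T -> R) : predictable_covariation P (fun t => <<s G t >>)
  (mart jump r X f) (mart jump r X g) (fun t => pint X (carre jump r f g) 0 t).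
Proof.
have bQ t : 0 <= t -> Fbd G t (pint X (carre jump r f g) 0 t).
  by move=> t0; apply: (Fbd_pint JP); rewrite lexx.
split; [exact: mart_square_integrable|exact: mart_square_integrable| | |].
- apply: (@lipschitz_predictable _ _ _ _ _ (fmax (carre jump r f g))).
    by move=> t t0 B mB; apply: Fbd_preimage mB; exact: bQ.
  by move=> w s t st; exact: pint_lip.
- move=> w; split.
    have := @pint_bound _ _ _ _ _ _ _ _ _ _ _ JP (carre jump r f g) 0 0 w; rewrite lexx subrr mulr0.
    by move=> /(_ isT); rewrite normr_le0 => /eqP.
  move=> U U0; split; first by apply: (@lipschitz_cadlag _ _ (fmax (carre jump r f g))) ; [exact: fmax_ge0|] => s t; exact: pint_lip.
  by apply: (@lipschitz_bounded_variation _ _ (fmax (carre jump r f g))) => //; [exact: fmax_ge0|] => s t; exact: pint_lip.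
- apply: is_martingale_bd => [t t0|s t Z st bZ].
    by apply: bdmeasB; [apply: bdmeasM; exact: (Fbd_mart JP)|exact: bQ].
  have /andP[s0 st'] := st.
  rewrite -[RHS](cov_mart JP f g st bZ); apply: eq_Rintegral => w _.
  rewrite (pintD JP _ w (a := 0) (s := s) (t := t)) ?lexx//.
  by move: (mart _ _ _ f t w) (mart _ _ _ g t w) (pint _ _ 0 s w) => a b c; ring.
Qed.

End Covariation.

Section CovariationLimit.
Context (R : realType) (G : set R) (N : R -> nat) (K gK : R -> R)
  (alpha delta beta : R -> R) (sigmastar : R) (M : nat -> int).
Context (d : R -> measure_display) (Om : forall g : R, measurableType (d g))
    (P : forall g : R, probability (Om g) R)
    (sigma : forall g : R, R -> Om g -> config (N g))
    (init : forall g : R, config (N g) -> R).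
Hypothesis KM : kac_model G K gK alpha delta beta M P sigma init.
Variables (Cm CM : R).
Hypothesis Cm0 : 0 <= Cm.
Hypothesis CM0 : 0 <= CM.
Local Notation good := (good G N K alpha delta beta sigmastar M).
Hypothesis gd_near : forall c, 0 < c -> \forall g \near kac_limit G, good c Cm CM g.
Local Notation r g := (fun (c : config (N g)) (i : site (N g)) => (alpha g)^-1 * rate K g (beta g) c i).
Local Notation X g := (fun t => @sigma g (t / alpha g)).
Local Notation obs g phi := (field_observable K g (delta g) phi).
Local Notation Gam g phi psi := (carre (@exchange (N g)) (r g) (obs g phi) (obs g psi)).

Lemma cvge_to_0 (u : R -> \bar R) : (forall g, 0 <= u g)%E ->
  (forall e : R, 0 < e -> \forall g \near kac_limit G, (u g <= e%:E)%E) -> u g @[g --> kac_limit G] --> 0%E.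
Proof.
move=> u0 H; apply/fine_cvgP; split.
  apply: filterS (H 1 ltr01) => g u1; rewrite ge0_fin_numE//; exact: le_lt_trans u1 (ltry _).
apply/cvgrPdist_le => e e0; apply: filterS (H e e0) => g ue /=.
have uf : u g \is a fin_num by rewrite ge0_fin_numE//; exact: le_lt_trans ue (ltry _).
by rewrite sub0r normrN ger0_norm ?fine_ge0// -lee_fin fineK.
Qed.

(** Uniformity in t is free: the supremum is at most the integral over [0, T] of the absolute
    deviation of the carre du champ. *)
Lemma covariation_limit (phi psi : R -> R) (T : R) : smooth_torus phi -> smooth_torus psi -> 0 < T ->
  (\int[P g]_w ereal_sup
     [set `|pint (X g) (Gam g phi psi) 0 t w - sigmastar ^+ 2 * t * dirichlet_form phi psi|%:E
        | t in `[0%R, T]])%E @[g --> kac_limit G] --> 0%E.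
Proof.
move=> sphi spsi T0; apply: cvge_to_0 => [g|e e0].
  apply: integral_ge0 => w _; apply: ereal_sup_ge; exists `|pint (X g) (Gam g phi psi) 0 0 w - sigmastar ^+ 2 * 0 * dirichlet_form phi psi|%:E.
    by exists 0 => //=; rewrite in_itv/= lexx ltW.
  by rewrite lee_fin.
have [c c0 H] := carre_L1 sigmastar KM Cm0 CM0 sphi spsi (ltW T0) e0.
apply: filterS (gd_near c0) => g gd; have JP := model_jump_process KM (good_G gd).
pose D := dirichlet_form phi psi.
pose k cc := `|Gam g phi psi cc - sigmastar ^+ 2 * D|.
apply: (@le_trans _ _ (\int[P g]_w (pint (X g) k 0 T w)%:E)%E).
  apply: le_integralT => w; apply: ge_ereal_sup => _ [t /= + <-]; rewrite in_itv/= => /andP[t0 tT].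
  rewrite lee_fin; have st : (0 : R) <= 0 <= t by rewrite lexx.
  have k0 x : 0 <= k x by exact: normr_ge0.
  apply: (@le_trans _ _ (pint (X g) k 0 t w)); last first.
    by rewrite (pintD JP k w (a := 0) (s := t) (t := T)) ?lexx//= lerDl; exact: pint_ge0.
  have aux1 x : Gam g phi psi x <= sigmastar ^+ 2 * D + 1 * k x.
    by rewrite mul1r addrC -lerBlDr ler_norm.
  have h1 := pint_affine JP w aux1 st.
  have aux2 x : - Gam g phi psi x <= - (sigmastar ^+ 2 * D) + 1 * k x.
    by rewrite mul1r addrC -lerBlDr opprK addrC /k distrC ler_norm.
  have h2 := pint_affine JP w aux2 st.
  have hN : pint (X g) (fun x => - Gam g phi psi x) 0 t w = - pint (X g) (Gam g phi psi) 0 t w.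
    rewrite /pint -[RHS]mulN1r -(@IntZ _ _ R lebesgue_measure `[0, t]%classic (measurable_itv _) (itvc_fin 0 t)); last first.
      by have [] := pint_rsum JP (Gam g phi psi) w st.
    by apply: eq_Rintegral => u _; rewrite mulN1r.
  rewrite hN subr0 mul1r in h2; rewrite subr0 mul1r in h1.
  rewrite -/D (_ : sigmastar ^+ 2 * t * D = sigmastar ^+ 2 * D * t); last by ring.
  rewrite mulNr in h2; apply/ler_normlP; split.
    by rewrite opprB addrC -lerBrDr [leRHS]addrC.
  by rewrite lerBlDl.
have bk := pint_bd JP k (s := 0) (t := T); rewrite lexx (ltW T0) in bk; have {}bk := bk isT.
have ik := bdmeas_integrable measurableT (P_fin (P g)) bk.
have fk := integrable_fin_num measurableT ik.
by rewrite -(fineK fk) lee_fin; exact: H.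
Qed.

End CovariationLimit.

(** * Characteristic functions of the increments *)

Section MartingaleLinear.
Context (R : realType) (T I : finType) (jump : T -> I -> T) (r : T -> I -> R).
Context d (Om : measurableType d) (P : probability Om R) (X : R -> Om -> T).
Context (G : R -> set (set Om)) (Ph : R -> (T -> R) -> T -> R).
Hypothesis JP : jump_process jump r P X G Ph.

Lemma pint_sum (J : finType) (a : J -> R) (f : J -> T -> R) (s t : R) w : 0 <= s <= t ->
  pint X (fun x => \sum_j a j * f j x) s t w = \sum_j a j * pint X (f j) s t w.
Proof.
move=> st; have mI : measurable (`[s, t] : set R) by exact: measurable_itv.
have bf j : bdmeas (`[s, t] : set R) (fun u => f j (X u w)) by have [] := pint_rsum JP (f j) w st.
have bz j := bdmeasZ (a j) (bf j).
rewrite /pint (@Int_sum _ _ R lebesgue_measure _ mI (itvc_fin s t) _ _ _ _ bz).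
by apply: eq_bigr => j _; exact: (@IntZ _ _ R lebesgue_measure _ mI (itvc_fin s t) (a j) _ (bf j)).
Qed.

Lemma dmart_sum (J : finType) (a : J -> R) (f : J -> T -> R) (s t : R) w : 0 <= s <= t ->
  dmart jump r X (fun x => \sum_j a j * f j x) s t w = \sum_j a j * dmart jump r X (f j) s t w.
Proof.
move=> st; rewrite /dmart (martB JP) //.
have -> : jump_gen jump r (fun x => \sum_j a j * f j x) =
  fun x => \sum_j a j * jump_gen jump r (f j) x.
  apply: funext => x; rewrite /jump_gen.
  under [RHS]eq_bigr do rewrite mulr_sumr.
  rewrite exchange_big/=; apply: eq_bigr => i _; rewrite -sumrB mulr_sumr.
  by apply: eq_bigr => j _; ring.
rewrite pint_sum// -!sumrB; apply: eq_bigr => j _.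
by rewrite (martB JP)//; ring.
Qed.

End MartingaleLinear.

Section CharacteristicLimit.
Context (R : realType) (G : set R) (N : R -> nat) (K gK : R -> R)
  (alpha delta beta : R -> R) (sigmastar : R) (M : nat -> int).
Context (d : R -> measure_display) (Om : forall g : R, measurableType (d g))
    (P : forall g : R, probability (Om g) R)
    (sigma : forall g : R, R -> Om g -> config (N g))
    (init : forall g : R, config (N g) -> R).
Hypothesis KM : kac_model G K gK alpha delta beta M P sigma init.
Variables (Cm CM : R).
Hypothesis Cm0 : 0 <= Cm.
Hypothesis CM0 : 0 <= CM.
Local Notation good := (good G N K alpha delta beta sigmastar M).
Local Notation r g := (fun (c : config (N g)) (i : site (N g)) => (alpha g)^-1 * rate K g (beta g) c i).
Local Notation X g := (fun t => @sigma g (t / alpha g)).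
Local Notation obs g phi := (field_observable K g (delta g) phi).
Local Notation Gam g phi psi := (carre (@exchange (N g)) (r g) (obs g phi) (obs g psi)).
Local Notation dM g phi := (dmart (@exchange (N g)) (r g) (X g) (obs g phi)).
Local Notation Df := (@dirichlet_form R).

Lemma obs_sum (J : finType) (a : J -> R) (phi : J -> R -> R) g :
  obs g (fun x => \sum_j a j * phi j x) = fun c : config (N g) => \sum_j a j * obs g (phi j) c.
Proof.
apply: funext => c; rewrite /field_observable /pairing.
under [RHS]eq_bigr do rewrite mulrCA.
rewrite -mulr_sumr; congr (_ * _); under [RHS]eq_bigr do rewrite mulr_sumr.
rewrite exchange_big/=; apply: eq_bigr => i _; rewrite mulr_sumr.
by apply: eq_bigr => j _; ring.
Qed.

Lemma dM_sum (J : finType) (a : J -> R) (phi : J -> R -> R) g (s t : R) w : G g -> 0 <= s <= t ->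
  dM g (fun x => \sum_j a j * phi j x) s t w = \sum_j a j * dM g (phi j) s t w.
Proof.
move=> Gg st; have JP := model_jump_process KM Gg.
by rewrite obs_sum (dmart_sum JP).
Qed.

Lemma dirichlet_ge0 (f : R -> R) : 0 <= Df f f.
Proof. by apply: Rintegral_ge0 => x _; rewrite -expr2 sqr_ge0. Qed.

(** Induction on the number of time intervals: the earlier increments form the phase [y0], known at
    the start of the last interval, and [cos_step] multiplies by the Gaussian factor of that
    interval. *)
Lemma cos_limit (h b : R) (psi : nat -> R -> R) (m : nat) : 0 <= h -> (forall l, smooth_torus (psi l)) ->
  forall e : R, 0 < e -> exists2 c : R, 0 < c & forall g, good c Cm CM g ->
  `|Ex (P g) (fun w => cos (b + \sum_(l < m) dM g (psi l) (l%:R * h) (l.+1%:R * h) w)) -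
    expR (- (2^-1 * h * \sum_(l < m) sigmastar ^+ 2 * Df (psi l) (psi l))) * cos b| <= e.
Proof.
move=> h0 spsi; elim: m => [|m IH] e e0.
  exists 1 => // g gd; rewrite (_ : (fun w => _) = fun=> cos b); last first.
    by apply: funext => w; rewrite big_ord0 addr0.
  by rewrite Ex_cst big_ord0 mulr0 oppr0 expR0 mul1r subrr normr0 ltW.
have sm0 : 0 <= m%:R * h <= m.+1%:R * h by rewrite mulr_ge0//= ler_wpM2r// ler_nat.
have t0 : 0 <= m.+1%:R * h by rewrite mulr_ge0.
pose q := sigmastar ^+ 2 * Df (psi m) (psi m).
have q0 : 0 <= q by rewrite mulr_ge0 ?sqr_ge0 ?dirichlet_ge0.
have e3 : 0 < e / 3 by rewrite divr_gt0.
have [c1 c10 H1] := IH _ e3.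
have [c2 c20 H2] := carre_L1 sigmastar KM Cm0 CM0 (spsi m) (spsi m) t0 e3.
have [Gm Gm0 HG] := good_carre sigmastar KM Cm CM (spsi m).
have [B B0 HB] := torus_bounded (torus_derive1 (spsi m)).
pose A := 32 * B * Gm * h.
have A0 : 0 <= A by rewrite !mulr_ge0.
have A1 : 0 < 3 * (A + 1) by rewrite mulr_gt0// ltr_wpDl.
exists (Num.min (Num.min c1 c2) (Num.min 1 (e / (3 * (A + 1))))).
  by rewrite !lt_min c10 c20 ltr01 divr_gt0.
move=> g; set c := Num.min _ _ => gd.
have cc1 : c <= c1 by rewrite !ge_min lexx.
have cc2 : c <= c2 by rewrite !ge_min lexx orbT.
have cc3 : c <= 1 by rewrite !ge_min lexx !orbT.
have cc4 : c * (3 * (A + 1)) <= e by rewrite -ler_pdivlMr// !ge_min lexx !orbT.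
have c0 : 0 < c by apply: lt_le_trans (good_p gd); exact: mesh_gt0.
have Gg := good_G gd; have JP := model_jump_process KM Gg.
pose y0 w := b + \sum_(l < m) dM g (psi l) (l%:R * h) (l.+1%:R * h) w.
have by0 : Fbd (history (alpha g) (@sigma g)) (m%:R * h) y0.
  apply: bdmeasD; first exact: bdmeas_cst.
  apply: bdmeas_sum => l.
  apply: (Fbd_mono JP (s := l.+1%:R * h)).
    by rewrite mulr_ge0//= ler_wpM2r// ler_nat.
  by apply: (Fbd_dmart JP); rewrite mulr_ge0//= ler_wpM2r// ler_nat.
have Dj0 : 0 <= 4 * B * c by rewrite !mulr_ge0// ltW.
have H5 : `|Ex (P g) (fun w => cos (y0 w)) -
    expR (- (2^-1 * h * \sum_(l < m) sigmastar ^+ 2 * Df (psi l) (psi l))) * cos b| <= e / 3.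
  exact: H1 g (good_le cc1 gd).
move: H5; have := cos_step JP Dj0 (good_jump KM (spsi m) HB gd) (HG c g gd cc3) sm0 q0 by0.
rewrite (_ : (fun w => cos (y0 w + _)) =
   fun w => cos (b + \sum_(l < m.+1) dM g (psi l) (l%:R * h) (l.+1%:R * h) w)); last first.
  apply: funext => w; congr cos; rewrite /y0 -addrA; congr (b + _).
  by rewrite big_ord_recr.
have -> : m.+1%:R * h - m%:R * h = h by rewrite -mulrBl -natr1 addrAC subrr add0r mul1r.
have -> : 2^-1 * h * (\sum_(l < m.+1) sigmastar ^+ 2 * Df (psi l) (psi l)) =
    2^-1 * h * (\sum_(l < m) sigmastar ^+ 2 * Df (psi l) (psi l)) + q / 2 * h.
  by rewrite big_ord_recr mulrDr; congr (_ + _); rewrite /q mulrC mulrA; ring.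
rewrite opprD expRD.
have E1 : 0 <= expR (- (q / 2 * h)) <= 1.
  apply/andP; split; first exact: expR_ge0.
  rewrite -[leRHS]expR0 ler_expR oppr_le0; apply: mulr_ge0 => //.
  by apply: divr_ge0.
have H3 : 2^-1 * Ex (P g) (pint (X g) (fun x => `|Gam g (psi m) (psi m) x - q|) (m%:R * h) (m.+1%:R * h)) <= e / 3.
  apply: (@le_trans _ _ (2^-1 * (e / 3))); last by rewrite ler_piMl ?(ltW e3)// invf_le1// ler1n.
  rewrite ler_pM2l ?invr_gt0//; apply: le_trans (H2 g (good_le cc2 gd)).
  by apply: (Ex_pint_mono JP) => // x; exact: normr_ge0.
have H4 : 8 * (4 * B * c) * Gm * h <= e / 3.
  have -> : 8 * (4 * B * c) * Gm * h = c * A by rewrite /A; ring.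
  by rewrite ler_pdivlMr//; apply: le_trans cc4; rewrite -mulrA ler_pM2l// mulrC ler_pM2l// lerDl.
move: H3 H4; set u := 2^-1 * _; set v := 8 * _ * _ * _.
set Ea := Ex _ _; set Eb := Ex (P g) (fun w : Om g => cos (y0 w)).
set x := expR (- (2^-1 * _ * _)); set y := expR _ in E1 *; set z := cos b.
move=> H3 H4 H6 H5.
have -> : Ea - x * y * z = (Ea - y * Eb) + y * (Eb - x * z) by ring.
apply: le_trans (ler_normD _ _) _; rewrite normrM.
have /andP[y0' y1] := E1; rewrite (ger0_norm y0').
have : y * `|Eb - x * z| <= e / 3 by apply: le_trans H5; rewrite ler_piMl.
by move: (y * `|_|) => k; move: H6 H3 H4; move: (`|Ea - _|) => k'; lra.
Qed.

Lemma second_moment_limit (phi : R -> R) : smooth_torus phi -> exists2 C : R, 0 <= C &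
  forall c g s t, good c Cm CM g -> c <= 1 -> 0 <= s <= t ->
  Ex (P g) (fun w => dM g phi s t w ^+ 2) <= C * (t - s).
Proof.
move=> sphi; have [Gm Gm0 HG] := good_carre sigmastar KM Cm CM sphi.
have [B B0 HB] := torus_bounded (torus_derive1 sphi).
exists Gm => // c g s t gd c1 st; have JP := model_jump_process KM (good_G gd).
exact: (second_moment_mart JP (HG c g gd c1) st).
Qed.

End CharacteristicLimit.

(** * Square-integrable and Gaussian random variables *)

Section SquareIntegrable.
Context d (Om : measurableType d) (R : realType) (P : probability Om R).
Implicit Types (X Y Z f g : Om -> R).
Local Notation int f := (P.-integrable setT (EFin \o f)).

Lemma int_meas f : int f -> measurable_fun setT f.
Proof. by move=> /measurable_int/measurable_EFinP. Qed.

Lemma int_dom f g : measurable_fun setT f -> int g -> (forall w, `|f w| <= g w) -> int f.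
Proof.
move=> mf ig fg; apply: le_integrable ig => //; first exact/measurable_EFinP.
by move=> w _; rewrite lee_fin; apply: le_trans (fg w) (ler_norm _).
Qed.

Lemma int_sum (J : Type) (s : seq J) (f : J -> Om -> R) : (forall j, int (f j)) ->
  int (fun w => \sum_(j <- s) f j w) /\
  Ex P (fun w => \sum_(j <- s) f j w) = \sum_(j <- s) Ex P (f j).
Proof.
move=> fi; elim: s => [|j s [IH1 IH2]].
  rewrite (_ : (fun w => _) = fun=> 0); last by apply: funext => w; rewrite big_nil.
  by split; [exact: integrable0|rewrite big_nil Ex_cst].
rewrite (_ : (fun w => _) = fun w => f j w + \sum_(j <- s) f j w); last first.
  by apply: funext => w; rewrite big_cons.
split; first by apply: (integrableD measurableT (fi j) IH1).
by rewrite big_cons -IH2 /Ex (RintegralD measurableT (fi j) IH1).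
Qed.

Lemma int_scale (a : R) f : int f -> int (fun w => a * f w).
Proof. by move=> fi; apply: (integrableZl measurableT a fi). Qed.

Lemma int_sqr_mul X Y : measurable_fun setT X -> measurable_fun setT Y ->
  int (fun w => X w ^+ 2) -> int (fun w => Y w ^+ 2) -> int (fun w => X w * Y w).
Proof.
move=> mX mY iX iY; apply: (int_dom (g := fun w => X w ^+ 2 + Y w ^+ 2)).
- exact: measurable_funM.
- exact: (integrableD measurableT iX iY).
- move=> w; rewrite normrM -(real_normK (num_real (X w))) -(real_normK (num_real (Y w))).
  by move: (normr_ge0 (X w)) (normr_ge0 (Y w)) (sqr_ge0 (`|X w| - `|Y w|)); nra.
Qed.

Section Orthogonality.
Variable G : set (set Om).
Hypothesis Gm : forall A, <<s G >> A -> measurable A.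

(* Increasing approximation of Z by nonnegative combinations of indicators of <<s G>>. *)
Let ortho_ge0 Y Z : int Y -> int (fun w => Z w * Y w) ->
  (forall B, <<s G >> B -> Rintegral P B Y = 0) ->
  measurable_fun (setT : set (g_sigma_algebraType G)) Z -> (forall w, 0 <= Z w) ->
  Ex P (fun w => Z w * Y w) = 0.
Proof.
move=> iY iZY YB mZ Z0; have mY := int_meas iY.
pose h (n : nat) : R := n.+1%:R; have h0 n : 0 < h n by [].
pose A n (k : nat) := Z @^-1` `[k.+1%:R / h n, +oo[.
have FA n k : <<s G >> (A n k).
  by have := mZ measurableT _ (measurable_itv `[k.+1%:R / h n, +oo[); rewrite setTI.
have iA n k : int (fun w => (\1_(A n k) : Om -> R) w * Y w).
  apply: (int_dom (g := fun w => `|Y w|)).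
  - by apply: measurable_funM => //; apply: measurable_indic; exact: Gm.
  - exact: (integrable_abse iY).
  - by move=> w; rewrite normrM ler_piMl// indicE; case: (_ \in _); rewrite ?normr0 ?normr1.
have EA n k : Ex P (fun w => (\1_(A n k) : Om -> R) w * Y w) = 0.
  rewrite -(YB _ (FA n k)) [RHS]Rintegral_mkcond; apply: eq_Rintegral => w _.
  by rewrite patchE indicE; case: ifP => _; rewrite ?mul1r ?mul0r.
pose W n w : R := (h n)^-1 * \sum_(k < n.+1 * n.+1) (\1_(A n k) : Om -> R) w.
have WE n : (fun w => W n w * Y w) =
    fun w => (h n)^-1 * \sum_(k < n.+1 * n.+1) (\1_(A n k) : Om -> R) w * Y w.
  by apply: funext => w; rewrite /W -mulrA mulr_suml.
have EW n : int (fun w => W n w * Y w) /\ Ex P (fun w => W n w * Y w) = 0.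
  have [i1 e1] := int_sum (index_enum 'I_(n.+1 * n.+1)) (fun k => iA n k).
  rewrite WE; split; first exact: int_scale.
  by rewrite /Ex RintegralZl// -/(Ex P _) e1 big1 ?mulr0.
have Wval n w : W n w = (minn (Num.trunc (Z w * h n)) (n.+1 * n.+1))%:R / h n.
  rewrite /W mulrC; congr (_ / _).
  have x0 : 0 <= Z w * h n by rewrite mulr_ge0.
  have /andP[m1 m2] := truncn_itv x0; set m := Num.trunc _ in m1 m2 *.
  transitivity (\sum_(k < n.+1 * n.+1 | (k < minn m (n.+1 * n.+1))%N) (1 : R)).
    rewrite [RHS]big_mkcond; apply: eq_bigr => k _; rewrite indicE leq_min ltn_ord andbT.
    have -> : (w \in A n k) = (k < m)%N; last by case: ifP.
    apply/idP/idP.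
      rewrite inE /A/= in_itv/= andbT ler_pdivrMr// => kx.
      by have := le_lt_trans kx m2; rewrite ltr_nat ltnS.
    move=> km; rewrite inE /A/= in_itv/= andbT ler_pdivrMr//.
    by apply: le_trans m1; rewrite ler_nat.
  by rewrite -(big_ord_widen_cond _ xpredT (fun=> (1 : R))) ?geq_minr// sumr_const card_ord.
have mle n w : (Num.trunc (Z w * h n))%:R <= Z w * h n.
  by have /andP[] := truncn_itv (mulr_ge0 (Z0 w) (ltW (h0 n))).
have W0 n w : 0 <= W n w <= Z w.
  rewrite Wval divr_ge0//= ler_pdivrMr//; apply: le_trans (mle n w).
  by rewrite ler_nat geq_minl.
suff H : (fun n => Rintegral P setT (fun w => W n w * Y w)) @ \oo --> Rintegral P setT (fun w => Z w * Y w).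
  have c0 : (fun n => Rintegral P setT (fun w => W n w * Y w)) = fun=> 0.
    by apply: funext => n; exact: (EW n).2.
  by rewrite c0 in H; apply: (cvg_unique _ H) => //; exact: cvg_cst.
have mW n := int_meas (EW n).1.
apply: (@dct _ _ _ P (fun n w => W n w * Y w) (fun w => Z w * Y w) (fun w => `|Z w * Y w|)
  mW _ (integrable_abse iZY) _).2 => [w|n w]; last first.
  by rewrite [`|W n w * Y w|]normrM [`|Z w * Y w|]normrM ler_wpM2r//; have /andP[a b] := W0 n w; rewrite (ger0_norm a) (ger0_norm (Z0 w)).
have L0 : (fun n => `|Y w| * (h n)^-1) @ \oo --> (0 : R).
  by rewrite -(mulr0 `|Y w|); apply: cvgMr; exact: cvg_harmonic.
apply/cvgrPdist_le => e e0; move/cvgrPdist_le : L0 => /(_ _ e0).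
apply: filterS2 (nbhs_infty_ge (Num.trunc (Z w)).+1) => n nZ.
rewrite sub0r normrN ger0_norm ?mulr_ge0 ?invr_ge0 ?(ltW (h0 n))// => H; apply: le_trans H.
rewrite -mulrBl normrM mulrC ler_wpM2l//.
have Zn : Z w <= h n.
  have /andP[_ /ltW z2] := truncn_itv (Z0 w); apply: le_trans z2 _; rewrite ler_nat.
  exact: leqW.
have /andP[_ wz] := W0 n w; rewrite ger0_norm ?subr_ge0//.
rewrite Wval (minn_idPl _); last first.
  rewrite -(ler_nat R); apply: le_trans (mle n w) _.
  by rewrite natrM ler_pM2r.
rewrite lerBlDl -[X in _ <= _ + X]mul1r -mulrDl ler_pdivlMr//.
by have /andP[_ /ltW] := truncn_itv (mulr_ge0 (Z0 w) (ltW (h0 n))); rewrite -natr1.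
Qed.

(** The positive and negative parts of Z are treated separately. Unlike [Ex_ortho] this covers
    unbounded Z, as the Gaussian variables require. *)
Lemma ortho_L1 Y Z : int Y -> int (fun w => Z w * Y w) ->
  (forall B, <<s G >> B -> Rintegral P B Y = 0) ->
  measurable_fun (setT : set (g_sigma_algebraType G)) Z -> Ex P (fun w => Z w * Y w) = 0.
Proof.
move=> iY iZY YB mZ.
have mZ' : measurable_fun setT Z.
  by move=> _ B mB; rewrite setTI; apply: Gm; have := mZ measurableT _ mB; rewrite setTI.
have half (U : Om -> R) : measurable_fun (setT : set (g_sigma_algebraType G)) U ->
    measurable_fun setT U -> (forall w, `|U w| = `|Z w|) ->
    int (fun w => Num.max (U w) 0 * Y w) /\ Ex P (fun w => Num.max (U w) 0 * Y w) = 0.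
  move=> mU mU' UZ; suff i : int (fun w => Num.max (U w) 0 * Y w).
    split=> //; apply: ortho_ge0 => // [|w]; last by rewrite le_max lexx orbT.
    by apply: measurable_maxr => //; exact: measurable_cst.
  apply: (int_dom (g := fun w => `|Z w * Y w|)).
  - by apply: measurable_funM (int_meas iY); apply: measurable_maxr => //; exact: measurable_cst.
  - exact: (integrable_abse iZY).
  - move=> w; rewrite !normrM ler_wpM2r// -UZ; have [u0|/ltW u0] := leP (U w) 0; last by [].
    by rewrite normr0.
have [i1 e1] := half Z mZ mZ' (fun=> erefl).
have nZ w : `|-1 * Z w| = `|Z w| by rewrite mulN1r normrN.
have [i2 e2] := half (fun w => -1 * Z w) (measurable_funM (measurable_cst _) mZ)
  (measurable_funM (measurable_cst _) mZ') nZ.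
rewrite (_ : (fun w => _) = fun w => Num.max (Z w) 0 * Y w - Num.max (-1 * Z w) 0 * Y w).
  by rewrite /Ex (RintegralB measurableT i1 i2) -/(Ex P _) e1 -/(Ex P _) e2 subr0.
apply: funext => w; rewrite -mulrBl; congr (_ * _).
by have [z|z] := leP (Z w) 0; have [y|y] := leP (-1 * Z w) 0; lra.
Qed.

End Orthogonality.

Section CenteredGaussian.
Local Notation leb := (@lebesgue_measure R).

(** The Radon-Nikodym derivative of the normal law has the same integrals as [normal_pdf] over all
    Borel sets, so both agree almost everywhere. *)
Lemma normal_prob_integral (s : R) (f : R -> R) : s != 0 -> measurable_fun setT f ->
  (forall x, 0 <= f x) ->
  (\int[normal_prob 0 s]_x (f x)%:E = \int[leb]_x (f x * normal_pdf 0 s x)%:E)%E.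
Proof.
move=> s0 mf f0; have dom := @normal_prob_dominates R 0 s.
rewrite -(Radon_Nikodym_SigmaFinite.change_of_variables dom) => //; last first.
  exact/measurable_EFinP.
have iR := Radon_Nikodym_SigmaFinite.f_integrable dom.
have mq : measurable_fun setT (EFin \o normal_pdf 0 s) by apply/measurable_EFinP; exact: measurable_normal_pdf.
apply: ge0_ae_eq_integral => //.
- by apply: emeasurable_funM; [exact/measurable_EFinP|exact: measurable_int iR].
- by apply/measurable_EFinP; apply: measurable_funM => //; exact: measurable_normal_pdf.
- by move=> x _; rewrite mule_ge0 ?lee_fin//; exact: Radon_Nikodym_SigmaFinite.f_ge0.
- by move=> x _; rewrite lee_fin mulr_ge0// normal_pdf_ge0.
have := @integral_ae_eq _ _ _ leb setT measurableT (EFin \o normal_pdf 0 s) _ iR mq.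
have E (B : set R) : B `<=` setT -> measurable B ->
    (\int[leb]_(x in B) Radon_Nikodym_SigmaFinite.f (normal_prob 0 s) leb x =
     \int[leb]_(x in B) (EFin \o normal_pdf 0 s) x)%E.
  by move=> _ mB; rewrite -Radon_Nikodym_SigmaFinite.f_integral.
move=> /(_ E) [A [mA A0 sA]]; exists A; split=> //; apply: subset_trans sA => x /= H Hx; apply: H.
by move=> _; rewrite Hx// EFinM.
Qed.

Lemma gaussian_transfer X (s : R) (f : R -> R) : 0 < s -> measurable_fun setT X ->
  (forall B : set R, measurable B -> P (X @^-1` B) = normal_prob 0 s B) ->
  measurable_fun setT f -> (forall x, 0 <= f x) -> leb.-integrable setT (EFin \o (fun x => f x * normal_pdf 0 s x)) ->
  int (fun w => f (X w)) /\ Ex P (fun w => f (X w)) = Rintegral leb setT (fun x => f x * normal_pdf 0 s x).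
Proof.
move=> s0 mX PX mf f0 iq.
have E : (\int[P]_w (f (X w))%:E = \int[leb]_x (f x * normal_pdf 0 s x)%:E)%E.
  rewrite -normal_prob_integral ?gt_eqF//.
  have mX' : measurable_fun setT (X : Om -> measurableTypeR R) by exact: mX.
  pose X' : {RV P >-> measurableTypeR R} := MeasurableFun.Pack (MeasurableFun.Class (isMeasurableFun.Build _ _ Om (measurableTypeR R) X mX')).
  transitivity (\int[distribution P X']_y (f y)%:E)%E.
    rewrite ge0_integral_distribution//; first exact/measurable_EFinP.
  have := @eq_measure_integral _ (measurableTypeR R) R setT (normal_prob 0 s).
  move=> /(_ (distribution P X') (EFin \o f)); apply => B mB _.
  exact: PX.
have i : int (fun w => f (X w)).
  apply/integrableP; split; first by apply/measurable_EFinP; exact: measurableT_comp.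
  under eq_integral do rewrite /= ger0_norm//.
  by rewrite E; exact: (integrable_lty measurableT iq).
by split=> //; rewrite /Ex /Rintegral E.
Qed.

(** The formula is stated with the second moment of X in order to cover both alternatives, a normal
    law and a variable that vanishes almost surely. *)
Lemma centered_gaussian_cos X (b : R) : centered_gaussian P X ->
  int (fun w => X w ^+ 2) /\
  Ex P (fun w => cos (X w + b)) = expR (- (Ex P (fun w => X w ^+ 2) / 2)) * cos b.
Proof.
move=> [mX [[s s0 PX]|PX]].
  have [i2 e2] := gaussian_transfer s0 mX PX (f := fun x => x ^+ 2) (measurable_funX 2 (@measurable_id _ _ _))
    (fun x => sqr_ge0 _) (integrable_sqr_q s0).
  rewrite normal_variance// in e2; split=> //; rewrite e2.
  have mc : measurable_fun setT (fun x : R => cos (x + b)).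
    apply: measurableT_comp; first exact: continuous_measurable_fun (@continuous_cos R).
    exact: measurable_funD (@measurable_id _ _ _) (measurable_cst b).
  have ic : leb.-integrable setT (EFin \o (fun x => cos (x + b) * normal_pdf 0 s x)).
    apply: (integrable_bd s0 (c := 1)) => x; last first.
      by apply: le_trans (cos_max _) _; rewrite mul1r lerDl sqr_ge0.
    apply: continuous_comp; last exact: continuous_cos.
    by apply: cvgD; [exact: cvg_id|exact: cvg_cst].
  have i1 := integrableD measurableT (integrable_q s) ic.
  (* The transfer to the density is available for nonnegative functions, so 1 is added to the cosine
     and removed at the end. *)
  have f0 (x : R) : 0 <= 1 + cos (x + b).
    by have := cos_max (x + b); rewrite ler_norml => /andP[]; lra.
  have m1 : measurable_fun setT (fun x : R => 1 + cos (x + b)) by apply: measurable_funD => //; exact: measurable_cst.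
  have [|i3 e3] := gaussian_transfer s0 mX PX m1 f0.
    apply: eq_integrable i1 => // x _ /=; by rewrite mulrDl mul1r EFinD.
  have icX : int (fun w => cos (X w + b)).
    apply: (int_dom (g := cst 1)); [exact: (measurableT_comp mc mX)|exact: finite_measure_integrable_cst|].
    by move=> w; exact: cos_max.
  have i11 : int (cst 1) by exact: finite_measure_integrable_cst.
  have : Ex P (fun w => 1 + cos (X w + b)) = 1 + Ex P (fun w => cos (X w + b)).
    by rewrite /Ex (RintegralD measurableT i11 icX) -/(Ex P (cst 1)) Ex_cst.
  rewrite e3 (_ : Rintegral _ _ _ = 1 + expR (- (s ^+ 2 / 2)) * cos b); first by move=> /addrI.
  transitivity (Rintegral leb setT (fun x => normal_pdf 0 s x + cos (x + b) * normal_pdf 0 s x)).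
    by apply: eq_Rintegral => x _; rewrite mulrDl mul1r.
  rewrite (RintegralD measurableT (integrable_q s) ic); congr (_ + _).
    by rewrite /Rintegral integral_normal_pdf.
  have := normal_cos_fun s0 b 1; rewrite expr1n mul1r => <-.
  by apply: eq_Rintegral => x _; rewrite mul1r.
have mX0 : measurable (X @^-1` [set 0]) by rewrite -[X @^-1` _]setTI; apply: mX.
have ae0 : \forall w \ae P, X w = 0.
  exists (~` (X @^-1` [set 0])); split; [exact: measurableC| |by []].
  by rewrite probability_setC// PX subee.
have m2 : measurable_fun setT (fun w => X w ^+ 2) by exact: measurable_funX.
have E2 : (\int[P]_w (X w ^+ 2)%:E = 0)%E.
  rewrite -(integral0 P setT); apply: ae_eq_integral => //; first exact/measurable_EFinP.
  by apply: filterS ae0 => w /= -> _; rewrite expr0n.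
split.
  apply/integrableP; split; first exact/measurable_EFinP.
  by under eq_integral do rewrite /= ger0_norm ?sqr_ge0//; rewrite E2.
rewrite [in RHS]/Ex /Rintegral E2 mul0r oppr0 expR0 mul1r -[RHS](Ex_cst P).
congr fine; apply: ae_eq_integral => //.
- apply/measurable_EFinP; apply: measurableT_comp; first exact: continuous_measurable_fun (@continuous_cos R).
  exact: measurable_funD mX (measurable_cst b).
- by apply: filterS ae0 => w /= -> _; rewrite add0r.
Qed.

End CenteredGaussian.
End SquareIntegrable.

Lemma node_le (R : realType) (i j : nat) (h : R) : 0 <= h -> (i <= j)%N -> 0 <= i%:R * h <= j%:R * h.
Proof. by move=> h0 ij; rewrite mulr_ge0//= ler_wpM2r// ler_nat. Qed.

Lemma minn_shift (l m : nat) : (l < m)%N ->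
  [/\ minn l.+1 m.+1 = l.+1, minn l.+1 m = l.+1 & minn l m.+1 = l].
Proof. by move=> lm; split; lia. Qed.

(** * Increments of the limiting Gaussian martingale *)

Section WhiteNoiseSide.
Context (R : realType) d (Om : measurableType d) (P : probability Om R) (sg : R).
Context (W : (R -> R) -> R -> Om -> R).
Hypothesis hW : conservative_gaussian_martingale P sg W.
Local Notation int f := (P.-integrable setT (EFin \o f)).
Local Notation Df := (@dirichlet_form R).

Lemma cgm_gaussian (J : finType) (phi : J -> R -> R) (t a : J -> R) :
  (forall j, smooth_torus (phi j)) -> (forall j, 0 <= t j) ->
  centered_gaussian P (fun w => \sum_j a j * W (phi j) (t j) w).
Proof.
move=> sphi t0; have [_ H _] := hW.
have := H _ (phi \o @enum_val J J) (t \o @enum_val J J) (a \o @enum_val J J)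
  (fun i => sphi _) (fun i => t0 _).
rewrite (_ : (fun w => \sum_(i < _) _) = fun w => \sum_j a j * W (phi j) (t j) w)//.
apply: funext => w; rewrite [RHS](reindex (@enum_val J J))//=.
exact/onW_bij/enum_val_bij.
Qed.

Lemma cgm_L2 (phi : R -> R) t : smooth_torus phi -> 0 <= t ->
  measurable_fun setT (W phi t) /\ int (fun w => W phi t w ^+ 2).
Proof.
move=> sphi t0.
have gX : centered_gaussian P (W phi t).
  have := @cgm_gaussian unit (fun=> phi) (fun=> t) (fun=> 1) (fun=> sphi) (fun=> t0).
  rewrite (_ : (fun w => \sum_j _) = W phi t)//.
  by apply: funext => w; rewrite big_const card_unit /= mul1r addr0.
by split; [case: gX|have [] := centered_gaussian_cos 0 gX].
Qed.

Lemma cgm_int_mul (phi psi : R -> R) s t : smooth_torus phi -> smooth_torus psi -> 0 <= s -> 0 <= t ->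
  int (fun w => W phi s w * W psi t w).
Proof.
move=> sphi spsi s0 t0; have [m1 i1] := cgm_L2 sphi s0; have [m2 i2] := cgm_L2 spsi t0.
exact: int_sqr_mul.
Qed.

(** The martingale property of the product minus the covariation, between the times 0 and s and on
    the whole space; everything vanishes at time 0. *)
Lemma cgm_cov_diag (phi psi : R -> R) s : smooth_torus phi -> smooth_torus psi -> 0 <= s ->
  Ex P (fun w => W phi s w * W psi s w) = sg ^+ 2 * s * Df phi psi.
Proof.
move=> sphi spsi s0; have [W0 _ H] := hW.
have [_ _ _ _ [_ _ /(_ 0 s)]] := H phi psi sphi spsi.
rewrite lexx s0 => /(_ isT setT); set F := family_filtration W.
have FT : F 0 setT by have : measurable (setT : set (g_sigma_algebraType
  [set C | exists phi s (B : set R), [/\ smooth_torus phi, 0 <= s <= 0, measurable B & C = W phi s @^-1` B]])) by [].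
move=> /(_ FT) E.
have i1 := cgm_int_mul sphi spsi s0 s0.
have i2 : int (cst (sg ^+ 2 * s * Df phi psi)) by exact: finite_measure_integrable_cst.
have : Ex P (fun w => W phi s w * W psi s w - sg ^+ 2 * s * Df phi psi) = 0.
  rewrite /Ex /Rintegral E -[RHS](Ex_cst P); congr fine; apply: eq_integral => w _.
  by rewrite (W0 phi w sphi).1 mul0r mulr0 mul0r subrr.
by rewrite /Ex (RintegralB measurableT i1 i2) -/(Ex P (cst _)) Ex_cst => /eqP; rewrite subr_eq0 => /eqP.
Qed.

(** The later increment of W phi is orthogonal to W psi s, which is measurable for the family
    filtration at time s. *)
Lemma cgm_cov (phi psi : R -> R) s t : smooth_torus phi -> smooth_torus psi -> 0 <= s <= t ->
  Ex P (fun w => W psi s w * W phi t w) = sg ^+ 2 * s * Df psi phi.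
Proof.
move=> sphi spsi st; have /andP[s0 st'] := st; have t0 : 0 <= t by apply: le_trans st'.
have [_ _ H] := hW; have [[[_ iW mW] _] _ _ _ _] := H phi phi sphi sphi.
pose G := [set C | exists phi u (B : set R),
  [/\ smooth_torus phi, 0 <= u <= s, measurable B & C = W phi u @^-1` B]].
have Gm A : <<s G >> A -> measurable A.
  apply: (smallest_sub (C := sigma_algebra setT)) => [|_ [f [u [B [sf /andP[u0 _] mB ->]]]]].
    exact: sigma_algebra_measurable.
  by have [mf _] := cgm_L2 sf u0; rewrite -[_ @^-1` _]setTI; exact: mf.
have it := iW t t0; have is_ := iW s s0.
have iY : int (fun w => W phi t w - W phi s w) := integrableB measurableT it is_.
have i1 := cgm_int_mul spsi sphi s0 t0; have i2 := cgm_int_mul spsi sphi s0 s0.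
have iZY : int (fun w => W psi s w * (W phi t w - W phi s w)).
  have := integrableB measurableT i1 i2; apply: eq_integrable => // w _ /=.
  by rewrite mulrBr EFinB.
have YB B : <<s G >> B -> Rintegral P B (fun w => W phi t w - W phi s w) = 0.
  move=> GB; have mB := Gm B GB.
  have jt : P.-integrable B (EFin \o W phi t) by apply: integrableS it.
  have js : P.-integrable B (EFin \o W phi s) by apply: integrableS is_.
  by rewrite (RintegralB mB jt js) /Rintegral (mW s t st B GB) subrr.
have mZ : measurable_fun (setT : set (g_sigma_algebraType G)) (W psi s).
  move=> _ B mB; rewrite setTI; apply: sub_sigma_algebra; exists psi, s, B.
  by split=> //; rewrite s0 lexx.
have := ortho_L1 Gm iY iZY YB mZ.
rewrite (_ : (fun w => _ * (_ - _)) = fun w => W psi s w * W phi t w - W psi s w * W phi s w); last first.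
  by apply: funext => w; rewrite mulrBr.
rewrite /Ex (RintegralB measurableT i1 i2) -/(Ex P _) -/(Ex P _) cgm_cov_diag// => /eqP.
by rewrite subr_eq0 => /eqP.
Qed.

Definition increment (h : R) (phi : R -> R) (l : nat) w := W phi (l.+1%:R * h) w - W phi (l%:R * h) w.

(** The covariance at two grid times is proportional to their minimum, whose mixed second difference
    vanishes off the diagonal. *)
Lemma cgm_increment_cov (h : R) (phi psi : R -> R) (l m : nat) : 0 <= h -> smooth_torus phi -> smooth_torus psi ->
  int (fun w => increment h phi l w * increment h psi m w) /\
  Ex P (fun w => increment h phi l w * increment h psi m w) =
  if l == m then h * (sg ^+ 2 * Df phi psi) else 0.
Proof.
move=> h0 sphi spsi;
have DC : Df psi phi = Df phi psi by apply: eq_Rintegral => x _; rewrite mulrC.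
have cov (i j : nat) : int (fun w => W phi (i%:R * h) w * W psi (j%:R * h) w) /\
    Ex P (fun w => W phi (i%:R * h) w * W psi (j%:R * h) w) = (minn i j)%:R * (h * (sg ^+ 2 * Df phi psi)).
  split; first exact: (cgm_int_mul sphi spsi (mulr_ge0 (ler0n R i) h0) (mulr_ge0 (ler0n R j) h0)).
  have [ij|/ltnW ji] := leqP i j.
    have st : 0 <= i%:R * h <= j%:R * h := node_le h0 ij.
    by rewrite (cgm_cov spsi sphi st); move: (Df _ _) => D; ring.
  rewrite (_ : (fun w => _) = fun w => W psi (j%:R * h) w * W phi (i%:R * h) w).
    have st : 0 <= j%:R * h <= i%:R * h := node_le h0 ji.
    by rewrite (cgm_cov sphi spsi st) DC; move: (Df _ _) => D; ring.
  by apply: funext => w; rewrite mulrC.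
have [i1 e1] := cov l.+1 m.+1; have [i2 e2] := cov l.+1 m.
have [i3 e3] := cov l m.+1; have [i4 e4] := cov l m.
have i12 := integrableB measurableT i1 i2; have i34 := integrableB measurableT i3 i4.
have iA := integrableB measurableT i12 i34.
have E : (fun w => increment h phi l w * increment h psi m w) = fun w =>
  (W phi (l.+1%:R * h) w * W psi (m.+1%:R * h) w - W phi (l.+1%:R * h) w * W psi (m%:R * h) w) -
  (W phi (l%:R * h) w * W psi (m.+1%:R * h) w - W phi (l%:R * h) w * W psi (m%:R * h) w).
  by apply: funext => w; rewrite /increment -!mulrBr -mulrBl.
rewrite E; split; first exact: iA.
rewrite /Ex (RintegralB measurableT i12 i34) (RintegralB measurableT i1 i2) (RintegralB measurableT i3 i4).
rewrite -/(Ex P _) e1 -/(Ex P _) e2 -/(Ex P _) e3 -/(Ex P _) e4.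
move: (h * _) => z; rewrite -!mulrBl.
case: ltngtP => [lm|ml|<-].
- have [E1 E2 E3] := minn_shift lm.
  rewrite E1 E2 E3; ring.
- have [E1 E3 E2] := minn_shift ml; rewrite minnC in E1; rewrite minnC in E2; rewrite minnC in E3.
  rewrite E1 E2 E3; ring.
- rewrite !minnn (minn_idPr (leqnSn l)) (minn_idPl (leqnSn l)) -natr1; ring.
Qed.

(** The combination is centered Gaussian, and its variance is computed from the covariances of the
    increments: only equal time intervals contribute, each with a Dirichlet form. *)
Lemma cgm_cos (n k : nat) (h b : R) (phi : 'I_k -> R -> R) (a : 'I_n * 'I_k -> R) : 0 <= h ->
  (forall i, smooth_torus (phi i)) ->
  Ex P (fun w => cos (\sum_v a v * increment h (phi v.2) v.1 w + b)) =
  expR (- (2^-1 * h * \sum_(l < n) sg ^+ 2 *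
    Df (fun x => \sum_i a (l, i) * phi i x) (fun x => \sum_i a (l, i) * phi i x))) * cos b.
Proof.
move=> h0 sphi; pose U (v : 'I_n * 'I_k) := increment h (phi v.2) v.1.
have gY : centered_gaussian P (fun w => \sum_v a v * U v w).
  (* The boolean selects the end (true) or the start (false) of the time interval, with opposite
     signs of the coefficient. *)
  pose t (x : 'I_n * 'I_k * bool) : R := (x.1.1 + x.2)%N%:R * h.
  have := @cgm_gaussian _ (fun x : 'I_n * 'I_k * bool => phi x.1.2) t
    (fun x => if x.2 then a x.1 else - a x.1) (fun x => sphi _) (fun x => mulr_ge0 (ler0n _ _) h0).
  rewrite (_ : (fun w => \sum_j _) = fun w => \sum_v a v * U v w)//.
  apply: funext => w; rewrite -(pair_bigA _ (fun v s => (if s then a v else - a v) * W (phi v.2) (t (v, s)) w))/=.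
  apply: eq_bigr => v _; rewrite big_bool/= /U /increment /t/= addn1 addn0; ring.
have [_ ->] := centered_gaussian_cos b gY.
congr (expR (- _) * _).
have iU v v' : int (fun w => a v * a v' * (U v w * U v' w)).
  by apply: int_scale; exact: (cgm_increment_cov v.1 v'.1 h0 (sphi v.2) (sphi v'.2)).1.
have -> : (fun w => (\sum_v a v * U v w) ^+ 2) = fun w => \sum_v \sum_v' a v * a v' * (U v w * U v' w).
  apply: funext => w; rewrite expr2 mulr_suml; apply: eq_bigr => v _.
  by rewrite mulr_sumr; apply: eq_bigr => v' _; rewrite mulrACA.
have [_ ->] := int_sum (index_enum _) (fun v => (int_sum (index_enum _) (iU v)).1).
pose c v v' := h * (sg ^+ 2 * Df (phi v.2) (phi v'.2)).
have EU v v' : Ex P (fun w => a v * a v' * (U v w * U v' w)) =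
    if v.1 == v'.1 then a v * a v' * (h * (sg ^+ 2 * Df (phi v.2) (phi v'.2))) else 0.
  have [i1 e1] := cgm_increment_cov v.1 v'.1 h0 (sphi v.2) (sphi v'.2).
  rewrite /Ex (@RintegralZl _ _ _ P setT _ (a v * a v') measurableT i1) -/(Ex P _) e1.
  by rewrite -[v.1 == v'.1]val_eqE/=; case: ifP => _; rewrite ?mulr0.
transitivity (\sum_(l < n) \sum_i \sum_j a (l, i) * a (l, j) * (h * (sg ^+ 2 * Df (phi i) (phi j))) / 2).
  rewrite [RHS](pair_bigA _ (fun l i => \sum_j a (l, i) * a (l, j) * (h * (sg ^+ 2 * Df (phi i) (phi j))) / 2))/=.
  rewrite mulr_suml; apply: eq_bigr => -[l i] _ /=; rewrite -mulr_suml; congr (_ / 2).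
  have [_ ->] := int_sum (index_enum _) (iU (l, i)).
  rewrite [LHS](eq_bigr _ (fun v' _ => EU (l, i) v')) /=.
  transitivity (\sum_m \sum_j if l == m then a (l, i) * a (m, j) * (h * (sg ^+ 2 * Df (phi i) (phi j))) else 0).
    by rewrite pair_bigA; apply: eq_bigr => -[].
  rewrite (bigD1 l)//= eqxx [X in _ + X]big1 ?addr0// => m ml.
  by rewrite eq_sym (negbTE ml) big1.
rewrite mulr_sumr; apply: eq_bigr => l _; rewrite dirichlet_sum// !mulr_sumr.
apply: eq_bigr => i _; rewrite !mulr_sumr; apply: eq_bigr => j _; ring.
Qed.

Lemma cgm_increment_L2 (h : R) (phi : R -> R) (l : nat) : 0 <= h -> smooth_torus phi ->
  [/\ measurable_fun setT (increment h phi l), int (fun w => increment h phi l w ^+ 2) &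
      Ex P (fun w => increment h phi l w ^+ 2) = h * (sg ^+ 2 * Df phi phi)].
Proof.
move=> h0 sphi; have [i1 e1] := cgm_increment_cov l l h0 sphi sphi; rewrite eqxx in e1.
have E : (fun w => increment h phi l w ^+ 2) = fun w => increment h phi l w * increment h phi l w.
  by apply: funext => w; rewrite expr2.
rewrite E; split=> //; apply: measurable_funB.
  by have [] := cgm_L2 sphi (t := l.+1%:R * h); rewrite ?mulr_ge0.
by have [] := cgm_L2 sphi (t := l%:R * h); rewrite ?mulr_ge0.
Qed.

End WhiteNoiseSide.

(** * Expectations of trigonometric and Lipschitz functions *)

Section TrigExpectation.
Context (R : realType) d (Om : measurableType d) (P : probability Om R) (I : finType).
Variable V : Om -> I -> R.
Hypothesis mV : forall i, measurable_fun setT (V ^~ i).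
Local Notation int f := (P.-integrable setT (EFin \o f)).

Lemma cos_comp_meas (a : I -> R) (b : R) : measurable_fun setT (fun w => cos (\sum_i a i * V w i + b)).
Proof.
apply: measurableT_comp; first exact: continuous_measurable_fun (@continuous_cos R).
apply: measurable_funD (measurable_cst b); apply: measurable_sum => i.
by apply: measurable_funM (mV i); exact: measurable_cst.
Qed.

Lemma cos_comp_int (a : I -> R) (b : R) : int (fun w => cos (\sum_i a i * V w i + b)).
Proof.
apply: (int_dom (g := cst 1)); [exact: cos_comp_meas|exact: finite_measure_integrable_cst|].
by move=> w; exact: cos_max.
Qed.

Lemma trig_comp_int T : trig T -> int (fun w => T (V w)).
Proof.
move=> [l Tl].
rewrite (_ : (fun w => T (V w)) = fun w => \sum_(x <- l) x.1.1 * cos (\sum_i x.1.2 i * V w i + x.2)); last first.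
  by apply: funext => w; rewrite Tl.
by apply: (int_sum l _).1 => x; apply: int_scale; exact: cos_comp_int.
Qed.

Variables (f : (I -> R) -> R) (Lip b : R).
Hypothesis Lip0 : 0 <= Lip.
Hypothesis fLip : forall u v, `|f u - f v| <= Lip * \sum_i `|u i - v i|.
Hypothesis fb : forall u, `|f u| <= b.

(** Measurability is also a consequence of the approximation: the composition is a pointwise limit
    of trigonometric polynomials in measurable variables. *)
Lemma lip_comp_meas : measurable_fun setT (fun w => f (V w)).
Proof.
have H (n : nat) : exists T, trig T /\ forall v, `|T v - f v| <= n.+1%:R^-1 * \sum_i (1 + v i ^+ 2).
  by have [|T] := @trig_approx R I f Lip n.+1%:R^-1 fLip Lip0; [rewrite invr_gt0|exists T].
have [T TP] := choice H.
apply: (@measurable_fun_cvg _ _ _ _ (fun n w => T n (V w))).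
  by move=> n; apply: int_meas; apply: trig_comp_int; exact: (TP n).1.
move=> w _; set S := \sum_i (1 + V w i ^+ 2).
have L0 : (fun n : nat => S * (n.+1%:R)^-1) @ \oo --> (0 : R).
  by rewrite -(mulr0 S); apply: cvgMr; exact: cvg_harmonic.
apply/cvgrPdist_le => e e0; move/cvgrPdist_le : L0 => /(_ _ e0); apply: filterS => n.
have S0 : 0 <= S by apply: sumr_ge0 => i _; rewrite addr_ge0// sqr_ge0.
rewrite sub0r normrN ger0_norm ?mulr_ge0// => H1; apply: le_trans H1.
by rewrite distrC mulrC; exact: (TP n).2.
Qed.

Lemma lip_comp_int : int (fun w => f (V w)).
Proof.
apply: (int_dom (g := cst b)); [exact: lip_comp_meas|exact: finite_measure_integrable_cst|].
by move=> w; exact: fb.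
Qed.

(** The quadratic growth of the approximation error is integrated by means of the second moments. *)
Lemma trig_error T (e : R) (C : I -> R) : trig T -> 0 <= e ->
  (forall v, `|T v - f v| <= e * \sum_i (1 + v i ^+ 2)) ->
  (forall i, int (fun w => V w i ^+ 2)) -> (forall i, Ex P (fun w => V w i ^+ 2) <= C i) ->
  `|Ex P (fun w => T (V w)) - Ex P (fun w => f (V w))| <= e * \sum_i (1 + C i).
Proof.
move=> tT e0 Tf iV VC; have i1 := trig_comp_int tT; have i2 := lip_comp_int.
have iB := integrableB measurableT i1 i2.
have i11 : int (cst 1) by exact: finite_measure_integrable_cst.
have iS i : int (fun w => 1 + V w i ^+ 2) := integrableD measurableT i11 (iV i).
have [j1 j2] := int_sum (index_enum I) iS.
have jj := int_scale e j1.
have ES : Ex P (fun w => e * \sum_i (1 + V w i ^+ 2)) <= e * \sum_i (1 + C i).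
  rewrite /Ex (@RintegralZl _ _ _ P setT _ e measurableT j1) -/(Ex P _) j2.
  rewrite ler_wpM2l//; apply: ler_sum => i _.
  by rewrite /Ex (RintegralD measurableT i11 (iV i)) -/(Ex P (cst 1)) Ex_cst lerD2l; exact: VC.
rewrite -[Ex P _ - _](RintegralB measurableT i1 i2); apply: le_trans ES.
apply: (le_trans (le_normr_Rintegral measurableT iB)).
apply: (le_Rintegral measurableT (integrable_norm iB) jj) => w _; exact: Tf.
Qed.

End TrigExpectation.

(** * Convergence of Lipschitz functions of the increments *)

Section LipschitzLimit.
Context (R : realType) (G : set R) (N : R -> nat) (K gK : R -> R)
  (alpha delta beta : R -> R) (sigmastar : R) (M : nat -> int).
Context (d : R -> measure_display) (Om : forall g : R, measurableType (d g))
    (P : forall g : R, probability (Om g) R)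
    (sigma : forall g : R, R -> Om g -> config (N g))
    (init : forall g : R, config (N g) -> R).
Hypothesis KM : kac_model G K gK alpha delta beta M P sigma init.
Variables (Cm CM : R).
Hypothesis Cm0 : 0 <= Cm.
Hypothesis CM0 : 0 <= CM.
Context (d' : measure_display) (Om' : measurableType d') (P' : probability Om' R)
  (W : (R -> R) -> R -> Om' -> R).
Hypothesis hW : conservative_gaussian_martingale P' sigmastar W.
Variables (n k : nat) (h : R) (phi : 'I_k -> R -> R).
Hypothesis h0 : 0 <= h.
Hypothesis sphi : forall i, smooth_torus (phi i).
Local Notation good := (good G N K alpha delta beta sigmastar M).
Local Notation r g := (fun (c : config (N g)) (i : site (N g)) => (alpha g)^-1 * rate K g (beta g) c i).
Local Notation X g := (fun t => @sigma g (t / alpha g)).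
Local Notation obs g phi := (field_observable K g (delta g) phi).
Local Notation dM g phi := (dmart (@exchange (N g)) (r g) (X g) (obs g phi)).
Local Notation V := ('I_n * 'I_k)%type.

Definition micro_incr g (w : Om g) (v : V) : R := dM g (phi v.2) (v.1%:R * h) (v.1.+1%:R * h) w.
Definition macro_incr (w : Om') (v : V) : R := increment W h (phi v.2) v.1 w.

Let node (l : nat) : 0 <= l%:R * h <= l.+1%:R * h.
Proof. by rewrite mulr_ge0//= ler_wpM2r// ler_nat. Qed.

Lemma micro_incr_bd g v : G g -> bdmeas setT (fun w : Om g => micro_incr w v).
Proof.
move=> Gg; have JP := model_jump_process KM Gg; have /andP[a b] := node v.1.
by apply: (dmart_bd JP) => //; apply: le_trans b.
Qed.

Lemma char_limit (a : V -> R) (b e : R) : 0 < e -> exists2 c : R, 0 < c & forall g, good c Cm CM g ->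
  `|Ex (P g) (fun w => cos (\sum_v a v * micro_incr w v + b)) -
    Ex P' (fun w => cos (\sum_v a v * macro_incr w v + b))| <= e.
Proof.
move=> e0; have [psi [spsi psiE]] : exists psi : nat -> R -> R, (forall l, smooth_torus (psi l)) /\
    forall l : 'I_n, psi l = fun x => \sum_i a (l, i) * phi i x.
  exists (fun l x => \sum_i (if insub l is Some l' then a (l', i) else 0) * phi i x).
  by split=> l; [exact: torus_sum|rewrite valK].
have [c c0 H] := cos_limit sigmastar KM Cm0 CM0 b n h0 spsi e0.
exists c => // g gd.
have E1 : (fun w => cos (\sum_v a v * micro_incr w v + b)) =
    fun w => cos (b + \sum_(l < n) dM g (psi l) (l%:R * h) (l.+1%:R * h) w).
  apply: funext => w; rewrite [b + _]addrC; congr (cos (_ + b)).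
  transitivity (\sum_(l < n) \sum_i a (l, i) * micro_incr w (l, i)).
    by rewrite pair_bigA; apply: eq_bigr => -[].
  by apply: eq_bigr => l _; rewrite psiE (dM_sum KM _ _ _ (good_G gd) (node l)).
have ES : \sum_(l < n) sigmastar ^+ 2 * dirichlet_form (psi l) (psi l) = \sum_(l < n) sigmastar ^+ 2 *
    dirichlet_form (fun x => \sum_i a (l, i) * phi i x) (fun x => \sum_i a (l, i) * phi i x).
  by apply: eq_bigr => l _; rewrite psiE.
have E2 : Ex P' (fun w => cos (\sum_v a v * macro_incr w v + b)) =
    expR (- (2^-1 * h * \sum_(l < n) sigmastar ^+ 2 * dirichlet_form (psi l) (psi l))) * cos b.
  rewrite ES; exact: (cgm_cos hW b a h0 sphi).
rewrite E2 E1; exact: H.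
Qed.

Lemma trig_limit (T : (V -> R) -> R) (e : R) : trig T -> 0 < e -> exists2 c : R, 0 < c &
  forall g, good c Cm CM g ->
  `|Ex (P g) (fun w => T (micro_incr w)) - Ex P' (fun w => T (macro_incr w))| <= e.
Proof.
move=> [l Tl].
have mW v : measurable_fun setT (macro_incr ^~ v) by have [] := cgm_increment_L2 hW v.1 h0 (sphi v.2).
have mM g v : G g -> measurable_fun setT (fun w : Om g => micro_incr w v).
  by move=> Gg; have [] := micro_incr_bd v Gg.
have -> : T = fun v => \sum_(x <- l) x.1.1 * cos (\sum_i x.1.2 i * v i + x.2) by apply: funext.
elim: l e {Tl} => [|x l IH] e e0.
  exists 1 => // g _; have z d0 (O : measurableType d0) (Q : probability O R) (U : O -> V -> R) :
      Ex Q (fun w => \sum_(x <- [::]) x.1.1 * cos (\sum_i x.1.2 i * U w i + x.2)) = 0.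
      by rewrite -[RHS](Ex_cst Q 0); apply: eq_Rintegral => w _; rewrite big_nil.
  by rewrite (z _ _ (P g) (@micro_incr g)) (z _ _ P' macro_incr) subrr normr0 ltW.
have x0 : 0 < `|x.1.1| + 1 by rewrite ltr_wpDl.
have e2 : 0 < e / 2 by rewrite divr_gt0.
have ex : 0 < e / 2 / (`|x.1.1| + 1) by rewrite divr_gt0.
have [c1 c10 H1] := IH _ e2.
have [c2 c20 H2] := char_limit x.1.2 x.2 ex.
exists (Num.min c1 c2); first by rewrite lt_min c10.
move=> g gd; have Gg := good_G gd.
have gd1 : good c1 Cm CM g by apply: good_le gd; rewrite ge_min lexx.
have gd2 : good c2 Cm CM g by apply: good_le gd; rewrite ge_min lexx orbT.
have split_ d0 (O : measurableType d0) (Q : probability O R) (U : O -> V -> R) :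
    (forall v, measurable_fun setT (U ^~ v)) ->
    Ex Q (fun w => \sum_(x <- x :: l) x.1.1 * cos (\sum_i x.1.2 i * U w i + x.2)) =
    x.1.1 * Ex Q (fun w => cos (\sum_i x.1.2 i * U w i + x.2)) +
    Ex Q (fun w => \sum_(x <- l) x.1.1 * cos (\sum_i x.1.2 i * U w i + x.2)).
  move=> mU; have ix y := int_scale y.1.1 (cos_comp_int Q mU y.1.2 y.2).
  rewrite (int_sum (x :: l) ix).2 (int_sum l ix).2 big_cons; congr (_ + _).
  by rewrite /Ex (@RintegralZl _ _ _ Q setT _ x.1.1 measurableT (cos_comp_int Q mU x.1.2 x.2)).
rewrite (split_ _ _ (P g) (@micro_incr g) (fun v => mM g v Gg)) (split_ _ _ P' macro_incr mW).
have := H1 g gd1; have := H2 g gd2; rewrite ler_pdivlMr//.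
set u1 := Ex (P g) _; set u2 := Ex P' _; set u3 := Ex (P g) _; set u4 := Ex P' _.
have -> : x.1.1 * u1 + u3 - (x.1.1 * u2 + u4) = x.1.1 * (u1 - u2) + (u3 - u4) by ring.
move=> h1 h2; apply: le_trans (ler_normD _ _) _; rewrite normrM.
have : `|x.1.1| * `|u1 - u2| <= e / 2.
  by apply: le_trans h1; rewrite mulrC ler_wpM2l// lerDl.
by move: h2; move: (`|x.1.1| * _) (`|_|) => a' b'; lra.
Qed.

(** The bounds C on second moments hold for the limit and for all good g at once, so one
    trigonometric polynomial serves for both sides. *)
Lemma lipschitz_limit (f : (V -> R) -> R) (Lip b e : R) : 0 <= Lip ->
  (forall u v, `|f u - f v| <= Lip * \sum_i `|u i - v i|) -> (forall u, `|f u| <= b) -> 0 < e ->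
  exists2 c : R, 0 < c & forall g, good c Cm CM g ->
  `|Ex (P g) (fun w => f (micro_incr w)) - Ex P' (fun w => f (macro_incr w))| <= e.
Proof.
move=> Lip0 fLip fb e0.
have mW v : measurable_fun setT (macro_incr ^~ v) by have [] := cgm_increment_L2 hW v.1 h0 (sphi v.2).
have [C CP] : exists C : V -> R, forall v, [/\ 0 <= C v,
    Ex P' (fun w => macro_incr w v ^+ 2) <= C v & forall c g, good c Cm CM g -> c <= 1 ->
    Ex (P g) (fun w => micro_incr w v ^+ 2) <= C v].
  suff H v : exists C : R, [/\ 0 <= C, Ex P' (fun w => macro_incr w v ^+ 2) <= C & forall c g, good c Cm CM g -> c <= 1 ->
      Ex (P g) (fun w => micro_incr w v ^+ 2) <= C] by have [C CP] := choice H; exists C.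
  have [C1 C10 H1] := second_moment_limit sigmastar KM Cm CM (sphi v.2).
  have E0 : 0 <= Ex P' (fun w => macro_incr w v ^+ 2) by apply: Ex_ge0 => w; exact: sqr_ge0.
  exists (C1 * h + Ex P' (fun w => macro_incr w v ^+ 2)); split=> [||c g gd c1].
  - by rewrite addr_ge0// mulr_ge0.
  - by rewrite lerDr mulr_ge0.
  - have := H1 c g _ _ gd c1 (node v.1).
    have -> : v.1.+1%:R * h - v.1%:R * h = h by rewrite -mulrBl -natr1 addrAC subrr add0r mul1r.
    by move=> H2; apply: le_trans H2 _; rewrite lerDl.
pose S := \sum_v (1 + C v).
have S0 : 0 <= S by apply: sumr_ge0 => v _; have [c _ _] := CP v; rewrite addr_ge0.
have S1 : 0 < 3 * (S + 1) by rewrite mulr_gt0// ltr_wpDl.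
pose e1 := e / (3 * (S + 1)).
have e10 : 0 < e1 by rewrite divr_gt0.
have e1S : e1 * S <= e / 3.
  have : e1 * (3 * (S + 1)) = e by rewrite divfK// gt_eqF.
  by move: (ltW e10); rewrite mulrDr mulr1; nra.
have [T tT TP] := trig_approx fLip Lip0 e10.
have e3 : 0 < e / 3 by rewrite divr_gt0.
have [c c0 H] := trig_limit tT e3.
exists (Num.min c 1); first by rewrite lt_min c0/=.
move=> g gd; have Gg := good_G gd.
have gd1 : good c Cm CM g by apply: good_le gd; rewrite ge_min lexx.
have c1 : Num.min c 1 <= 1 by rewrite ge_min lexx orbT.
have mM v : measurable_fun setT (fun w : Om g => micro_incr w v) by have [] := micro_incr_bd v Gg.
have h1 : `|Ex (P g) (fun w => T (micro_incr w)) - Ex (P g) (fun w => f (micro_incr w))| <= e / 3.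
  apply: le_trans e1S.
  rewrite /S; apply: (trig_error (P := P g) mM Lip0 fLip fb (C := C) tT (ltW e10) TP) => v.
    by apply: (bdmeas_integrable _ (P_fin (P g))) => //; apply: bdmeasX; exact: micro_incr_bd.
  by have [_ _ /(_ _ g gd c1)] := CP v.
have h2 : `|Ex P' (fun w => T (macro_incr w)) - Ex P' (fun w => f (macro_incr w))| <= e / 3.
  apply: le_trans e1S.
  rewrite /S; apply: (trig_error (P := P') mW Lip0 fLip fb (C := C) tT (ltW e10) TP) => v.
    by have [] := cgm_increment_L2 hW v.1 h0 (sphi v.2).
  by have [] := CP v.
have := H g gd1; move: h1 h2.
set u1 := Ex _ _; set u2 := Ex _ _; set u3 := Ex _ _; set u4 := Ex _ _.
rewrite !ler_norml => /andP[a1 a2] /andP[b1 b2] /andP[d1 d2].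
by apply/andP; split; lra.
Qed.

End LipschitzLimit.

(** * Path functionals *)

Section PathDistance.
Context (R : realType) (k : nat) (T : R).
Hypothesis T0 : 0 < T.
Local Notation path := (R -> 'I_k -> R).
Implicit Types (x y z : path).

(** Truncation at 1 and the element 0 make this a supremum of a nonempty bounded set, for arbitrary
    paths and even for k = 0. *)
Definition udist y z : R :=
  sup [set s | s = 0 \/ exists t i, 0 <= t <= T /\ s = Num.min 1 `|y t i - z t i|].

Let ub1 y z : ubound [set s | s = 0 \/ exists t i, 0 <= t <= T /\ s = Num.min 1 `|y t i - z t i|] 1.
Proof. by move=> s [->//|[t [i [_ ->]]]]; rewrite ge_min lexx. Qed.

Lemma udist_le y z (s : R) : 0 <= s ->
  (forall t i, 0 <= t <= T -> Num.min 1 `|y t i - z t i| <= s) -> udist y z <= s.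
Proof.
move=> s0 H; apply: ge_sup; first by exists 0; left.
by move=> _ [->//|[t [i [tT ->]]]]; exact: H.
Qed.

Lemma udist_ge y z t i : 0 <= t <= T -> Num.min 1 `|y t i - z t i| <= udist y z.
Proof.
by move=> tT; apply: ub_le_sup; [exists 1; exact: ub1|right; exists t, i].
Qed.

Lemma udist_ge0 y z : 0 <= udist y z.
Proof. by apply: ub_le_sup; [exists 1; exact: ub1|left]. Qed.

Lemma udist_le1 y z : udist y z <= 1.
Proof. by apply: udist_le => // t i _; rewrite ge_min lexx. Qed.

Lemma udistC y z : udist y z = udist z y.
Proof.
by apply/eqP; rewrite eq_le !udist_le ?udist_ge0// => t i tT; rewrite distrC; exact: udist_ge.
Qed.

Lemma udist_triangle x y z : udist x z <= udist x y + udist y z.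
Proof.
apply: udist_le => [|t i tT]; first by rewrite addr_ge0 ?udist_ge0.
apply: le_trans (lerD (udist_ge x y i tT) (udist_ge y z i tT)).
have : `|x t i - z t i| <= `|x t i - y t i| + `|y t i - z t i|.
  by apply: le_trans (ler_normD _ _); rewrite addrA subrK.
move: (normr_ge0 (x t i - y t i)) (normr_ge0 (y t i - z t i)).
move: (`|x t i - z t i|) (`|x t i - y t i|) (`|y t i - z t i|) => a b c b0 c0 abc.
have m1 : Num.min 1 a <= 1 by rewrite ge_min lexx.
have m2 : Num.min 1 a <= a by rewrite ge_min lexx orbT.
by have [b1|b1] := leP 1 b; have [c1|c1] := leP 1 c; move: m1 m2; move: (Num.min 1 a) => q; lra.
Qed.

Lemma udist_sup y z (s : R) : 0 <= s ->
  (forall t i, 0 <= t <= T -> `|y t i - z t i| <= s) -> udist y z <= s.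
Proof. by move=> s0 H; apply: udist_le => // t i tT; rewrite ge_min H// orbT. Qed.

Lemma udistxx x : udist x x = 0.
Proof.
apply/eqP; rewrite eq_le udist_ge0 andbT; apply: udist_sup => // t i _.
by rewrite subrr normr0.
Qed.

Lemma udist_close y z (e : R) : 0 < e <= 1 -> udist y z < e -> skorokhod_close T e y z.
Proof.
move=> /andP[e0 e1] ye; exists id; split=> //.
  by apply: continuous_subspaceT => t; exact: cvg_id.
move=> t tT; rewrite subrr normr0; split=> // i.
have := le_lt_trans (udist_ge y z i tT) ye.
by rewrite gt_min ltNge e1.
Qed.

Section Envelope.
Variables (Phi : path -> R) (b : R).
Hypothesis Phib : forall x, `|Phi x| <= b.

(** The inf-convolution of [Phi] with L times the distance: the largest L-Lipschitz minorant on
    Skorokhod paths. Only such paths y compete, because [Phi] is continuous there only. *)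
Definition envelope (L : R) z : R := inf [set s | exists2 y, in_skorokhod T y & s = Phi y + L * udist y z].

Lemma zero_skorokhod : in_skorokhod T ((fun _ _ => 0) : path).
Proof.
move=> i; split=> t _; first exact: cvg_cst.
by apply/cvg_ex; exists 0; exact: cvg_cst.
Qed.

Variable L : R.
Hypothesis L0 : 0 <= L.

Let lbb z : lbound [set s | exists2 y, in_skorokhod T y & s = Phi y + L * udist y z] (- b).
Proof.
move=> _ [y _ ->]; have := Phib y; rewrite ler_norml => /andP[h _].
by rewrite -[leLHS]addr0 lerD// mulr_ge0// udist_ge0.
Qed.

Lemma envelope_le y z : in_skorokhod T y -> envelope L z <= Phi y + L * udist y z.
Proof. by move=> Dy; apply: ge_inf; [exists (- b); exact: lbb|exists y]. Qed.

Lemma envelope_ge z (s : R) : (forall y, in_skorokhod T y -> s <= Phi y + L * udist y z) ->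
  s <= envelope L z.
Proof.
move=> H; apply: lb_le_inf; last by move=> _ [y Dy ->]; exact: H.
exists (Phi (fun _ _ => 0) + L * udist (fun _ _ => 0) z), (fun _ _ => 0) => //.
exact: zero_skorokhod.
Qed.

Lemma envelope_lb z : - b <= envelope L z.
Proof.
apply: envelope_ge => y _; have := Phib y; rewrite ler_norml => /andP[h _].
by rewrite -[leLHS]addr0 lerD// mulr_ge0// udist_ge0.
Qed.

Lemma envelope_norm z : `|envelope L z| <= b + L.
Proof.
rewrite ler_norml; apply/andP; split.
  by rewrite opprD; apply: le_trans (envelope_lb z); rewrite gerDl oppr_le0.
apply: le_trans (envelope_le z zero_skorokhod) _; apply: lerD.
  by apply: le_trans (ler_norm _) (Phib _).
by rewrite ler_piMr// udist_le1.
Qed.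

Lemma envelope_lip z z' : `|envelope L z - envelope L z'| <= L * udist z z'.
Proof.
have H u v : envelope L u - L * udist u v <= envelope L v.
  apply: envelope_ge => y Dy; rewrite lerBlDr; apply: le_trans (envelope_le u Dy) _.
  by rewrite -addrA lerD2l -mulrDr ler_wpM2l// [udist u v]udistC; exact: udist_triangle.
have h1 := H z z'; have h2 := H z' z; rewrite udistC in h2.
by rewrite ler_norml; apply/andP; split; lra.
Qed.

Lemma envelope_le_self x : in_skorokhod T x -> envelope L x <= Phi x.
Proof. by move=> Dx; have := envelope_le x Dx; rewrite udistxx mulr0 addr0. Qed.

End Envelope.

(** A competitor at distance at least eta pays m eta >= 2 b, more than [Phi] can gain; a closer one
    is Skorokhod-close through the identity time change, and continuity applies. *)
Lemma envelope_cvg (Phi : path -> R) b x : (forall x, `|Phi x| <= b) -> skorokhod_continuous T Phi ->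
  in_skorokhod T x -> (fun m : nat => envelope Phi m%:R x) @ \oo --> Phi x.
Proof.
move=> Phib cPhi Dx; apply/cvgrPdist_le => e e0.
have [eta0 eta00 H] := cPhi x Dx e e0.
pose eta := Num.min eta0 1; have etap : 0 < eta by rewrite lt_min eta00/=.
have eta1 : eta <= 1 by rewrite ge_min lexx orbT.
have b0 : 0 <= b by apply: le_trans (Phib x).
apply: filterS (nbhs_infty_ge (Num.trunc (2 * b / eta)).+1) => m mb.
have mE : 2 * b <= m%:R * eta.
  rewrite -ler_pdivrMr//; apply: le_trans (ltW (truncnS_gt _)) _; by rewrite ler_nat.
have h1 := envelope_le_self Phib (ler0n R m) Dx.
rewrite ger0_norm ?subr_ge0// lerBlDr -lerBlDl.
apply: envelope_ge => y Dy; have [ye|ey] := ltP (udist x y) eta.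
  have C : skorokhod_close T eta0 x y.
    have [|lam [l1 l2 l3 l4 l5]] := @udist_close x y eta _ ye; first by rewrite etap.
    exists lam; split=> // t tT; have [h2 h3] := l5 t tT.
    have le0 : eta <= eta0 by rewrite ge_min lexx.
    by split=> [|i]; [exact: lt_le_trans h2 le0|exact: lt_le_trans (h3 i) le0].
  have := H y Dy C; rewrite ltr_norml => /andP[_ h2].
  have h3 : 0 <= m%:R * udist y x by rewrite mulr_ge0// udist_ge0.
  by rewrite lerBlDr; move: (m%:R * _) h3 => u u0; lra.
have h2 : m%:R * eta <= m%:R * udist y x by rewrite ler_wpM2l// udistC.
have := Phib x; have := Phib y; rewrite !ler_norml => /andP[h3 _] /andP[_ h4].
by move: (m%:R * eta) (m%:R * udist y x) mE h2 => u v; lra.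
Qed.

Section StepPath.
Variables (n : nat) (h : R).
Hypothesis h0 : 0 < h.
Hypothesis Th : T = n%:R * h.
Local Notation V := ('I_n * 'I_k)%type.

Definition step_path (v : V -> R) : path := fun t i => \sum_(l < n | l.+1%:R * h <= t) v (l, i).

Lemma step_path_lip (u v : V -> R) : udist (step_path u) (step_path v) <= \sum_j `|u j - v j|.
Proof.
apply: udist_sup => [|t i _]; first exact: sumr_ge0.
rewrite /step_path -sumrB; apply: le_trans (ler_norm_sum _ _ _) _.
have -> : \sum_j `|u j - v j| = \sum_l \sum_i `|u (l, i) - v (l, i)|.
  by rewrite pair_bigA; apply: eq_bigr => -[].
rewrite big_mkcond; apply: ler_sum => l _; apply: (@le_trans _ _ `|u (l, i) - v (l, i)|).
  by case: ifP.
by rewrite (bigD1 i)//= lerDl sumr_ge0.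
Qed.

(** The increments telescope to the value at the last grid point before t; at the final time T there
    is no further cell, and both paths agree. *)
Lemma step_path_close x (eta : R) : 0 <= eta -> (forall i, x 0 i = 0) ->
  (forall (l : nat) i u, (l < n)%N -> l%:R * h <= u <= l.+1%:R * h -> `|x u i - x (l%:R * h) i| <= eta) ->
  udist x (step_path (fun v => x (v.1.+1%:R * h) v.2 - x (v.1%:R * h) v.2)) <= eta.
Proof.
move=> eta0 x0 H; apply: udist_sup => // t i /andP[t0 tT].
have th0 : 0 <= t / h by rewrite divr_ge0// ltW.
have /andP[m1 m2] := truncn_itv th0; move: m1 m2; set m := Num.trunc _ => m1 m2.
have mh : m%:R * h <= t by rewrite -ler_pdivlMr.
have mh' : t <= m.+1%:R * h by rewrite -ler_pdivrMr// ltW.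
have mn : (m <= n)%N.
  by rewrite -(ler_nat R); apply: le_trans m1 _; rewrite ler_pdivrMr// -Th.
have -> : step_path (fun v => x (v.1.+1%:R * h) v.2 - x (v.1%:R * h) v.2) t i = x (m%:R * h) i.
  rewrite /step_path /=.
  have E (l : nat) : (l.+1%:R * h <= t) = (l < m)%N.
    rewrite -ler_pdivlMr//; apply/idP/idP => [lm|lm].
      by have := le_lt_trans lm m2; rewrite ltr_nat ltnS.
    by apply: le_trans m1; rewrite ler_nat.
  rewrite (eq_bigl (fun l : 'I_n => (l < m)%N)); last by move=> l; exact: E.
  rewrite -(big_ord_widen_cond _ xpredT (fun l => x (l.+1%:R * h) i - x (l%:R * h) i))//.
  rewrite -(big_mkord xpredT (fun l => x (l.+1%:R * h) i - x (l%:R * h) i)).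
  by rewrite (telescope_sumr (fun l => x (l%:R * h) i))// mul0r x0 subr0.
have [mn'|mn'] := ltnP m n; first by apply: H => //; rewrite mh.
have nm : m = n by apply/eqP; rewrite eqn_leq mn.
have -> : t = m%:R * h by apply/eqP; rewrite eq_le mh nm -Th tT.
by rewrite subrr normr0.
Qed.

End StepPath.
End PathDistance.

(** * Uniform continuity on compact time intervals *)

Section UniformContinuity.
Context (R : realType).

Lemma within_uniform (f : R -> R) (T eta : R) : {within `[0, +oo[, continuous f} -> 0 < eta ->
  exists2 de, 0 < de & forall s u, 0 <= s <= T -> 0 <= u -> `|u - s| < de -> `|f u - f s| <= eta.
Proof.
move=> /subspace_continuousP cf eta0.
have loc (x : R) : 0 <= x -> exists2 rr, 0 < rr & forall u, 0 <= u -> `|u - x| < rr -> `|f u - f x| <= eta / 2.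
  move=> x0; have e2 : 0 < eta / 2 by rewrite divr_gt0.
  have /(_ _) := cf x; rewrite /= in_itv/= x0 => /(_ isT)/cvgrPdist_le/(_ _ e2).
  move=> /nbhs_ballP[rr /= r0 Hr]; exists rr => // u u0 ur; rewrite distrC; apply: Hr.
    by rewrite /ball/= distrC.
  by rewrite /= in_itv/= u0.
pose Q (de x : R) := 0 <= x -> forall u, 0 <= u -> `|u - x| < de -> `|f u - f x| <= eta.
have cov : \forall de \near (0 : R)^'+, `[0, T] `<=` Q de.
  have := @segment_compact R 0 T; rewrite compact_near_coveringP => /(_ R (0 : R)^'+ Q _); apply => x.
  rewrite /= in_itv/= => /andP[x0 _]; have [rr r0 Hr] := loc x x0.
  have r2 : 0 < rr / 2 by rewrite divr_gt0.
  exists (ball x (rr / 2), [set de | de < rr / 2]) => /=.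
    by split; [exact: nbhsx_ballx|exact: nbhs_right_lt].
  move=> [x' de]/= [xx' dr] x'0 u u0 ud.
  have h1 : `|x' - x| < rr / 2 by rewrite distrC.
  have h2 : `|u - x| < rr.
    rewrite -(subrK x' u) -addrA; apply: le_lt_trans (ler_normD _ _) _.
    by have := lt_trans ud dr; move: h1; move: (`|x' - x|) (`|u - x'|) => p q; lra.
  have h3 : `|x' - x| < rr by apply: lt_trans h1 _; lra.
  have := Hr u u0 h2; have := Hr x' x'0 h3; rewrite (distrC (f x')).
  move=> h4 h5; rewrite -(subrK (f x) (f u)) -addrA; apply: le_trans (ler_normD _ _) _.
  by move: h4 h5; move: (`|f x - _|) (`|f u - _|) => p q; lra.
have [de de0 H] := (at_rightP _ _).1 cov.
exists (de / 2); first by rewrite divr_gt0.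
move=> s u sT u0 us; apply: (H (de / 2)) us => //.
  by rewrite divr_gt0//= add0r ltr_pdivrMr// ltr_pMr// ltr1n.
by case/andP: sT.
Qed.

Lemma within_cadlag (f : R -> R) (T : R) : {within `[0, +oo[, continuous f} -> cadlag T f.
Proof.
move=> cf; have U t e : 0 <= t -> 0 < e -> exists2 de, 0 < de & forall u, 0 <= u -> `|u - t| < de -> `|f u - f t| <= e.
  move=> t0 e0; have [de de0 H] := within_uniform t cf e0; exists de => // u u0 ut.
  by apply: H => //; rewrite t0 lexx.
split=> t /andP[t0 tT].
  apply/cvgrPdist_le => e e0; have [de de0 H] := U t e t0 e0; apply/at_rightP; exists de => // u /andP[tu ut].
  by rewrite distrC; apply: H; [rewrite (le_trans t0)// ltW|rewrite gtr0_norm ?subr_gt0// ltrBlDl].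
apply/cvg_ex; exists (f t); apply/cvgrPdist_le => e e0; have [de de0 H] := U t e (ltW t0) e0.
apply/at_leftP; exists (Num.min t de); first by rewrite lt_min t0.
move=> u /andP[tu ut]; rewrite distrC.
have m1 : Num.min t de <= t by rewrite ge_min lexx.
have m2 : Num.min t de <= de by rewrite ge_min lexx orbT.
by apply: H; [move: (Num.min _ _) tu m1 m2 => m; lra|rewrite ltr0_norm ?subr_lt0//; move: (Num.min _ _) tu m1 m2 => m; lra].
Qed.

End UniformContinuity.

(** * Convergence in law *)

Section BoundedIntegralN.
Context d (T : measurableType d) (R : realType) (P : probability T R).

Lemma integral_cst_prob (b : R) : (\int[P]_w b%:E = b%:E)%E.
Proof.
have i : P.-integrable setT (EFin \o cst b) by exact: finite_measure_integrable_cst.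
by rewrite -(fineK (integrable_fin_num measurableT i)); congr EFin; exact: Ex_cst.
Qed.

Lemma bounded_integral (f : T -> R) (b : R) : (forall w, `|f w| <= b) ->
  ((- b)%:E <= \int[P]_w (f w)%:E <= b%:E)%E.
Proof.
move=> fb; apply/andP; split.
  rewrite -(integral_cst_prob (- b)); apply: le_integralT => w.
  by rewrite lee_fin; have := fb w; rewrite ler_norml => /andP[].
rewrite -(integral_cst_prob b); apply: le_integralT => w.
by rewrite lee_fin; have := fb w; rewrite ler_norml => /andP[].
Qed.

(** The integrals of the positive and negative parts are finite and change roles; no measurability
    of f is assumed, since [Phi] of a path may lack it. *)
Lemma bounded_integralN (f : T -> R) (b : R) : (forall w, `|f w| <= b) ->
  (\int[P]_w (- f w)%:E = - \int[P]_w (f w)%:E)%E.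
Proof.
move=> fb.
have fin (g : T -> \bar R) : (forall w, 0 <= g w)%E -> (forall w, g w <= b%:E)%E -> (\int[P]_w g w)%E \is a fin_num.
  move=> g0 gb; rewrite ge0_fin_numE ?integral_ge0//.
  apply: le_lt_trans (ltry b); rewrite -(integral_cst_prob b); exact: le_integralT.
have b0 : 0 <= b by apply: le_trans (fb point).
have fp : (\int[P]_w (EFin \o f)^\+ w)%E \is a fin_num.
  apply: fin => w; first exact: funepos_ge0.
  rewrite funeposE ge_max lee_fin (le_trans (ler_norm _) (fb w))/=; by rewrite lee_fin.
have fn : (\int[P]_w (EFin \o f)^\- w)%E \is a fin_num.
  apply: fin => w; first exact: funeneg_ge0.
  by rewrite funenegE ge_max/= lee_fin (le_trans (ler_norm _))/= ?normrN// lee_fin.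
rewrite [LHS]integralE [in RHS]integralE.
have -> : (fun w => (- f w)%:E) = (\- (EFin \o f))%E by apply: funext => w; rewrite /= EFinN.
rewrite funeposN funenegN -(fineK fp) -(fineK fn) -!EFinB -EFinN; congr EFin; ring.
Qed.

End BoundedIntegralN.

Lemma fourth_bound_le (R : realType) (B Gm c h T : R) : 0 <= B -> 0 <= Gm -> 0 <= c <= 1 -> 0 <= h <= T ->
  fourth_bound (4 * B * c) Gm h <=
  h * (6 * Gm ^+ 2 * h + (128 * B * Gm * (1 + Gm * T) + 256 * B ^+ 2 * Gm) * c).
Proof.
move=> B0 G0 /andP[c0 c1] /andP[h0 hT]; rewrite /fourth_bound ler_wpM2l// -addrA lerD2l [leRHS]mulrDl.
apply: lerD.
  have -> : 32 * (4 * B * c) * Gm * (1 + Gm * h) = 128 * B * Gm * c * (1 + Gm * h) by ring.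
  have -> : 128 * B * Gm * (1 + Gm * T) * c = 128 * B * Gm * c * (1 + Gm * T) by ring.
  by rewrite ler_wpM2l ?mulr_ge0// lerD2l ler_wpM2l.
have -> : 16 * (4 * B * c) ^+ 2 * Gm = 256 * B ^+ 2 * Gm * c * c by ring.
rewrite ler_piMr//; exact: mulr_ge0 (mulr_ge0 (mulr_ge0 (ler0n R 256) (sqr_ge0 B)) G0) c0.
Qed.

Section WeakLimit.
Context (R : realType) (G : set R) (N : R -> nat) (K gK : R -> R)
  (alpha delta beta : R -> R) (sigmastar : R) (M : nat -> int).
Context (d : R -> measure_display) (Om : forall g : R, measurableType (d g))
    (P : forall g : R, probability (Om g) R)
    (sigma : forall g : R, R -> Om g -> config (N g))
    (init : forall g : R, config (N g) -> R).
Hypothesis KM : kac_model G K gK alpha delta beta M P sigma init.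
Variables (Cm CM : R).
Hypothesis Cm0 : 0 <= Cm.
Hypothesis CM0 : 0 <= CM.
Context (d' : measure_display) (Om' : measurableType d') (P' : probability Om' R)
  (W : (R -> R) -> R -> Om' -> R).
Hypothesis hW : conservative_gaussian_martingale P' sigmastar W.
Variables (k : nat) (phi : 'I_k -> R -> R).
Hypothesis sphi : forall i, smooth_torus (phi i).
Local Notation good := (good G N K alpha delta beta sigmastar M).
Local Notation r g := (fun (c : config (N g)) (i : site (N g)) => (alpha g)^-1 * rate K g (beta g) c i).
Local Notation X g := (fun t => @sigma g (t / alpha g)).
Local Notation obs g phi := (field_observable K g (delta g) phi).
Local Notation Mt g phi := (mart (@exchange (N g)) (r g) (X g) (obs g phi)).
Local Notation Gam g phi psi := (carre (@exchange (N g)) (r g) (obs g phi) (obs g psi)).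
Variable T : R.
Hypothesis T0 : 0 < T.

Definition micro_path g (w : Om g) : R -> 'I_k -> R := fun t i => Mt g (phi i) t w.
Definition macro_path (w : Om') : R -> 'I_k -> R := fun t i => W (phi i) t w.

Lemma micro_skorokhod g w : G g -> in_skorokhod T (@micro_path g w).
Proof.
move=> Gg i; have JP := model_jump_process KM Gg; have [a0 _] := km_pos KM Gg.
have [_ _ path _ _] := km_process KM Gg.
pose f : config (N g) -> R := obs g (phi i).
have [cr cl] : cadlag T (fun t => pint (X g) (jump_gen (@exchange (N g)) (r g) f) 0 t w).
  apply: (@lipschitz_cadlag _ _ (fmax (jump_gen (@exchange (N g)) (r g) f))); first exact: fmax_ge0.
  by move=> s t st; exact: (pint_lip JP).
split=> t tT.
  apply: cvgB (cr t tT); apply: cvgB (cvg_cst _).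
  apply: cvg_near_cst; have /andP[t0 _] := tT.
  by have := jp_right JP w t0; apply: filterS => s ->.
apply: is_cvgB (cl t tT); apply: is_cvgB (is_cvg_cst _).
have /andP[t0 _] := tT; have ta : 0 < t / alpha g by rewrite divr_gt0.
have [c /at_leftP[e e0 He]] := (path w).2 _ ta.
apply/cvg_ex; exists (f c); apply: cvg_near_cst; apply/at_leftP.
exists (e * alpha g) => [|v /andP[v1 v2]]; first exact: mulr_gt0.
rewrite He// ltr_pM2r ?invr_gt0// v2 andbT ltr_pdivlMr// mulrBl divfK ?gt_eqF//.
Qed.

Lemma micro_path0 g w i : G g -> @micro_path g w 0 i = 0.
Proof.
move=> Gg; have JP := model_jump_process KM Gg; rewrite /micro_path /mart !subrr sub0r; apply/eqP.
rewrite oppr_eq0 -normr_le0; apply: le_trans (pint_bound JP _ _ _) _; first by rewrite lexx.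
by rewrite subrr mulr0.
Qed.

Lemma macro_continuous w i : {within `[0, +oo[, continuous (fun t => W (phi i) t w)}.
Proof. by have [H _ _] := hW; have [] := H (phi i) w (sphi i). Qed.

Lemma macro_path0 w i : macro_path w 0 i = 0.
Proof. by have [H _ _] := hW; have [] := H (phi i) w (sphi i). Qed.

Lemma macro_skorokhod w : in_skorokhod T (macro_path w).
Proof. by move=> i; apply: within_cadlag; exact: macro_continuous. Qed.

Section Functional.
Variables (Phi : (R -> 'I_k -> R) -> R) (b : R).
Hypothesis Phib : forall x, `|Phi x| <= b.
Hypothesis cPhi : skorokhod_continuous T Phi.
Local Notation env := (envelope T Phi).
Local Notation h m := (T / m.+1%:R).
Local Notation V m := ('I_m.+1 * 'I_k)%type.

Let h0 m : 0 < h m. Proof. exact: divr_gt0. Qed.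
Let Th m : T = m.+1%:R * h m. Proof. by rewrite mulrC divfK. Qed.

Definition discrete (m : nat) (L : R) (v : V m -> R) : R := env L (step_path (h m) v).

Lemma discrete_lip m L u v : 0 <= L -> `|discrete L u - discrete L v| <= L * \sum_(j : V m) `|u j - v j|.
Proof.
move=> L0; apply: (le_trans (envelope_lip T Phib L0 _ _)).
by rewrite ler_wpM2l//; exact: step_path_lip.
Qed.

Lemma discrete_norm m L (u : V m -> R) : 0 <= L -> `|discrete L u| <= b + L.
Proof. by move=> L0; exact: envelope_norm. Qed.

(** Limit paths are uniformly continuous on [0, T], so step paths converge to them for the uniform
    distance, for which the envelope is Lipschitz. *)
Lemma envelope_macro_limit (L : R) : 0 <= L -> bdmeas setT (fun w => env L (macro_path w)) /\
  (fun m => Ex P' (fun w => discrete L (macro_incr W (n := m.+1) (h m) phi w))) @ \oo -->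
  Ex P' (fun w => env L (macro_path w)).
Proof.
move=> L0; apply: (Ex_cvg P' (b := b + L)) => [m|m w|w]; last first.
- apply/cvgrPdist_le => e e0; have L1 : 0 < L + 1 by rewrite ltr_wpDl.
  pose eta := e / (L + 1); have eta0 : 0 < eta by rewrite divr_gt0.
  have Le : L * eta <= e.
    by rewrite /eta mulrA ler_pdivrMr// mulrC ler_pM2l// lerDl.
  have near i : \forall m \near \oo, forall (l : nat) u, (l < m.+1)%N -> l%:R * h m <= u <= l.+1%:R * h m ->
      `|macro_path w u i - macro_path w (l%:R * h m) i| <= eta.
    have [de de0 H] := within_uniform T (@macro_continuous w i) eta0.
    apply: filterS (nbhs_infty_ge (Num.trunc (T / de)).+1) => m md l u lm /andP[u1 u2].
    have l0 : 0 <= l%:R * h m by rewrite mulr_ge0// ltW.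
    have hd : h m < de.
      rewrite ltr_pdivrMr// mulrC -ltr_pdivrMr//; apply: lt_le_trans (truncnS_gt _) _.
      by rewrite ler_nat; apply: leqW.
    apply: H; [|exact: le_trans u1|].
      rewrite l0/= [leRHS](Th m) ler_wpM2r ?ler_nat ?(ltW (h0 m))//; exact: ltnW.
    rewrite ger0_norm ?subr_ge0//; apply: le_lt_trans hd; rewrite lerBlDl.
    by apply: le_trans u2 _; rewrite -natr1 mulrDl mul1r.
  have : \forall m \near \oo, forall i (l : nat) u, (l < m.+1)%N -> l%:R * h m <= u <= l.+1%:R * h m ->
      `|macro_path w u i - macro_path w (l%:R * h m) i| <= eta by exact: filter_forall.
  apply: filterS => m Hm; apply: le_trans Le.
  apply: (le_trans (envelope_lip T Phib L0 _ _)); rewrite ler_wpM2l//.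
  apply: (step_path_close (h0 m) (Th m) (ltW eta0)); first exact: macro_path0.
  by move=> l i u; exact: Hm.
- exact: discrete_norm.
- apply: (@lip_comp_meas _ _ _ P' _ _ _ (discrete L) L L0).
    by move=> v; have [] := cgm_increment_L2 hW v.1 (ltW (h0 m)) (sphi v.2).
  by move=> u v; exact: discrete_lip.
Qed.

Lemma functional_limit : bdmeas setT (fun w => Phi (macro_path w)) /\
  (fun j : nat => Ex P' (fun w => env j%:R (macro_path w))) @ \oo --> Ex P' (fun w => Phi (macro_path w)).
Proof.
apply: (Ex_cvg P' (b := b)) => [j|j w|w].
- by have [[]] := envelope_macro_limit (ler0n R j).
- rewrite ler_norml (envelope_lb T Phib (ler0n R j))/=.
  apply: le_trans (envelope_le_self Phib (ler0n R j) (macro_skorokhod w)) _.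
  by apply: le_trans (ler_norm _) (Phib _).
- exact: (envelope_cvg Phib cPhi (macro_skorokhod w)).
Qed.

(** [Phi] at the path dominates the envelope at its step path minus L times their distance. The
    expected distance is at most eta plus the probabilities that the path oscillates by more than
    eta in a cell: m + 1 cells with fourth moments h (Q h + A c), divided by eta^4. *)
Lemma micro_lower : exists Q A : R, [/\ 0 <= Q, 0 <= A & forall m (L eta c : R) g, 0 <= L -> 0 < eta -> c <= 1 ->
  good c Cm CM g ->
  ((Ex (P g) (fun w => discrete L (micro_incr K alpha delta beta sigma (n := m.+1) (h m) phi w)) -
    L * (eta + eta ^- 4 * (T * (Q * h m + A * c))))%:E <= \int[P g]_w (Phi (micro_path w))%:E)%E].
Proof.
have H1 i : exists B : R, 0 <= B /\ forall x, `|derive1 (phi i) x| <= B.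
  by have [B B0 HB] := torus_bounded (torus_derive1 (sphi i)); exists B.
have [B HB] := choice H1.
have H2 i : exists Gm : R, 0 <= Gm /\ forall c g, good c Cm CM g -> c <= 1 -> forall x, Gam g (phi i) (phi i) x <= Gm.
  by have [Gm G0 HG] := good_carre sigmastar KM Cm CM (sphi i); exists Gm.
have [Gm HG] := choice H2.
pose q i := 6 * Gm i ^+ 2; pose a i := 128 * B i * Gm i * (1 + Gm i * T) + 256 * B i ^+ 2 * Gm i.
have B0 i : 0 <= B i by have [] := HB i.
have G0 i : 0 <= Gm i by have [] := HG i.
exists (\sum_i q i), (\sum_i a i); split.
- by apply: sumr_ge0 => i _; rewrite mulr_ge0// sqr_ge0.
- apply: sumr_ge0 => i _; apply: addr_ge0.
    by apply: mulr_ge0; [rewrite !mulr_ge0|rewrite addr_ge0// mulr_ge0// ltW].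
  exact: mulr_ge0 (mulr_ge0 (ler0n R 256) (sqr_ge0 _)) (G0 i).
move=> m L eta c g L0 eta0 c1 gd; have Gg := good_G gd; have JP := model_jump_process KM Gg.
have c0 : 0 <= c by apply: le_trans (good_p gd); apply: ltW; exact: mesh_gt0.
have node (l : nat) : 0 <= l%:R * h m <= l.+1%:R * h m.
  by rewrite mulr_ge0 ?(ltW (h0 m))//= ler_wpM2r ?(ltW (h0 m))// ler_nat.
have Dj0 i : 0 <= 4 * B i * c by rewrite !mulr_ge0.
have Jb i := good_jump KM (sphi i) (HB i).2 gd.
have [Z HZ] := choice (fun v : V m => sup_mart JP (Dj0 v.2) (Jb v.2) ((HG v.2).2 c g gd c1) (node v.1) eta0).
have bZ v : bdmeas setT (Z v).
  have [FZ _ _ _] := HZ v; apply: (Fbd_bd JP _ FZ); exact: le_trans (andP (node v.1)).1 (andP (node v.1)).2.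
have Z0 v w : 0 <= Z v w by have [_ H _ _] := HZ v; have /andP[] := H w.
pose vi (w : Om g) := micro_incr K alpha delta beta sigma (n := m.+1) (h m) phi w.
have bI : bdmeas setT (fun w => discrete L (vi w)).
  split; last by exists (b + L) => w _; exact: discrete_norm.
  apply: (@lip_comp_meas _ _ _ (P g) _ _ _ (discrete L) L L0).
    by move=> v; have [] := micro_incr_bd KM phi (ltW (h0 m)) v Gg.
  by move=> u v; exact: discrete_lip.
have bS : bdmeas setT (fun w => \sum_v Z v w) by exact: bdmeas_sum.
have bE : bdmeas setT (fun w => eta + \sum_v Z v w) by apply: bdmeasD => //; exact: bdmeas_cst.
pose U w := discrete L (vi w) - L * (eta + \sum_v Z v w).
have bU : bdmeas setT U by apply: bdmeasB => //; exact: bdmeasZ.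
have iU := bdmeas_integrable measurableT (P_fin (P g)) bU.
have fU := integrable_fin_num measurableT iU.
apply: (@le_trans _ _ (\int[P g]_w (U w)%:E)%E); last first.
  apply: le_integralT => w; rewrite lee_fin /U lerBlDr.
  apply: (le_trans (envelope_le Phib L0 _ (micro_skorokhod w Gg))).
  rewrite lerD2l ler_wpM2l//; have S0 : 0 <= \sum_v Z v w by apply: sumr_ge0 => v _; exact: Z0.
  (* Either some cell has an excessive oscillation and the distance is at most 1 by truncation, or
     all oscillations are at most eta. *)
  have [[v Zv]|nZ] := pselect (exists v, Z v w = 1).
    apply: le_trans (udist_le1 _ _ _) _; apply: (@le_trans _ _ (\sum_v Z v w)); last by rewrite lerDr ltW.
    by rewrite (bigD1 v)//= Zv lerDl; apply: sumr_ge0 => u _; exact: Z0.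
  apply: (@le_trans _ _ eta); last by rewrite lerDl.
  apply: (step_path_close (h0 m) (Th m) (ltW eta0)); first by move=> i; exact: micro_path0.
  move=> l i u lm lu; rewrite leNgt; apply/negP => bad; apply: nZ.
  by exists (Ordinal lm, i); have [_ _ _ H] := HZ (Ordinal lm, i); exact: (H w u lu bad).
have -> : (\int[P g]_w (U w)%:E)%E = (Ex (P g) U)%:E by rewrite -(fineK fU).
rewrite lee_fin /U ExB//; last exact: bdmeasZ.
rewrite lerD2l lerN2 ExZ// ler_wpM2l// ExD//; last exact: bdmeas_cst.
rewrite Ex_cst lerD2l Ex_sum//.
have hT : 0 <= h m <= T by rewrite (ltW (h0 m))/= ler_pdivrMr// ler_peMr ?ler1n// ltW.
have fbE v : Ex (P g) (Z v) <= eta ^- 4 * (h m * (q v.2 * h m + a v.2 * c)).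
  have [_ _ HE _] := HZ v; rewrite -ler_pdivrMl ?invr_gt0 ?exprn_gt0// invrK.
  apply: le_trans HE _.
  have -> : v.1.+1%:R * h m - v.1%:R * h m = h m by rewrite -mulrBl -natr1 addrAC subrr add0r mul1r.
  by apply: fourth_bound_le => //; rewrite c0.
apply: (le_trans (ler_sum _ (fun v _ => fbE v))).
rewrite -mulr_sumr ler_wpM2l ?invr_ge0 ?exprn_ge0 ?(ltW eta0)//.
rewrite -(pair_bigA _ (fun (l : 'I_m.+1) i => h m * (q i * h m + a i * c)))/=.
rewrite sumr_const card_ord -mulr_sumr big_split/= -!mulr_suml -[leLHS]mulr_natl mulrA -Th.
exact: lexx.
Qed.

(** Order of the choices: the Lipschitz constant L of the envelope, then eta against L, then the
    number of cells m against L and eta, and last c, which makes the jumps small and the increments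
    converge. *)
Lemma functional_liminf (e : R) : 0 < e -> exists2 c : R, 0 < c & forall g, good c Cm CM g ->
  ((Ex P' (fun w => Phi (macro_path w)) - e)%:E <= \int[P g]_w (Phi (micro_path w))%:E)%E.
Proof.
move=> e0; have e6 : 0 < e / 6 by rewrite divr_gt0.
have [Q [A [Q0 A0 low]]] := micro_lower.
have [_ lPhi] := functional_limit.
have [j _ Hj] : \forall j \near \oo, `|Ex P' (fun w => Phi (macro_path w)) - Ex P' (fun w => env j%:R (macro_path w))| <= e / 6.
  by move/cvgrPdist_le : lPhi; apply.
have {Hj}Hj := Hj j (leqnn j); pose L : R := j%:R; have L0 : 0 <= L by [].
have L1 : 0 < 6 * (L + 1) by rewrite mulr_gt0// ltr_wpDl.
pose eta := e / (6 * (L + 1)); have eta0 : 0 < eta by rewrite divr_gt0.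
have Leta : L * eta <= e / 6.
  have : eta * (6 * (L + 1)) = e by rewrite divfK// gt_eqF.
  by move: (ltW eta0); rewrite mulrDr mulr1; move: (L) (eta) => x y; lra.
have [_ lenv] := envelope_macro_limit L0.
pose C := L * eta ^- 4 * T * Q * T.
have lC : (fun m : nat => C * (m.+1%:R)^-1) @ \oo --> (0 : R).
  by rewrite -(mulr0 C); apply: cvgMr; exact: cvg_harmonic.
have [m _ Hm] : \forall m \near \oo, `|Ex P' (fun w => env L (macro_path w)) -
     Ex P' (fun w => discrete L (macro_incr W (n := m.+1) (h m) phi w))| <= e / 6 /\ C * (m.+1%:R)^-1 <= e / 6.
  move/cvgrPdist_le : lenv => /(_ _ e6); move/cvgrPdist_le : lC => /(_ _ e6).
  apply: filterS2 => m h1 h2; split=> //.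
  by move: h1; rewrite sub0r normrN => h1; apply: le_trans (ler_norm _) h1.
have {Hm}[Hm HC] := Hm m (leqnn m).
have [c1 c10 H1] := lipschitz_limit (n := m.+1) KM Cm0 CM0 hW (ltW (h0 m)) sphi L0
  (fun u v : V m -> R => discrete_lip u v L0) (fun u : V m -> R => discrete_norm u L0) e6.
pose D := L * eta ^- 4 * T * A.
have D0 : 0 <= D.
  apply: mulr_ge0 => //; apply: mulr_ge0; last exact: ltW.
  by rewrite mulr_ge0// invr_ge0 exprn_ge0// ltW.
have D1 : 0 < 6 * (D + 1) by rewrite mulr_gt0// ltr_wpDl.
exists (Num.min (Num.min c1 1) (e / (6 * (D + 1)))).
  by rewrite !lt_min c10 ltr01 divr_gt0.
move=> g; set c := Num.min _ _ => gd.
have cc1 : c <= c1 by rewrite !ge_min lexx.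
have cc2 : c <= 1 by rewrite !ge_min lexx orbT.
have cc3 : c * (6 * (D + 1)) <= e by rewrite -ler_pdivlMr// ge_min lexx orbT.
have c0 : 0 < c by apply: lt_le_trans (good_p gd); exact: mesh_gt0.
have Dc : D * c <= e / 6.
  rewrite ler_pdivlMr//; apply: le_trans cc3.
  have -> : c * (6 * (D + 1)) = D * c * 6 + c * 6 by ring.
  by rewrite lerDl mulr_ge0// ltW.
apply: le_trans (low m L eta c g L0 eta0 cc2 gd); rewrite lee_fin.
have := H1 g (good_le cc1 gd).
have -> : L * (eta + eta ^- 4 * (T * (Q * h m + A * c))) = L * eta + C * (m.+1%:R)^-1 + D * c.
  by rewrite /C /D; move: (eta ^- 4) (m.+1%:R^-1) => x y; ring.
move: Hj Hm HC Leta Dc; rewrite -/L.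
set u1 := Ex _ _; set u2 := Ex _ _; set u3 := Ex _ _; set u4 := Ex _ _.
move: (C * _) (L * _) (D * _) => x y z.
move=> /ler_normlP[_ h1] /ler_normlP[_ h2] h3 h4 h5 /ler_normlP[h6 _].
by lra.
Qed.

End Functional.

Hypothesis gd_near : forall c, 0 < c -> \forall g \near kac_limit G, good c Cm CM g.

(** The lower bound for - [Phi] is an upper bound for [Phi], because negation commutes with the
    integrals of bounded functions. *)
Lemma weak_limit (Phi : (R -> 'I_k -> R) -> R) : bounded_functional Phi -> skorokhod_continuous T Phi ->
  (\int[P g]_w (Phi (@micro_path g w))%:E)%E @[g --> kac_limit G] --> (\int[P']_w (Phi (macro_path w))%:E)%E.
Proof.
move=> [b Phib] cPhi.
have Nb x : `|- Phi x| <= b by rewrite normrN.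
have cN : skorokhod_continuous T (fun x => - Phi x).
  move=> x Dx e e0; have [eta eta0 H] := cPhi x Dx e e0; exists eta => // y Dy xy.
  by rewrite -opprD normrN; exact: H.
have [bW _] := functional_limit Phib cPhi.
have iW := bdmeas_integrable measurableT (P_fin P') bW.
have fW := integrable_fin_num measurableT iW.
pose E0 := Ex P' (fun w => Phi (macro_path w)).
have -> : (\int[P']_w (Phi (macro_path w))%:E)%E = E0%:E by rewrite /E0 /Ex /Rintegral fineK.
have fin g : (\int[P g]_w (Phi (@micro_path g w))%:E)%E \is a fin_num.
  have /andP[h1 h2] := bounded_integral (P g) (fun w => Phib (@micro_path g w)).
  by rewrite fin_numE; apply/andP; split; apply/eqP => E; [move: h1|move: h2]; rewrite E.
apply/fine_cvgP; split; first by apply: nearW => g; exact: fin.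
apply/cvgrPdist_le => e e0.
have [c1 c10 H1] := functional_liminf Phib cPhi e0.
have [c2 c20 H2] := functional_liminf Nb cN e0.
have c0 : 0 < Num.min c1 c2 by rewrite lt_min c10.
apply: filterS (gd_near c0) => g gd /=.
have gd1 : good c1 Cm CM g by apply: good_le gd; rewrite ge_min lexx.
have gd2 : good c2 Cm CM g by apply: good_le gd; rewrite ge_min lexx orbT.
have := H1 g gd1; have := H2 g gd2.
rewrite (bounded_integralN (P g) (fun w => Phib (@micro_path g w))) -(fineK (fin g)) -EFinN !lee_fin.
have -> : Ex P' (fun w => - Phi (macro_path w)) = - E0.
  rewrite /E0 -mulN1r -(ExZ P' (-1) bW); apply: eq_Rintegral => w _; by rewrite mulN1r.
rewrite /= -/E0; move: (fine _) (E0) => z E1 h1 h2.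
by rewrite ler_norml; apply/andP; split; lra.
Qed.

End WeakLimit.

Theorem theorem11 (R : realType) (G : set R) (N : R -> nat) (K : R -> R)
    (alpha delta beta : R -> R) (nu chi sigmastar A Mbar : R)
    (M : nat -> int) (f0 : forall g : R, config (N g) -> R)
    (d : R -> measure_display) (Om : forall g : R, measurableType (d g))
    (P : forall g : R, probability (Om g) R)
    (sigma : forall g : R, R -> Om g -> config (N g))
    (hG : G `<=` `]0, 1 / 4[)
    (hN : N g @[g --> kac_limit G] --> \oo)
    (hpos : forall g, G g -> 0 < alpha g /\ 0 < delta g)
    (hA : assumption_kernel G N K)
    (hB : assumption_scaling G N K alpha delta beta nu chi sigmastar A)
    (hC : assumption_entropy G K beta M f0)
    (hM : (delta g)^-1 * (eps R (N g) * (M (N g))%:~R) @[g --> kac_limit G]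
          --> Mbar)
    (hf0 : forall g, G g -> is_density K g (beta g) (M (N g)) (f0 g))
    (hsigma : forall g, G g ->
      kawasaki_process (P g) K g (beta g) (M (N g))
        (fun c => f0 g c * gibbs K g (beta g) (M (N g)) c) (sigma g)) :
  let Mg (g : R) (phi : R -> R) : R -> Om g -> R :=
    dynkin_martingale K g (beta g) (alpha g) (delta g) (sigma g) phi in
  let Fg (g t : R) := natural_filtration (sigma g) (t / alpha g) in
  (forall phi psi : R -> R, smooth_torus phi -> smooth_torus psi ->
    exists2 Q : forall g : R, R -> Om g -> R,
      forall g, G g ->
        predictable_covariation (P g) (Fg g) (Mg g phi) (Mg g psi) (Q g) &
      forall T : R, 0 < T ->
        (\int[P g]_w ereal_sup
           [set `|Q g t w - sigmastar ^+ 2 * t * dirichlet_form phi psi|%:E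
              | t in `[0%R, T]])%E @[g --> kac_limit G] --> 0%E)
  /\
  (forall (d' : measure_display) (Om' : measurableType d')
      (P' : probability Om' R) (W : (R -> R) -> R -> Om' -> R),
    conservative_gaussian_martingale P' sigmastar W ->
    forall (k : nat) (phi : 'I_k -> R -> R),
      (forall i, smooth_torus (phi i)) ->
      cvg_in_law (kac_limit G) P
        (fun g w t i => Mg g (phi i) t w) P' (fun w t i => W (phi i) t w)).

Proof.
(* The membership in W^{1,1} provides an integrable weak derivative [gK], whose L1 norm bounds the
   variation of the kernel. *)
have [_ [cK [_ [gK gK1 wK]] _] _ _ _] := hA.
have igK : (@lebesgue_measure R).-integrable setT (EFin \o gK) by apply/Lfun1_integrable.
have [Cm [CM [Cm0 CM0 good_near]]] := eventually_good hG hN hpos hA hB hM.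
have KM := KacModel hG hpos hA igK wK hsigma.
move=> Mg Fg.
pose X g t : Om g -> config (N g) := @sigma g (t / alpha g).
pose r g (c : config (N g)) (i : site (N g)) := (alpha g)^-1 * rate K g (beta g) c i.
have ME g phi : Mg g phi = mart (@exchange (N g)) (@r g) (X g) (field_observable K g (delta g) phi).
  by apply: funext => t; apply: funext => w; exact: dynkin_martE.
split=> [phi psi sphi spsi|d' Om' P' W hW k phi sphi T T0 Phi bPhi cPhi].
  exists (fun g t => pint (X g) (carre (@exchange (N g)) (@r g) (field_observable K g (delta g) phi)
    (field_observable K g (delta g) psi)) 0 t) => [g Gg|T T0].
    by rewrite !ME; exact: jump_covariation (model_jump_process KM Gg) _ _.
  exact: (covariation_limit KM Cm0 CM0 good_near sphi spsi T0).
rewrite (_ : (fun g => \int[P g]_w (Phi (fun t i => Mg g (phi i) t w))%:E)%E =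
  fun g => (\int[P g]_w (Phi (fun t i => mart (@exchange (N g)) (@r g) (X g)
    (field_observable K g (delta g) (phi i)) t w))%:E)%E).
  exact: (weak_limit KM Cm0 CM0 hW sphi T0 good_near bPhi cPhi).
apply: funext => g; apply: eq_integral => w _; congr (Phi _)%:E.
by apply: funext => t; apply: funext => i; rewrite ME.
Qed.
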